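(* (i) Let $\phi:(\mathbb{P}^1_{\mathbb{C}})^3\dashrightarrow\mathbb{P}^3_{\mathbb{C}}$ be a general real trilinear birational map of type $(1,2,2)$ with parametric line congruences $S,T,U$, and let $a,b,c,x,y\subset\mathbb{P}^3_{\mathbb{C}}$ be the lines (unique up to interchanging $x$ and $y$) such that $x,y$ are skew, $a,b,c$ are pairwise skew, each of $a,b,c$ intersects both $x$ and $y$, the focal lines of $S$ are $x$ and $y$, the focal lines of $T$ are $a$ and $c$, and the focal lines of $U$ are $a$ and $b$. Then one of the following holds: a) the lines $a,b,c,x,y$ are all real; b) the lines $a,b,c$ are real, and $x,y$ are skew complex-conjugate lines. (ii) For every (not necessarily general) real trilinear birational map of type $(1,2,2)$, with parametric line congruences $S,T,U$, there are lines $a,b,c,x,y\subset\mathbb{P}^3_{\mathbb{C}}$, either all real (case a) or with $a,b,c$ real and $x,y$ skew complex-conjugate (case b), such that, up to permutation of the factors of $\mathbb{P}^1_{\mathbb{C}}\times\mathbb{P}^1_{\mathbb{C}}\times\mathbb{P}^1_{\mathbb{C}}$ (and the corresponding permutation of the congruences), the following holds. In case a), one of: a.1) (General) $a,b,c$ are pairwise skew and $x,y$ are skew; $S$ is hyperbolic linear with focal lines $x,y$; $T$ is hyperbolic linear with focal lines $a,c$; $U$ is hyperbolic linear with focal lines $a,b$. a.2) $a,c$ are skew, $b\leadsto a$, and $x,y$ are skew; $S$ is hyperbolic linear with focal lines $x,y$; $T$ is hyperbolic linear with focal lines $a,c$; $U$ is parabolic linear with focal line $2a$. a.3) $a,b,c$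 are pairwise skew and $y\leadsto x$; $S$ is parabolic linear with focal line $2x$; $T$ is hyperbolic linear with focal lines $a,c$; $U$ is hyperbolic linear with focal lines $a,b$. a.4) $a,c$ are skew, $b\leadsto a$, and $y\leadsto x$; $S$ is parabolic linear with focal line $2x$; $T$ is hyperbolic linear with focal lines $a,c$; $U$ is parabolic linear with focal line $2a$. a.5) $a$ is skew to both $b$ and $c$, the intersection $P=b\cap c\cap x$ is a point, and $x,y$ are skew; $S$ is hyperbolic linear with focal lines $x,y$; $T$ is hyperbolic linear with focal lines $a,c$; $U$ is hyperbolic linear with focal lines $a,b$. a.6) $b\leadsto a$ and $c\leadsto a$ approaching through different smooth quadrics, and $x,y$ are skew; $S$ is hyperbolic linear with focal lines $x,y$; $T$ is parabolic linear with focal line $2a$; $U$ is parabolic linear with focal line $2a$. a.7) $b\leadsto a$ and $c\leadsto a$ approaching through different smooth quadrics, and $y\leadsto x$; $S$ is parabolic linear with focal line $2x$; $T$ is parabolic linear with focal line $2a$; $U$ is parabolic linear with focal line $2a$. a.8) $a$ is skew to both $b$ and $c$, the intersection $P=b\cap c\cap x$ is a point, and $y\leadsto x$; $S$ is parabolic linear with focal line $2x$; $T$ is hyperbolic linear with focal lines $a,c$; $U$ is hyperbolic linear with focal lines $a,b$. In case b), one of: b.1) $a,b,c$ are pairwise skew; $S$ is elliptic linear with focal lines $x,y$; $T$ is hyperbolic linear with focal lines $a,c$; $U$ is hyperbolic linear with focal lines $a,b$. b.2) $a,c$ are skew and $b\leadsto a$; $S$ is elliptic linear with focal lines $x,y$;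 $T$ is hyperbolic linear with focal lines $a,c$; $U$ is parabolic linear with focal line $2a$. b.3) $b\leadsto a$ and $c\leadsto a$ approaching through different smooth quadrics; $S$ is elliptic linear with focal lines $x,y$; $T$ is parabolic linear with focal line $2a$; $U$ is parabolic linear with focal line $2a$.
   Context: A variety $X\subset\mathbb{P}^n_{\mathbb{C}}$ is real if $X=\overline{X}$. Let $Q\subset\mathbb{P}^5_{\mathbb{C}}=\mathbb{P}(\bigwedge^2\mathbb{C}^4)$ be the Klein quadric, parametrizing lines in $\mathbb{P}^3_{\mathbb{C}}$ by Plücker coordinates. A line congruence is an algebraic surface $X\subset Q$; it is real if $X$ is real and its real locus $X(\mathbb{R})$ has real dimension $2$. A (irreducible) variety $V\subset\mathbb{P}^3_{\mathbb{C}}$ is focal for $X$ if $V\cap x\neq\varnothing$ for every line $x\in X$ and $V$ is minimal with this property (no proper subvariety of $V$ has it). A real line congruence $X$ is linear if it is contained in a 3-plane of $\mathbb{P}^5_{\mathbb{C}}$; a linear one is hyperbolic if it has two skew real focal lines, elliptic if it has two skew complex-conjugate focal lines, and parabolic if it has a single focal line (limit case of the other two). Notation $y\leadsto x$: this denotes the limiting configuration in which the line $y$ has become infinitely near to $x$ through some smooth quadric surface $G\subset\mathbb{P}^3_{\mathbb{C}}$ (flat limit of two skew lines of one ruling), i.e. the two lines are replaced by the double line supported on $x$ and contained in $G$, denoted $2x$; the corresponding parabolic linear congruence consists of the lines $\ell$ through a point $P\in x$ which are tangent to $G$ at $P$ ($\ell\subset T_PG$). A trilinear rational map is a rational map $\phi:(\mathbb{P}^1_{\mathbb{C}})^3\dashrightarrow\mathbb{P}^3_{\mathbb{C}}$,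 $(s_0:s_1)\times(t_0:t_1)\times(u_0:u_1)\mapsto(f_0:f_1:f_2:f_3)$, with $f_i$ trilinear in the three pairs of variables and without common factor. It is real if all $f_i$ have real coefficients. It is birational if it has a rational inverse $\phi^{-1}=(\sigma_0:\sigma_1)\times(\tau_0:\tau_1)\times(\upsilon_0:\upsilon_1)$, where each pair consists of homogeneous polynomials in $x_0,\dots,x_3$ of the same degree without common factor; its type is $(\deg\sigma_i,\deg\tau_j,\deg\upsilon_k)$. An $s$-line is the image of the restriction of $\phi$ to a fixed value of $(t_0:t_1)\times(u_0:u_1)$; $t$- and $u$-lines are defined analogously. The parametric line congruences $S,T,U$ of $\phi$ are the line congruences defined by (the closures in $Q$ of) the families of $s$-, $t$- and $u$-lines, respectively. ''General'' means: in a nonempty Zariski open subset of the variety of (real) trilinear birational maps of the given type. *)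

(* Defs.v *)
From HB Require Import structures.
From mathcomp Require Import all_boot all_order all_algebra all_fingroup.
From mathcomp Require Import reals complex mpoly.

Set Implicit Arguments.
Unset Strict Implicit.
Unset Printing Implicit Defensive.

Import Order.TTheory GRing.Theory Num.Theory.
Local Open Scope ring_scope.
Local Open Scope complex_scope.

Section ProjectiveSets.
Variable K : fieldType.

(* A subset of P^(n-1)(K) is given by the homogeneous coordinate vectors of its
   points.  The sets produced below contain only nonzero vectors and are stable
   under nonzero scalars. *)
Definition pset (n : nat) := 'rV[K]_n -> Prop.

Definition psubset n (X Y : pset n) := forall v, X v -> Y v.

Definition homogeneous n (f : {mpoly K[n]}) := exists d : nat, f \is d.-homog.

Definition zero_locus n (F : {mpoly K[n]} -> Prop) : pset n :=
  fun v => v != 0 /\ forall f, F f -> f.@[v ord0] = 0.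

Definition zclosed n (X : pset n) :=
  exists F : {mpoly K[n]} -> Prop,
    (forall f, F f -> homogeneous f) /\ (forall v, X v <-> zero_locus F v).

Definition zclosure n (X : pset n) : pset n :=
  zero_locus (fun f => homogeneous f /\ forall v, X v -> f.@[v ord0] = 0).

Definition variety n (X : pset n) :=
  [/\ zclosed X, exists v, X v
    & forall Y Z : pset n, zclosed Y -> zclosed Z ->
        (forall v, X v -> Y v \/ Z v) -> psubset X Y \/ psubset X Z].

(* Krull dimension of X for the Zariski topology of P^(n-1)(K): the supremum of
   the lengths of the chains of irreducible closed subsets. *)
Definition dim_ge n (X : pset n) (d : nat) :=
  exists Z : nat -> pset n,
    (forall i, (i <= d)%N -> variety (Z i) /\ psubset (Z i) X) /\
    (forall i, (i < d)%N -> psubset (Z i) (Z i.+1) /\ ~ psubset (Z i.+1) (Z i)).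

Definition zdim n (X : pset n) (d : nat) := dim_ge X d /\ ~ dim_ge X d.+1.

(* P holds for a general element of V: on a nonempty subset of V which is open
   for the Zariski topology induced on V. *)
Definition general n (V P : pset n) :=
  exists Z : pset n,
    [/\ zclosed Z, exists w, V w /\ ~ Z w & forall w, V w -> ~ Z w -> P w].

(* Lines in P^3 are the two-dimensional subspaces of K^4. *)
Definition is_line (L : {vspace 'rV[K]_4}) := \dim L = 2%N.

Definition line_through (u v : 'rV[K]_4) : {vspace 'rV[K]_4} :=
  <<[:: u; v]>>%VS.

Definition skew_lines (L M : {vspace 'rV[K]_4}) := (L :&: M)%VS = 0%VS.

Definition lines_meet (L M : {vspace 'rV[K]_4}) := (L :&: M)%VS <> 0%VS.

Definition points (L : {vspace 'rV[K]_4}) : pset 4 :=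
  fun v => v != 0 /\ v \in L.

(* Plücker coordinates in the order p01, p02, p03, p12, p13, p23. *)
Definition pl_fst (k : 'I_6) : 'I_4 := inord (nth 0 [:: 0; 0; 0; 1; 1; 2] k)%N.
Definition pl_snd (k : 'I_6) : 'I_4 := inord (nth 0 [:: 1; 2; 3; 2; 3; 3] k)%N.

Definition plucker (u v : 'rV[K]_4) : 'rV[K]_6 :=
  \row_k (u ord0 (pl_fst k) * v ord0 (pl_snd k)
          - u ord0 (pl_snd k) * v ord0 (pl_fst k)).

Definition klein_quadric : pset 6 := fun p =>
  p != 0 /\
  p ord0 (inord 0%N) * p ord0 (inord 5%N) - p ord0 (inord 1%N) * p ord0 (inord 4%N)
  + p ord0 (inord 2%N) * p ord0 (inord 3%N) = 0.

(* p is a vector of Plücker coordinates of the line L; every vector of Plücker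
   coordinates of L is of the form plucker u v for some basis (u, v) of L. *)
Definition plucker_of (p : 'rV[K]_6) (L : {vspace 'rV[K]_4}) :=
  is_line L /\ exists u v : 'rV[K]_4, L = line_through u v /\ p = plucker u v.

Definition meets_all (X : pset 6) (V : pset 4) :=
  forall p L, X p -> plucker_of p L -> exists z, V z /\ points L z.

Definition focal (X : pset 6) (V : pset 4) :=
  [/\ variety V, meets_all X V
    & forall W : pset 4, variety W -> psubset W V -> meets_all X W ->
        psubset V W].

Definition focal_line (X : pset 6) (L : {vspace 'rV[K]_4}) :=
  is_line L /\ focal X (points L).

Definition focal_lines_are (X : pset 6) (L M : {vspace 'rV[K]_4}) :=
  forall N, focal_line X N <-> N = L \/ N = M.

Definition quadric (q : {mpoly K[4]}) : pset 4 :=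
  fun v => v != 0 /\ q.@[v ord0] = 0.

Definition smooth_quadric (q : {mpoly K[4]}) :=
  q \is 2.-homog /\
  forall v, quadric q v -> exists i, (q^`M(i)).@[v ord0] <> 0.

Definition tangent_at (q : {mpoly K[4]}) (P v : 'rV[K]_4) :=
  \sum_i (q^`M(i)).@[P ord0] * v ord0 i = 0.

(* y ~> x through the smooth quadric q = 0: y is the limit at e = 0 of the lines
   y_e = <u + e u', v + e v'> of the quadric, which are skew to x = <u, v> for
   e <> 0 (hence in the same ruling as x).  The flat limit of the unions of x
   and y_e is then the double line double_line x q. *)
Definition inf_near (q : {mpoly K[4]}) (y x : {vspace 'rV[K]_4}) :=
  [/\ smooth_quadric q, is_line x
    & exists u v u' v' : 'rV[K]_4,
        let y_ (e : K) := line_through (u + e *: u') (v + e *: v') in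
        [/\ x = line_through u v, y = y_ 0
          & forall e, [/\ is_line (y_ e), psubset (points (y_ e)) (quadric q)
                        & e <> 0 -> skew_lines (y_ e) x]]].

(* Ideal I(x)^2 + (q) of the double line supported on the line x and contained
   in the quadric q = 0. *)
Definition double_line (x : {vspace 'rV[K]_4}) (q f : {mpoly K[4]}) :=
  exists (s : seq ({mpoly K[4]} * {mpoly K[4]})) (h : {mpoly K[4]}),
    (forall gg, gg \in s -> forall v, v \in x ->
       gg.1.@[v ord0] = 0 /\ gg.2.@[v ord0] = 0) /\
    f = \sum_(gg <- s) gg.1 * gg.2 + h * q.

Definition same_double_line (x : {vspace 'rV[K]_4}) (q q' : {mpoly K[4]}) :=
  forall f, double_line x q f <-> double_line x q' f.

Definition tangent_congruence (x : {vspace 'rV[K]_4}) (q : {mpoly K[4]}) :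
    pset 6 := fun p =>
  exists L P, [/\ plucker_of p L, points x P, points L P
                & forall v, v \in L -> tangent_at q P v].

Definition no_common_factor (m n : nat) (f : 'I_m -> {mpoly K[n]}) :=
  forall d : {mpoly K[n]},
    (forall i, exists g, f i = g * d) -> d \is a GRing.unit.

(* A trilinear map is given by the coefficients of f_0, ..., f_3: that of f_i at
   the monomial with variable number e k in the k-th pair, for k < 3. *)
Definition tri_dim := #|{: 'I_4 * {ffun 'I_3 -> 'I_2}}|.

Definition tri_coef (w : 'rV[K]_tri_dim) i e := w ord0 (enum_rank (i, e)).

Definition param_var (k : 'I_3) (j : 'I_2) : {mpoly K[3 * 2]} :=
  'X_(mxvec_index k j).

Definition tri_poly (w : 'rV[K]_tri_dim) (i : 'I_4) : {mpoly K[3 * 2]} :=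
  \sum_(e : {ffun 'I_3 -> 'I_2}) tri_coef w i e *: \prod_k param_var k (e k).

(* Value at z, whose k-th row holds the homogeneous coordinates in the k-th
   factor P^1. *)
Definition tri_eval (w : 'rV[K]_tri_dim) (z : 'M[K]_(3, 2)) : 'rV[K]_4 :=
  \row_i (tri_poly w i).@[mxvec z ord0].

(* The pairs (g k 0 : g k 1) have degree d k and define a rational inverse: the
   last two conditions say that both composites are defined and equal to the
   identity as rational maps. *)
Definition rational_inverse (w : 'rV[K]_tri_dim)
    (g : 'I_3 -> 'I_2 -> {mpoly K[4]}) (d : 'I_3 -> nat) :=
  let phi := [tuple tri_poly w i | i < 4] in
  let psi := [tuple mxvec (\matrix_(k < 3, j < 2) g k j) ord0 l | l < 3 * 2] in
  [/\ forall k j, g k j \is (d k).-homog,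
      forall k, no_common_factor (g k),
      forall k, (exists j, g k j \mPo phi <> 0) /\
        (g k 0 \mPo phi) * param_var k 1 = (g k 1 \mPo phi) * param_var k 0
    & (exists i, tri_poly w i \mPo psi <> 0) /\
      forall i i', (tri_poly w i \mPo psi) * 'X_i'
                   = (tri_poly w i' \mPo psi) * 'X_i].

Definition tri_birational (w : 'rV[K]_tri_dim) (d : 'I_3 -> nat) :=
  no_common_factor (tri_poly w) /\ exists g, rational_inverse w g d.

(* L is the image of the restriction of the map to fixed values, given by z, of
   the parameters of the factors other than the k-th one. *)
Definition param_line (w : 'rV[K]_tri_dim) (k : 'I_3)
    (L : {vspace 'rV[K]_4}) :=
  is_line L /\
  exists z : 'M[K]_(3, 2), (forall i, row i z != 0) /\
    forall v, v \in L <->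
      exists r : 'rV[K]_2,
        v = tri_eval w (\matrix_(i, j) if i == k then r ord0 j else z i j).

Definition param_congruence (w : 'rV[K]_tri_dim) (k : 'I_3) : pset 6 :=
  zclosure (fun p => exists L, param_line w k L /\ plucker_of p L).

End ProjectiveSets.

Section RealStructure.
Variable R : realType.
Local Notation C := R[i].

Definition to_complex n (v : 'rV[R]_n) : 'rV[C]_n := map_mx (fun r => r%:C) v.

Definition conj_row n (v : 'rV[C]_n) : 'rV[C]_n := map_mx (fun z => z^*) v.

Definition real_pset n (X : pset C n) := forall v, X v <-> X (conj_row v).

Definition real_locus n (X : pset C n) : pset R n := fun v => X (to_complex v).

Definition conj_lines (x y : {vspace 'rV[C]_4}) :=
  forall v, (v \in x) = (conj_row v \in y).

Definition real_line (x : {vspace 'rV[C]_4}) := conj_lines x x.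

(* The dimension of a real algebraic set is the Krull dimension for the Zariski
   topology of P^5(R), as usual in real algebraic geometry. *)
Definition real_line_congruence (X : pset C 6) :=
  [/\ variety X, psubset X (@klein_quadric C), zdim X 2, real_pset X
    & zdim (real_locus X) 2].

Definition linear_congruence (X : pset C 6) :=
  real_line_congruence X /\
  exists W : {vspace 'rV[C]_6}, \dim W = 4%N /\ forall p, X p -> p \in W.

Definition hyperbolic (X : pset C 6) (x y : {vspace 'rV[C]_4}) :=
  [/\ linear_congruence X, skew_lines x y, real_line x, real_line y
    & focal_lines_are X x y].

Definition elliptic (X : pset C 6) (x y : {vspace 'rV[C]_4}) :=
  [/\ linear_congruence X, skew_lines x y, conj_lines x y
    & focal_lines_are X x y].

(* Parabolic linear with focal line 2x, the double structure on x being the one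
   given by the quadric q = 0. *)
Definition parabolic (X : pset C 6) (x : {vspace 'rV[C]_4})
    (q : {mpoly C[4]}) :=
  [/\ linear_congruence X, forall N, focal_line X N <-> N = x
    & forall p, X p <-> tangent_congruence x q p].

Definition type122 (k : 'I_3) : nat := if k == ord0 then 1%N else 2%N.

(* Real maps are given by real coefficients, so that this set lies in P^31(R). *)
Definition real_bir122 : pset R tri_dim :=
  fun w => tri_birational (to_complex w) type122.

Definition congruence (w : 'rV[R]_tri_dim) (k : 'I_3) : pset C 6 :=
  param_congruence (to_complex w) k.

Definition focal_configuration (w : 'rV[R]_tri_dim)
    (a b c x y : {vspace 'rV[C]_4}) :=
  [/\ [/\ is_line a, is_line b, is_line c, is_line x & is_line y],
      [/\ skew_lines x y, skew_lines a b, skew_lines a c & skew_lines b c],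
      forall l, l \in [:: a; b; c] -> lines_meet l x /\ lines_meet l y
    & [/\ focal_lines_are (congruence w 0) x y,
          focal_lines_are (congruence w 1) a c
        & focal_lines_are (congruence w 2) a b]].

End RealStructure.

(* Main.v *)
Require Import Defs.
From HB Require Import structures.
From mathcomp Require Import all_boot all_order all_algebra all_fingroup.
From mathcomp Require Import reals complex mpoly.
From mathcomp Require Import ring zify.
From mathcomp Require boolp.

Set Implicit Arguments.
Unset Strict Implicit.
Unset Printing Implicit Defensive.

Import Order.TTheory GRing.Theory Num.Theory.
Local Open Scope ring_scope.
Local Open Scope complex_scope.

(** Let phi be a real map of type (1,2,2).  Real and imaginary parts of the linear pair inverting s give
    a real pair sigma with phi(s,t,u) sigma = A(t,u) s, whereas t and u have no linear inverse, their
    inverses being coprime pairs of quadrics.  As sigma kills a vector for each s, the four vectors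
    phi(s,e_j,e_k) are dependent, and by birationality a dependency has rank one: it is a base point
    (t_s,u_s).  If (t_s,u_s) depended on s, then t or u would have a linear inverse; hence it is constant,
    and placing it at t = u = e_1 leaves
      phi = t0 u0 P0(s) + t0 u1 P1(s) + t1 u0 P2(s),   P_j(s) = (a_j s, s N_j).
    The same argument shows that the pencil of the combinations of the N_j killing the a_j contains an
    invertible matrix, so that up to coordinates N_j is the multiplication by z_j + w_j i on K[i],
    i^2 = k.  Thus phi is determined by k and an invertible matrix with rows (a_j, z_j, w_j).

    In this form the three congruences are explicit quadric surfaces in 3-planes.  The focal lines of S
    are the eigenlines for the two square roots of k, so that the sign of k decides between the
    hyperbolic, the parabolic and the elliptic case.  T and U share the focal line a; the other focal line
    of T is spanned by P2(e_0), P2(e_1) when a_2 <> 0, and becomes infinitely near to a when a_2 = 0;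
    similarly for U, P1 and a_1.  The two other focal lines meet exactly when
    N_1 / a_1 - N_2 / a_2 is singular, and then at a point of an eigenline.

    For general maps, det (phi(e0,t,e0), phi(e1,t,e0), phi(e0,t,e1), phi(e1,t,e1)) is a binary quartic
    l(t)^2 d(t).  The degenerations with k = 0 or a_1 = 0 make it a square, and those where b and c meet
    give it a triple root; both are excluded by an invariant of quartics, which is nonzero for the map
    (s0 A : s1 A : s0 t1 u0 : s1 t0 u1), A = t0 u0 + t0 u1 + t1 u0. *)

(** * Polynomial identities *)

(** The definitions live over the complex numbers, but the frames of the classification must be
    real. The argument from [bir_data] to the normal form is therefore carried out over any
    [numFieldType] and applied over the reals. What it needs descends from complex birationality
    because polynomial identities are tested at points with natural coordinates, common to both
    fields. Irreducibility and Krull dimension of a congruence and of its real locus come from one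
    explicit object: a quadric in a 3-plane with an affine chart by two parameters. The chart gives
    irreducibility and a chain of length two, and the algebraic dependence of four polynomials in
    two variables excludes a chain of length three. For [k < 0] the eigenlines are not real, so the
    real locus of S requires an equation in which [k] occurs but not its roots. The constancy of the
    base point is decided by the bilinear form A. If A is nondegenerate, moving base points lie on
    the graph of a projectivity, and five of them would give a linear inverse of u; if A is a
    product, they stay on two fixed rulings. *)

Section PolynomialFunctions.
Variable K : numFieldType.

Lemma poly_nat_eq0 (p : {poly K}) : (forall k : nat, p.[k%:R] = 0) -> p = 0.
Proof.
move=> h; apply/eqP; apply: contraT => p0.
pose rs := [seq k%:R : K | k <- iota 0 (size p)].
have := max_poly_roots p0 (_ : all (root p) rs) (_ : uniq rs).
rewrite size_map size_iota ltnn => -> //.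
  by apply/allP => _ /mapP[k _ ->]; rewrite /root h.
rewrite map_inj_uniq ?iota_uniq // => a b /eqP; rewrite eqr_nat => /eqP; exact.
Qed.

Lemma poly_generic_eq0 (p q : {poly K}) :
  q != 0 -> (forall x, q.[x] != 0 -> p.[x] = 0) -> p = 0.
Proof.
move=> q0 h; apply/eqP; have : p * q = 0.
  apply: poly_nat_eq0 => k; rewrite hornerM.
  by have [->|/h ->] := eqVneq q.[k%:R] 0; rewrite ?mulr0 ?mul0r.
by move/eqP; rewrite mulf_eq0 (negPf q0) orbF.
Qed.

Lemma horner_mmap n (p : {mpoly K[n]}) (c : 'I_n -> {poly K}) x :
  (mmap polyC c p).[x] = p.@[fun i => (c i).[x]].
Proof.
rewrite mevalE /mmap horner_sum; apply: eq_bigr => m _.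
rewrite hornerM hornerC horner_prod; congr (_ * _); apply: eq_bigr => i _.
by rewrite horner_exp.
Qed.

(** Reduction modulo [B] isolates the first digit, and division by [B] shifts the others. The digits
    in question are the exponents of a monomial. *)
Lemma base_code_inj (B n : nat) (a b : nat -> nat) :
  (forall i, (i < n)%N -> (a i < B)%N /\ (b i < B)%N) ->
  (\sum_(i < n) a i * B ^ i = \sum_(i < n) b i * B ^ i)%N ->
  forall i, (i < n)%N -> a i = b i.
Proof.
elim: n a b => [|n IHn] a b //= hab.
rewrite !big_ord_recl !expn0 !muln1.
under eq_bigr do rewrite expnS mulnCA.
under [in RHS]eq_bigr do rewrite expnS mulnCA.
rewrite -!big_distrr /= => h.
have [a0 b0] := hab 0%N isT.
have B0 : (0 < B)%N by apply: leq_ltn_trans a0.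
have e0 : a 0%N = b 0%N.
  by move/(congr1 (modn^~ B)): (h); rewrite /= !(addnC (_ 0%N)) !(mulnC B) !modnMDl !modn_small.
move/eqP: h; rewrite e0 eqn_add2l eqn_pmul2l // => /eqP h.
case=> [|i] // hi; apply: (IHn (a \o S) (b \o S)) => // j hj; exact: hab.
Qed.

(* Kronecker substitution [x_i := x ^ (B ^ i)] separates the monomials. *)
Lemma mpoly_nat_eq0 n (p : {mpoly K[n]}) :
  (forall k : 'I_n -> nat, p.@[fun i => (k i)%:R] = 0) -> p = 0.
Proof.
move=> h; pose B := msize p.
pose code (m : 'X_{1..n}) := (\sum_(i < n) m i * B ^ i)%N.
have P0 : mmap polyC (fun i : 'I_n => 'X^(B ^ i)) p = 0.
  apply: poly_nat_eq0 => k; rewrite horner_mmap -[RHS](h (fun i => k ^ (B ^ i))%N).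
  by apply: meval_eq => i; rewrite hornerXn natrX.
apply/mpolyP => m0; rewrite mcoeff0.
have [hm0|/memN_msupp_eq0 //] := boolP (m0 \in msupp p).
move/(congr1 (fun q : {poly K} => q`_(code m0))): P0; rewrite coef0 /mmap coef_sum => <-.
have cE m : mmap1 (fun i : 'I_n => 'X^(B ^ i) : {poly K}) m = 'X^(code m).
  rewrite /mmap1 /code; elim/big_ind2: _ => [|x1 x2 y1 y2 -> ->|i _]; rewrite ?expr0 //.
    by rewrite exprD.
  by rewrite -exprM mulnC.
under eq_bigr do rewrite cE coefCM coefXn.
rewrite (bigD1_seq m0) ?msupp_uniq //= eqxx mulr1 big_seq_cond big1 ?addr0 // => m /andP[hm mm0].
case: eqP => [e|]; last by rewrite mulr0.
case/eqP: mm0; apply/mnmP => i.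
have lt1 m' (i' : 'I_n) : m' \in msupp p -> (m' i' < B)%N.
  move=> /msize_mdeg_lt; apply: leq_ltn_trans.
  by rewrite mdegE (bigD1 i') //= leq_addr.
have := @base_code_inj B n (fun j => nth 0%N m j) (fun j => nth 0%N m0 j) _ _ i (ltn_ord i).
rewrite -!mnm_nth; apply.
  by move=> j hj; rewrite -!(mnm_nth _ _ (Ordinal hj)) !lt1.
rewrite /code in e; under eq_bigr do rewrite -mnm_nth.
by under [in RHS]eq_bigr do rewrite -mnm_nth.
Qed.

Lemma mpoly_ext n (p q : {mpoly K[n]}) : (forall v, p.@[v] = q.@[v]) -> p = q.
Proof.
move=> h; apply/eqP; rewrite -subr_eq0; apply/eqP; apply: mpoly_nat_eq0 => k.
by rewrite mevalB h subrr.
Qed.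

Lemma mpoly_generic_eq0 n (p h : {mpoly K[n]}) :
  h != 0 -> (forall v, h.@[v] != 0 -> p.@[v] = 0) -> p = 0.
Proof.
move=> h0 H; have : p * h = 0.
  apply: mpoly_ext => v; rewrite mevalM meval0.
  by have [->|/H ->] := eqVneq h.@[v] 0; rewrite ?mulr0 ?mul0r.
by move/eqP; rewrite mulf_eq0 (negPf h0) orbF => /eqP.
Qed.

Lemma mpoly_neq0_ex n (p : {mpoly K[n]}) :
  p != 0 -> exists k : 'I_n -> nat, p.@[fun i => (k i)%:R] != 0.
Proof.
move=> p0; apply: boolp.contrapT => h; case/eqP: p0; apply: mpoly_nat_eq0 => k.
by apply/eqP; apply: contraT => hk; case: h; exists k.
Qed.

Lemma homog_scale n (p : {mpoly K[n]}) d (c : K) (v : 'I_n -> K) :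
  p \is d.-homog -> p.@[fun i => c * v i] = c ^+ d * p.@[v].
Proof.
move=> /dhomogP hp; rewrite !mevalE mulr_sumr !big_seq; apply: eq_bigr => m /hp dm.
rewrite mulrCA; congr (_ * _); rewrite -[in c ^+ d]dm /= mdegE -prodrXr -big_split /=.
by apply: eq_bigr => i _; rewrite exprMn.
Qed.

End PolynomialFunctions.

(** * Irreducible sets and dimension *)

Section ProjectiveVarieties.
Variable K : numFieldType.

Lemma zclosure_closed n (X : pset K n) : zclosed (zclosure X).
Proof.
by exists (fun f => homogeneous f /\ forall v, X v -> f.@[v ord0] = 0); split=> [f []|].
Qed.

Lemma zclosure_sub n (X : pset K n) v : v != 0 -> X v -> zclosure X v.
Proof. by move=> v0 Xv; split=> // f [_]; apply. Qed.

Lemma zclosure_min n (X Z : pset K n) :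
  zclosed Z -> psubset X Z -> psubset (zclosure X) Z.
Proof.
move=> [F [Fh ZF]] XZ v [v0 hv]; apply/ZF; split=> // f Ff; apply: hv; split=> [|w /XZ].
  exact: Fh.
by move/ZF => [_]; apply.
Qed.

Lemma zclosed_neq0 n (Z : pset K n) v : zclosed Z -> Z v -> v != 0.
Proof. by move=> [F [_ ZF]] /ZF[]. Qed.

Lemma zclosed_scale n (Z : pset K n) c v :
  zclosed Z -> c != 0 -> Z v -> Z (c *: v).
Proof.
move=> [F [Fh ZF]] c0 /ZF[v0 hv]; apply/ZF; split=> [|f Ff].
  by rewrite scaler_eq0 negb_or c0.
have [d fd] := Fh f Ff.
rewrite (@meval_eq _ _ _ (fun i => c * v ord0 i)); last by move=> i; rewrite mxE.
by rewrite (homog_scale _ _ fd) hv ?mulr0.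
Qed.

Lemma zclosed_sep n (Z : pset K n) v : zclosed Z -> v != 0 -> ~ Z v ->
  exists f, [/\ homogeneous f, forall w, Z w -> f.@[w ord0] = 0 & f.@[v ord0] != 0].
Proof.
move=> [F [Fh ZF]] v0 nZ; apply: boolp.contrapT => h; apply: nZ; apply/ZF; split=> // f Ff.
apply/eqP; apply: contraT => fv; case: h; exists f; split=> //; first exact: Fh.
by move=> w /ZF[_]; apply.
Qed.

(** The zero loci of the two factors are closed and cover [Z], so irreducibility selects one of
    them. *)
Lemma variety_mul n (Z : pset K n) (f g : {mpoly K[n]}) :
  variety Z -> homogeneous f -> homogeneous g ->
  (forall v, Z v -> f.@[v ord0] * g.@[v ord0] = 0) ->
  (forall v, Z v -> f.@[v ord0] = 0) \/ (forall v, Z v -> g.@[v ord0] = 0).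
Proof.
move=> [Zc _ irr] hf hg fg.
have cl (q : {mpoly K[n]}) : homogeneous q -> zclosed (fun v => v != 0 /\ q.@[v ord0] = 0).
  move=> hq; exists (eq q); split=> [_ <- //|v].
  split=> [[v0 qv]|[v0 hv]]; first by split=> // _ <-.
  by split=> //; exact: hv.
have [v Zv|Zf|Zg] := irr _ _ (cl f hf) (cl g hg).
- have v0 := zclosed_neq0 Zc Zv.
  by move/eqP: (fg v Zv); rewrite mulf_eq0 => /orP[]/eqP; [left|right].
- by left=> v /Zf[].
- by right=> v /Zg[].
Qed.

(** The parameters range over the part [h != 0] of affine space. The polynomials [th] need not be
    homogeneous, since only the vectors of the image matter. *)
Definition param_image n k (th : 'I_n -> {mpoly K[k]}) (h : {mpoly K[k]}) : pset K n :=
  fun v => exists2 z, h.@[z] != 0 & v = \row_i (th i).@[z].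

Lemma meval_param n k (f : {mpoly K[n]}) (th : 'I_n -> {mpoly K[k]}) z :
  (f \mPo [tuple th i | i < n]).@[z] = f.@[(\row_i (th i).@[z] : 'rV_n) ord0].
Proof.
by rewrite comp_mpoly_meval; apply: meval_eq => i; rewrite tnth_mktuple mxE.
Qed.

Lemma param_image_neq0 n k (th : 'I_n -> {mpoly K[k]}) h (f : {mpoly K[n]}) v :
  homogeneous f -> zclosure (param_image th h) v -> f.@[v ord0] != 0 ->
  f \mPo [tuple th i | i < n] != 0.
Proof.
move=> fh [v0 hv]; apply: contraNN => /eqP e; apply/eqP; apply: hv; split=> // w [z _ ->].
by rewrite -meval_param e meval0.
Qed.

(** A form that does not vanish on the closure pulls back to a nonzero polynomial, and nonzero
    polynomials have a nonzero product; so two proper closed subsets cannot cover. *)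
Lemma param_variety n k (th : 'I_n -> {mpoly K[k]}) h :
  h != 0 -> (forall z, h.@[z] != 0 -> \row_i (th i).@[z] != 0) ->
  variety (zclosure (param_image th h)).
Proof.
move=> h0 hth; split; first exact: zclosure_closed.
  have [z hz] := mpoly_neq0_ex h0.
  exists (\row_i (th i).@[fun i => (z i)%:R]); apply: zclosure_sub; first exact: hth.
  by exists (fun i => (z i)%:R).
move=> Y Z Yc Zc cov.
set X := zclosure _.
have sub v : X v -> v != 0 by case.
apply: boolp.contrapT => /boolp.not_orP[nY nZ].
have sep W : zclosed W -> ~ psubset X W -> exists f, [/\ homogeneous f,
    forall w, W w -> f.@[w ord0] = 0 & f \mPo [tuple th i | i < n] != 0].
  move=> Wc nW; have [v /boolp.not_implyP[Xv nWv]] : exists v, ~ (X v -> W v).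
    by apply/boolp.existsNP.
  have [f [fh fW fv]] := zclosed_sep Wc (sub v Xv) nWv.
  by exists f; split=> //; exact: param_image_neq0 fh Xv fv.
have [f [fh fY f0]] := sep Y Yc nY.
have [g [gh gZ g0]] := sep Z Zc nZ.
have : (f \mPo [tuple th i | i < n]) * (g \mPo [tuple th i | i < n]) * h != 0.
  by rewrite !mulf_neq0.
case/mpoly_neq0_ex => z; rewrite !mevalM !mulf_eq0 !negb_or !meval_param => /andP[/andP[fz gz] hz].
have Xz : X (\row_i (th i).@[fun i => (z i)%:R]).
  by apply: zclosure_sub; [exact: hth | exists (fun i => (z i)%:R)].
by case: (cov _ Xz) => [/fY e|/gZ e]; [rewrite e eqxx in fz | rewrite e eqxx in gz].
Qed.

Lemma homog_sum n d (I : finType) (F : I -> {mpoly K[n]}) :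
  (forall i, F i \is d.-homog) -> \sum_i F i \is d.-homog.
Proof. by move=> h; apply: rpred_sum => i _; exact: h. Qed.

(** On [Z'] the relation reduces to its term without [f], so [h 0] vanishes there and is zero. The
    rest is divisible by [f], which can be cancelled on the irreducible [Z]; the induction goes on
    with [N] lowered by one. *)
Lemma chain_step n (Z Z' : pset K n) f D m N (h : nat -> {mpoly K[n]}) :
  variety Z -> psubset Z' Z ->
  f \is D.-homog -> (forall v, Z' v -> f.@[v ord0] = 0) ->
  ~ (forall v, Z v -> f.@[v ord0] = 0) -> (m <= N)%N ->
  (forall k, (k < m)%N -> h k \is (D * (N - k)).-homog) ->
  (forall k, (k < m)%N -> (forall v, Z' v -> (h k).@[v ord0] = 0) -> h k = 0) ->
  (forall v, Z v -> (\sum_(k < m) h k * f ^+ k).@[v ord0] = 0) ->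
  forall k, (k < m)%N -> h k = 0.
Proof.
move=> Zv Z'Z fD fZ' fZ; elim: m N h => [|m IHm] N h //= mN hD hh hs.
have h0 : h 0%N = 0.
  apply: hh => // v Z'v; have := hs v (Z'Z v Z'v); rewrite big_ord_recl expr0 mulr1 mevalD.
  rewrite raddf_sum /= big1 ?addr0 // => i _.
  by rewrite mevalM exprS mevalM fZ' // mul0r mulr0.
case=> [|k] // km; apply: (IHm N.-1 (fun k => h k.+1)) => //.
- by rewrite -ltnS prednK // (leq_trans _ mN).
- by move=> j jm; rewrite -subn1 subnAC subn1 -subnS; exact: hD.
- by move=> j jm; exact: hh.
have [|||//|g0] := @variety_mul n Z f (\sum_(k < m) h k.+1 * f ^+ k) Zv.
- by exists D.
- exists (D * N.-1)%N; apply: homog_sum => i.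
  have -> : (D * N.-1 = D * (N - i.+1) + D * i)%N.
    by rewrite -mulnDr; congr (_ * _)%N; have := ltn_ord i; lia.
  by apply: dhomogM; [apply: hD; rewrite ltnS | exact: dhomogMn].
- move=> v Zv'; rewrite -mevalM; have := hs v Zv'.
  rewrite big_ord_recl h0 mul0r add0r mulr_sumr => <-; congr (_.@[_]).
  by apply: eq_bigr => i _; rewrite /= exprS mulrCA.
by move=> v Zv'; exact: g0.
Qed.

Lemma msize_exp_le n (p : {mpoly K[n]}) d k :
  (msize p <= d.+1)%N -> (msize (p ^+ k) <= (d * k).+1)%N.
Proof.
move=> hp; elim: k => [|k IHk]; first by rewrite expr0 msize1.
rewrite exprS; have [->|p0] := eqVneq p 0; first by rewrite mul0r msize0.
have [->|pk0] := eqVneq (p ^+ k) 0; first by rewrite mulr0 msize0.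
by rewrite msizeM // mulnS -addnS -subn1 leq_subLR add1n -addSn leq_add.
Qed.

Lemma msize_mul_le n (p q : {mpoly K[n]}) d e :
  (msize p <= d.+1)%N -> (msize q <= e.+1)%N -> (msize (p * q) <= (d + e).+1)%N.
Proof.
move=> hp hq; have [->|p0] := eqVneq p 0; first by rewrite mul0r msize0.
have [->|q0] := eqVneq q 0; first by rewrite mulr0 msize0.
by rewrite msizeM // -addnS -subn1 leq_subLR add1n -addSn leq_add.
Qed.

(** Counting: the [m ^ 3] monomials lie in a space of dimension [B ^ 2], where [B] grows linearly
    with [m]. The power of the first polynomial makes all monomials of degree [3 * m], so that the
    relation comes from a form. *)
Lemma algebraic_dependence (g : 'I_4 -> {mpoly K[2]}) :
  exists m (c : 'I_m * 'I_m * 'I_m -> K), (exists x, c x != 0) /\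
   \sum_x c x *: (g 0 ^+ (3 * m - x.1.1 - x.1.2 - x.2) * g 1 ^+ x.1.1
                  * g 2 ^+ x.1.2 * g 3 ^+ x.2) = 0.
Proof.
pose d := (\max_(i < 4) msize (g i))%N.
have gd i : (msize (g i) <= d.+1)%N.
  by apply: leqW; rewrite /d (bigD1 i) //= leq_maxl.
(* Since [B] is at most [(9 * d).+1 * m], a value of [m] above [(9 * d).+1 ^ 2] gives
   [B ^ 2 < m ^ 3]. *)
pose m := ((9 * d).+1 ^ 2).+1; pose B := (9 * d * m).+1.
pose mono (x : 'I_m * 'I_m * 'I_m) := g 0 ^+ (3 * m - x.1.1 - x.1.2 - x.2) * g 1 ^+ x.1.1
                  * g 2 ^+ x.1.2 * g 3 ^+ x.2.
have size_mono x : (msize (mono x) <= B)%N.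
  have : (msize (mono x) <=
    (d * (3 * m - x.1.1 - x.1.2 - x.2) + d * x.1.1 + d * x.1.2 + d * x.2).+1)%N.
    by rewrite /mono !(msize_mul_le, msize_exp_le).
  move=> h; apply: leq_trans h _; rewrite ltnS -!mulnDr (mulnC 9) -mulnA leq_mul2l.
  apply/orP; right.
  have l i : (i < m -> i <= m)%N by move=> /ltnW.
  have := l _ (ltn_ord x.1.1); have := l _ (ltn_ord x.1.2); have := l _ (ltn_ord x.2).
  move: (nat_of_ord x.1.1) (nat_of_ord x.1.2) (nat_of_ord x.2) => a b e.
  move=> ha hb he; apply: (@leq_trans (3 * m + m + m + m)).
    by rewrite !leq_add // -!subnDA leq_subr.
  by rewrite -!mulSnr leq_mul2r orbT.
pose T1 := ('I_m * 'I_m * 'I_m)%type; pose T2 := ('I_B * 'I_B)%type.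
pose mn (y : T2) : 'X_{1..2} := [multinom of [:: nat_of_ord y.1; nat_of_ord y.2]].
pose A : 'M[K]_(#|{: T1}|, #|{: T2}|) := \matrix_(x, y) (mono (enum_val x))@_(mn (enum_val y)).
have : kermx A != 0.
  rewrite -mxrank_eq0 mxrank_ker -lt0n subn_gt0.
  apply: leq_ltn_trans (rank_leq_col A) _.
  rewrite !card_prod !card_ord.
  have Bm : (B <= (9 * d).+1 * m)%N by rewrite /B [leqRHS]mulSn -[leqLHS]add1n leq_add2r.
  apply: (@leq_ltn_trans (((9 * d).+1 * m) * ((9 * d).+1 * m))%N); first by rewrite leq_mul.
  have a2 : ((9 * d).+1 * (9 * d).+1 < m)%N by rewrite mulnn ltnS.
  by rewrite mulnACA -[ltnRHS]mulnA ltn_pmul2r.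
case/rowV0Pn => v /sub_kermxP vA v0.
exists m, (fun x => v ord0 (enum_rank x)); split.
  apply: boolp.contrapT => h; case/eqP: v0; apply/rowP => i; rewrite mxE.
  apply/eqP; apply: contraT => vi; case: h; exists (enum_val i).
  by rewrite enum_valK.
apply/mpolyP => mm; rewrite mcoeff0 raddf_sum /=.
under eq_bigr do rewrite mcoeffZ.
have [hB|hB] := boolP ((mm ord0 < B)%N && (mm (lift ord0 ord0) < B)%N); last first.
  apply: big1 => x _; rewrite -/(mono x) (@memN_msupp_eq0 _ _ (mono x)) ?mulr0 //.
  apply: contraNN hB => /msize_mdeg_lt hm.
  have := leq_trans hm (size_mono x); rewrite mdegE !big_ord_recl big_ord0 addn0 => hb.
  by rewrite (leq_ltn_trans _ hb) ?leq_addr // (leq_ltn_trans _ hb) ?leq_addl.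
case/andP: hB => h0 h1.
have := congr1 (fun w : 'rV_ _ => w ord0 (enum_rank (Ordinal h0, Ordinal h1))) vA.
rewrite !mxE (reindex_onto enum_rank enum_val) /=; last by move=> i _; rewrite enum_valK.
under eq_bigl do rewrite enum_rankK eqxx.
move=> e; rewrite -[RHS]e; apply: eq_bigr => x _; rewrite mxE !enum_rankK; congr (_ * _@__).
apply/mnmP => i; rewrite [RHS](mnm_nth 0%N); case: i => [[|[|]]] //= hi;
  by congr (mm _); apply: val_inj.
Qed.

End ProjectiveVarieties.

(** * Upper bound for the dimension of a parametrized surface *)

Section SurfaceDimension.
Variable K : numFieldType.

(** Grouping by powers of [g3], then [g2], then [g1] prepares three successive uses of
    [chain_step]. *)
Lemma nested_dependence (g0 g1 g2 g3 : {mpoly K[2]}) :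
  exists m (c : nat -> nat -> nat -> K),
   (exists i j k, [/\ (i < m)%N, (j < m)%N, (k < m)%N & c i j k != 0]) /\
   \sum_(k < m) (\sum_(j < m) (\sum_(i < m) c i j k *: g0 ^+ (3 * m - k - j - i) * g1 ^+ i)
      * g2 ^+ j) * g3 ^+ k = 0.
Proof.
have [m [c [[x0 cx0] cs]]] :=
  algebraic_dependence (fun i : 'I_4 => nth 0 [:: g0; g3; g2; g1] i).
have [m0|m0] := posnP m; first by move: (x0.2); rewrite m0 => [[]].
case: m m0 c x0 cx0 cs => // m _ c x0 cx0 cs.
exists m.+1, (fun i j k => c (inord k, inord j, inord i)); split.
  exists x0.2, x0.1.2, x0.1.1; rewrite !ltn_ord !inord_val; split=> //.
  by case: x0 cx0 => [[]].
rewrite -[RHS]cs [RHS](eq_bigr (fun x => (c (x.1.1, x.1.2, x.2) *: g0 ^+ (3 * m.+1 - x.1.1 - x.1.2 - x.2) * g1 ^+ x.2)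
     * g2 ^+ x.1.2 * g3 ^+ x.1.1)); last first.
  by move=> [[k j] i] _ /=; rewrite -!scalerAl; congr (_ *: _); ring.
rewrite -(pair_bigA _ (fun y i => (c (y.1, y.2, i) *: g0 ^+ (3 * m.+1 - y.1 - y.2 - i) * g1 ^+ i)
     * g2 ^+ y.2 * g3 ^+ y.1)) /=.
rewrite -(pair_bigA _ (fun k j => \sum_i (c (k, j, i) *: g0 ^+ (3 * m.+1 - k - j - i) * g1 ^+ i)
     * g2 ^+ j * g3 ^+ k)) /=.
apply: eq_bigr => k _; rewrite mulr_suml; apply: eq_bigr => j _.
by rewrite !mulr_suml; apply: eq_bigr => i _; rewrite !inord_val.
Qed.

(** For a chain [Z 0], ..., [Z 3] in the surface there are forms vanishing on [Z i] but not on
    [Z i.+1]. With a coordinate nonzero at a point of [Z 0] they make four forms, which satisfy a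
    nontrivial relation on the surface. Peeling it off along [Z 3], [Z 2] and [Z 1] makes all its
    coefficients vanish. *)
Lemma surface_dim_lt3 n (X : pset K n) (th : 'I_n -> {mpoly K[2]}) h :
  psubset X (zclosure (param_image th h)) -> ~ dim_ge X 3.
Proof.
have le1 (m k : nat) : (k < m)%N -> (m <= 3 * m - k)%N by clear; lia.
have le2 (m k j : nat) : (k < m)%N -> (j < m)%N -> (m <= 3 * m - k - j)%N by clear; lia.
move=> XP [Z [Zv Zs]].
have Zvar i : (i <= 3)%N -> variety (Z i) by move=> /Zv[].
have Zc i : (i <= 3)%N -> zclosed (Z i) by move=> /Zvar[].
have [z Zz] : exists z, Z 0%N z by case: (Zvar 0%N isT).
have Zz_ i : (i <= 3)%N -> Z i z.
  by elim: i => // i IHi hi; apply: (Zs i hi).1; apply: IHi; apply: ltnW.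
have [j0 zj0] : exists j, z ord0 j != 0.
  by apply/rV0Pn; exact: zclosed_neq0 (Zc 0%N isT) Zz.
have ex i : (i < 3)%N -> exists fd : {mpoly K[n]} * nat, [/\ fd.1 \is fd.2.-homog,
    forall v, Z i v -> fd.1.@[v ord0] = 0 & exists2 v, Z i.+1 v & fd.1.@[v ord0] != 0].
  move=> hi; have [v /boolp.not_implyP[Zv1 nZ]] : exists v, ~ (Z i.+1 v -> Z i v).
    by apply/boolp.existsNP; exact: (Zs i hi).2.
  have [f [[d fd] fZ fv]] :=
    zclosed_sep (Zc i (ltnW hi)) (zclosed_neq0 (Zc i.+1 hi) Zv1) nZ.
  by exists (f, d); split=> //; exists v.
have [[p1 d1] /= [h1 v1 n1]] := ex 0%N isT.
have [[p2 d2] /= [h2 v2 n2]] := ex 1%N isT.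
have [[p3 d3] /= [h3 v3 n3]] := ex 2%N isT.
(* The coordinate [l] is nonzero at a point common to the whole chain. Its powers bring the three
   forms to the common degree [D] and cannot make a form vanish on an irreducible [Z i]. *)
pose D := (d1 + d2 + d3)%N; pose l : {mpoly K[n]} := 'X_j0.
have lh : l \is 1.-homog by rewrite dhomogX /= mdeg1.
have lz e : (l ^+ e).@[z ord0] != 0 by rewrite rmorphXn /= mevalXU expf_neq0.
have lhe e : l ^+ e \is e.-homog by rewrite -[X in X.-homog]mul1n; exact: dhomogMn.
pose F0 := l ^+ D; pose F1 := p1 * l ^+ (D - d1); pose F2 := p2 * l ^+ (D - d2).
pose F3 := p3 * l ^+ (D - d3).
have F0h : F0 \is D.-homog by exact: lhe.
have Fh (p : {mpoly K[n]}) d : p \is d.-homog -> (d <= D)%N -> p * l ^+ (D - d) \is D.-homog.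
  by move=> hp hd; rewrite -[X in X.-homog](subnKC hd); apply: dhomogM => //; exact: lhe.
have F1h : F1 \is D.-homog by apply: Fh => //; rewrite /D -addnA leq_addr.
have F2h : F2 \is D.-homog by apply: Fh => //; rewrite /D addnAC leq_addl.
have F3h : F3 \is D.-homog by apply: Fh => //; rewrite /D leq_addl.
have Fv (p q : {mpoly K[n]}) i : (forall v, Z i v -> p.@[v ord0] = 0) ->
    forall v, Z i v -> (p * q).@[v ord0] = 0.
  by move=> hp v /hp e; rewrite mevalM e mul0r.
have Fn (p : {mpoly K[n]}) d e i : (i <= 3)%N -> p \is d.-homog ->
    (exists2 v, Z i v & p.@[v ord0] != 0) -> ~ (forall v, Z i v -> (p * l ^+ e).@[v ord0] = 0).
  move=> hi hp [v Zv0 pv] hv; have [||w Zw|a|a] := @variety_mul _ n (Z i) p (l ^+ e) (Zvar i hi).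
  - by exists d.
  - by exists e.
  - by rewrite -mevalM hv.
  - by rewrite a ?eqxx in pv.
  - by have := lz e; rewrite a ?eqxx //; exact: Zz_.
have [m [c [[i0 [j [k [hi hj hk cn]]]] cs]]] := nested_dependence
  (F0 \mPo [tuple th i | i < n]) (F1 \mPo [tuple th i | i < n])
  (F2 \mPo [tuple th i | i < n]) (F3 \mPo [tuple th i | i < n]).
pose A1 k j i := c i j k *: F0 ^+ (3 * m - k - j - i).
pose A2 k j := \sum_(i < m) A1 k j i * F1 ^+ i.
pose A3 k := \sum_(j < m) A2 k j * F2 ^+ j.
have hA1 k' j' i' : A1 k' j' i' \is (D * (3 * m - k' - j' - i')).-homog.
  by apply: rpredZ; exact: dhomogMn.
have hsum N f (u : nat -> {mpoly K[n]}) : f \is D.-homog -> (m <= N)%N ->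
    (forall i', (i' < m)%N -> u i' \is (D * (N - i')).-homog) ->
    \sum_(i' < m) u i' * f ^+ i' \is (D * N).-homog.
  move=> fh mN hu; apply: homog_sum => i'.
  have -> : (D * N = D * (N - i') + D * i')%N.
    by rewrite -mulnDr subnK // (leq_trans (ltnW (ltn_ord i')) mN).
  by apply: dhomogM; [exact: hu | exact: dhomogMn].
have hA2 k' j' : (k' < m)%N -> (j' < m)%N -> A2 k' j' \is (D * (3 * m - k' - j')).-homog.
  by move=> ? ?; apply: hsum => //; exact: le2.
have hA3 k' : (k' < m)%N -> A3 k' \is (D * (3 * m - k')).-homog.
  by move=> ?; apply: hsum => //; [exact: le1 | move=> *; exact: hA2].
have s1 k' j' : (k' < m)%N -> (j' < m)%N ->
    (forall v, Z 1%N v -> (A2 k' j').@[v ord0] = 0) ->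
    forall i', (i' < m)%N -> c i' j' k' = 0.
  move=> hk' hj' hv i' hi'.
  have cz e : (forall v, Z 0%N v -> (A1 k' j' e).@[v ord0] = 0) -> c e j' k' = 0.
    move=> /(_ z Zz); rewrite mevalZ => /eqP; rewrite mulf_eq0 rmorphXn /= expf_eq0.
    by rewrite (negPf (lz _)) andbF orbF => /eqP.
  apply: (cz i'); suff -> : A1 k' j' i' = 0 by move=> v _; rewrite meval0.
  move: i' hi'; apply: (@chain_step _ _ _ _ _ _ _ (3 * m - k' - j')%N (A1 k' j') (Zvar 1%N isT) _ F1h (Fv _ _ _ v1)) hv.
  - exact: (Zs 0%N isT).1.
  - exact: Fn h1 n1.
  - exact: le2.
  - by move=> i' _; exact: hA1.
  - by move=> i' _ /cz e; rewrite /A1 e scale0r.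
have s2 k' : (k' < m)%N -> (forall v, Z 2%N v -> (A3 k').@[v ord0] = 0) ->
    forall j', (j' < m)%N -> A2 k' j' = 0.
  move=> hk' hv; apply: (@chain_step _ _ _ _ _ _ _ (3 * m - k')%N (A2 k') (Zvar 2%N isT) _ F2h (Fv _ _ _ v2)) hv.
  - exact: (Zs 1%N isT).1.
  - exact: Fn h2 n2.
  - exact: le1.
  - by move=> j' ?; exact: hA2.
  - by move=> j' ? /s1 e; apply: big1 => i' _; rewrite /A1 e ?scale0r ?mul0r.
have s3 : forall k', (k' < m)%N -> A3 k' = 0.
  apply: (@chain_step _ _ _ _ _ _ _ (3 * m)%N A3 (Zvar 3%N isT) (Zs 2%N isT).1 F3h (Fv _ _ _ v3) (Fn _ _ _ _ _ h3 n3)).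
  - done.
  - exact: leq_pmull.
  - by move=> k' ?; exact: hA3.
  - move=> k' hk' /s2 e; apply: big1 => j' _; rewrite e ?mul0r //.
  (* The pullback of the form is the relation [cs], so the form vanishes on the closure of the
     image. *)
  move=> v Zv3; have [_ /(_ _ Zv3) /XP Xv] := Zv 3%N isT.
  have hom : homogeneous (\sum_(k' < m) A3 k' * F3 ^+ k').
    by exists (D * (3 * m))%N; apply: hsum => //; exact: leq_pmull.
  apply/eqP; apply: contraT => /(param_image_neq0 hom Xv); apply: contraR => _.
  rewrite -[X in _ == X]cs; apply/eqP; rewrite raddf_sum; apply: eq_bigr => k' _.
  rewrite /= rmorphM rmorphXn /= /A3 raddf_sum; congr (_ * _); apply: eq_bigr => j' _.
  rewrite /= rmorphM rmorphXn /= /A2 raddf_sum; congr (_ * _); apply: eq_bigr => i' _.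
  by rewrite /= rmorphM /= /A1 linearZ /= !rmorphXn.
case/eqP: cn; apply: s1 hi => // v _.
by rewrite (s2 k hk) ?meval0 // => w _; rewrite s3 ?meval0.
Qed.

End SurfaceDimension.

Definition row4 (K : fieldType) (a b c d : K) : 'rV[K]_4 := \row_i nth 0 [:: a; b; c; d] i.

Lemma row4E (K : fieldType) (v : 'rV[K]_4) :
  v = row4 (v ord0 (inord 0)) (v ord0 (inord 1)) (v ord0 (inord 2)) (v ord0 (inord 3)).
Proof.
apply/rowP => i; rewrite !mxE; case: i => [[|[|[|[|]]]]] //= hi;
  by congr (v ord0 _); apply: val_inj; rewrite /= inordK.
Qed.

Lemma row4_inj (K : fieldType) (a b c d a' b' c' d' : K) :
  row4 a b c d = row4 a' b' c' d' -> [/\ a = a', b = b', c = c' & d = d'].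
Proof.
move=> e; have h (k : 'I_4) : nth 0 [:: a; b; c; d] k = nth 0 [:: a'; b'; c'; d'] k.
  by move/rowP: e => /(_ k); rewrite !mxE.
split; [exact: (h (Ordinal (isT : 0 < 4)%N)) | exact: (h (Ordinal (isT : 1 < 4)%N))
       | exact: (h (Ordinal (isT : 2 < 4)%N)) | exact: (h (Ordinal (isT : 3 < 4)%N))].
Qed.

Definition linear_form (K : fieldType) n (c : 'cV[K]_n) : {mpoly K[n]} :=
  \sum_i c i ord0 *: 'X_i.

Lemma linear_form_homog (K : numFieldType) n (c : 'cV[K]_n) : linear_form c \is 1.-homog.
Proof. by apply: rpred_sum => i _; apply: rpredZ; rewrite dhomogX /= mdeg1. Qed.

Lemma meval_linear_form (K : fieldType) n (c : 'cV[K]_n) (v : 'rV[K]_n) :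
  (linear_form c).@[v ord0] = (v *m c) ord0 ord0.
Proof.
rewrite /linear_form raddf_sum mxE /=; apply: eq_bigr => i _.
by rewrite mevalZ mevalXU mulrC.
Qed.

Lemma mulmx_col_entry (K : fieldType) n m (v : 'rV[K]_n) (M : 'M[K]_(n, m)) j :
  (v *m col j M) ord0 ord0 = (v *m M) ord0 j.
Proof. by rewrite !mxE; apply: eq_bigr => i _; rewrite mxE. Qed.

(** * Quadric surfaces in a 3-plane *)

Section QuadricSurface.
Variables (K : numFieldType) (n : nat) (E : 'M[K]_(4, n)) (D : 'M[K]_(n, 4)).
Variables al be ga : K.

Definition qf (z w : K) := al * z ^+ 2 + be * (z * w) + ga * w ^+ 2.

(** The rows of [E] span the 3-plane, with coordinates [a], [b], [c], [d]. For nonzero [qf] the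
    surface is a smooth quadric or a quadric cone according to the discriminant of [qf]; both kinds
    occur below. *)
Definition quadric_surface : pset K n := fun p =>
  p != 0 /\ exists a b c d, p = row4 a b c d *m E /\ a * d = qf b c.

Hypothesis ED : E *m D = 1%:M.
Hypothesis q0 : (al != 0) || (be != 0) || (ga != 0).

Lemma coord_rowK (v : 'rV[K]_4) : v *m E *m D = v.
Proof. by rewrite -mulmxA ED mulmx1. Qed.

Lemma row4_neq0 a b c d : a != 0 -> row4 a b c d *m E != 0.
Proof.
apply: contraNneq => /(congr1 (mulmx^~ D)); rewrite coord_rowK mul0mx => e.
by move/rowP: e => /(_ ord0); rewrite !mxE /= => ->.
Qed.

(** The affine chart [a = 1]. Polynomials in place of [b] and [c] allow points and curves of the
    surface to be parametrized in the same way. *)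
Definition qparam k (P Q : {mpoly K[k]}) (i : 'I_n) : {mpoly K[k]} :=
  \sum_(j < 4) nth 0 [:: 1; P; Q; al *: P ^+ 2 + be *: (P * Q) + ga *: Q ^+ 2] j * (E j i)%:MP.

Lemma qparamE k (P Q : {mpoly K[k]}) z :
  \row_i (qparam P Q i).@[z] = row4 1 P.@[z] Q.@[z] (qf P.@[z] Q.@[z]) *m E.
Proof.
apply/rowP => i; rewrite !mxE raddf_sum /=; apply: eq_bigr => j _.
rewrite mxE mevalM mevalC; congr (_ * _).
case: j => [[|[|[|[|]]]]] //= _; first by rewrite meval1.
by rewrite !expr2 !mevalD !mevalZ !mevalM /qf !expr2.
Qed.

(** The right inverse [D] of [E] reads off the coordinates, which turns membership into polynomial
    conditions on [p]. *)
Lemma quadric_surface_closed p :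
  quadric_surface p <-> p != 0 /\ p = p *m D *m E /\
    let v := (p *m D) ord0 in
    v (inord 0) * v (inord 3) = qf (v (inord 1)) (v (inord 2)).
Proof.
split=> [[p0 [a [b [c [d [pE e]]]]]]|[p0 [e1 e2]]].
  split=> //; rewrite pE !coord_rowK; split=> //=.
  by rewrite !mxE !inordK.
split=> //; do 4 eexists; split; last exact: e2.
by rewrite {1}e1 {1}[p *m D]row4E.
Qed.

Lemma sub_quadric_surface k (P Q : {mpoly K[k]}) h :
  psubset (zclosure (param_image (qparam P Q) h)) quadric_surface.
Proof.
apply: zclosure_min; last first.
  move=> _ [z _ ->]; rewrite qparamE; split; first by rewrite row4_neq0 ?oner_eq0.
  by do 4 eexists; split; [reflexivity | rewrite mul1r].
pose L k := linear_form (col (inord k : 'I_4) D).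
pose q := L 0%N * L 3%N - (al *: L 1%N ^+ 2 + be *: (L 1%N * L 2%N) + ga *: L 2%N ^+ 2).
exists (fun f => (exists i, f = linear_form (col i (1%:M - D *m E))) \/ f = q); split.
  move=> f [[i ->]|->]; first by exists 1%N; exact: linear_form_homog.
  have Lh k' : L k' \is 1.-homog by exact: linear_form_homog.
  exists 2%N; rewrite /q rpredB // ?(dhomogM (Lh _) (Lh _)) //.
  by rewrite !rpredD // rpredZ // ?(dhomogM (Lh _) (Lh _)).
move=> p; rewrite quadric_surface_closed.
have Lp k' : (L k').@[p ord0] = (p *m D) ord0 (inord k').
  by rewrite meval_linear_form mulmx_col_entry.
have qp : q.@[p ord0] = 0 <-> let v := (p *m D) ord0 in
    v (inord 0) * v (inord 3) = qf (v (inord 1)) (v (inord 2)).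
  rewrite /q !expr2 mevalB !mevalD !mevalZ !mevalM /= !Lp /qf !expr2.
  by split=> [/eqP|->]; rewrite ?subr_eq0 ?subrr // => /eqP.
have lp : (forall i, (linear_form (col i (1%:M - D *m E))).@[p ord0] = 0) <-> p = p *m D *m E.
  have e i : (linear_form (col i (1%:M - D *m E))).@[p ord0] = (p - p *m D *m E) ord0 i.
    by rewrite meval_linear_form mulmx_col_entry mulmxBr mulmx1 mulmxA.
  split=> [h'|h' i]; last by rewrite e -h' subrr mxE.
  by apply/eqP; rewrite -subr_eq0; apply/eqP/rowP => i; rewrite -e h' mxE.
split=> [[p0 [/lp e1 /qp e2]]|[p0 h']].
  by split=> // f [[i ->]|->] //; exact: e1.
by split=> //; split; [apply/lp => i; apply: h'; left; exists i | apply/qp/h'; right].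
Qed.

Lemma form_poly (f : {mpoly K[n]}) (c : 'I_4 -> {poly K}) :
  exists P : {poly K}, forall x, P.[x] = f.@[((\row_j (c j).[x]) *m E) ord0].
Proof.
exists (mmap polyC (fun i => \sum_j c j * (E j i)%:P) f) => x; rewrite horner_mmap.
apply: meval_eq => i; rewrite mxE horner_sum; apply: eq_bigr => j _.
by rewrite !hornerE mxE.
Qed.

(** The chart misses the section [a = 0]. A form vanishing on the chart vanishes there by passing to
    limits along polynomial curves: points with [a = 0] and [d != 0] are limits of points with
    [a != 0], and points with [a = d = 0] are limits of the former. *)
Lemma quadric_surface_sub (h : {mpoly K[2]}) :
  h != 0 -> psubset quadric_surface (zclosure (param_image (qparam 'X_ord0 'X_ord_max) h)).
Proof.
move=> h0 p [p0 [a [b [c [d [pE e]]]]]]; split=> // f [[df fh] fv].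
have f1 z w : f.@[(row4 1 z w (qf z w) *m E) ord0] = 0.
  have fth : f \mPo [tuple qparam ('X_ord0 : {mpoly K[2]}) 'X_ord_max i | i < n] = 0.
    apply: (mpoly_generic_eq0 h0) => v hv; rewrite meval_param; apply: fv.
    by exists v.
  have := congr1 (meval (fun i : 'I_2 => if i == ord0 then z else w)) fth.
  by rewrite meval_param meval0 qparamE !mevalXU.
have f2 a' b' c' d' : a' != 0 -> a' * d' = qf b' c' -> f.@[(row4 a' b' c' d' *m E) ord0] = 0.
  move=> a0 e'; have -> : row4 a' b' c' d' *m E =
      a' *: (row4 1 (b' / a') (c' / a') (qf (b' / a') (c' / a')) *m E).
    rewrite scalemxAl; congr (_ *m _); apply/rowP => i; rewrite !mxE.
    have -> : qf (b' / a') (c' / a') = d' / a'.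
      apply: (mulfI a0); rewrite mulrCA mulfV // mulr1; apply: (mulfI a0); rewrite e' /qf; field.
      exact: a0.
    case: i => [[|[|[|[|]]]]] //= _; [by rewrite mulr1 | | | ]; by rewrite mulrCA mulfV ?mulr1.
  rewrite (@meval_eq _ _ _ (fun i => a' * (row4 1 (b' / a') (c' / a') (qf (b' / a') (c' / a')) *m E) ord0 i)).
    by rewrite (homog_scale _ _ fh) f1 mulr0.
  by move=> i; rewrite [LHS]mxE.
have lim (c4 : 'I_4 -> {poly K}) (g : {poly K}) : g != 0 ->
    (forall x, g.[x] != 0 -> f.@[((\row_j (c4 j).[x]) *m E) ord0] = 0) ->
    f.@[((\row_j (c4 j).[0]) *m E) ord0] = 0.
  move=> g0 hg; have [P hP] := form_poly f c4.
  have : P = 0 by apply: (poly_generic_eq0 g0) => x /hg; rewrite hP.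
  by move=> P0; rewrite -hP P0 horner0.
have f3 b' c' d' : d' != 0 -> qf b' c' = 0 -> f.@[(row4 0 b' c' d' *m E) ord0] = 0.
  move=> d0 e'.
  have [n1 [n2 nq]] : exists n1 n2, qf n1 n2 != 0.
    case/orP: q0 => [/orP[]|] hh.
    - by exists 1, 0; rewrite /qf expr0n expr1n !mulr0 !addr0 mulr1.
    - have [hal|hal] := eqVneq al 0; last first.
        by exists 1, 0; rewrite /qf expr0n expr1n !mulr0 !addr0 mulr1.
      have [hga|hga] := eqVneq ga 0; last first.
        by exists 0, 1; rewrite /qf expr0n expr1n !mul0r !mulr0 !add0r mulr1.
      by exists 1, 1; rewrite /qf hal hga !mul0r add0r addr0 !mulr1.
    - by exists 0, 1; rewrite /qf expr0n expr1n !mul0r !mulr0 !add0r mulr1.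
  (* The curve moves [(b', c')] in a direction [(n1, n2)] on which [qf] is nonzero. The first
     coordinate [g] is forced by the equation of the surface; it has no constant term because
     [qf b' c' = 0], and its leading coefficient is [dd != 0]. *)
  pose bb := (2 * al * b' * n1 + be * (b' * n2 + c' * n1) + 2 * ga * c' * n2) / d'.
  pose dd := qf n1 n2 / d'.
  pose g : {poly K} := bb *: 'X + dd *: 'X ^+ 2.
  pose c4 (j : 'I_4) : {poly K} := nth 0 [:: g; b'%:P + n1 *: 'X; c'%:P + n2 *: 'X; d'%:P] j.
  have g0 : g != 0.
    apply/eqP => /(congr1 (fun P : {poly K} => P`_2)); rewrite coefD !coefZ coefX coefXn coef0 /= mulr0 add0r mulr1.
    by move/eqP; rewrite mulf_eq0 (negPf nq) invr_eq0 (negPf d0).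
  have -> : row4 0 b' c' d' = \row_j (c4 j).[0].
    apply/rowP => i; rewrite !mxE /c4 /g; case: i => [[|[|[|[|]]]]] //= _; rewrite !hornerE ?expr0n /=; ring.
  apply: (lim c4 g g0) => x gx.
  have -> : \row_j (c4 j).[x] = row4 g.[x] (b' + n1 * x) (c' + n2 * x) d'.
    by apply/rowP => i; rewrite !mxE /c4; case: i => [[|[|[|[|]]]]] //= _; rewrite !hornerE.
  apply: f2 => //; rewrite /g /bb /dd hornerD !hornerZ hornerX hornerXn.
  rewrite -[LHS]addr0 -e' /qf; field.
  exact: d0.
rewrite pE; have [a0|/f2 -> //] := eqVneq a 0.
have qbc : qf b c = 0 by rewrite -e a0 mul0r.
rewrite a0; have [d0|/f3 -> //] := eqVneq d 0.
pose c4 (j : 'I_4) : {poly K} := nth 0 [:: 0; b%:P; c%:P; 'X] j.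
have -> : row4 0 b c d = \row_j (c4 j).[0].
  by apply/rowP => i; rewrite !mxE /c4 d0; case: i => [[|[|[|[|]]]]] //= _; rewrite !hornerE.
apply: (lim c4 'X) => [|x]; first by rewrite polyX_eq0.
rewrite hornerX => x0.
have -> : \row_j (c4 j).[x] = row4 0 b c x.
  by apply/rowP => i; rewrite !mxE /c4; case: i => [[|[|[|[|]]]]] //= _; rewrite !hornerE.
exact: f3.
Qed.

Lemma quadric_surfaceE (h : {mpoly K[2]}) : h != 0 -> forall p,
  quadric_surface p <-> zclosure (param_image (qparam 'X_ord0 'X_ord_max) h) p.
Proof. by move=> h0 p; split; [exact: quadric_surface_sub | exact: sub_quadric_surface]. Qed.

Lemma qparam_variety k (P Q : {mpoly K[k]}) h : h != 0 ->
  variety (zclosure (param_image (qparam P Q) h)).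
Proof.
by move=> h0; apply: param_variety => // z _; rewrite qparamE row4_neq0 ?oner_eq0.
Qed.

Lemma variety_ext (X Y : pset K n) : (forall p, X p <-> Y p) -> variety X -> variety Y.
Proof.
move=> XY [[F [Fh FX]] [v Xv] irr]; split.
- by exists F; split=> // p; split=> [/XY/FX|/FX/XY].
- by exists v; apply/XY.
- move=> A B Ac Bc cov; have [] := irr A B Ac Bc; first by move=> p /XY/cov.
    by move=> XA; left=> p /XY/XA.
  by move=> XB; right=> p /XY/XB.
Qed.

Lemma quadric_surface_variety : variety quadric_surface.
Proof.
have n0 : (1 : {mpoly K[2]}) != 0 by rewrite oner_eq0.
apply: variety_ext (qparam_variety 'X_ord0 'X_ord_max n0) => p.
exact: iff_sym (quadric_surfaceE n0 p).
Qed.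

Lemma quadric_surface_dim : zdim quadric_surface 2.
Proof.
have n0 : (1 : {mpoly K[2]}) != 0 by rewrite oner_eq0.
split; last first.
  by apply: (@surface_dim_lt3 _ _ _ (qparam 'X_ord0 'X_ord_max) 1); exact: quadric_surface_sub.
pose X0 : {mpoly K[2]} := 'X_ord0; pose X1 : {mpoly K[2]} := 'X_ord_max.
(* A point, a curve in the section [c = 0], and the whole surface. *)
pose Z (i : nat) : pset K n := match i with
  | 0 => zclosure (param_image (qparam (0 : {mpoly K[2]}) 0) 1)
  | 1 => zclosure (param_image (qparam X0 0) 1)
  | _ => zclosure (param_image (qparam X0 X1) 1) end.
exists Z; split=> [i _|i].
  split; first by case: i => [|[|i]]; exact: qparam_variety.
  by case: i => [|[|i]]; exact: sub_quadric_surface.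
have coord (P Q : {mpoly K[2]}) j p : (forall z, (row4 1 P.@[z] Q.@[z] (qf P.@[z] Q.@[z])) ord0 j = 0) ->
    zclosure (param_image (qparam P Q) 1) p -> (p *m D) ord0 j = 0.
  move=> PQ [p0 hp]; rewrite -mulmx_col_entry -meval_linear_form; apply: hp; split.
    by exists 1%N; exact: linear_form_homog.
  move=> _ [z _ ->]; rewrite qparamE meval_linear_form mulmx_col_entry coord_rowK; exact: PQ.
have pt (P Q : {mpoly K[2]}) z : zclosure (param_image (qparam P Q) 1)
    (row4 1 P.@[z] Q.@[z] (qf P.@[z] Q.@[z]) *m E).
  apply: zclosure_sub; first by rewrite row4_neq0 ?oner_eq0.
  by exists z; rewrite ?meval1 ?oner_eq0 // qparamE.
have cl (P Q : {mpoly K[2]}) : zclosed (zclosure (param_image (qparam P Q) 1)).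
  exact: zclosure_closed.
case: i => [|[|//]] _; split.
- apply: zclosure_min; first exact: cl.
  move=> _ [z _ ->]; rewrite qparamE.
  have := pt X0 0 (fun=> 0); rewrite !mevalXU !meval0; exact.
- move=> h; have := pt X0 0 (fun=> 1); rewrite !mevalXU !meval0 => /h.
  move/(coord _ _ (Ordinal (isT : 1 < 4)%N)); rewrite coord_rowK !mxE /= => e.
  by move/eqP: (oner_neq0 K); apply; apply: e => z; rewrite !mxE /= meval0.
- apply: zclosure_min; first exact: cl.
  move=> _ [z _ ->]; rewrite qparamE.
  have := pt X0 X1 (fun i => if i == ord0 then z ord0 else 0); rewrite !mevalXU !meval0; exact.
- move=> h; have := pt X0 X1 (fun=> 1); rewrite !mevalXU => /h.
  move/(coord _ _ (Ordinal (isT : 2 < 4)%N)); rewrite coord_rowK !mxE /= => e.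
  by move/eqP: (oner_neq0 K); apply; apply: e => z; rewrite !mxE /= meval0.
Qed.

End QuadricSurface.

(** * Lines and Plücker coordinates *)

Section Lines.
Variable K : fieldType.
Implicit Types (u v w : 'rV[K]_4) (L M N : {vspace 'rV[K]_4}).

Lemma mem_line u v w :
  reflect (exists a b, w = a *: u + b *: v) (w \in line_through u v).
Proof.
rewrite /line_through span_cons span_seq1; apply: (iffP memv_addP).
  by case=> _ /vlineP[a ->] [_ /vlineP[b ->] ->]; exists a, b.
move=> [a [b ->]]; exists (a *: u); first by rewrite memvZ // memv_line.
by exists (b *: v); rewrite // memvZ // memv_line.
Qed.

Definition indep2 u v := forall a b : K, a *: u + b *: v = 0 -> a = 0 /\ b = 0.

Lemma is_line_through u v : is_line (line_through u v) <-> indep2 u v.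
Proof.
have e : is_line (line_through u v) <-> free [:: u; v].
  by rewrite /free /is_line /line_through; split=> [->|/eqP].
rewrite e; split=> [fr a b ab|h].
  move/freeP: fr => /(_ (fun i => if i == ord0 then a else b)).
  rewrite !big_ord_recl big_ord0 /= addr0 => /(_ ab) h.
  by split; [exact: (h ord0) | exact: (h (lift ord0 ord0))].
apply/freeP => k; rewrite !big_ord_recl big_ord0 /= addr0 => /h[k0 k1] i.
by case: (unliftP ord0 i) => [j ->|-> //]; rewrite (ord1 j).
Qed.

Lemma indep2_neq0 u v a b : indep2 u v -> (a != 0) || (b != 0) -> a *: u + b *: v != 0.
Proof. by move=> h; apply: contraTneq => /h[-> ->]; rewrite eqxx. Qed.

Lemma line_eq L M : is_line L -> is_line M -> (forall v, v \in L -> v \in M) -> L = M.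
Proof.
move=> hL hM sub; apply/eqP; rewrite eqEdim hL hM leqnn andbT.
by apply/subvP.
Qed.

Lemma is_line_gen L : is_line L -> exists u v, L = line_through u v /\ indep2 u v.
Proof.
move=> hL; have bL := vbasisP L; have e : <<vbasis L>>%VS = L by exact: span_basis.
case: (vbasis L) e bL => s /= /eqP sz e bL; rewrite hL in sz.
case: s sz e bL => [|u [|v [|]]] //= _ e bL; exists u, v.
by split=> //; apply/is_line_through; rewrite /line_through e.
Qed.

End Lines.

Section PluckerCoordinates.
Variable K : fieldType.

Definition row6 (a b c d e f : K) : 'rV[K]_6 := \row_i nth 0 [:: a; b; c; d; e; f] i.

Lemma row6_inj a b c d e f a' b' c' d' e' f' :
  row6 a b c d e f = row6 a' b' c' d' e' f' ->
  [/\ a = a', b = b', c = c' & [/\ d = d', e = e' & f = f']].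
Proof.
move=> h; have {}h (k : 'I_6) : nth 0 [:: a; b; c; d; e; f] k = nth 0 [:: a'; b'; c'; d'; e'; f'] k.
  by move/rowP: h => /(_ k); rewrite !mxE.
split; [exact: (h (Ordinal (isT : 0 < 6)%N)) | exact: (h (Ordinal (isT : 1 < 6)%N))
       | exact: (h (Ordinal (isT : 2 < 6)%N)) | ].
by split; [exact: (h (Ordinal (isT : 3 < 6)%N)) | exact: (h (Ordinal (isT : 4 < 6)%N))
       | exact: (h (Ordinal (isT : 5 < 6)%N))].
Qed.

Lemma plucker_row4 (a0 a1 a2 a3 b0 b1 b2 b3 : K) :
  plucker (row4 a0 a1 a2 a3) (row4 b0 b1 b2 b3) =
  row6 (a0 * b1 - a1 * b0) (a0 * b2 - a2 * b0) (a0 * b3 - a3 * b0)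
       (a1 * b2 - a2 * b1) (a1 * b3 - a3 * b1) (a2 * b3 - a3 * b2).
Proof.
by apply/rowP => k; rewrite !mxE /pl_fst /pl_snd;
  case: k => [[|[|[|[|[|[|]]]]]]] //= _; rewrite !inordK.
Qed.

Lemma row4_mulE n (G : 'M[K]_(4, n)) a b c d j :
  (row4 a b c d *m G) ord0 j = a * G (inord 0) j + b * G (inord 1) j
     + c * G (inord 2) j + d * G (inord 3) j.
Proof.
rewrite mxE !big_ord_recl big_ord0 !mxE /= addr0 !addrA.
by congr (_ * G _ j + _ * G _ j + _ * G _ j + _ * G _ j); apply: val_inj; rewrite /= inordK.
Qed.

Lemma row6_mulE n (G : 'M[K]_(6, n)) a b c d e f j :
  (row6 a b c d e f *m G) ord0 j = a * G (inord 0) j + b * G (inord 1) j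
     + c * G (inord 2) j + d * G (inord 3) j + e * G (inord 4) j + f * G (inord 5) j.
Proof.
rewrite mxE !big_ord_recl big_ord0 !mxE /= addr0 !addrA.
by congr (_ * G _ j + _ * G _ j + _ * G _ j + _ * G _ j + _ * G _ j + _ * G _ j);
  apply: val_inj; rewrite /= inordK.
Qed.

(** The exterior square of [G], which transports Plücker coordinates under a change of frame. *)
Definition compound (G : 'M[K]_4) : 'M[K]_6 :=
  \matrix_k plucker (row (pl_fst k) G) (row (pl_snd k) G).

Lemma plucker_mul (u v : 'rV[K]_4) G :
  plucker (u *m G) (v *m G) = plucker u v *m compound G.
Proof.
rewrite [u]row4E [v]row4E; move: (u _ _) (u _ _) (u _ _) (u _ _) => a0 a1 a2 a3.
move: (v _ _) (v _ _) (v _ _) (v _ _) => b0 b1 b2 b3.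
rewrite plucker_row4; apply/rowP => k; rewrite row6_mulE mxE !row4_mulE !mxE.
by rewrite /pl_fst /pl_snd !inordK //=; ring.
Qed.

Lemma plucker_delta (k : 'I_6) : plucker (delta_mx ord0 (pl_fst k)) (delta_mx ord0 (pl_snd k))
  = delta_mx ord0 k :> 'rV[K]_6.
Proof.
apply/rowP => l; rewrite !mxE /pl_fst /pl_snd /= -!val_eqE /=.
by case: k => [[|[|[|[|[|[|]]]]]]] //= _; case: l => [[|[|[|[|[|[|]]]]]]] //= _;
  rewrite !inordK //= ?mulr0 ?mul0r ?mulr1 ?subr0.
Qed.

Lemma compoundM G H : compound (G *m H) = compound G *m compound H.
Proof.
apply/row_matrixP => k; rewrite row_mul !rowK -plucker_mul.
by congr plucker; rewrite -row_mul.
Qed.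

Lemma compound1 : compound 1%:M = 1%:M.
Proof.
apply/row_matrixP => k; rewrite rowK.
have r1 (i : 'I_4) : row i (1%:M : 'M[K]_4) = delta_mx ord0 i by rewrite rowE mulmx1.
by rewrite !r1 plucker_delta rowE mulmx1.
Qed.

Definition polar (p q : 'rV[K]_6) : K :=
  let P k := p ord0 (inord k) in let Q k := q ord0 (inord k) in
  P 0 * Q 5 - P 1 * Q 4 + P 2 * Q 3 + P 3 * Q 2 - P 4 * Q 1 + P 5 * Q 0.

Lemma polar_row6 a b c d e f a' b' c' d' e' f' :
  polar (row6 a b c d e f) (row6 a' b' c' d' e' f') =
  a * f' - b * e' + c * d' + d * c' - e * b' + f * a'.
Proof. by rewrite /polar !mxE !inordK. Qed.

(** Multiplied by [a] or by [b], the polar form becomes an expression in the common point, which can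
    be rewritten as a point of the second line. The point is nonzero, so [a] or [b] can be
    cancelled. *)
Lemma meet_polar (n n' l l' : 'rV[K]_4) a b c d :
  a *: n + b *: n' = c *: l + d *: l' -> a *: n + b *: n' != 0 ->
  polar (plucker n n') (plucker l l') = 0.
Proof.
rewrite [n]row4E [n']row4E [l]row4E [l']row4E.
move: (n _ _) (n _ _) (n _ _) (n _ _) (n' _ _) (n' _ _) (n' _ _) (n' _ _) => n3 n2 n1 n0 m3 m2 m1 m0.
move: (l _ _) (l _ _) (l _ _) (l _ _) (l' _ _) (l' _ _) (l' _ _) (l' _ _) => l3 l2 l1 l0 k3 k2 k1 k0.
rewrite !plucker_row4 polar_row6 => e nz.
have {}e (i : 'I_4) : a * nth 0 [:: n0; n1; n2; n3] i + b * nth 0 [:: m0; m1; m2; m3] i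
    = c * nth 0 [:: l0; l1; l2; l3] i + d * nth 0 [:: k0; k1; k2; k3] i.
  by move/rowP: e => /(_ i); rewrite !mxE.
have /= e0 := e (Ordinal (isT : 0 < 4)%N); have /= e1 := e (Ordinal (isT : 1 < 4)%N).
have /= e2 := e (Ordinal (isT : 2 < 4)%N); have /= e3 := e (Ordinal (isT : 3 < 4)%N).
set q := (X in X = 0).
have qa : a * q = 0.
  have s0 : a * n0 = c * l0 + d * k0 - b * m0 by rewrite -e0 addrK.
  have s1 : a * n1 = c * l1 + d * k1 - b * m1 by rewrite -e1 addrK.
  have s2 : a * n2 = c * l2 + d * k2 - b * m2 by rewrite -e2 addrK.
  have s3 : a * n3 = c * l3 + d * k3 - b * m3 by rewrite -e3 addrK.
  transitivity ((a * n0 * m1 - a * n1 * m0) * (l2 * k3 - l3 * k2)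
    - (a * n0 * m2 - a * n2 * m0) * (l1 * k3 - l3 * k1)
    + (a * n0 * m3 - a * n3 * m0) * (l1 * k2 - l2 * k1)
    + (a * n1 * m2 - a * n2 * m1) * (l0 * k3 - l3 * k0)
    - (a * n1 * m3 - a * n3 * m1) * (l0 * k2 - l2 * k0)
    + (a * n2 * m3 - a * n3 * m2) * (l0 * k1 - l1 * k0)); first by rewrite /q; ring.
  by rewrite s0 s1 s2 s3; ring.
have qb : b * q = 0.
  have s0 : b * m0 = c * l0 + d * k0 - a * n0 by rewrite -e0 addrC addKr.
  have s1 : b * m1 = c * l1 + d * k1 - a * n1 by rewrite -e1 addrC addKr.
  have s2 : b * m2 = c * l2 + d * k2 - a * n2 by rewrite -e2 addrC addKr.
  have s3 : b * m3 = c * l3 + d * k3 - a * n3 by rewrite -e3 addrC addKr.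
  transitivity ((n0 * (b * m1) - n1 * (b * m0)) * (l2 * k3 - l3 * k2)
    - (n0 * (b * m2) - n2 * (b * m0)) * (l1 * k3 - l3 * k1)
    + (n0 * (b * m3) - n3 * (b * m0)) * (l1 * k2 - l2 * k1)
    + (n1 * (b * m2) - n2 * (b * m1)) * (l0 * k3 - l3 * k0)
    - (n1 * (b * m3) - n3 * (b * m1)) * (l0 * k2 - l2 * k0)
    + (n2 * (b * m3) - n3 * (b * m2)) * (l0 * k1 - l1 * k0)); first by rewrite /q; ring.
  by rewrite s0 s1 s2 s3; ring.
apply/eqP; move/eqP: qa; rewrite mulf_eq0 => /orP[/eqP a0|//].
move/eqP: qb; rewrite mulf_eq0 => /orP[/eqP b0|//].
by rewrite a0 b0 !scale0r addr0 eqxx in nz.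
Qed.

Lemma klein_plucker (u v : 'rV[K]_4) : plucker u v != 0 -> klein_quadric (plucker u v).
Proof.
move=> h; split=> //; rewrite [u]row4E [v]row4E plucker_row4 !mxE !inordK //=; ring.
Qed.

(** The six coordinates are the minors with [i < j]; the others follow by antisymmetry. *)
Lemma plucker_minors (u v P Q : 'rV[K]_4) : plucker u v = plucker P Q ->
  forall i j, u ord0 i * v ord0 j - u ord0 j * v ord0 i
    = P ord0 i * Q ord0 j - P ord0 j * Q ord0 i.
Proof.
move=> e i j; wlog ij : i j / (i <= j)%N.
  move=> H; case/orP: (leq_total i j) => [/H //|/H h].
  by apply: oppr_inj; rewrite !opprB.
have f (k : 'I_6) : u ord0 (pl_fst k) * v ord0 (pl_snd k) - u ord0 (pl_snd k) * v ord0 (pl_fst k)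
   = P ord0 (pl_fst k) * Q ord0 (pl_snd k) - P ord0 (pl_snd k) * Q ord0 (pl_fst k).
  by move/rowP: e => /(_ k); rewrite !mxE.
have [->|nij] := eqVneq i j; first by rewrite !subrr.
have [k [-> ->]] : exists k : 'I_6, i = pl_fst k /\ j = pl_snd k; last exact: f.
case: i j ij nij => [i hi] [j hj] /=.
have o (x : nat) (hx : (x < 4)%N) (k : 'I_6) : nth 0%N [:: 0; 0; 0; 1; 1; 2]%N k = x -> Ordinal hx = pl_fst k.
  by move=> h1; apply: val_inj; rewrite /= /pl_fst h1 inordK.
have o' (x : nat) (hx : (x < 4)%N) (k : 'I_6) : nth 0%N [:: 1; 2; 3; 2; 3; 3]%N k = x -> Ordinal hx = pl_snd k.
  by move=> h1; apply: val_inj; rewrite /= /pl_snd h1 inordK.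
case: i hi => [|[|[|[|//]]]] hi; case: j hj => [|[|[|[|//]]]] hj //= _ nij;
  try by case/eqP: nij; apply: val_inj.
- by exists (Ordinal (isT : 0 < 6)%N); split; [apply: o | apply: o'].
- by exists (Ordinal (isT : 1 < 6)%N); split; [apply: o | apply: o'].
- by exists (Ordinal (isT : 2 < 6)%N); split; [apply: o | apply: o'].
- by exists (Ordinal (isT : 3 < 6)%N); split; [apply: o | apply: o'].
- by exists (Ordinal (isT : 4 < 6)%N); split; [apply: o | apply: o'].
- by exists (Ordinal (isT : 5 < 6)%N); split; [apply: o | apply: o'].
Qed.

Lemma plucker_neq0 (u v : 'rV[K]_4) : indep2 u v <-> plucker u v != 0.
Proof.
split=> h; last first.
  move=> a b e; have pl (c : K) : c = 0 \/ plucker u v = 0 -> c = 0 by case=> // e'; rewrite e' eqxx in h.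
  have ev i : a * u ord0 i + b * v ord0 i = 0 by move/rowP: e => /(_ i); rewrite !mxE.
  split; apply: pl; [have [->|a0] := eqVneq a 0 | have [->|b0] := eqVneq b 0]; try by left.
    right; apply/rowP => k; rewrite !mxE; apply: (mulfI a0); rewrite mulr0.
    transitivity ((a * u ord0 (pl_fst k) + b * v ord0 (pl_fst k)) * v ord0 (pl_snd k)
       - (a * u ord0 (pl_snd k) + b * v ord0 (pl_snd k)) * v ord0 (pl_fst k)); first by ring.
    by rewrite !ev !mul0r subrr.
  right; apply/rowP => k; rewrite !mxE; apply: (mulfI b0); rewrite mulr0.
  transitivity (u ord0 (pl_fst k) * (a * u ord0 (pl_snd k) + b * v ord0 (pl_snd k))
       - u ord0 (pl_snd k) * (a * u ord0 (pl_fst k) + b * v ord0 (pl_fst k))); first by ring.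
  by rewrite !ev !mulr0 subrr.
apply/eqP => e.
have e2 i j : u ord0 i * v ord0 j - u ord0 j * v ord0 i = 0.
  have -> := @plucker_minors u v 0 0 _ i j; first by rewrite !mxE mul0r subrr.
  by rewrite e; apply/rowP => k; rewrite !mxE mul0r subrr.
have [u0|] := eqVneq u 0.
  by have [] := h 1 0; rewrite ?u0 ?scaler0 ?scale0r ?addr0 // => /eqP; rewrite oner_eq0.
case/rV0Pn => i ui; have [] := h (v ord0 i) (- u ord0 i).
  by apply/rowP => j; rewrite !mxE; have := e2 j i => <-; ring.
by move=> _ /eqP; rewrite oppr_eq0 (negPf ui).
Qed.

Lemma plucker_comb (u v : 'rV[K]_4) a b c d :
  plucker (a *: u + b *: v) (c *: u + d *: v) = (a * d - b * c) *: plucker u v.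
Proof. by apply/rowP => k; rewrite !mxE; ring. Qed.

(** Cramer's rule for a nonzero minor [d] of [u] and [v]; the equality of all minors makes the
    remaining coordinates of [P] consistent with it. *)
Lemma plucker_mem (u v P Q : 'rV[K]_4) :
  plucker u v = plucker P Q -> plucker u v != 0 -> P \in line_through u v.
Proof.
move=> e /rV0Pn[k]; rewrite mxE; move: (pl_fst k) (pl_snd k) => i j; set d := (X in X != 0) => d0.
have m := plucker_minors e.
apply/mem_line; exists ((P ord0 i * v ord0 j - P ord0 j * v ord0 i) / d),
  ((u ord0 i * P ord0 j - u ord0 j * P ord0 i) / d).
apply/rowP => l; rewrite !mxE; apply: (mulIf d0).
transitivity (P ord0 l * (P ord0 i * Q ord0 j - P ord0 j * Q ord0 i)); first by rewrite -m.
transitivity (P ord0 j * (P ord0 i * Q ord0 l - P ord0 l * Q ord0 i)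
     - P ord0 i * (P ord0 j * Q ord0 l - P ord0 l * Q ord0 j)); first by ring.
by rewrite -!m; field; exact: d0.
Qed.

Lemma plucker_line (u v P Q : 'rV[K]_4) :
  plucker u v = plucker P Q -> plucker u v != 0 -> line_through u v = line_through P Q.
Proof.
move=> e e0; have e0' : plucker P Q != 0 by rewrite -e.
apply: line_eq; [exact/is_line_through/plucker_neq0 | exact/is_line_through/plucker_neq0 |].
move=> w /mem_line[a [b ->]]; apply: memvD; apply: memvZ.
  exact: plucker_mem (esym e) e0'.
apply: (@plucker_mem _ _ v (- u)) => //.
by rewrite -e; apply/rowP => k; rewrite !mxE; ring.
Qed.

Lemma plucker_of_eq (p : 'rV[K]_6) L (u v : 'rV[K]_4) :
  plucker_of p L -> p = plucker u v -> p != 0 /\ L = line_through u v.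
Proof.
move=> [hL [u' [v' [LE ->]]]] e; have h : plucker u' v' != 0.
  by apply/plucker_neq0/is_line_through; rewrite -LE.
by rewrite LE; split=> //; exact: plucker_line.
Qed.

Lemma plucker_of_line (u v : 'rV[K]_4) : indep2 u v -> plucker_of (plucker u v) (line_through u v).
Proof. by move=> h; split; [exact/is_line_through | exists u, v]. Qed.

End PluckerCoordinates.

(** * Model congruences and their focal lines *)

Section LineVarieties.
Variable K : numFieldType.
Implicit Types (L M N : {vspace 'rV[K]_4}).

Lemma points_closed (u v : 'rV[K]_4) : zclosed (points (line_through u v)).
Proof.
pose B := col_mx u v.
exists (fun f => exists i, f = linear_form (col i (cokermx B))); split.
  by move=> _ [i ->]; exists 1%N; exact: linear_form_homog.
have e (w : 'rV[K]_4) : (forall i, (linear_form (col i (cokermx B))).@[w ord0] = 0) <-> (w <= B)%MS.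
  rewrite submxE; split=> [h|/eqP h i]; last by rewrite meval_linear_form mulmx_col_entry h mxE.
  by apply/eqP/rowP => i; rewrite -mulmx_col_entry -meval_linear_form h mxE.
have sub (w : 'rV[K]_4) : (w <= B)%MS <-> w \in line_through u v.
  split=> [/submxP[D ->]|/mem_line[a [b ->]]].
    rewrite -[D]hsubmxK mul_row_col; apply/mem_line.
    by exists (lsubmx D ord0 ord0), (rsubmx D ord0 ord0); rewrite -!mul_scalar_mx -!mx11_scalar.
  apply/submxP; exists (row_mx a%:M b%:M).
  by rewrite mul_row_col !mul_scalar_mx.
move=> w; split=> [[w0 wL]|[w0 h]]; split=> //.
  by move=> _ [i ->]; apply: (e w).2; apply/sub.
by apply/sub/e => i; apply: h; exists i.
Qed.

Lemma points_variety L : is_line L -> variety (points L).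
Proof.
move=> /is_line_gen[u [v [-> uv]]].
pose th (i : 'I_4) : {mpoly K[2]} := u ord0 i *: 'X_ord0 + v ord0 i *: 'X_ord_max.
have thE z : \row_i (th i).@[z] = z ord0 *: u + z ord_max *: v.
  by apply/rowP => i; rewrite !mxE mevalD !mevalZ !mevalXU !(mulrC (_ _ i)).
pose h : {mpoly K[2]} := 'X_ord0.
have h0 : h != 0.
  apply/eqP => /(congr1 (meval (fun=> 1))); rewrite mevalXU meval0 => /eqP.
  by rewrite oner_eq0.
apply: (@variety_ext _ _ (zclosure (param_image th h))); last first.
  by apply: param_variety => // z; rewrite mevalXU thE => z0; apply: indep2_neq0 => //; rewrite z0.
move=> w; split.
  move: w; apply: zclosure_min; first exact: points_closed.
  move=> w [z]; rewrite mevalXU thE => z0 ->; split; last by apply/mem_line; do 2 eexists.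
  by apply: indep2_neq0 => //; rewrite z0.
move=> [w0 /mem_line[a [b wE]]]; split=> // f [fh fv].
have e : f \mPo [tuple th i | i < 4] = 0.
  by apply: (mpoly_generic_eq0 h0) => z hz; rewrite meval_param; apply: fv; exists z.
have := congr1 (meval (fun i : 'I_2 => if i == ord0 then a else b)) e.
by rewrite meval_param thE meval0 /= wE.
Qed.

(** A closed subset of [L] that meets a line of [X] whose only point on [L] is [z] must contain [z].
    As such a line exists for every [z], the subset is all of [L]. *)
Lemma focal_criterion (X : pset K 6) L : is_line L -> meets_all X (points L) ->
  (forall z, points L z -> exists p M, [/\ X p, plucker_of p M
      & forall w, w \in M -> w \in L -> exists c, w = c *: z]) ->
  focal_line X L.
Proof.
move=> hL hm hz; split=> //; split=> //; first exact: points_variety.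
move=> W Wv WL Wm z Lz; have [p [M [Xp pM Mz]]] := hz z Lz.
have [z' [Wz' [z'0 Mz']]] := Wm p M Xp pM.
have [_ Lz'] := WL z' Wz'; have [c zc] := Mz z' Mz' Lz'.
have c0 : c != 0 by apply: contraNneq z'0 => c0; rewrite zc c0 scale0r.
have -> : z = c^-1 *: z' by rewrite zc scalerA mulVf ?scale1r.
by apply: zclosed_scale; rewrite ?invr_eq0 //; case: Wv.
Qed.

End LineVarieties.

Section StandardSurfaces.
Variable K : numFieldType.
Implicit Types (G : 'M[K]_4).

(** Integer entries allow products of explicit matrices to be checked by computation. *)
Definition int_mx m n (s : seq (seq int)) : 'M[K]_(m, n) :=
  \matrix_(i, j) (nth 0 (nth [::] s i) j)%:~R.

(** The 3-plane p01 = p23 = 0, on which the Klein quadric reads p02 p13 = p03 p12: the lines joining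
    a point of [line01] to a point of [line23]. *)
Definition join_mx : 'M[K]_(4, 6) :=
  int_mx 4 6 [:: [:: 0;1;0;0;0;0]; [:: 0;0;1;0;0;0]; [:: 0;0;0;1;0;0]; [:: 0;0;0;0;1;0]].
(** The 3-plane p23 = 0, p03 = p12, on which the Klein quadric is the cone p02 p13 = p03 ^ 2 with
    vertex [line01]: the lines tangent along [line01] to the quadric x0 x3 = x1 x2. *)
Definition cone_mx : 'M[K]_(4, 6) :=
  int_mx 4 6 [:: [:: 0;1;0;0;0;0]; [:: 1;0;0;0;0;0]; [:: 0;0;1;1;0;0]; [:: 0;0;0;0;1;0]].

Lemma int_mxM m n p (s t r : seq (seq int)) :
  (forall i j, (i < m)%N -> (j < p)%N ->
    \sum_(k < n) nth 0 (nth [::] s i) k * nth 0 (nth [::] t k) j = nth 0 (nth [::] r i) j) ->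
  int_mx m n s *m int_mx n p t = int_mx m p r.
Proof.
move=> h; apply/matrixP => i j; rewrite !mxE -h // rmorph_sum /=.
by apply: eq_bigr => k _; rewrite !mxE rmorphM.
Qed.

Lemma int_mx1 : int_mx 4 4 [:: [:: 1;0;0;0]; [:: 0;1;0;0]; [:: 0;0;1;0]; [:: 0;0;0;1]] = 1%:M.
Proof.
apply/matrixP => i j; rewrite !mxE -val_eqE /=.
by case: i j => [[|[|[|[|]]]] //= _] [[|[|[|[|]]]] //= _].
Qed.

Definition right_inv (A : 'M[K]_(4, 6)) := exists D : 'M[K]_(6, 4), A *m D = 1%:M.

Ltac int_mx_tac := rewrite -int_mx1; apply: int_mxM; case=> [|[|[|[|//]]]];
  case=> [|[|[|[|//]]]] _ _; rewrite !big_ord_recl big_ord0 /=; reflexivity.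

Lemma join_mx_inv : right_inv join_mx.
Proof.
exists (int_mx 6 4 [:: [:: 0;0;0;0]; [:: 1;0;0;0]; [:: 0;1;0;0]; [:: 0;0;1;0]; [:: 0;0;0;1]; [:: 0;0;0;0]]).
int_mx_tac.
Qed.

Lemma cone_mx_inv : right_inv cone_mx.
Proof.
exists (int_mx 6 4 [:: [:: 0;1;0;0]; [:: 1;0;0;0]; [:: 0;0;1;0]; [:: 0;0;0;0]; [:: 0;0;0;1]; [:: 0;0;0;0]]).
int_mx_tac.
Qed.

Lemma right_inv_compound (A : 'M[K]_(4, 6)) G :
  G \in unitmx -> right_inv A -> right_inv (A *m compound G).
Proof.
move=> Gu [D AD]; exists (compound (invmx G) *m D).
rewrite -mulmxA (mulmxA (compound G)) -compoundM mulmxV // compound1 mul1mx.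
exact: AD.
Qed.

Lemma row4_join a b c d : row4 a b c d *m join_mx = row6 0 a b c d 0.
Proof.
apply/rowP => j; rewrite row4_mulE !mxE !inordK //.
by case: j => [[|[|[|[|[|[|]]]]]]] //= _; ring.
Qed.

Lemma row4_cone a b c d : row4 a b c d *m cone_mx = row6 b a c c d 0.
Proof.
apply/rowP => j; rewrite row4_mulE !mxE !inordK //.
by case: j => [[|[|[|[|[|[|]]]]]]] //= _; ring.
Qed.

Definition join_surface G := quadric_surface (join_mx *m compound G) 0 1 0.
Definition cone_surface G := quadric_surface (cone_mx *m compound G) 0 0 1.

Definition vec G a b c d : 'rV[K]_4 := row4 a b c d *m G.

Definition line01 G := line_through (vec G 1 0 0 0) (vec G 0 1 0 0).
Definition line23 G := line_through (vec G 0 0 1 0) (vec G 0 0 0 1).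

Lemma join_surfaceE G p : join_surface G p <->
  p != 0 /\ exists a b c d, p = row6 0 a b c d 0 *m compound G /\ a * d = b * c.
Proof.
rewrite /join_surface /quadric_surface /qf.
by split=> [] [p0 [a [b [c [d [pE e]]]]]]; split=> //;
  exists a, b, c, d; rewrite pE mulmxA row4_join; split=> //; rewrite e; ring.
Qed.

Lemma cone_surfaceE G p : cone_surface G p <->
  p != 0 /\ exists a b c d, p = row6 b a c c d 0 *m compound G /\ a * d = c ^+ 2.
Proof.
rewrite /cone_surface /quadric_surface /qf.
by split=> [] [p0 [a [b [c [d [pE e]]]]]]; split=> //;
  exists a, b, c, d; rewrite pE mulmxA row4_cone; split=> //; rewrite e; ring.
Qed.

Lemma vec_comb G a b c d a' b' c' d' x y :
  x *: vec G a b c d + y *: vec G a' b' c' d' =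
  vec G (x * a + y * a') (x * b + y * b') (x * c + y * c') (x * d + y * d').
Proof.
rewrite /vec !scalemxAl -mulmxDl; congr (_ *m _); apply/rowP => i; rewrite !mxE.
by case: i => [[|[|[|[|]]]]].
Qed.

Lemma vecE G v : G \in unitmx -> exists a b c d, v = vec G a b c d.
Proof.
move=> Gu; rewrite -[v](mulmxKV Gu) [v *m _]row4E; do 4 eexists; reflexivity.
Qed.

Lemma vec_inj G a b c d a' b' c' d' : G \in unitmx ->
  vec G a b c d = vec G a' b' c' d' -> [/\ a = a', b = b', c = c' & d = d'].
Proof. by move=> Gu /(congr1 (mulmx^~ (invmx G))); rewrite !mulmxK // => /row4_inj. Qed.

Lemma vec0 G : vec G 0 0 0 0 = 0.
Proof. by apply/rowP => j; rewrite row4_mulE mxE; ring. Qed.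

Lemma plucker_vec G a0 a1 a2 a3 b0 b1 b2 b3 :
  plucker (vec G a0 a1 a2 a3) (vec G b0 b1 b2 b3) =
  row6 (a0 * b1 - a1 * b0) (a0 * b2 - a2 * b0) (a0 * b3 - a3 * b0)
       (a1 * b2 - a2 * b1) (a1 * b3 - a3 * b1) (a2 * b3 - a3 * b2) *m compound G.
Proof. by rewrite plucker_mul plucker_row4. Qed.

Lemma mem_line01 G v : reflect (exists a b, v = vec G a b 0 0) (v \in line01 G).
Proof.
by apply: (iffP (mem_line _ _ _)) => [[a [b ->]]|[a [b ->]]]; exists a, b;
  rewrite vec_comb !mulr0 !mulr1 ?addr0 ?add0r.
Qed.

Lemma mem_line23 G v : reflect (exists a b, v = vec G 0 0 a b) (v \in line23 G).
Proof.
by apply: (iffP (mem_line _ _ _)) => [[a [b ->]]|[a [b ->]]]; exists a, b;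
  rewrite vec_comb !mulr0 !mulr1 ?addr0 ?add0r.
Qed.

Section Basis.
Variable G : 'M[K]_4.
Hypothesis Gu : G \in unitmx.

Lemma is_line01 : is_line (line01 G).
Proof.
apply/is_line_through => a b; rewrite vec_comb -(vec0 G) => /(vec_inj Gu)[].
by rewrite !mulr0 !mulr1 addr0 add0r => -> ->.
Qed.

Lemma is_line23 : is_line (line23 G).
Proof.
apply/is_line_through => a b; rewrite vec_comb -(vec0 G) => /(vec_inj Gu)[_ _].
by rewrite !mulr0 !mulr1 addr0 add0r => -> ->.
Qed.

Lemma skew_line01_23 : skew_lines (line01 G) (line23 G).
Proof.
apply/eqP; rewrite -subv0; apply/subvP => v; rewrite memv_cap memv0 => /andP[].
by move=> /mem_line01[a [b ->]] /mem_line23[c [d /(vec_inj Gu)[-> -> _ _]]]; rewrite vec0.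
Qed.

Lemma compound_unit : compound G \in unitmx.
Proof.
have : compound G *m compound (invmx G) = 1%:M by rewrite -compoundM mulmxV // compound1.
by case/mulmx1_unit.
Qed.

Lemma line_basis N : is_line N -> exists a0 a1 a2 a3 b0 b1 b2 b3,
  N = line_through (vec G a0 a1 a2 a3) (vec G b0 b1 b2 b3) /\
  row6 (a0 * b1 - a1 * b0) (a0 * b2 - a2 * b0) (a0 * b3 - a3 * b0)
       (a1 * b2 - a2 * b1) (a1 * b3 - a3 * b1) (a2 * b3 - a3 * b2) != 0.
Proof.
move=> /is_line_gen[u [v [-> /plucker_neq0]]].
have [a0 [a1 [a2 [a3 ->]]]] := vecE u Gu; have [b0 [b1 [b2 [b3 ->]]]] := vecE v Gu.
rewrite plucker_vec => h; exists a0, a1, a2, a3, b0, b1, b2, b3; split=> //.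
by apply: contraNneq h => ->; rewrite mul0mx.
Qed.

Lemma line_meets_polar (a0 a1 a2 a3 b0 b1 b2 b3 c0 c1 c2 c3 d0 d1 d2 d3 : K) z :
  points (line_through (vec G a0 a1 a2 a3) (vec G b0 b1 b2 b3)) z ->
  points (line_through (vec G c0 c1 c2 c3) (vec G d0 d1 d2 d3)) z ->
  polar (plucker (row4 a0 a1 a2 a3) (row4 b0 b1 b2 b3))
        (plucker (row4 c0 c1 c2 c3) (row4 d0 d1 d2 d3)) = 0.
Proof.
move=> [z0 /mem_line[a [b e]]] [_ /mem_line[c [d e']]].
apply: (@meet_polar _ _ _ _ _ a b c d).
  apply: (@row_free_inj _ _ _ _ G); first by rewrite row_free_unit.
  by rewrite !mulmxDl -!scalemxAl -/(vec _ _ _ _ _) -e.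
apply: contraNneq z0 => h; rewrite e /vec !scalemxAl -mulmxDl h mul0mx //.
Qed.

End Basis.

End StandardSurfaces.

Section FocalLines.
Variables (K : numFieldType) (G : 'M[K]_4).
Hypothesis Gu : G \in unitmx.

Lemma vec_eq0 a b c d : (vec G a b c d == 0) = [&& a == 0, b == 0, c == 0 & d == 0].
Proof.
apply/eqP/and4P => [|[/eqP-> /eqP-> /eqP-> /eqP->]]; last exact: vec0.
by rewrite -(vec0 G) => /(vec_inj Gu)[-> -> -> ->].
Qed.

Lemma meets_polar X a0 a1 a2 a3 b0 b1 b2 b3 c0 c1 c2 c3 d0 d1 d2 d3 :
  meets_all X (points (line_through (vec G a0 a1 a2 a3) (vec G b0 b1 b2 b3))) ->
  X (plucker (vec G c0 c1 c2 c3) (vec G d0 d1 d2 d3)) ->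
  plucker (vec G c0 c1 c2 c3) (vec G d0 d1 d2 d3) != 0 ->
  polar (plucker (row4 a0 a1 a2 a3) (row4 b0 b1 b2 b3))
        (plucker (row4 c0 c1 c2 c3) (row4 d0 d1 d2 d3)) = 0.
Proof.
move=> hm Xp p0; have hp := plucker_of_line ((plucker_neq0 _ _).2 p0).
by have [z [h1 h2]] := hm _ _ Xp hp; apply: (line_meets_polar Gu h1 h2).
Qed.

Lemma row6_compound_eq0 a b c d e f :
  (row6 a b c d e f *m compound G == 0) = [&& a == 0, b == 0, c == 0, d == 0, e == 0 & f == 0].
Proof.
have z : row6 0 0 0 0 0 0 = 0 :> 'rV[K]_6.
  by apply/rowP => j; rewrite !mxE; case: j => [[|[|[|[|[|[|]]]]]]].
apply/eqP/idP => [h|/and5P[/eqP-> /eqP-> /eqP-> /eqP-> /andP[/eqP-> /eqP->]]]; last by rewrite z mul0mx.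
have := congr1 (mulmx^~ (invmx (compound G))) h.
rewrite mulmxK ?compound_unit // mul0mx -z => /row6_inj[-> -> -> [-> -> ->]].
by rewrite eqxx.
Qed.

Lemma rank1_decomp (a b c d : K) : a * d = b * c ->
  exists x y z w, [/\ a = x * z, b = x * w, c = y * z & d = y * w].
Proof.
move=> e; have [a0|a0] := eqVneq a 0; last first.
  exists 1, (c / a), a, b; rewrite !mul1r divfK //; split=> //.
  by apply: (mulfI a0); rewrite e; field; exact: a0.
have [b0|b0] := eqVneq b 0; last first.
  exists 1, (d / b), 0, b; rewrite !mul1r mulr0 divfK //; split=> //.
  by apply: (mulfI b0); rewrite -e a0 mul0r mulr0.
by exists 0, 1, c, d; rewrite !mul0r !mul1r.
Qed.

Lemma join_surface_join p : join_surface G p -> exists x y z w,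
  p = plucker (vec G x y 0 0) (vec G 0 0 z w).
Proof.
move=> /join_surfaceE[p0 [a [b [c [d [pE /rank1_decomp[x [y [z [w [ea eb ec ed]]]]]]]]]]].
exists x, y, z, w; rewrite plucker_vec pE; congr (row6 _ _ _ _ _ _ *m _); rewrite ?ea ?eb ?ec ?ed; ring.
Qed.

Lemma plucker_vec_join x y z w : plucker (vec G x y 0 0) (vec G 0 0 z w) =
  row6 0 (x * z) (x * w) (y * z) (y * w) 0 *m compound G.
Proof. by rewrite plucker_vec; congr (row6 _ _ _ _ _ _ *m _); ring. Qed.

Lemma join_surface_plucker x y z w : (x != 0) || (y != 0) -> (z != 0) || (w != 0) ->
  join_surface G (plucker (vec G x y 0 0) (vec G 0 0 z w)).
Proof.
move=> xy zw; apply/join_surfaceE; rewrite plucker_vec_join; split; last first.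
  by do 4 eexists; split; [reflexivity | ring].
rewrite row6_compound_eq0 !mulf_eq0 eqxx andbT /=.
by case: (x == 0) xy; case: (y == 0) => //= _; case: (z == 0) zw; case: (w == 0).
Qed.

Lemma join_meets01 : meets_all (join_surface G) (points (line01 G)).
Proof.
move=> p L Xp pL; have [x [y [z [w pE]]]] := join_surface_join Xp.
have [p0 LE] := plucker_of_eq pL pE; exists (vec G x y 0 0).
have nz : vec G x y 0 0 != 0.
  apply: contraNneq p0 => e; rewrite pE e; apply/eqP/rowP => k.
  by rewrite !mxE !mul0r subrr.
split; split=> //; first by apply/mem_line01; exists x, y.
by rewrite LE; apply/mem_line; exists 1, 0; rewrite scale1r scale0r addr0.
Qed.

Lemma join_meets23 : meets_all (join_surface G) (points (line23 G)).
Proof.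
move=> p L Xp pL; have [x [y [z [w pE]]]] := join_surface_join Xp.
have [p0 LE] := plucker_of_eq pL pE; exists (vec G 0 0 z w).
have nz : vec G 0 0 z w != 0.
  apply: contraNneq p0 => e; rewrite pE e; apply/eqP/rowP => k.
  by rewrite !mxE !mulr0 subrr.
split; split=> //; first by apply/mem_line23; exists z, w.
by rewrite LE; apply/mem_line; exists 0, 1; rewrite scale1r scale0r add0r.
Qed.

Lemma line01_only a0 a1 a2 a3 b0 b1 b2 b3 :
  let N := line_through (vec G a0 a1 a2 a3) (vec G b0 b1 b2 b3) in
  is_line N -> a0 * b1 - a1 * b0 != 0 -> a0 * b2 - a2 * b0 = 0 -> a0 * b3 - a3 * b0 = 0 ->
  a1 * b2 - a2 * b1 = 0 -> a1 * b3 - a3 * b1 = 0 -> N = line01 G.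
Proof.
move=> N hN p01 p02 p03 p12 p13.
have a2z : a2 = 0.
  apply: (mulIf p01); transitivity (a1 * (a0 * b2 - a2 * b0) - a0 * (a1 * b2 - a2 * b1)); first by ring.
  by rewrite p12 p02 !mulr0 subr0 mul0r.
have a3z : a3 = 0.
  apply: (mulIf p01); transitivity (a1 * (a0 * b3 - a3 * b0) - a0 * (a1 * b3 - a3 * b1)); first by ring.
  by rewrite p13 p03 !mulr0 subr0 mul0r.
have b2z : b2 = 0.
  apply: (mulIf p01); transitivity (b1 * (a0 * b2 - a2 * b0) - b0 * (a1 * b2 - a2 * b1)); first by ring.
  by rewrite p12 p02 !mulr0 subr0 mul0r.
have b3z : b3 = 0.
  apply: (mulIf p01); transitivity (b1 * (a0 * b3 - a3 * b0) - b0 * (a1 * b3 - a3 * b1)); first by ring.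
  by rewrite p13 p03 !mulr0 subr0 mul0r.
apply: line_eq => //; first exact: is_line01.
move=> v /mem_line[a [b ->]]; apply/mem_line01; rewrite vec_comb a2z a3z b2z b3z !mulr0 addr0.
by do 2 eexists.
Qed.

Lemma line23_only a0 a1 a2 a3 b0 b1 b2 b3 :
  let N := line_through (vec G a0 a1 a2 a3) (vec G b0 b1 b2 b3) in
  is_line N -> a2 * b3 - a3 * b2 != 0 -> a0 * b2 - a2 * b0 = 0 -> a0 * b3 - a3 * b0 = 0 ->
  a1 * b2 - a2 * b1 = 0 -> a1 * b3 - a3 * b1 = 0 -> N = line23 G.
Proof.
move=> N hN p23 p02 p03 p12 p13.
have a0z : a0 = 0.
  apply: (mulIf p23); transitivity (a2 * (a0 * b3 - a3 * b0) - a3 * (a0 * b2 - a2 * b0)); first by ring.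
  by rewrite p03 p02 !mulr0 subr0 mul0r.
have a1z : a1 = 0.
  apply: (mulIf p23); transitivity (a2 * (a1 * b3 - a3 * b1) - a3 * (a1 * b2 - a2 * b1)); first by ring.
  by rewrite p13 p12 !mulr0 subr0 mul0r.
have b0z : b0 = 0.
  apply: (mulIf p23); transitivity (b2 * (a0 * b3 - a3 * b0) - b3 * (a0 * b2 - a2 * b0)); first by ring.
  by rewrite p03 p02 !mulr0 subr0 mul0r.
have b1z : b1 = 0.
  apply: (mulIf p23); transitivity (b2 * (a1 * b3 - a3 * b1) - b3 * (a1 * b2 - a2 * b1)); first by ring.
  by rewrite p13 p12 !mulr0 subr0 mul0r.
apply: line_eq => //; first exact: is_line23.
move=> v /mem_line[a [b ->]]; apply/mem_line23; rewrite vec_comb a0z a1z b0z b1z !mulr0 addr0.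
by do 2 eexists.
Qed.

(** Through each point of one edge there is a line to the other edge, which gives minimality.
    Conversely, a line meeting the four lines between basis vectors of the two edges has p02 = p03 =
    p12 = p13 = 0, and the Plücker relation leaves only one of p01 and p23. *)
Lemma join_focal_lines : focal_lines_are (join_surface G) (line01 G) (line23 G).
Proof.
move=> N; split; last first.
  case=> ->; apply: focal_criterion; [exact: is_line01 | exact: join_meets01 | |
    exact: is_line23 | exact: join_meets23 | ].
    move=> z [z0 /mem_line01[a [b zE]]]; rewrite zE in z0 *.
    have ab : (a != 0) || (b != 0) by rewrite -negb_and; move: z0; rewrite vec_eq0 eqxx !andbT.
    have X := @join_surface_plucker a b 1 0 ab; rewrite oner_eq0 in X.
    exists (plucker (vec G a b 0 0) (vec G 0 0 1 0)), (line_through (vec G a b 0 0) (vec G 0 0 1 0)).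
    split; [exact: X | by apply/plucker_of_line/plucker_neq0; case: (X isT) |].
    move=> _ /mem_line[x [y ->]] /mem_line01[a' [b']]; rewrite {1}vec_comb.
    move=> /(vec_inj Gu)[_ _]; rewrite mulr0 mulr1 add0r => -> _.
    by exists x; rewrite scale0r addr0.
  move=> z [z0 /mem_line23[a [b zE]]]; rewrite zE in z0 *.
  have ab : (a != 0) || (b != 0) by rewrite -negb_and; move: z0; rewrite vec_eq0 eqxx.
  have X := @join_surface_plucker 1 0 a b; rewrite oner_eq0 in X.
  exists (plucker (vec G 1 0 0 0) (vec G 0 0 a b)), (line_through (vec G 1 0 0 0) (vec G 0 0 a b)).
  split; [exact: X | by apply/plucker_of_line/plucker_neq0; case: (X isT ab) |].
  move=> _ /mem_line[x [y ->]] /mem_line23[a' [b']]; rewrite {1}vec_comb.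
  move=> /(vec_inj Gu)[]; rewrite mulr0 mulr1 addr0 => -> _ _ _.
  by exists y; rewrite scale0r add0r.
move=> [hN [_ hm _]].
have [a0 [a1 [a2 [a3 [b0 [b1 [b2 [b3 [NE p0]]]]]]]]] := line_basis Gu hN.
rewrite NE in hm hN *.
have t x y z w : (x != 0) || (y != 0) -> (z != 0) || (w != 0) ->
    polar (plucker (row4 a0 a1 a2 a3) (row4 b0 b1 b2 b3)) (plucker (row4 x y 0 0) (row4 0 0 z w)) = 0.
  move=> xy zw; have X := join_surface_plucker xy zw.
  by apply: (meets_polar hm X); case: X.
have o : (1 != 0 :> K) || (0 != 0 :> K) by rewrite oner_eq0.
have o' : (0 != 0 :> K) || (1 != 0 :> K) by rewrite oner_eq0 orbT.
have := t _ _ _ _ o o; have := t _ _ _ _ o o'; have := t _ _ _ _ o' o; have := t _ _ _ _ o' o'.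
rewrite !plucker_row4 !polar_row6 !(mulr0, mul0r, mulr1, subr0, sub0r, addr0, add0r, oppr0).
move=> /eqP; rewrite oppr_eq0 => /eqP p02 p03 p12 /eqP; rewrite oppr_eq0 => /eqP p13.
have pl : (a0 * b1 - a1 * b0) * (a2 * b3 - a3 * b2) = 0.
  transitivity ((a0 * b2 - a2 * b0) * (a1 * b3 - a3 * b1) - (a0 * b3 - a3 * b0) * (a1 * b2 - a2 * b1)).
    by ring.
  by rewrite p02 p03 !mul0r subrr.
have [p01|p01] := eqVneq (a0 * b1 - a1 * b0) 0; last by left; apply: line01_only.
right; apply: line23_only => //; apply: contraNneq p0 => p23.
by rewrite p01 p02 p03 p12 p13 p23; apply/eqP/rowP => j; rewrite !mxE; case: j => [[|[|[|[|[|[|]]]]]]].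
Qed.

Lemma cone_surface_join p : cone_surface G p -> exists x y k m l,
  p = plucker (vec G x y 0 0) (vec G m l (k * x) (k * y)) .
Proof.
move=> /cone_surfaceE[p0 [a [b [c [d [pE e]]]]]]; rewrite {p0}pE.
have [a0|a0] := eqVneq a 0.
  have c0 : c = 0 by apply/eqP; rewrite -sqrf_eq0 -e a0 mul0r.
  have [d0|d0] := eqVneq d 0.
    (* The vertex of the cone is [line01] itself, obtained with [k = 0]. *)
    exists 1, 0, 0, 0, b; rewrite plucker_vec; congr (row6 _ _ _ _ _ _ *m _); rewrite ?a0 ?c0 ?d0; ring.
  exists 0, 1, d, (- b), 0; rewrite plucker_vec; congr (row6 _ _ _ _ _ _ *m _); rewrite ?a0 ?c0 ?d0; ring.
exists a, c, a^-1, 0, (b / a); rewrite plucker_vec; congr (row6 _ _ _ _ _ _ *m _); try (field; exact: a0).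
transitivity (a * d / a); first by field; exact: a0.
by rewrite e; field; exact: a0.
Qed.

Lemma plucker_vec_cone x y k m l : plucker (vec G x y 0 0) (vec G m l (k * x) (k * y)) =
  row6 (x * l - y * m) (k * x ^+ 2) (k * (x * y)) (k * (x * y)) (k * y ^+ 2) 0 *m compound G.
Proof. by rewrite plucker_vec; congr (row6 _ _ _ _ _ _ *m _); ring. Qed.

Lemma cone_surface_plucker x y k m l :
  plucker (vec G x y 0 0) (vec G m l (k * x) (k * y)) != 0 ->
  cone_surface G (plucker (vec G x y 0 0) (vec G m l (k * x) (k * y))).
Proof.
move=> h; apply/cone_surfaceE; split=> //; rewrite plucker_vec_cone.
by do 4 eexists; split; [reflexivity | ring].
Qed.

Lemma cone_meets : meets_all (cone_surface G) (points (line01 G)).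
Proof.
move=> p L Xp pL; have [x [y [k [m [l pE]]]]] := cone_surface_join Xp.
have [p0 LE] := plucker_of_eq pL pE; exists (vec G x y 0 0).
have nz : vec G x y 0 0 != 0.
  apply: contraNneq p0 => e; rewrite pE e; apply/eqP/rowP => j.
  by rewrite !mxE !mul0r subrr.
split; split=> //; first by apply/mem_line01; exists x, y.
by rewrite LE; apply/mem_line; exists 1, 0; rewrite scale1r scale0r addr0.
Qed.

Lemma cone_focal_lines N : focal_line (cone_surface G) N <-> N = line01 G.
Proof.
split; last first.
  move=> ->; apply: focal_criterion; [exact: is_line01 | exact: cone_meets |].
  move=> z [z0 /mem_line01[a [b zE]]]; rewrite zE in z0 *.
  have ab : ~~ ((a == 0) && (b == 0)) by move: z0; rewrite vec_eq0 eqxx !andbT.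
  have p0 : plucker (vec G a b 0 0) (vec G 0 0 (1 * a) (1 * b)) != 0.
    rewrite plucker_vec_cone row6_compound_eq0 !mul1r !sqrf_eq0.
    by apply: contraNN ab => /and4P[_ -> _ /and3P[_ -> _]].
  exists (plucker (vec G a b 0 0) (vec G 0 0 (1 * a) (1 * b))),
    (line_through (vec G a b 0 0) (vec G 0 0 (1 * a) (1 * b))).
  split; [exact: cone_surface_plucker | by apply/plucker_of_line/plucker_neq0 |].
  move=> _ /mem_line[x [y ->]] /mem_line01[a' [b']]; rewrite {1}vec_comb.
  move=> /(vec_inj Gu)[_ _ /eqP]; rewrite !mul1r mulr0 add0r mulf_eq0 => h1 /eqP.
  rewrite add0r mulf_eq0 => h2; exists x.
  suff -> : y = 0 by rewrite scale0r addr0.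
  by apply/eqP; move: h1 h2 ab; case: (y == 0) => //= -> ->.
move=> [hN [_ hm _]].
have [a0 [a1 [a2 [a3 [b0 [b1 [b2 [b3 [NE p0]]]]]]]]] := line_basis Gu hN.
rewrite NE in hm hN *.
have t x y k m l : plucker (vec G x y 0 0) (vec G m l (k * x) (k * y)) != 0 ->
    polar (plucker (row4 a0 a1 a2 a3) (row4 b0 b1 b2 b3))
          (plucker (row4 x y 0 0) (row4 m l (k * x) (k * y))) = 0.
  by move=> h; apply: (meets_polar hm) => //; exact: cone_surface_plucker.
(* The test lines are tangents at three points of [line01], and [line01] itself. They give p13 = p02
   = p23 = 0 and p03 = - p12, whereupon the Plücker relation reads p12 ^ 2 = 0. *)
have t1 := t 1 0 1 0 0; have t2 := t 0 1 1 0 0; have t3 := t 1 1 1 0 0; have t4 := t 1 0 0 0 1.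
rewrite plucker_vec_cone row6_compound_eq0 plucker_row4 plucker_row4 polar_row6 in t1.
rewrite plucker_vec_cone row6_compound_eq0 plucker_row4 plucker_row4 polar_row6 in t2.
rewrite plucker_vec_cone row6_compound_eq0 plucker_row4 plucker_row4 polar_row6 in t3.
rewrite plucker_vec_cone row6_compound_eq0 plucker_row4 plucker_row4 polar_row6 in t4.
move: t1 t2 t3 t4.
rewrite !(expr1n, expr0n, mulr0, mul0r, mulr1, subr0, sub0r, addr0, add0r, oppr0, oner_eq0, subrr, eqxx) /=.
move=> /(_ isT)/eqP; rewrite oppr_eq0 => /eqP p13 /(_ isT)/eqP; rewrite oppr_eq0 => /eqP p02 /(_ isT) p3 /(_ isT) p23.
have p03 : (a0 * b3 - a3 * b0) = - (a1 * b2 - a2 * b1).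
  apply/eqP; rewrite -addr_eq0 -[X in _ == X]p3 p13 p02; apply/eqP; ring.
have pl : (a0 * b1 - a1 * b0) * (a2 * b3 - a3 * b2) - (a0 * b2 - a2 * b0) * (a1 * b3 - a3 * b1)
    + (a0 * b3 - a3 * b0) * (a1 * b2 - a2 * b1) = 0 by ring.
have p12 : a1 * b2 - a2 * b1 = 0.
  apply/eqP; rewrite -sqrf_eq0 expr2 -oppr_eq0 -mulNr -p03; apply/eqP.
  by move: pl; rewrite p23 p02 mul0r mulr0 subr0 add0r.
rewrite p12 oppr0 in p03; apply: line01_only => //.
apply: contraNneq p0 => p01.
by rewrite p01 p02 p03 p12 p13 p23; apply/eqP/rowP => j; rewrite !mxE; case: j => [[|[|[|[|[|[|]]]]]]].
Qed.

End FocalLines.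

(** * Tangent planes of a ruled quadric along a line *)

Section TangentQuadric.
Variables (K : numFieldType).

Definition grad (f : {mpoly K[4]}) (P v : 'rV[K]_4) := \sum_i (f^`M(i)).@[P ord0] * v ord0 i.

Lemma gradB f g P v : grad (f - g) P v = grad f P v - grad g P v.
Proof. by rewrite /grad -sumrB; apply: eq_bigr => i _; rewrite mderivB mevalB mulrBl. Qed.

Lemma gradD f g P v : grad (f + g) P v = grad f P v + grad g P v.
Proof. by rewrite /grad -big_split; apply: eq_bigr => i _; rewrite mderivD mevalD mulrDl. Qed.

Lemma gradM f g P v :
  grad (f * g) P v = grad f P v * g.@[P ord0] + f.@[P ord0] * grad g P v.
Proof.
rewrite /grad mulr_suml mulr_sumr -big_split; apply: eq_bigr => i _ /=.
by rewrite mderivM mevalD !mevalM; ring.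
Qed.

Lemma grad_linear_form (c : 'cV[K]_4) P v : grad (linear_form c) P v = (v *m c) ord0 ord0.
Proof.
rewrite /grad mxE; apply: eq_bigr => i _; rewrite mulrC; congr (_ * _).
rewrite /linear_form (raddf_sum (mderiv i)) /= raddf_sum /= (bigD1 i) //= big1 => [|j ji].
  rewrite mderivZ mderivX mevalZ mevalZ mnm1E eqxx mul1r.
  have -> : (U_(i) - U_(i))%MM = 0%MM by apply/mnmP => k; rewrite mnmBE subnn mnmE.
  by rewrite mpolyX0 meval1 mulr1 addr0.
by rewrite mderivZ mderivX mevalZ mevalZ mnm1E (negPf ji) mul0r mulr0.
Qed.

Variable G : 'M[K]_4.
Hypothesis Gu : G \in unitmx.

Definition coord_form k := linear_form (col (inord k : 'I_4) (invmx G)).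

Definition ruled_quadric : {mpoly K[4]} :=
  coord_form 0 * coord_form 3 - coord_form 1 * coord_form 2.

Lemma coord_form_vec a b c d k : (k < 4)%N ->
  (coord_form k).@[(vec G a b c d) ord0] = nth 0 [:: a; b; c; d] k.
Proof. by move=> hk; rewrite meval_linear_form mulmx_col_entry mulmxK // mxE inordK. Qed.

Lemma ruled_quadric_vec a b c d : ruled_quadric.@[(vec G a b c d) ord0] = a * d - b * c.
Proof. by rewrite mevalB !mevalM !coord_form_vec. Qed.

Lemma grad_ruled_quadric a b c d a' b' c' d' :
  grad ruled_quadric (vec G a b c d) (vec G a' b' c' d') = a' * d + a * d' - b' * c - b * c'.
Proof.
have g k P : (k < 4)%N -> grad (coord_form k) P (vec G a' b' c' d') = nth 0 [:: a'; b'; c'; d'] k.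
  by move=> hk; rewrite grad_linear_form -meval_linear_form coord_form_vec.
by rewrite gradB !gradM !g // !coord_form_vec //=; ring.
Qed.

Lemma ruled_quadric_smooth : smooth_quadric ruled_quadric.
Proof.
have h k : coord_form k \is 1.-homog by exact: linear_form_homog.
split; first by rewrite rpredB // (dhomogM (h _) (h _)).
move=> v [v0 _]; apply: boolp.contrapT => /boolp.forallNP hv.
have gz w : grad ruled_quadric v w = 0.
  by apply: big1 => i _; have /boolp.contrapT -> := hv i; rewrite mul0r.
have [a [b [c [d vE]]]] := vecE v Gu; case/eqP: v0; rewrite vE.
have := gz (vec G 1 0 0 0); have := gz (vec G 0 1 0 0); have := gz (vec G 0 0 1 0).
have := gz (vec G 0 0 0 1); rewrite vE !grad_ruled_quadric.
rewrite !(mul0r, mulr0, mul1r, mulr1, add0r, addr0, subr0, sub0r) => -> /eqP.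
rewrite oppr_eq0 => /eqP-> /eqP; rewrite oppr_eq0 => /eqP-> ->; exact: vec0.
Qed.

(** The lines spanned by (1, 0, e, 0) and (0, 1, 0, e) belong to the ruling of [line01]. In
    [inf_near] the infinitely near line is represented by the limit at [e = 0], hence by [line01]
    itself. *)
Lemma ruled_quadric_inf_near : inf_near ruled_quadric (line01 G) (line01 G).
Proof.
split; [exact: ruled_quadric_smooth | exact: is_line01 |].
exists (vec G 1 0 0 0), (vec G 0 1 0 0), (vec G 0 0 1 0), (vec G 0 0 0 1) => y_.
split=> //; first by rewrite /y_ !scale0r !addr0.
move=> e; rewrite /y_.
have c1 a b c d (x : 'rV[K]_4) : vec G a b c d + e *: x = 1 *: vec G a b c d + e *: x by rewrite scale1r.
rewrite !c1 !vec_comb !(mulr0, mulr1, add0r, addr0).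
have mem w : w \in line_through (vec G 1 0 e 0) (vec G 0 1 0 e) ->
    exists a b, w = vec G a b (a * e) (b * e).
  by move=> /mem_line[a [b ->]]; exists a, b; rewrite vec_comb !(mulr0, mulr1, add0r, addr0).
split.
- apply/is_line_through => a b; rewrite vec_comb !(mulr0, mulr1, add0r, addr0) -(vec0 G).
  by move=> /(vec_inj Gu)[-> ->].
- move=> w [w0 /mem[a [b wE]]]; split=> //; rewrite wE ruled_quadric_vec; ring.
move=> e0; apply/eqP; rewrite -subv0; apply/subvP => w; rewrite memv_cap memv0 => /andP[/mem[a [b ->]]].
move=> /mem_line01[c [d /(vec_inj Gu)[_ _ /eqP + /eqP]]].
have /negPf e0' : e != 0 by exact/eqP.
by rewrite !mulf_eq0 e0' !orbF => /eqP -> /eqP ->; rewrite mul0r vec0.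
Qed.

(** Tangency at (x, y, 0, 0) means that the last two coordinates are proportional to (x, y), which
    is the parametrization of the cone. *)
Lemma cone_tangent p : cone_surface G p <-> tangent_congruence (line01 G) ruled_quadric p.
Proof.
split=> [Xp|[L [P [pL [P0 Px] [_ PL] tan]]]].
  have [x [y [k [m [l pE]]]]] := cone_surface_join Xp.
  have p0 : p != 0 by case: Xp.
  have nz : vec G x y 0 0 != 0.
    apply: contraNneq p0 => e; rewrite pE e; apply/eqP/rowP => j.
    by rewrite !mxE !mul0r subrr.
  exists (line_through (vec G x y 0 0) (vec G m l (k * x) (k * y))), (vec G x y 0 0); split.
  - by rewrite pE; apply/plucker_of_line/plucker_neq0; rewrite -pE.
  - by split=> //; apply/mem_line01; exists x, y.
  - by split=> //; apply/mem_line; exists 1, 0; rewrite scale1r scale0r addr0.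
  - move=> _ /mem_line[a [b ->]]; rewrite vec_comb /tangent_at -/(grad _ _ _) grad_ruled_quadric; ring.
have [x [y PE]] := mem_line01 _ _ Px; rewrite PE in P0 PL tan.
move: pL => [hL [u [v [LE pE]]]].
have p0 : p != 0 by rewrite pE; apply/plucker_neq0/is_line_through; rewrite -LE.
(* a second point of the line, so that p is a multiple of its wedge with P *)
have [w [wL [c [c0 pw]]]] : exists w, w \in L /\ exists c, c != 0 /\ p = c *: plucker (vec G x y 0 0) w.
  rewrite LE in PL *; have /mem_line[a [b abE]] := PL; rewrite abE.
  have [a0|a0] := eqVneq a 0.
    have b0 : b != 0 by apply: contraNneq P0 => b0; rewrite abE a0 b0 !scale0r addr0.
    exists u; split; first by apply/mem_line; exists 1, 0; rewrite scale1r scale0r addr0.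
    exists (- b^-1); rewrite oppr_eq0 invr_eq0; split=> //.
    by rewrite pE a0; apply/rowP => k; rewrite !mxE; field; exact: b0.
  exists v; split; first by apply/mem_line; exists 0, 1; rewrite scale1r scale0r add0r.
  exists (a^-1); rewrite invr_eq0; split=> //.
  by rewrite pE; apply/rowP => k; rewrite !mxE; field; exact: a0.
have [w0 [w1 [w2 [w3 wE]]]] := vecE w Gu.
have := tan w wL; rewrite wE /tangent_at -/(grad _ _ _) grad_ruled_quadric => tw.
have [k [k2 k3]] : exists k, w2 = k * x /\ w3 = k * y.
  have e : x * w3 = y * w2 by move/eqP: tw; rewrite !mulr0 add0r subr0 subr_eq0 => /eqP.
  have [x0|x0] := eqVneq x 0.
    have y0 : y != 0.
      by apply: contraNneq P0 => y0; rewrite x0 y0 vec0.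
    exists (w3 / y); rewrite divfK // x0 mulr0; split=> //.
    by apply: (mulfI y0); rewrite -e x0 mul0r mulr0.
  exists (w2 / x); rewrite divfK //; split=> //.
  by apply: (mulfI x0); rewrite e; field; exact: x0.
apply/cone_surfaceE; split=> //; rewrite pw wE k2 k3 plucker_vec_cone.
exists (c * (k * x ^+ 2)), (c * (x * w1 - y * w0)), (c * (k * (x * y))), (c * (k * y ^+ 2)).
split; last by ring.
rewrite scalemxAl; congr (_ *m _); apply/rowP => j; rewrite !mxE.
by case: j => [[|[|[|[|[|[|]]]]]]] //= _; rewrite mulr0.
Qed.

End TangentQuadric.

(** Products of two forms vanishing on the line have zero gradient along it, so only the multiple of
    the other quadric contributes. Thus a double line determines the tangent planes along its
    support. *)
Lemma same_double_line_grad (K : numFieldType) (G G' : 'M[K]_4) :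
  G \in unitmx -> G' \in unitmx -> line01 G = line01 G' ->
  same_double_line (line01 G) (ruled_quadric G) (ruled_quadric G') ->
  forall P, P \in line01 G -> exists k, forall v,
    grad (ruled_quadric G) P v = k * grad (ruled_quadric G') P v.
Proof.
move=> Gu Gu' e same P Pa.
have [|s [h [sv qE]]] := (same (ruled_quadric G)).1.
  by exists [::], 1; split=> //; rewrite big_nil add0r mul1r.
exists h.@[P ord0] => v; rewrite [in LHS]qE gradD gradM.
have -> : (ruled_quadric G').@[P ord0] = 0.
  by move: Pa; rewrite e => /mem_line01[a [b ->]]; rewrite ruled_quadric_vec //; ring.
rewrite mulr0 add0r.
have -> : grad (\sum_(gg <- s) gg.1 * gg.2) P v = 0; last by rewrite add0r.
elim: s sv {qE} => [|gg s IHs] sv.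
  by rewrite big_nil /grad big1 // => i _; rewrite mderiv0 meval0 mul0r.
rewrite big_cons gradD IHs; last by move=> x xs; apply: sv; rewrite inE xs orbT.
rewrite gradM; have [|-> ->] := sv gg _ P Pa; first by rewrite inE eqxx.
by rewrite mulr0 mul0r !addr0.
Qed.

Lemma zdim_ext (K : numFieldType) n (X Y : pset K n) d :
  (forall p, X p <-> Y p) -> zdim X d -> zdim Y d.
Proof.
move=> XY [[Z [Zv Zs]] nX]; split.
  by exists Z; split=> // i /Zv[Zi ZX]; split=> // p /ZX/XY.
move=> [Z' [Zv' Zs']]; apply: nX; exists Z'; split=> // i /Zv'[Zi ZY].
by split=> // p /ZY/XY.
Qed.

Lemma conj_rowM (R : realType) m n (v : 'rV[R[i]]_m) (A : 'M[R]_(m, n)) :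
  conj_row (v *m map_mx (real_complex R) A) = conj_row v *m map_mx (real_complex R) A.
Proof.
rewrite /conj_row map_mxM; congr (_ *m _); apply/matrixP => i j; rewrite !mxE.
by apply/eqP; rewrite eq_complex /= oppr0 !eqxx.
Qed.

(** * Complex quadric surfaces with real equations *)

Section RealSurfaces.
Variable R : realType.
Local Notation C := R[i].
Variables (A : 'M[R]_(4, 6)) (al be ga : R).
Hypothesis Ainv : right_inv A.
Hypothesis q0 : (al != 0) || (be != 0) || (ga != 0).

Local Notation toC := (map_mx (real_complex R)).

Definition complex_surface := quadric_surface (toC A) al%:C be%:C ga%:C.

Lemma complex_inv : exists2 D : 'M[R]_(6, 4), A *m D = 1%:M & toC A *m toC D = 1%:M.
Proof. by case: Ainv => D AD; exists D => //; rewrite -map_mxM AD map_mx1. Qed.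

Lemma complex_q0 : (al%:C != 0) || (be%:C != 0) || (ga%:C != 0).
Proof. by rewrite !fmorph_eq0. Qed.

Lemma real_locus_surface v :
  real_locus complex_surface v <-> quadric_surface A al be ga v.
Proof.
have [D AD ADC] := complex_inv.
rewrite /real_locus /complex_surface (quadric_surface_closed _ _ _ ADC) (quadric_surface_closed _ _ _ AD).
have -> : to_complex v = toC v by [].
have e : toC v *m toC D = toC (v *m D) by rewrite map_mxM.
rewrite map_mx_eq0 e -map_mxM.
have h : qf al%:C be%:C ga%:C ((toC (v *m D)) ord0 (inord 1)) ((toC (v *m D)) ord0 (inord 2))
   = (qf al be ga ((v *m D) ord0 (inord 1)) ((v *m D) ord0 (inord 2)))%:C.
  by rewrite /qf !(rmorphD, rmorphM, rmorphXn) /= !mxE.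
split=> [[v0 [e1 e2]]|[v0 [e1 e2]]]; split=> //.
  split; first by move/map_mx_inj: e1.
  move: e2; cbv zeta; rewrite h => e2; apply: (fmorph_inj (real_complex R)); rewrite -[RHS]e2.
  by rewrite rmorphM /= [in RHS]mxE [in X in _ = _ * X]mxE.
split; first by rewrite -e1.
cbv zeta; rewrite h -e2 rmorphM /=; rewrite [in LHS]mxE [in X in _ * X = _]mxE //.
Qed.

Lemma conj_row_neq0 n (v : 'rV[C]_n) : (conj_row v == 0) = (v == 0).
Proof. by rewrite /conj_row map_mx_eq0. Qed.

Lemma conj_rowK n (v : 'rV[C]_n) : conj_row (conj_row v) = v.
Proof. by apply/rowP => j; rewrite !mxE conjcK. Qed.

Lemma complex_surface_real : real_pset complex_surface.
Proof.
suff h v : complex_surface v -> complex_surface (conj_row v).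
  by move=> v; split=> [/h //|/h]; rewrite conj_rowK.
move=> [v0 [a [b [c [d [vE e]]]]]]; split; first by rewrite conj_row_neq0.
exists a^*, b^*, c^*, d^*; rewrite vE conj_rowM; split.
  congr (_ *m _); apply/rowP => j; rewrite !mxE.
  by case: j => [[|[|[|[|]]]]].
rewrite -rmorphM e /qf !(rmorphD, rmorphM, rmorphXn) /=.
by congr (_ * _ + _ * _ + _ * _); apply/eqP; rewrite eq_complex /= oppr0 !eqxx.
Qed.

(** The dimension of the surface and that of its real locus are two instances of
    [quadric_surface_dim], over the complex and over the real numbers. *)
Lemma complex_surface_linear (X : pset C 6) :
  (forall p, X p <-> complex_surface p) -> psubset X (@klein_quadric C) ->
  linear_congruence X.
Proof.
move=> XE XK; have [D AD ADC] := complex_inv.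
have XE' p : complex_surface p <-> X p by apply: iff_sym.
split.
  split=> //.
  - apply: variety_ext XE' _; exact: quadric_surface_variety ADC complex_q0.
  - apply: zdim_ext XE' _; exact: quadric_surface_dim ADC complex_q0.
  - by move=> v; rewrite !XE; exact: complex_surface_real.
  - apply: zdim_ext (quadric_surface_dim AD q0) => v.
    by rewrite -real_locus_surface /real_locus XE.
pose f : 'Hom('rV[C]_4, 'rV[C]_6) := linfun (mulmxr (toC A)).
exists (limg f); split; last first.
  move=> p /XE[_ [a [b [c [d [-> _]]]]]].
  by rewrite -[row4 a b c d *m _](lfunE (mulmxr (toC A))) memv_img ?memvf.
have k0 : lker f == 0%VS.
  apply/lker0P => u v; rewrite !lfunE /= => /(congr1 (mulmx^~ (toC D))).
  by rewrite -!mulmxA ADC !mulmx1.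
by rewrite limg_dim_eq ?dimvf ?(eqP k0) ?capv0.
Qed.

End RealSurfaces.

(** * Trilinear maps and their line congruences *)

Section TrilinearMap.
Variable K : numFieldType.

Definition tri_vec (w : 'rV[K]_(tri_dim)) (i j k : 'I_2) : 'rV[K]_4 :=
  \row_l tri_coef w l [ffun m : 'I_3 => nth i [:: i; j; k] m].

Definition trimap (w : 'rV[K]_(tri_dim)) (s t u : 'rV[K]_2) : 'rV[K]_4 :=
  \sum_i \sum_j \sum_k (s ord0 i * t ord0 j * u ord0 k) *: tri_vec w i j k.

Lemma tri_evalE w z : tri_eval w z = trimap w (row 0 z) (row 1 z) (row 2 z).
Proof.
apply/rowP => l; rewrite mxE /tri_poly raddf_sum /=.
rewrite (reindex (fun x : 'I_2 * ('I_2 * 'I_2) =>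
   [ffun m : 'I_3 => nth x.1 [:: x.1; x.2.1; x.2.2] m])) /=; last first.
  exists (fun e : {ffun 'I_3 -> 'I_2} => (e 0, (e 1, e 2))) => [[i [j k]] _|e _] /=.
    by rewrite !ffunE.
  apply/ffunP => m; rewrite ffunE; case: m => [[|[|[|]]]] //= h; congr (e _); exact: val_inj.
rewrite -(pair_bigA _ (fun i jk => (tri_coef w l [ffun m : 'I_3 => nth i [:: i; jk.1; jk.2] m] *:
   \prod_k param_var K k ([ffun m : 'I_3 => nth i [:: i; jk.1; jk.2] m] k)).@[mxvec z ord0])) /=.
rewrite /trimap summxE; apply: eq_bigr => i _.
rewrite -(pair_bigA _ (fun j k => (tri_coef w l [ffun m : 'I_3 => nth i [:: i; j; k] m] *:
   \prod_k0 param_var K k0 ([ffun m : 'I_3 => nth i [:: i; j; k] m] k0)).@[mxvec z ord0])) /=.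
rewrite summxE; apply: eq_bigr => j _; rewrite summxE; apply: eq_bigr => k _.
rewrite mevalZ rmorph_prod /= !mxE mulrC; congr (_ * _).
rewrite !big_ord_recl big_ord0 !ffunE /= mulr1 /param_var !mevalXU !mxvecE mulrA.
by congr (z _ _ * z _ _ * z _ _); apply: val_inj.
Qed.

(** Common shape of the three parametric congruences: [s] and [u] are the two fixed parameters, and
    [F0], [F1] are the values at the two unit vectors of the free one. *)
Definition pencil_lines (F0 F1 : 'rV[K]_2 -> 'rV[K]_2 -> 'rV[K]_4) : pset K 6 :=
  zclosure (fun p => exists L, (is_line L /\ exists s u, [/\ s != 0, u != 0 &
    forall v, v \in L <-> exists r : 'rV[K]_2, v = r ord0 ord0 *: F0 s u + r ord0 ord_max *: F1 s u])
    /\ plucker_of p L).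

Lemma zclosure_ext n (X Y : pset K n) : (forall p, X p <-> Y p) ->
  forall p, zclosure X p <-> zclosure Y p.
Proof.
by move=> XY p; split=> [] [p0 hp]; split=> // f [fh fv]; apply: hp; split=> // v /XY; apply: fv.
Qed.

Definition unit_row (i : 'I_2) : 'rV[K]_2 := delta_mx ord0 i.

Lemma trimap_coord w (s t u : 'rV[K]_2) l :
  let s0 := s ord0 ord0 in let s1 := s ord0 ord_max in
  let t0 := t ord0 ord0 in let t1 := t ord0 ord_max in
  let u0 := u ord0 ord0 in let u1 := u ord0 ord_max in
  let V i j k := tri_vec w i j k ord0 l in
  trimap w s t u ord0 l =
    s0 * (t0 * (u0 * V ord0 ord0 ord0 + u1 * V ord0 ord0 ord_max)
        + t1 * (u0 * V ord0 ord_max ord0 + u1 * V ord0 ord_max ord_max))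
  + s1 * (t0 * (u0 * V ord_max ord0 ord0 + u1 * V ord_max ord0 ord_max)
        + t1 * (u0 * V ord_max ord_max ord0 + u1 * V ord_max ord_max ord_max)).
Proof.
cbv zeta; rewrite /trimap !big_ord_recl !big_ord0.
have -> : lift ord0 ord0 = ord_max :> 'I_2 by apply: val_inj.
rewrite !addr0.
have e (x y : 'rV[K]_4) : (x + y) ord0 l = x ord0 l + y ord0 l by rewrite mxE.
have f c (x : 'rV[K]_4) : (c *: x) ord0 l = c * x ord0 l by rewrite mxE.
by rewrite !e !f; ring.
Qed.

Lemma unit_rowE (i j : 'I_2) : unit_row i ord0 j = (j == i)%:R.
Proof. by rewrite mxE. Qed.

Lemma row_lin2 n (a b : K) (x y : 'rV[K]_n) l :
  (a *: x + b *: y) ord0 l = a * x ord0 l + b * y ord0 l.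
Proof. by rewrite !mxE. Qed.

Ltac trimap_lin_tac := apply/rowP => ?; rewrite row_lin2 !trimap_coord !unit_rowE;
  rewrite !eqxx /=; ring.

Lemma trimap_lin0 w r t u : trimap w r t u =
  r ord0 ord0 *: trimap w (unit_row ord0) t u + r ord0 ord_max *: trimap w (unit_row ord_max) t u.
Proof. trimap_lin_tac. Qed.

Lemma trimap_lin1 w s r u : trimap w s r u =
  r ord0 ord0 *: trimap w s (unit_row ord0) u + r ord0 ord_max *: trimap w s (unit_row ord_max) u.
Proof. trimap_lin_tac. Qed.

Lemma trimap_lin2 w s t r : trimap w s t r =
  r ord0 ord0 *: trimap w s t (unit_row ord0) + r ord0 ord_max *: trimap w s t (unit_row ord_max).
Proof. trimap_lin_tac. Qed.

Definition mk3 (s t u : 'rV[K]_2) : 'M[K]_(3, 2) := \matrix_(i, j) nth 0 [:: s; t; u] i ord0 j.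

Lemma row_mk3 s t u i : row i (mk3 s t u) = nth 0 [:: s; t; u] i.
Proof. by apply/rowP => j; rewrite !mxE. Qed.

Lemma param_congruence0 w p : param_congruence w 0 p <->
  pencil_lines (fun t u => trimap w (unit_row ord0) t u) (fun t u => trimap w (unit_row ord_max) t u) p.
Proof.
apply: zclosure_ext => q; split=> [] [L [[hL hx] qL]]; exists L; split=> //; split=> //.
  case: hx => z [z0 hz]; exists (row 1 z), (row 2 z); split=> // v; rewrite hz.
  split=> [] [r ->]; exists r; rewrite tri_evalE -trimap_lin0 //;
    by congr trimap; apply/rowP => j; rewrite !mxE.
case: hx => t [u [t0 u0 hv]]; exists (mk3 t t u); split.
  by move=> i; rewrite row_mk3; case: i => [[|[|[|]]]].
move=> v; rewrite hv; split=> [] [r ->]; exists r; rewrite tri_evalE -trimap_lin0 //;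
    by congr trimap; apply/rowP => j; rewrite !mxE.
Qed.

Lemma param_congruence1 w p : param_congruence w 1 p <->
  pencil_lines (fun s u => trimap w s (unit_row ord0) u) (fun s u => trimap w s (unit_row ord_max) u) p.
Proof.
apply: zclosure_ext => q; split=> [] [L [[hL hx] qL]]; exists L; split=> //; split=> //.
  case: hx => z [z0 hz]; exists (row 0 z), (row 2 z); split=> // v; rewrite hz.
  split=> [] [r ->]; exists r; rewrite tri_evalE -trimap_lin1 //;
    by congr trimap; apply/rowP => j; rewrite !mxE.
case: hx => t [u [t0 u0 hv]]; exists (mk3 t t u); split.
  by move=> i; rewrite row_mk3; case: i => [[|[|[|]]]].
move=> v; rewrite hv; split=> [] [r ->]; exists r; rewrite tri_evalE -trimap_lin1 //;
    by congr trimap; apply/rowP => j; rewrite !mxE.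
Qed.

Lemma param_congruence2 w p : param_congruence w 2 p <->
  pencil_lines (fun s t => trimap w s t (unit_row ord0)) (fun s t => trimap w s t (unit_row ord_max)) p.
Proof.
apply: zclosure_ext => q; split=> [] [L [[hL hx] qL]]; exists L; split=> //; split=> //.
  case: hx => z [z0 hz]; exists (row 0 z), (row 1 z); split=> // v; rewrite hz.
  split=> [] [r ->]; exists r; rewrite tri_evalE -trimap_lin2 //;
    by congr trimap; apply/rowP => j; rewrite !mxE.
case: hx => t [u [t0 u0 hv]]; exists (mk3 t u t); split.
  by move=> i; rewrite row_mk3; case: i => [[|[|[|]]]].
move=> v; rewrite hv; split=> [] [r ->]; exists r; rewrite tri_evalE -trimap_lin2 //;
    by congr trimap; apply/rowP => j; rewrite !mxE.
Qed.

Lemma mulmx_unit_neq0 n (v : 'rV[K]_n) (M : 'M[K]_n) : M \in unitmx -> (v *m M == 0) = (v == 0).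
Proof.
move=> Mu; apply/eqP/eqP => [e|->]; last by rewrite mul0mx.
by rewrite -[v](mulmxK Mu) e mul0mx.
Qed.

(** Invertible changes of the parameters permute the lines of the family, so the congruences may be
    computed in the coordinates of the normal form. *)
Lemma pencil_lines_change (F0 F1 F0' F1' : 'rV[K]_2 -> 'rV[K]_2 -> 'rV[K]_4) (S U T : 'M[K]_2) :
  S \in unitmx -> U \in unitmx -> T \in unitmx ->
  (forall (s u r : 'rV[K]_2), r ord0 ord0 *: F0 s u + r ord0 ord_max *: F1 s u =
     (r *m T) ord0 ord0 *: F0' (s *m S) (u *m U) + (r *m T) ord0 ord_max *: F1' (s *m S) (u *m U)) ->
  forall p, pencil_lines F0 F1 p <-> pencil_lines F0' F1' p.
Proof.
move=> Su Uu Tu h; apply: zclosure_ext => q; split=> [] [L [[hL [s [u [s0 u0 hv]]]] qL]];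
  exists L; split=> //; split=> //.
  exists (s *m S), (u *m U); rewrite !mulmx_unit_neq0 //; split=> // v; rewrite hv.
  split=> [] [r ->]; first by exists (r *m T); rewrite h.
  by exists (r *m invmx T); rewrite h mulmxKV.
exists (s *m invmx S), (u *m invmx U); rewrite !mulmx_unit_neq0 ?unitmx_inv //; split=> // v; rewrite hv.
split=> [] [r ->]; first by exists (r *m invmx T); rewrite h !mulmxKV.
by exists (r *m T); rewrite h !mulmxKV.
Qed.

Definition row2 (a b : K) : 'rV[K]_2 := \row_i (if i == ord0 then a else b).

Section PencilSurface.
Variables (E : 'M[K]_(4, 6)) (al be ga : K).
Hypothesis Einv : right_inv E.
Hypothesis q0 : (al != 0) || (be != 0) || (ga != 0).

(** The surface is closed and contains all lines of the family. For the other inclusion it suffices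
    to reach the part [h != 0] of the affine chart, whose closure is the surface. *)
Lemma pencil_surface (F0 F1 : 'rV[K]_2 -> 'rV[K]_2 -> 'rV[K]_4) (h : {mpoly K[2]}) :
  (forall s u, exists a b c d, plucker (F0 s u) (F1 s u) = row4 a b c d *m E
      /\ a * d = qf al be ga b c) ->
  h != 0 ->
  (forall x, h.@[x] != 0 -> exists (s u : 'rV[K]_2) (k : K), [/\ s != 0, u != 0, k != 0 &
     plucker (F0 s u) (F1 s u) = k *: (row4 1 (x ord0) (x ord_max) (qf al be ga (x ord0) (x ord_max)) *m E)]) ->
  forall p, pencil_lines F0 F1 p <-> quadric_surface E al be ga p.
Proof.
move=> h1 h0 h2 p; have [D ED] := Einv; split.
  move: p; apply: zclosure_min.
    by case: (quadric_surface_variety ED q0).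
  move=> p [L [[hL [s [u [s0 u0 hv]]]] [_ [v1 [v2 [LE pE]]]]]].
  have p0 : p != 0 by rewrite pE; apply/plucker_neq0/is_line_through; rewrite -LE.
  split=> //.
  have [r1 e1] : exists r : 'rV_2, v1 = r ord0 ord0 *: F0 s u + r ord0 ord_max *: F1 s u.
    by apply/hv; rewrite LE; apply/mem_line; exists 1, 0; rewrite scale1r scale0r addr0.
  have [r2 e2] : exists r : 'rV_2, v2 = r ord0 ord0 *: F0 s u + r ord0 ord_max *: F1 s u.
    by apply/hv; rewrite LE; apply/mem_line; exists 0, 1; rewrite scale1r scale0r add0r.
  have [a [b [c [d [pl e]]]]] := h1 s u.
  rewrite pE e1 e2 plucker_comb pl; set k := (X in X *: _).
  exists (k * a), (k * b), (k * c), (k * d); split.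
    rewrite scalemxAl; congr (_ *m _); apply/rowP => j; rewrite !mxE.
    by case: j => [[|[|[|[|]]]]].
  by rewrite mulrACA e /qf; ring.
move=> Xp; have := quadric_surface_sub q0 h0 Xp; move: p {Xp}; apply: zclosure_min.
  exact: zclosure_closed.
move=> _ [x hx ->]; rewrite qparamE !mevalXU; apply: zclosure_sub; first by rewrite (row4_neq0 ED) ?oner_eq0.
have [s [u [k [s0 u0 k0 pl]]]] := h2 x hx.
have pl' : row4 1 (x ord0) (x ord_max) (qf al be ga (x ord0) (x ord_max)) *m E =
    plucker (F0 s u) (k^-1 *: F1 s u).
  have := @plucker_comb _ (F0 s u) (F1 s u) 1 0 0 k^-1; rewrite !scale1r !scale0r addr0 add0r => ->.
  by rewrite mul1r mul0r subr0 pl scalerA mulVf ?scale1r.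
have nz : plucker (F0 s u) (k^-1 *: F1 s u) != 0 by rewrite -pl' (row4_neq0 ED) ?oner_eq0.
rewrite pl'; exists (line_through (F0 s u) (k^-1 *: F1 s u)); split; last first.
  exact/plucker_of_line/plucker_neq0.
split; first exact/is_line_through/plucker_neq0.
exists s, u; split=> // v; split=> [/mem_line[a [b ->]]|[r ->]].
  by exists (row2 a (b / k)); rewrite !mxE /= scalerA.
by apply/mem_line; exists (r ord0 ord0), (r ord0 ord_max * k); rewrite scalerA mulfK.
Qed.

End PencilSurface.

End TrilinearMap.

(** * Families of lines that sweep out quadric surfaces *)

Section ParametricSurfaces.
Variable K : numFieldType.
Local Notation fst2 r := (r ord0 ord0).
Local Notation snd2 r := (r ord0 ord_max).

Definition row3 (a b c : K) : 'rV[K]_3 := \row_i nth 0 [:: a; b; c] i.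

Lemma row3_inj a b c a' b' c' : row3 a b c = row3 a' b' c' -> [/\ a = a', b = b' & c = c'].
Proof.
move=> e; have h (k : 'I_3) : nth 0 [:: a; b; c] k = nth 0 [:: a'; b'; c'] k.
  by move/rowP: e => /(_ k); rewrite !mxE.
split; [exact: (h (Ordinal (isT : 0 < 3)%N)) | exact: (h (Ordinal (isT : 1 < 3)%N))
       | exact: (h (Ordinal (isT : 2 < 3)%N))].
Qed.

Lemma row3E (v : 'rV[K]_3) : exists a b c, v = row3 a b c.
Proof.
exists (v ord0 (inord 0)), (v ord0 (inord 1)), (v ord0 (inord 2)).
apply/rowP => i; rewrite !mxE; case: i => [[|[|[|]]]] //= hi;
  by congr (v ord0 _); apply: val_inj; rewrite /= inordK.
Qed.

Lemma row3Z k a b c : k *: row3 a b c = row3 (k * a) (k * b) (k * c).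
Proof. by apply/rowP => i; rewrite !mxE; case: i => [[|[|[|]]]]. Qed.

(* The three bilinear monomials that vanish at t0 = u0 = 0. *)
Definition mono3 (t u : 'rV[K]_2) := row3 (fst2 t * fst2 u) (fst2 t * snd2 u) (snd2 t * fst2 u).

Lemma row2_neq0 (a b : K) : a != 0 -> row2 a b != 0.
Proof. by apply: contraNneq => /rowP/(_ ord0); rewrite !mxE /= => ->. Qed.

Lemma mpoly2_eval0 (h : {mpoly K[2]}) : h = 0 -> forall z w, h.@[fun i : 'I_2 => if i == ord0 then z else w] = 0.
Proof. by move=> -> z w; rewrite meval0. Qed.

(** The three monomials map pairs (t, u) birationally to a plane: where the first coordinate [y0] is
    nonzero, (y0, y1, y2) is reached, up to the factor [y0], from t = (y0, y2) and u = (y0, y1). The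
    polynomial [h] is this coordinate on the chart. *)
Lemma mono3_surface (E : 'M[K]_(4, 6)) (al be ga : K) (M : 'M[K]_3)
  (F0 F1 : 'rV[K]_2 -> 'rV[K]_2 -> 'rV[K]_4) :
  right_inv E -> (al != 0) || (be != 0) || (ga != 0) -> M \in unitmx ->
  (forall t u a b c, mono3 t u *m M = row3 a b c ->
     plucker (F0 t u) (F1 t u) = row4 (a ^+ 2) (a * b) (a * c) (qf al be ga b c) *m E) ->
  forall p, pencil_lines F0 F1 p <-> quadric_surface E al be ga p.
Proof.
move=> Einv q0 Mu hF.
pose m i := invmx M i ord0.
have mE z w : (row3 1 z w *m invmx M) ord0 ord0 = m ord0 + m (inord 1) * z + m (inord 2) * w.
  rewrite mxE !big_ord_recl big_ord0 !mxE /= mul1r addr0 addrA.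
  by congr (_ + _ + _); rewrite mulrC; congr (invmx M _ _ * _); apply: val_inj; rewrite /= inordK.
pose h : {mpoly K[2]} := (m ord0)%:MP + m (inord 1) *: 'X_ord0 + m (inord 2) *: 'X_ord_max.
have hE x : h.@[x] = m ord0 + m (inord 1) * x ord0 + m (inord 2) * x ord_max.
  by rewrite !mevalD mevalC !mevalZ !mevalXU.
apply: (@pencil_surface _ E al be ga Einv q0 _ _ h) => [t u||x hx].
- have [a [b [c e]]] := row3E (mono3 t u *m M).
  exists (a ^+ 2), (a * b), (a * c), (qf al be ga b c); split; first exact: hF.
  by rewrite /qf; ring.
- apply/eqP => /mpoly2_eval0 h0; have := h0 0 0; have := h0 1 0; have := h0 0 1.
  rewrite !hE /= !(mulr0, mulr1, addr0) => e1 e2 e3; rewrite e3 !add0r in e1 e2.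
  have : (M *m invmx M) ord0 ord0 = 0.
    rewrite mxE big1 // => i _; suff -> : invmx M i ord0 = 0 by rewrite mulr0.
    case: i => [[|[|[|]]]] //= hi; [rewrite -[RHS]e3 | rewrite -[RHS]e2 | rewrite -[RHS]e1];
      by congr (invmx M _ _); apply: val_inj; rewrite /= ?inordK.
  by rewrite mulmxV // mxE eqxx => /eqP; rewrite oner_eq0.
have [y0 [y1 [y2 yE]]] := row3E (row3 1 (x ord0) (x ord_max) *m invmx M).
have y0E : y0 = h.@[x] by rewrite hE -mE yE mxE.
have ny : y0 != 0 by rewrite y0E.
exists (row2 y0 y2), (row2 y0 y1), (y0 ^+ 2); rewrite !row2_neq0 // expf_neq0 //; split=> //.
rewrite (hF _ _ y0 (y0 * x ord0) (y0 * x ord_max)); last first.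
  have -> : mono3 (row2 y0 y2) (row2 y0 y1) = y0 *: row3 y0 y1 y2.
    by rewrite row3Z /mono3 !mxE /= (mulrC y2).
  by rewrite -scalemxAl -yE mulmxKV // row3Z mulr1.
rewrite scalemxAl; congr (_ *m _); apply/rowP => i; rewrite !mxE /qf.
by case: i => [[|[|[|[|]]]]] //= _; ring.
Qed.

Lemma spectral_join G (M : 'M[K]_3) (F0 F1 : 'rV[K]_2 -> 'rV[K]_2 -> 'rV[K]_4) :
  G \in unitmx -> M \in unitmx ->
  (forall t u a b c, mono3 t u *m M = row3 a b c ->
     F0 t u = vec G a c 0 0 /\ F1 t u = vec G 0 0 a b) ->
  forall p, pencil_lines F0 F1 p <-> join_surface G p.
Proof.
move=> Gu Mu hF; apply: mono3_surface Mu _.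
- exact: right_inv_compound (join_mx_inv _).
- by rewrite oner_eq0 orbT.
move=> t u a b c /hF[-> ->]; rewrite plucker_vec mulmxA row4_join /qf.
by congr (row6 _ _ _ _ _ _ *m _); ring.
Qed.

Lemma spectral_cone G (M : 'M[K]_3) (F0 F1 : 'rV[K]_2 -> 'rV[K]_2 -> 'rV[K]_4) :
  G \in unitmx -> M \in unitmx ->
  (forall t u a b c, mono3 t u *m M = row3 a b c ->
     F0 t u = vec G a c 0 0 /\ F1 t u = vec G 0 b a c) ->
  forall p, pencil_lines F0 F1 p <-> cone_surface G p.
Proof.
move=> Gu Mu hF; apply: mono3_surface Mu _.
- exact: right_inv_compound (cone_mx_inv _).
- by rewrite oner_eq0 orbT.
move=> t u a b c /hF[-> ->]; rewrite plucker_vec mulmxA row4_cone /qf.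
by congr (row6 _ _ _ _ _ _ *m _); ring.
Qed.

Lemma quad_mpoly_neq0 (q0 q1 q2 : K) (i : 'I_2) : ~~ [&& q0 == 0, q1 == 0 & q2 == 0] ->
  q0%:MP + q1 *: 'X_i + q2 *: ('X_i * 'X_i) != 0 :> {mpoly K[2]}.
Proof.
apply: contraNneq => h.
have e x : q0 + q1 * x + q2 * (x * x) = 0.
  by rewrite -[RHS](@meval0 2 K (fun=> x)) -h !mevalD mevalC !mevalZ mevalM mevalXU.
have q00 : q0 = 0 by have := e 0; rewrite !mulr0 !addr0.
have := e 1; have := e (-1); rewrite q00 !(mulr1, add0r) mulrNN mulrN !mulr1 => e1 e2.
have : q2 *+ 2 = 0 by rewrite -[RHS]addr0 -{1}e1 -e2; ring.
move/eqP; rewrite mulrn_eq0 /= => /eqP q20; move: e2; rewrite q20 addr0 => ->.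
by rewrite !eqxx.
Qed.

Section PencilOfPlanes.
Variables (G : 'M[K]_4) (a0 b0 c0 d0 a1 b1 c1 d1 k0 k1 : K).
Variables F0 F1 : 'rV[K]_2 -> 'rV[K]_2 -> 'rV[K]_4.
Hypothesis Gu : G \in unitmx.

(** Each line joins the point [s] of [line23] to the point s (u0 N0 + u1 N1) of [line01], for two
    2x2 matrices N0, N1. All pairs of points are swept out unless s N0 and s N1 are always
    proportional; the three numbers of the hypothesis are the coefficients of their wedge as a
    quadratic form in [s]. *)
Lemma transversal_join :
  (forall s u, F0 s u = vec G (fst2 u * (fst2 s * a0 + snd2 s * c0) + snd2 u * (fst2 s * a1 + snd2 s * c1))
     (fst2 u * (fst2 s * b0 + snd2 s * d0) + snd2 u * (fst2 s * b1 + snd2 s * d1))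
     ((fst2 u * k0 + snd2 u * k1) * fst2 s) ((fst2 u * k0 + snd2 u * k1) * snd2 s)) ->
  (forall s u, F1 s u = fst2 u *: vec G 0 0 (fst2 s) (snd2 s)) ->
  ~~ [&& a0 * b1 - b0 * a1 == 0, a0 * d1 + c0 * b1 - b0 * c1 - d0 * a1 == 0
     & c0 * d1 - d0 * c1 == 0] ->
  forall p, pencil_lines F0 F1 p <-> join_surface G p.
Proof.
move=> hF0 hF1 nz.
have pl s u : plucker (F0 s u) (F1 s u) = row4
   (fst2 u * ((fst2 u * (fst2 s * a0 + snd2 s * c0) + snd2 u * (fst2 s * a1 + snd2 s * c1)) * fst2 s))
   (fst2 u * ((fst2 u * (fst2 s * a0 + snd2 s * c0) + snd2 u * (fst2 s * a1 + snd2 s * c1)) * snd2 s))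
   (fst2 u * ((fst2 u * (fst2 s * b0 + snd2 s * d0) + snd2 u * (fst2 s * b1 + snd2 s * d1)) * fst2 s))
   (fst2 u * ((fst2 u * (fst2 s * b0 + snd2 s * d0) + snd2 u * (fst2 s * b1 + snd2 s * d1)) * snd2 s))
   *m (join_mx K *m compound G).
  have -> : F1 s u = vec G 0 0 (fst2 u * fst2 s) (fst2 u * snd2 s).
    rewrite hF1 /vec scalemxAl; congr (_ *m _); apply/rowP => i; rewrite !mxE.
    by case: i => [[|[|[|[|]]]]] //= _; rewrite mulr0.
  rewrite hF0 plucker_vec mulmxA row4_join; congr (row6 _ _ _ _ _ _ *m _); ring.
pose h1 : {mpoly K[2]} := (a0 * b1 - b0 * a1)%:MP + (a0 * d1 + c0 * b1 - b0 * c1 - d0 * a1) *: 'X_ord0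
   + (c0 * d1 - d0 * c1) *: ('X_ord0 * 'X_ord0).
pose h2 : {mpoly K[2]} := (b1%:MP + d1 *: 'X_ord0) - 'X_ord_max * (a1%:MP + c1 *: 'X_ord0).
have h10 : h1 != 0 by exact: quad_mpoly_neq0.
have h2E x : h2.@[x] = (b1 + d1 * x ord0) - x ord_max * (a1 + c1 * x ord0).
  by rewrite mevalB mevalM !mevalD !mevalC !mevalZ !mevalXU.
have h20 : h2 != 0.
  apply: contraNneq nz => /mpoly2_eval0 h0.
  have := h0 0 0; have := h0 1 0; have := h0 0 1; have := h0 1 1.
  rewrite !h2E /= !(mulr0, mulr1, mul0r, mul1r, addr0, subr0) => + + + b10; rewrite b10 !(add0r, sub0r).
  move=> + /eqP; rewrite oppr_eq0 => + /eqP a10; rewrite a10 add0r => + d10; rewrite d10 sub0r.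
  by move/eqP; rewrite oppr_eq0 => /eqP ->; rewrite !(mulr0, subr0, addr0) eqxx.
apply: (@pencil_surface _ (join_mx K *m compound G) 0 1 0 _ _ _ _ (h1 * h2)).
- exact: right_inv_compound (join_mx_inv _).
- by rewrite oner_eq0 orbT.
- by move=> s u; do 4 eexists; split; [exact: pl | rewrite /qf; ring].
- by rewrite mulf_neq0.
move=> x; rewrite mevalM mulf_eq0 negb_or => /andP[].
have h1E : h1.@[x] = (a0 * b1 - b0 * a1) + (a0 * d1 + c0 * b1 - b0 * c1 - d0 * a1) * x ord0
   + (c0 * d1 - d0 * c1) * (x ord0 * x ord0).
  by rewrite !mevalD mevalC !mevalZ mevalM !mevalXU.
move=> x1 x2; rewrite h2E in x2.
(* The coordinate [x ord0] gives [s], and [u] solves the linear equation that puts the point of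
   [line01] in the ratio [x ord_max]. *)
exists (row2 1 (x ord0)), (row2 (h2.@[x]) (- ((b0 + d0 * x ord0) - x ord_max * (a0 + c0 * x ord0)))), (h2.@[x] * h1.@[x]).
rewrite !row2_neq0 ?oner_eq0 ?mulf_neq0 // ?h2E //; split=> //.
rewrite pl !mxE /= scalemxAl; congr (_ *m _); apply/rowP => i; rewrite !mxE h1E /qf.
by case: i => [[|[|[|[|]]]]] //= _; ring.
Qed.

(** Now each line passes through the point [s] of [line01] and is tangent there. The parameter [u]
    sweeps out the tangents at [s] unless k0 u0 + k1 u1 and the wedge of s with s (u0 N0 + u1 N1)
    are proportional as linear forms in [u]; the hypothesis excludes this for general [s]. *)
Lemma transversal_cone :
  (forall s u, F0 s u = vec G (fst2 u * (fst2 s * a0 + snd2 s * c0) + snd2 u * (fst2 s * a1 + snd2 s * c1))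
     (fst2 u * (fst2 s * b0 + snd2 s * d0) + snd2 u * (fst2 s * b1 + snd2 s * d1))
     ((fst2 u * k0 + snd2 u * k1) * fst2 s) ((fst2 u * k0 + snd2 u * k1) * snd2 s)) ->
  (forall s u, F1 s u = fst2 u *: vec G (fst2 s) (snd2 s) 0 0) ->
  ~~ [&& k0 * b1 - k1 * b0 == 0, k0 * (d1 - a1) - k1 * (d0 - a0) == 0
     & k0 * c1 - k1 * c0 == 0] ->
  forall p, pencil_lines F0 F1 p <-> cone_surface G p.
Proof.
move=> hF0 hF1 nz.
have pl s u : plucker (F0 s u) (F1 s u) = row4
   (- fst2 u * ((fst2 u * k0 + snd2 u * k1) * fst2 s ^+ 2))
   (- fst2 u * (fst2 s * (fst2 u * (fst2 s * b0 + snd2 s * d0) + snd2 u * (fst2 s * b1 + snd2 s * d1))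
       - snd2 s * (fst2 u * (fst2 s * a0 + snd2 s * c0) + snd2 u * (fst2 s * a1 + snd2 s * c1))))
   (- fst2 u * ((fst2 u * k0 + snd2 u * k1) * (fst2 s * snd2 s)))
   (- fst2 u * ((fst2 u * k0 + snd2 u * k1) * snd2 s ^+ 2))
   *m (cone_mx K *m compound G).
  have -> : F1 s u = vec G (fst2 u * fst2 s) (fst2 u * snd2 s) 0 0.
    rewrite hF1 /vec scalemxAl; congr (_ *m _); apply/rowP => i; rewrite !mxE.
    by case: i => [[|[|[|[|]]]]] //= _; rewrite mulr0.
  rewrite hF0 plucker_vec mulmxA row4_cone; congr (row6 _ _ _ _ _ _ *m _); ring.
pose h1 : {mpoly K[2]} := (k0 * b1 - k1 * b0)%:MP + (k0 * (d1 - a1) - k1 * (d0 - a0)) *: 'X_ord_max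
   + (- (k0 * c1 - k1 * c0)) *: ('X_ord_max * 'X_ord_max).
pose h2 : {mpoly K[2]} := b1%:MP + (d1 - a1) *: 'X_ord_max - c1 *: ('X_ord_max * 'X_ord_max) - k1 *: 'X_ord0.
have h10 : h1 != 0 by apply: quad_mpoly_neq0; rewrite oppr_eq0.
have h2E x : h2.@[x] = b1 + (d1 - a1) * x ord_max - c1 * (x ord_max * x ord_max) - k1 * x ord0.
  by rewrite !mevalB !mevalD !mevalC !mevalZ !mevalM !mevalXU.
have h20 : h2 != 0.
  apply: contraNneq nz => /mpoly2_eval0 h0.
  have := h0 0 0; have := h0 1 0; have := h0 0 1; have := h0 0 (-1).
  rewrite !h2E /= !(mulr0, mulr1, mul0r, mul1r, addr0, subr0) => + + + b10; rewrite b10 !(add0r, sub0r).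
  move=> + + /eqP; rewrite oppr_eq0 => + + /eqP k10; rewrite mulrNN mulrN !mulr1 => e1 e2.
  have : c1 *+ 2 = 0.
    by rewrite -[RHS]oppr0 -[X in - X]addr0 -{1}e1 -e2; ring.
  move/eqP; rewrite mulrn_eq0 /= => /eqP c10; move: e2; rewrite c10 subr0 => ->.
  by rewrite k10 !(mulr0, mul0r, subr0) eqxx.
apply: (@pencil_surface _ (cone_mx K *m compound G) 0 0 1 _ _ _ _ (h1 * h2)).
- exact: right_inv_compound (cone_mx_inv _).
- by rewrite oner_eq0 orbT.
- by move=> s u; do 4 eexists; split; [exact: pl | rewrite /qf; ring].
- by rewrite mulf_neq0.
move=> x; rewrite mevalM mulf_eq0 negb_or => /andP[].
have h1E : h1.@[x] = (k0 * b1 - k1 * b0) + (k0 * (d1 - a1) - k1 * (d0 - a0)) * x ord_max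
   + (- (k0 * c1 - k1 * c0)) * (x ord_max * x ord_max).
  by rewrite !mevalD mevalC !mevalZ mevalM !mevalXU.
move=> x1 x2; rewrite h2E in x2.
exists (row2 1 (x ord_max)), (row2 (h2.@[x]) (- (b0 + (d0 - a0) * x ord_max - c0 * (x ord_max * x ord_max) - k0 * x ord0))), (- (h2.@[x] * h1.@[x])).
rewrite !row2_neq0 ?oppr_eq0 ?oner_eq0 ?mulf_neq0 // ?h2E //; split=> //.
rewrite pl !mxE /= scalemxAl; congr (_ *m _); apply/rowP => i; rewrite !mxE h1E /qf.
by case: i => [[|[|[|[|]]]]] //= _; ring.
Qed.

End PencilOfPlanes.

End ParametricSurfaces.

(** * Consequences of type (1,2,2) *)

Definition bilin_comb (K : numFieldType) (F : 'rV[K]_2 -> 'rV[K]_2 -> 'rV[K]_4) (a b c d : K) :=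
  a *: F (unit_row K ord0) (unit_row K ord0) + b *: F (unit_row K ord0) (unit_row K ord_max)
  + c *: F (unit_row K ord_max) (unit_row K ord0) + d *: F (unit_row K ord_max) (unit_row K ord_max).

Lemma trimap_bilin (K : numFieldType) w (s t u : 'rV[K]_2) :
  trimap w s t u = bilin_comb (trimap w s) (t ord0 ord0 * u ord0 ord0) (t ord0 ord0 * u ord0 ord_max)
     (t ord0 ord_max * u ord0 ord0) (t ord0 ord_max * u ord0 ord_max).
Proof.
rewrite /bilin_comb; apply/rowP => l.
have e (x y : 'rV[K]_4) : (x + y) ord0 l = x ord0 l + y ord0 l by rewrite mxE.
have f c (x : 'rV[K]_4) : (c *: x) ord0 l = c * x ord0 l by rewrite mxE.
by rewrite !e !f !trimap_coord !unit_rowE !eqxx /=; ring.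
Qed.

Lemma row2E (K : fieldType) (v : 'rV[K]_2) a b : v ord0 ord0 = a -> v ord0 ord_max = b ->
  v = \row_i (if i == ord0 then a else b).
Proof.
move=> <- <-; apply/rowP => i; rewrite mxE; case: eqP => [->//|h]; congr (v _ _).
by case: i h => [[|[|]]] //= hi h; [case: h; apply: val_inj | apply: val_inj].
Qed.

Lemma cross_mul_eq0 (A : comNzRingType) (g0 g1 l0 l1 x0 x1 : A) :
  g0 * x1 = g1 * x0 -> l0 * x1 = l1 * x0 -> x0 * (g0 * l1 - g1 * l0) = 0.
Proof.
move=> gx lx; transitivity (g0 * (l1 * x0) - g1 * x0 * l0); first by ring.
by rewrite -lx -gx; ring.
Qed.

Section BirationalFacts.
Variable K : numFieldType.
Variable w : 'rV[K]_tri_dim.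

Local Notation phi := [tuple tri_poly w i | i < 4].

Lemma meval_phi (f : {mpoly K[4]}) (z : 'M[K]_(3, 2)) :
  (f \mPo phi).@[mxvec z ord0] = f.@[(tri_eval w z) ord0].
Proof. by rewrite comp_mpoly_meval; apply: meval_eq => i; rewrite tnth_mktuple mxE. Qed.

Lemma mpoly6_neq0_ex (f : {mpoly K[3 * 2]}) : f != 0 ->
  exists k : 'M[nat]_(3, 2), f.@[mxvec (map_mx (fun n => n%:R) k) ord0] != 0.
Proof.
move=> /mpoly_neq0_ex[k hk]; exists (vec_mx (\row_i k i)); move: hk; congr (_ != 0).
by apply: meval_eq => i; rewrite map_vec_mx vec_mxK !mxE.
Qed.

Variable g : 'I_3 -> 'I_2 -> {mpoly K[4]}.
Variable d : 'I_3 -> nat.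
Hypothesis gi : rational_inverse w g d.

Lemma inverse_rel k z : (g k 0).@[(tri_eval w z) ord0] * z k 1 = (g k 1).@[(tri_eval w z) ord0] * z k 0.
Proof.
have [_ _ /(_ k)[_ e] _] := gi; move/(congr1 (meval (mxvec z ord0))): e.
by rewrite !mevalM !meval_phi /param_var !mevalXU !mxvecE.
Qed.

(** The map composed with its inverse is the identity up to a scalar factor, so generic points are
    in the image. *)
Lemma dominant (h : {mpoly K[4]}) e : h \is e.-homog -> h \mPo phi = 0 -> h = 0.
Proof.
move=> hh h0; have [_ _ _ [[i fi] fe]] := gi.
set psi := [tuple mxvec (\matrix_(k < 3, j < 2) g k j) ord0 l | l < 3 * 2] in fi fe.
have psiE x j : (tri_poly w j \mPo psi).@[x] = tri_eval w (\matrix_(k, l) (g k l).@[x]) ord0 j.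
  rewrite comp_mpoly_meval mxE; apply: meval_eq => l; rewrite tnth_mktuple.
  by case/mxvec_indexP: l => k l; rewrite !mxvecE !mxE.
have fXi : (tri_poly w i \mPo psi) * 'X_i != 0.
  rewrite mulf_neq0 //; first exact/eqP.
  by apply/eqP => /(congr1 (meval (fun=> 1))); rewrite mevalXU meval0 => /eqP; rewrite oner_eq0.
apply: (mpoly_generic_eq0 fXi) => x; rewrite mevalM mevalXU mulf_eq0 negb_or => /andP[kx x0].
set y := tri_eval w (\matrix_(k, l) (g k l).@[x]).
have yE j : y ord0 j = (y ord0 i / x i) * x j.
  have := congr1 (meval x) (fe i j); rewrite !mevalM !mevalXU !psiE -/y => ij.
  by rewrite mulrAC ij mulfK.
have : h.@[y ord0] = 0 by rewrite -meval_phi h0 meval0.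
rewrite (@meval_eq _ _ _ (fun j => (y ord0 i / x i) * x j)) // (homog_scale _ _ hh).
move/eqP; rewrite mulf_eq0 expf_eq0 mulf_eq0 invr_eq0 (negPf x0) orbF.
by rewrite -psiE (negPf kx) andbF => /eqP.
Qed.

(** Each variable changes by a multiple of [L], hence so does every polynomial. When [L] is a linear
    form with value 1 at [e], the substitution is the projection to the hyperplane [L = 0], and the
    identity is division by [L]. *)
Lemma mpoly_subst_linear n (L : {mpoly K[n]}) (e : 'I_n -> K) (f : {mpoly K[n]}) :
  exists q, f = f \mPo [tuple 'X_i - e i *: L | i < n] + q * L.
Proof.
elim/mpolyind: f => [|c m p _ _ [q IHq]]; first by exists 0; rewrite comp_mpoly0 add0r mul0r.
have [q' hq'] : exists q', 'X_[m] = 'X_[m] \mPo [tuple 'X_i - e i *: L | i < n] + q' * L.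
  rewrite comp_mpolyX mpolyXE_id.
  have step (a b a' b' : {mpoly K[n]}) : (exists q, a = a' + q * L) -> (exists q, b = b' + q * L) ->
      exists q, a * b = a' * b' + q * L.
    move=> [q1 ->] [q2 ->]; exists (a' * q2 + q1 * b' + q1 * q2 * L); ring.
  elim/big_rec2: _ => [|i a b _]; first by exists 0; rewrite mul0r addr0.
  apply: (step); rewrite tnth_mktuple.
  elim: (m i) => [|k IHk]; first by exists 0; rewrite !expr0 mul0r addr0.
  rewrite !exprS; apply: (step) IHk; exists (e i)%:MP.
  by rewrite mul_mpolyC subrK.
exists (c *: q' + q); rewrite {1}IHq {1}hq' comp_mpolyD comp_mpolyZ mulrDl scalerDr -scalerAl; ring.
Qed.

Lemma dominant_nat (h : {mpoly K[4]}) e : h \is e.-homog ->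
  (forall k : 'M[nat]_(3, 2), h.@[(tri_eval w (map_mx (fun n => n%:R) k)) ord0] = 0) -> h = 0.
Proof.
move=> hh hz; apply: (dominant hh); apply/eqP; apply: contraT => /mpoly6_neq0_ex[k].
by rewrite meval_phi hz eqxx.
Qed.

Lemma linear_form_eq0 n (c : 'cV[K]_n) : linear_form c = 0 -> c = 0.
Proof.
move=> /mpolyP h; apply/colP => i; rewrite mxE -[RHS](mcoeff0 K U_(i)%MM) -h.
rewrite /linear_form raddf_sum /= (bigD1 i) //= big1 => [|j ji].
  by rewrite mcoeffZ mcoeffX eqxx mulr1 addr0.
rewrite mcoeffZ mcoeffX; case: eqP => [/mnmP/(_ i)|]; rewrite ?mulr0 //.
by rewrite !mnm1E eqxx (negPf ji).
Qed.

Lemma linear_form_subst n (c c0 : 'cV[K]_n) (e : 'I_n -> K) :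
  linear_form c \mPo [tuple 'X_i - e i *: linear_form c0 | i < n]
  = linear_form c - (\sum_i c i ord0 * e i) *: linear_form c0.
Proof.
apply: mpoly_ext => x; rewrite comp_mpoly_meval mevalB mevalZ /linear_form !raddf_sum /= mulr_suml -sumrB.
apply: eq_bigr => i _; rewrite !mevalZ !mevalXU tnth_mktuple mevalB mevalZ mevalXU raddf_sum /=; ring.
Qed.

Lemma mpoly_vec_ext (p q : {mpoly K[3 * 2]}) :
  (forall z : 'M[K]_(3, 2), p.@[mxvec z ord0] = q.@[mxvec z ord0]) -> p = q.
Proof.
move=> h; apply: mpoly_ext => v; have := h (vec_mx (\row_i v i)); rewrite vec_mxK.
have e (f : {mpoly K[3 * 2]}) : f.@[(\row_i v i : 'rV_(3 * 2)) ord0] = f.@[v].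
  by apply: meval_eq => i; rewrite mxE.
by rewrite !e.
Qed.

(** The linear pair would be proportional to the pair [g k]. On the hyperplane where the first
    linear form vanishes the second does not, so the first divides [g k 0]. The quotient divides
    both members of [g k], so it is constant by coprimality, and [g k 0] would have degree 1 instead
    of 2. *)
Lemma no_linear_inverse k (c0 c1 : 'cV[K]_4) : no_common_factor (g k) -> d k = 2 ->
  (forall z, (tri_eval w z *m c0) ord0 ord0 * z k 1 = (tri_eval w z *m c1) ord0 ord0 * z k 0) ->
  c0 = 0 /\ c1 = 0.
Proof.
move=> ncf dk hL; have [gh _ /(_ k)[_ gE] _] := gi.
pose L0 := linear_form c0; pose L1 := linear_form c1.
have LE : (L0 \mPo phi) * param_var K k 1 = (L1 \mPo phi) * param_var K k 0.
  by apply: mpoly_vec_ext => z; rewrite !mevalM !meval_phi /param_var !mevalXU !mxvecE !meval_linear_form.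
have Lz (c : 'cV[K]_4) : linear_form c \mPo phi = 0 -> c = 0.
  by move=> h; apply: linear_form_eq0; apply: dominant h; exact: linear_form_homog.
have X0 j : param_var K k j != 0.
  by apply/eqP => /(congr1 (meval (fun=> 1))); rewrite mevalXU meval0 => /eqP; rewrite oner_eq0.
have c0z : c0 = 0.
  apply/eqP; apply: contraT => /eqP c00.
  have [i ci] : exists i, c0 i ord0 != 0 by apply/cV0Pn/eqP.
  have L0n : L0 != 0 by apply/eqP => /linear_form_eq0.
  have gL : g k 0 * L1 = g k 1 * L0.
    apply/eqP; rewrite -subr_eq0; apply/eqP; apply: (@dominant _ (d k + 1)).
      by rewrite rpredB //; apply: dhomogM; rewrite ?gh ?linear_form_homog.
    apply/eqP; have /mulfI inj := X0 0; rewrite -(inj_eq inj) mulr0; apply/eqP.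
    rewrite rmorphB !rmorphM /=.
    exact: cross_mul_eq0 gE LE.
  (* A point at which [L0] takes the value 1, so that the substitution kills [L0]. *)
  pose e j := if j == i then (c0 i ord0)^-1 else 0.
  have eE : \sum_j c0 j ord0 * e j = 1.
    rewrite (bigD1 i) //= /e eqxx mulfV // big1 ?addr0 // => j /negPf ->; exact: mulr0.
  have L0s : L0 \mPo [tuple 'X_i - e i *: L0 | i < 4] = 0.
    by rewrite linear_form_subst eE scale1r subrr.
  have L1s := linear_form_subst c1 c0 e.
  set m := (\sum_j _) in L1s.
  (* If [L1] were a multiple of [L0], the parameter would have a constant ratio. *)
  have L1n : L1 - m *: L0 != 0.
    apply/eqP => /eqP; rewrite subr_eq0 => /eqP L1E; apply: c00; apply: Lz.
    move: LE; rewrite L1E -mul_mpolyC rmorphM /= comp_mpolyC => /eqP; rewrite -subr_eq0.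
    rewrite -/L0 [X in X - _]mulrC [X in _ - X](_ : _ = (m%:MP * param_var K k 0) * (L0 \mPo phi)); last by ring.
    rewrite -mulrBl mulf_eq0 => /orP[/eqP|/eqP //].
    move=> /(congr1 (meval (mxvec (\matrix_(a, b) (if b == 1 then 1 else 0)) ord0))).
    rewrite mevalB mevalM mevalC /param_var !mevalXU !mxvecE !mxE /= mulr0 subr0 meval0 => /eqP.
    by rewrite oner_eq0.
  have [q qE] := mpoly_subst_linear L0 e (g k 0).
  have g0s : g k 0 \mPo [tuple 'X_i - e i *: L0 | i < 4] = 0.
    move/(congr1 (comp_mpoly [tuple 'X_i - e i *: L0 | i < 4])): gL.
    rewrite !rmorphM /= L0s mulr0 L1s => /eqP; rewrite mulf_eq0 (negPf L1n) orbF => /eqP //.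
  rewrite g0s add0r in qE.
  have q1E : g k 1 = L1 * q.
    by apply: (mulIf L0n); rewrite -gL qE; ring.
  have qu : q \is a GRing.unit.
    apply: ncf => j; case: j => [[|[|]]] //= hj.
      by exists L0; rewrite mulrC -qE; congr (g k _); apply: val_inj.
    by exists L1; rewrite -q1E; congr (g k _); apply: val_inj.
  have [c cn qc] : exists2 c, c != 0 & q = c%:MP.
    move: qu => /andP[/eqP qc cu]; exists q@_0 => //.
  by apply: contraTneq cu => ->; rewrite unitr0.
  have g01 : g k 0 \is 1.-homog by rewrite qE qc mul_mpolyC rpredZ ?linear_form_homog.
  have g0n : g k 0 != 0 by rewrite qE mulf_neq0 // qc mpolyC_eq0.
  by have := dhomog_uniq g0n g01 (gh k 0); rewrite dk.
split=> //; apply: Lz; apply/eqP; move: LE; rewrite /L0 c0z.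
have -> : linear_form (0 : 'cV[K]_4) = 0 by apply: big1 => i _; rewrite mxE scale0r.
rewrite comp_mpoly0 mul0r => /esym/eqP; by rewrite mulf_eq0 (negPf (X0 0)) orbF.
Qed.

Lemma no_linear_inverse_nat k (c0 c1 : 'cV[K]_4) : no_common_factor (g k) -> d k = 2 ->
  (forall n : 'M[nat]_(3, 2), let z := map_mx (fun n => n%:R) n in
    (tri_eval w z *m c0) ord0 ord0 * z k 1 = (tri_eval w z *m c1) ord0 ord0 * z k 0) ->
  c0 = 0 /\ c1 = 0.
Proof.
move=> ncf dk hn; apply: (no_linear_inverse ncf dk) => z.
have : (linear_form c0 \mPo phi) * param_var K k 1 - (linear_form c1 \mPo phi) * param_var K k 0 = 0.
  apply/eqP; apply: contraT => /mpoly6_neq0_ex[n].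
  rewrite mevalB !mevalM !meval_phi !meval_linear_form /param_var !mevalXU !mxvecE.
  by rewrite hn subrr eqxx.
move=> /(congr1 (meval (mxvec z ord0))).
rewrite mevalB !mevalM !meval_phi !meval_linear_form /param_var !mevalXU !mxvecE meval0.
by move/eqP; rewrite subr_eq0 => /eqP.
Qed.

Lemma trimapZ c (s t u : 'rV[K]_2) : trimap w (c *: s) t u = c *: trimap w s t u.
Proof.
apply/rowP => l; rewrite [RHS]mxE !trimap_coord.
have e (v : 'rV[K]_2) j : (c *: v) ord0 j = c * v ord0 j by rewrite mxE.
by rewrite !e; ring.
Qed.

(** Suppose the matrix of the relation is invertible. Adding a suitable multiple of it to the
    rank-one tensor of (t, u) gives another rank-one tensor, hence a second preimage of the same
    point. The inverse of t makes the two first components proportional, and then t would be in the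
    kernel of the invertible matrix. *)
Lemma kernel_singular : exists2 h : {poly K}, h != 0 & forall x, h.[x] != 0 ->
  forall a b c e, bilin_comb (trimap w (row2 1 x)) a b c e = 0 -> a * e = b * c.
Proof.
have [gh _ /(_ 1)[[j gj] _] _] := gi.
have E (z : 'M[K]_(3, 2)) : (g 1 j \mPo phi).@[mxvec z ord0] = (g 1 j).@[(trimap w (row 0 z) (row 1 z) (row 2 z)) ord0].
  by rewrite meval_phi tri_evalE.
have X00 : param_var K 0 ord0 != 0.
  by apply/eqP => /(congr1 (meval (fun=> 1))); rewrite mevalXU meval0 => /eqP; rewrite oner_eq0.
have [|n] := @mpoly6_neq0_ex ((g 1 j \mPo phi) * param_var K 0 ord0).
  by rewrite mulf_neq0 //; exact/eqP.
set z := map_mx _ n; rewrite mevalM E /param_var mevalXU mxvecE mulf_eq0 negb_or => /andP[gz z0].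
set t := row 1 z in gz; set u := row 2 z in gz.
(* With [t] and [u] frozen and [s = (1, x)] free, a coordinate of the inverse becomes a polynomial
   in [x]; it is the required [h]. *)
pose cp (l : 'I_(3 * 2)) : {poly K} := mxvec (\matrix_(i < 3, k < 2)
  (if (i == 0) then (if k == ord0 then 1 else 'X) else (z i k)%:P)) ord0 l.
have cpE x : (mmap polyC cp (g 1 j \mPo phi)).[x] = (g 1 j).@[(trimap w (row2 1 x) t u) ord0].
  rewrite horner_mmap.
  have := E (mk3 (row2 1 x) t u); rewrite !row_mk3 /= => <-.
  apply: meval_eq => l; rewrite /cp; case/mxvec_indexP: l => i k; rewrite !mxvecE !mxE.
  case: i => [[|[|[|]]]] //= hi; rewrite ?mxE.
  - by case: eqP; rewrite ?hornerC ?hornerX.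
  - by rewrite hornerC; congr ((n _ _)%:R); apply: val_inj.
  - by rewrite hornerC; congr ((n _ _)%:R); apply: val_inj.
exists (mmap polyC cp (g 1 j \mPo phi)).
  apply: contraNneq gz => h0.
  have := cpE (z 0 ord_max / z 0 ord0); rewrite h0 horner0 => e.
  have -> : row 0 z = z 0 ord0 *: row2 1 (z 0 ord_max / z 0 ord0).
    apply/rowP => k; rewrite !mxE; case: eqP => [->|hk]; first by rewrite mulr1.
    rewrite mulrC divfK //; last by rewrite mxE in z0.
    congr ((n _ _)%:R).
    by case: k hk => [[|[|]]] //= hk h'; [case: h'; apply: val_inj | apply: val_inj].
  rewrite trimapZ (@meval_eq _ _ _ (fun i => z 0 ord0 * (trimap w (row2 1 (z 0 ord_max / z 0 ord0)) t u) ord0 i)); last first.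
    by move=> i; rewrite mxE.
  by rewrite (homog_scale _ _ (gh 1 j)) -e mulr0.
move=> x; rewrite cpE => gx a b c e hk; apply/eqP; apply: contraT => dn.
pose cs (l : 'I_(3 * 2)) : {mpoly K[4]} := mxvec (\matrix_(i < 3, k < 2)
  (if i == 0 then (if k == ord0 then 1 else x%:MP) else
   if i == 1 then (if k == ord0 then 'X_(inord 0) else 'X_(inord 1)) else
   (if k == ord0 then 'X_(inord 2) else 'X_(inord 3)))) ord0 l.
pose H := (g 1 j \mPo phi) \mPo [tuple cs l | l < 3 * 2].
have HE v : H.@[v] = (g 1 j).@[(trimap w (row2 1 x) (row2 (v (inord 0)) (v (inord 1)))
   (row2 (v (inord 2)) (v (inord 3)))) ord0].
  have := E (mk3 (row2 1 x) (row2 (v (inord 0)) (v (inord 1))) (row2 (v (inord 2)) (v (inord 3)))).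
  rewrite !row_mk3 /= => <-; rewrite comp_mpoly_meval; apply: meval_eq => l; rewrite tnth_mktuple /cs.
  case/mxvec_indexP: l => i k; rewrite !mxvecE !mxE.
  by case: i => [[|[|[|]]]] //= hi; rewrite !mxE; case: eqP => _; rewrite ?meval1 ?mevalC ?mevalXU.
(* The polarization of the determinant between the tensor of (t, u) and the relation: adding [m]
   times the relation gives the determinant [m * B + m ^ 2 * (a * e - b * c)], whose nonzero root is
   the [m] chosen below. *)
pose B : {mpoly K[4]} := e *: ('X_(inord 0) * 'X_(inord 2)) + a *: ('X_(inord 1) * 'X_(inord 3))
   - b *: ('X_(inord 1) * 'X_(inord 2)) - c *: ('X_(inord 0) * 'X_(inord 3)).
have BE v : B.@[v] = e * (v (inord 0) * v (inord 2)) + a * (v (inord 1) * v (inord 3))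
   - b * (v (inord 1) * v (inord 2)) - c * (v (inord 0) * v (inord 3)).
  by rewrite !mevalB !mevalD !mevalZ !mevalM !mevalXU.
have pick4 (p q r s : K) : exists v : 'I_4 -> K, [/\ v (inord 0) = p, v (inord 1) = q, v (inord 2) = r & v (inord 3) = s].
  by exists (fun i => nth 0 [:: p; q; r; s] i); rewrite !inordK.
have Hn : H != 0.
  apply: contraNneq gx => H0.
  have [v [v0 v1 v2 v3]] := pick4 (t ord0 ord0) (t ord0 ord_max) (u ord0 ord0) (u ord0 ord_max).
  have := HE v; rewrite H0 meval0 v0 v1 v2 v3.
  by rewrite /row2 -!(row2E (erefl _) (erefl _)) => <-.
have Bn : B != 0.
  apply: contraNneq dn => B0.
  have ev p q r s : e * (p * r) + a * (q * s) - b * (q * r) - c * (p * s) = 0.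
    have [v [<- <- <- <-]] := pick4 p q r s; by rewrite -BE B0 meval0.
  have e0 := ev 1 0 1 0; have a0 := ev 0 1 0 1; have b0 := ev 0 1 1 0; have c0 := ev 1 0 0 1.
  move: e0 a0 b0 c0; rewrite !(mulr0, mul0r, mulr1, addr0, add0r, subr0, sub0r).
  by move=> -> -> /eqP; rewrite oppr_eq0 => /eqP -> _; rewrite !mul0r eqxx.
have [n'] := mpoly_neq0_ex (mulf_neq0 Hn Bn).
set v : 'I_4 -> K := fun i => (n' i)%:R; rewrite mevalM mulf_eq0 negb_or => /andP[].
rewrite HE BE; set t0 := v (inord 0); set t1 := v (inord 1); set u0 := v (inord 2); set u1 := v (inord 3).
set Bv := (X in _ -> X != 0 -> _) => gv Bv0.
have D0 : a * e - b * c != 0 by rewrite subr_eq0.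
pose m := - (Bv / (a * e - b * c)).
have [p0 [p1 [q0 [q1 [m00 m01 m10 m11]]]]] :
  exists p0 p1 q0 q1, [/\ t0 * u0 + m * a = p0 * q0, t0 * u1 + m * b = p0 * q1,
     t1 * u0 + m * c = p1 * q0 & t1 * u1 + m * e = p1 * q1].
  have [|p0 [p1 [q0 [q1 h]]]] := @rank1_decomp K (t0 * u0 + m * a) (t0 * u1 + m * b)
     (t1 * u0 + m * c) (t1 * u1 + m * e); last by exists p0, p1, q0, q1.
  by rewrite /m /Bv; field; exact: D0.
have same : trimap w (row2 1 x) (row2 p0 p1) (row2 q0 q1) = trimap w (row2 1 x) (row2 t0 t1) (row2 u0 u1).
  rewrite !trimap_bilin !mxE /= -m00 -m01 -m10 -m11.
  have -> (F : 'rV[K]_2 -> 'rV[K]_2 -> 'rV[K]_4) a1 a2 a3 a4 b1 b2 b3 b4 :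
      bilin_comb F (a1 + m * b1) (a2 + m * b2) (a3 + m * b3) (a4 + m * b4) =
      bilin_comb F a1 a2 a3 a4 + m *: bilin_comb F b1 b2 b3 b4.
    by apply/rowP => l; rewrite !mxE; ring.
  by rewrite hk scaler0 addr0.
have r1 := inverse_rel 1 (mk3 (row2 1 x) (row2 t0 t1) (row2 u0 u1)).
have r2 := inverse_rel 1 (mk3 (row2 1 x) (row2 p0 p1) (row2 q0 q1)).
rewrite tri_evalE !row_mk3 /= !mxE /= in r1; rewrite tri_evalE !row_mk3 /= same !mxE /= in r2.
set G0 := (g 1 0).@[_] in r1 r2; set G1 := (g 1 1).@[_] in r1 r2.
have par : t0 * p1 - t1 * p0 = 0.
  apply/eqP; apply: contraT => tp.
  have G00 : G0 = 0.
    apply: (mulIf tp); transitivity ((G0 * p1) * t0 - (G0 * t1) * p0); first by ring.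
    by rewrite r1 r2; ring.
  have G10 : G1 = 0.
    apply: (mulIf tp); transitivity ((G1 * t0) * p1 - (G1 * p0) * t1); first by ring.
    by rewrite -r1 -r2; ring.
  case/negP: gv; apply/eqP; case: j {gj E X00 gz cp cpE gx cs H HE Hn} => [[|[|]]] //= hj.
    by rewrite -[RHS]G00 /G0; congr (_.@[_]); congr (g 1 _); apply: val_inj.
  by rewrite -[RHS]G10 /G1; congr (_.@[_]); congr (g 1 _); apply: val_inj.
have m0 : m != 0 by rewrite oppr_eq0 mulf_neq0 // invr_eq0.
have k1 : t0 * c - t1 * a = 0.
  apply: (mulfI m0); transitivity (t0 * (p1 * q0) - t1 * (p0 * q0)).
    by rewrite -m00 -m10; ring.
  by transitivity ((t0 * p1 - t1 * p0) * q0); [ring | rewrite par mul0r mulr0].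
have k2 : t0 * e - t1 * b = 0.
  apply: (mulfI m0); transitivity (t0 * (p1 * q1) - t1 * (p0 * q1)).
    by rewrite -m01 -m11; ring.
  by transitivity ((t0 * p1 - t1 * p0) * q1); [ring | rewrite par mul0r mulr0].
have t00 : t0 = 0.
  apply: (mulfI D0); transitivity (a * (t0 * e - t1 * b) - b * (t0 * c - t1 * a)); first by ring.
  by rewrite k1 k2 !mulr0 subrr.
have t10 : t1 = 0.
  apply: (mulfI D0); transitivity (c * (t0 * e - t1 * b) - e * (t0 * c - t1 * a)); first by ring.
  by rewrite k1 k2 !mulr0 subrr.
by case/negP: Bv0; apply/eqP; rewrite /Bv t00 t10; ring.
Qed.

End BirationalFacts.

(** * Descent to the reals *)

Section RealFacts.
Variables (R : realType) (w : 'rV[R]_tri_dim).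
Local Notation C := R[i].
Local Notation toC := (map_mx (real_complex R)).
Hypothesis bir : real_bir122 w.

Lemma trimap_toC s t u : trimap (to_complex w) (toC s) (toC t) (toC u) = toC (trimap w s t u).
Proof.
apply/rowP => l; rewrite [RHS]mxE !trimap_coord !(rmorphD, rmorphM) /= !mxE.
by rewrite /tri_coef !mxE.
Qed.

Lemma tri_eval_toC z : tri_eval (to_complex w) (toC z) = toC (trimap w (row 0 z) (row 1 z) (row 2 z)).
Proof. by rewrite tri_evalE -!map_row trimap_toC. Qed.

Lemma nat_toC m n (k : 'M[nat]_(m, n)) : map_mx (fun n => n%:R) k = toC (map_mx (fun n => n%:R) k) :> 'M[C]_(m, n).
Proof. by apply/matrixP => i j; rewrite !mxE rmorph_nat. Qed.

Lemma real_span (c : 'cV[R]_4) : (forall s t u, trimap w s t u *m c = 0) -> c = 0.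
Proof.
move=> h; have [_ [g gi]] := bir.
have : toC c = 0.
  apply: linear_form_eq0; apply: (dominant_nat gi (linear_form_homog _)) => k.
  by rewrite meval_linear_form nat_toC tri_eval_toC -map_mxM h map_mx0 mxE.
by move/eqP; rewrite map_mx_eq0 => /eqP.
Qed.

Definition no_linear_param (par : 'rV[R]_2 -> 'rV[R]_2 -> 'rV[R]_2 -> 'rV[R]_2) :=
  forall L : 'M[R]_(4, 2),
  (forall s t u, (trimap w s t u *m L) ord0 ord0 * par s t u ord0 ord_max
      = (trimap w s t u *m L) ord0 ord_max * par s t u ord0 ord0) -> L = 0.

Lemma real_no_linear (k : 'I_3) : k != 0 ->
  no_linear_param (fun s t u => nth 0 [:: s; t; u] k).
Proof.
move=> k0 L hL; have [_ [g gi]] := bir.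
have dk : type122 k = 2 by rewrite /type122 (negPf k0).
have [_ ncf _ _] := gi.
have [|e0 e1] := no_linear_inverse_nat (c0 := toC (col ord0 L)) (c1 := toC (col ord_max L)) gi (ncf k) dk.
  move=> n z; rewrite /z nat_toC tri_eval_toC.
  set z' := map_mx _ n; move: (hL (row 0 z') (row 1 z') (row 2 z')).
  have -> : nth 0 [:: row 0 z'; row 1 z'; row 2 z'] k = row k z'.
    by case: k k0 {dk hL z} => [[|[|[|]]]] //= hk _; congr row; apply: val_inj.
  set F := trimap _ _ _ _.
  have cE j : (toC F *m toC (col j L)) ord0 ord0 = ((F *m L) ord0 j)%:C.
    by rewrite -map_mxM mxE mulmx_col_entry.
  have zE j : toC z' k j = (z' k j)%:C by rewrite mxE.
  rewrite !cE !zE => /(congr1 (real_complex R)).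
  rewrite ![row k z' _ _]mxE (rmorphM (real_complex R)) (rmorphM (real_complex R)) /= => e.
  have -> : (1 : 'I_2) = ord_max by apply: val_inj.
  by have -> : (0 : 'I_2) = ord0 by apply: val_inj.
move: e0 e1 => /eqP; rewrite map_mx_eq0 => /eqP e0 /eqP; rewrite map_mx_eq0 => /eqP e1.
apply/matrixP => i j; rewrite [RHS]mxE.
have [->|hj] := eqVneq j ord0; first by move/colP: e0 => /(_ i); rewrite !mxE.
have -> : j = ord_max.
  by case: j hj => [[|[|]]] //= h _; apply: val_inj.
by move/colP: e1 => /(_ i); rewrite !mxE.
Qed.

Lemma homog1_linear (p : {mpoly C[4]}) : p \is 1.-homog -> exists c, p = linear_form c.
Proof.
move=> /dhomogP hp; exists (\col_i p@_(U_(i))); apply/mpolyP => m.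
rewrite /linear_form raddf_sum /=.
under eq_bigr do rewrite mcoeffZ mcoeffX mxE.
have [mp|mp] := boolP (m \in msupp p); last first.
  rewrite (memN_msupp_eq0 mp) big1 // => i _; case: eqP => [e|]; last by rewrite mulr0.
  by rewrite e (memN_msupp_eq0 mp) mul0r.
have /eqP := hp m mp; rewrite /= mdeg_eq1 => /existsP[i /eqP ->].
rewrite (bigD1 i) //= eqxx mulr1 big1 ?addr0 // => j ji.
by case: eqP => [/mnmP/(_ i)|]; rewrite ?mulr0 // !mnm1E eqxx (negPf ji).
Qed.

Definition re_mx m n (A : 'M[C]_(m, n)) : 'M[R]_(m, n) := map_mx (@complex.Re R) A.
Definition im_mx m n (A : 'M[C]_(m, n)) : 'M[R]_(m, n) := map_mx (@complex.Im R) A.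

Lemma re_mulmx n (v : 'rV[R]_4) (A : 'M[C]_(4, n)) i j : (v *m re_mx A) i j = complex.Re ((toC v *m A) i j).
Proof.
rewrite !mxE raddf_sum; apply: eq_bigr => l _; rewrite !mxE.
by case: (A l j) => x y /=; rewrite mul0r subr0.
Qed.

Lemma im_mulmx n (v : 'rV[R]_4) (A : 'M[C]_(4, n)) i j : (v *m im_mx A) i j = complex.Im ((toC v *m A) i j).
Proof.
rewrite !mxE raddf_sum; apply: eq_bigr => l _; rewrite !mxE.
by case: (A l j) => x y /=; rewrite mul0r addr0.
Qed.

Lemma real_sigma : exists sg : 'M[R]_(4, 2), sg != 0 /\
  forall s t u, (trimap w s t u *m sg) ord0 ord0 * s ord0 ord_max
      = (trimap w s t u *m sg) ord0 ord_max * s ord0 ord0.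
Proof.
have [_ [g gi]] := bir; have [gh _ gne _] := gi.
have [c0 c0E] := homog1_linear (gh 0 0); have [c1 c1E] := homog1_linear (gh 0 1).
pose B : 'M[C]_(4, 2) := \matrix_(i, j) (if j == ord0 then c0 i ord0 else c1 i ord0).
have B0 (v : 'rV[C]_4) : (v *m B) ord0 ord0 = (v *m c0) ord0 ord0.
  by rewrite !mxE; apply: eq_bigr => i _; rewrite mxE.
have B1 (v : 'rV[C]_4) : (v *m B) ord0 ord_max = (v *m c1) ord0 ord0.
  by rewrite !mxE; apply: eq_bigr => i _; rewrite mxE.
have Bn : B != 0.
  apply/eqP => /matrixP Bz; have [[j hj] _] := gne 0; apply: hj.
  have c00 : c0 = 0 by apply/colP => i; have := Bz i ord0; rewrite !mxE.
  have c10 : c1 = 0 by apply/colP => i; have := Bz i ord_max; rewrite !mxE.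
  have l0 : linear_form (0 : 'cV[C]_4) = 0 by apply: big1 => i _; rewrite mxE scale0r.
  case: j => [[|[|]]] //= hj.
    have -> : Ordinal hj = 0 by apply: val_inj.
    by rewrite c0E c00 l0 comp_mpoly0.
  have -> : Ordinal hj = 1 by apply: val_inj.
  by rewrite c1E c10 l0 comp_mpoly0.
have rel s t u : (toC (trimap w s t u) *m B) ord0 ord0 * (s ord0 ord_max)%:C
   = (toC (trimap w s t u) *m B) ord0 ord_max * (s ord0 ord0)%:C.
  have := inverse_rel gi 0 (toC (mk3 s t u)); rewrite tri_eval_toC !row_mk3 /=.
  rewrite c0E c1E !meval_linear_form B0 B1 !mxE /=.
  by have -> : (1 : 'I_2) = ord_max by apply: val_inj.
have [reB|reB] := eqVneq (re_mx B) 0.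
  exists (im_mx B); split.
    apply: contraNneq Bn => imB; apply/eqP/matrixP => i j; apply/eqP; rewrite eq_complex.
    by move/matrixP: reB => /(_ i j); move/matrixP: imB => /(_ i j); rewrite !mxE => -> ->; rewrite !eqxx.
  move=> s t u; rewrite !im_mulmx; have := congr1 (@complex.Im R) (rel s t u).
  case: ((toC _ *m B) ord0 ord0) => a b; case: ((toC _ *m B) ord0 ord_max) => c d /=.
  by rewrite !mulr0 !add0r.
exists (re_mx B); split=> // s t u; rewrite !re_mulmx; have := congr1 (@complex.Re R) (rel s t u).
case: ((toC _ *m B) ord0 ord0) => a b; case: ((toC _ *m B) ord0 ord_max) => c d /=.
by rewrite !mulr0 !subr0.
Qed.

(** The exceptional values are zeros of a complex polynomial. Largeness of the set [good] is
    expressed by its detecting real polynomials, so that no finite list of exceptions has to be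
    carried along. *)
Lemma real_kernel : exists good : R -> Prop,
  (forall p : {poly R}, (forall x, good x -> p.[x] = 0) -> p = 0) /\
  forall x, good x -> forall a b c e,
    bilin_comb (trimap w (row2 1 x)) a b c e = 0 -> a * e = b * c.
Proof.
have [_ [g gi]] := bir; have [h h0 hk] := kernel_singular gi.
exists (fun x => h.[x%:C] != 0); split=> [p hp|x hx a b c e habce].
  have : map_poly (real_complex R) p * h = 0.
    apply: poly_nat_eq0 => k; rewrite hornerM.
    have [->|hn] := eqVneq h.[k%:R] 0; first by rewrite mulr0.
    have kE : k%:R = (k%:R : R)%:C by rewrite rmorph_nat.
    by rewrite kE horner_map hp ?rmorph0 ?mul0r // -kE.
  by move/eqP; rewrite mulf_eq0 (negPf h0) orbF map_poly_eq0 => /eqP.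
apply: (fmorph_inj (real_complex R)); rewrite (rmorphM (real_complex R)) (rmorphM (real_complex R)).
apply: (hk _ hx); move/(congr1 toC): habce; rewrite map_mx0 => <-.
have r2 : row2 1 x%:C = toC (row2 1 x).
  by apply/rowP => i; rewrite !mxE; case: eqP => //; rewrite rmorph1.
have uE i : unit_row C i = toC (unit_row R i).
  by apply/rowP => j; rewrite !mxE rmorph_nat.
by rewrite /bilin_comb r2 !uE !trimap_toC !map_mxD !map_mxZ.
Qed.

End RealFacts.

(** * The axis form *)

Section BasePoint.
Variable K : numFieldType.
Implicit Types (F : 'rV[K]_2 -> 'rV[K]_2 -> 'rV[K]_2 -> 'rV[K]_4) (sg : 'M[K]_(4, 2)).
Local Notation e0 := (unit_row K ord0).
Local Notation e1 := (unit_row K ord_max).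

Definition wedge (x y : 'rV[K]_2) := x ord0 ord0 * y ord0 ord_max - x ord0 ord_max * y ord0 ord0.

Definition trilinear F :=
  [/\ forall a b x y t u, F (a *: x + b *: y) t u = a *: F x t u + b *: F y t u,
      forall a b x y s u, F s (a *: x + b *: y) u = a *: F s x u + b *: F s y u
    & forall a b x y s t, F s t (a *: x + b *: y) = a *: F s t x + b *: F s t y].

(* sg is the linear inverse of s of a birational map F of type (1,2,2); the coprime quadratic inverses of
   t and u exclude linear ones. *)
Record bir_data F sg : Prop := BirData {
  b_tri : trilinear F;
  b_span : forall c : 'cV[K]_4, (forall s t u, F s t u *m c = 0) -> c = 0;
  b_sg0 : sg != 0;
  b_sg : forall s t u, wedge (F s t u *m sg) s = 0;
  b_kern : exists good : K -> Prop,
    (forall p : {poly K}, (forall x, good x -> p.[x] = 0) -> p = 0) /\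
    forall x, good x -> forall a b c e, bilin_comb (F (row2 1 x)) a b c e = 0 -> a * e = b * c;
  b_nlt : forall L : 'M[K]_(4, 2), (forall s t u, wedge (F s t u *m L) t = 0) -> L = 0;
  b_nlu : forall L : 'M[K]_(4, 2), (forall s t u, wedge (F s t u *m L) u = 0) -> L = 0
}.

Lemma row2_decomp (v : 'rV[K]_2) : v = v ord0 ord0 *: e0 + v ord0 ord_max *: e1.
Proof.
apply/rowP => i; rewrite !mxE eqxx /=; case: i => [[|[|]]] //= h.
  by rewrite mulr1 mulr0 addr0; congr (v _ _); apply: val_inj.
by rewrite mulr1 mulr0 add0r; congr (v _ _); apply: val_inj.
Qed.

Lemma e0E : (e0 ord0 ord0 = 1) * (e0 ord0 ord_max = 0).
Proof. by rewrite !mxE. Qed.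
Lemma e1E : (e1 ord0 ord0 = 0) * (e1 ord0 ord_max = 1).
Proof. by rewrite !mxE. Qed.

Lemma row2_eq (x y : 'rV[K]_2) : x ord0 ord0 = y ord0 ord0 ->
  x ord0 ord_max = y ord0 ord_max -> x = y.
Proof. by move=> h1 h2; rewrite [x]row2_decomp [y]row2_decomp h1 h2. Qed.

Lemma tri_bilin F s t u : trilinear F ->
  F s t u = bilin_comb (F s) (t ord0 ord0 * u ord0 ord0) (t ord0 ord0 * u ord0 ord_max)
     (t ord0 ord_max * u ord0 ord0) (t ord0 ord_max * u ord0 ord_max).
Proof.
move=> [_ f1 f2]; rewrite {1}[t]row2_decomp {1}[u]row2_decomp f1 !f2 /bilin_comb.
by rewrite !scalerDr !scalerA !addrA.
Qed.

Lemma bilin_combM F s a b c d n (M : 'M[K]_(4, n)) : bilin_comb (F s) a b c d *m M =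
  a *: (F s e0 e0 *m M) + b *: (F s e0 e1 *m M) + c *: (F s e1 e0 *m M) + d *: (F s e1 e1 *m M).
Proof. by rewrite !mulmxDl -!scalemxAl. Qed.

Lemma bir_data_swap F sg : bir_data F sg -> bir_data (fun s t u => F s u t) sg.
Proof.
case=> [[f0 f1 f2] sp s0 sE [good [gi gk]] nt nu]; apply: BirData => //.
- by move=> c h; apply: sp => s t u; exact: (h s u t).
- exists good; split=> // x gx a b c e h; rewrite [b * c]mulrC; apply: (gk x gx).
  by rewrite -[RHS]h /bilin_comb; congr (_ + _); rewrite -!addrA; congr (_ + _); rewrite addrC.
- by move=> L h; apply: nu => s t u; exact: (h s u t).
- by move=> L h; apply: nt => s t u; exact: (h s u t).
Qed.

Lemma mul2E (x : 'rV[K]_2) n (M : 'M[K]_(2, n)) j :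
  (x *m M) ord0 j = x ord0 ord0 * M ord0 j + x ord0 ord_max * M ord_max j.
Proof.
rewrite mxE !big_ord_recl big_ord0 addr0.
by congr (_ + x _ _ * M _ _); apply: val_inj.
Qed.

Lemma det2E (M : 'M[K]_2) : \det M = M ord0 ord0 * M ord_max ord_max - M ord0 ord_max * M ord_max ord0.
Proof.
rewrite (expand_det_row _ ord0) !big_ord_recl big_ord0 /cofactor !det_mx11 !mxE /= addr0 expr0 expr1.
rewrite mul1r mulN1r mulrN; by congr (_ * M _ _ - M _ _ * M _ _); apply: val_inj.
Qed.

Lemma wedgeM (M : 'M[K]_2) (x y : 'rV[K]_2) : wedge (x *m M) (y *m M) = wedge x y * \det M.
Proof. by rewrite /wedge !mul2E det2E; ring. Qed.

Lemma row_lin n (M : 'M[K]_(2, n)) a b (x y : 'rV[K]_2) :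
  (a *: x + b *: y) *m M = a *: (x *m M) + b *: (y *m M).
Proof. by rewrite mulmxDl -!scalemxAl. Qed.

Lemma bir_data_change F sg (T U : 'M[K]_2) : T \in unitmx -> U \in unitmx ->
  bir_data F sg -> bir_data (fun s t u => F s (t *m T) (u *m U)) sg.
Proof.
move=> Tu Uu [[f0 f1 f2] sp s0 sE [good [gi gk]] nt nu].
have Ftri : trilinear F by [].
have dT : \det T != 0 by rewrite -unitfE -unitmxE.
have dU : \det U != 0 by rewrite -unitfE -unitmxE.
apply: BirData => //.
- by split=> a b x y s t; rewrite ?row_lin ?f0 ?f1 ?f2.
- move=> c h; apply: sp => s t u; have := h s (t *m invmx T) (u *m invmx U).
  by rewrite !mulmxKV.
- exists good; split=> // x gx a b c e h.
  pose q i j := a * (T ord0 i * U ord0 j) + b * (T ord0 i * U ord_max j)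
     + c * (T ord_max i * U ord0 j) + e * (T ord_max i * U ord_max j).
  have : q ord0 ord0 * q ord_max ord_max = q ord0 ord_max * q ord_max ord0.
    apply: (gk x gx); rewrite -[RHS]h /q /bilin_comb !(tri_bilin _ (_ *m _) _ Ftri) /bilin_comb.
    rewrite !mul2E !unit_rowE !eqxx /=; apply/rowP => l; rewrite !mxE; ring.
  move=> /eqP; rewrite -subr_eq0 => /eqP qq; apply/eqP; rewrite -subr_eq0.
  have : (a * e - b * c) * (\det T * \det U) = 0 by rewrite -qq /q !det2E; ring.
  by move/eqP; rewrite !mulf_eq0 (negPf dT) (negPf dU) !orbF.
- move=> L h; rewrite -[L](mulmxK Tu); suff -> : L *m T = 0 by rewrite mul0mx.
  apply: nt => s t u; have := h s (t *m invmx T) (u *m invmx U); rewrite !mulmxKV // => e.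
  by rewrite mulmxA -{2}[t](mulmxKV Tu) wedgeM e mul0r.
- move=> L h; rewrite -[L](mulmxK Uu); suff -> : L *m U = 0 by rewrite mul0mx.
  apply: nu => s t u; have := h s (t *m invmx T) (u *m invmx U); rewrite !mulmxKV // => e.
  by rewrite mulmxA -{2}[u](mulmxKV Uu) wedgeM e mul0r.
Qed.

Section Data.
Variables (F : 'rV[K]_2 -> 'rV[K]_2 -> 'rV[K]_2 -> 'rV[K]_4) (sg : 'M[K]_(4, 2)).
Hypothesis bF : bir_data F sg.

Let Ftri := b_tri bF.

Definition axis_form t u := (F e0 t u *m sg) ord0 ord0.

(** A linear map for which every vector is an eigenvector is a scalar; it is enough to look at [e0],
    [e1] and their sum. *)
Lemma axis_formE s t u : F s t u *m sg = axis_form t u *: s.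
Proof.
have [f0 _ _] := Ftri; have h := b_sg bF.
have h0 := h e0 t u; have h1 := h e1 t u; have h2 := h (1 *: e0 + 1 *: e1) t u.
rewrite f0 mulmxDl -!scalemxAl !scale1r in h2.
rewrite {1}[s]row2_decomp f0 mulmxDl -!scalemxAl /axis_form.
move: h0 h1 h2; rewrite /wedge ![(_ + _ : 'rV_2) _ _]mxE !e0E !e1E !(mulr0, mulr1, add0r, addr0, subr0, sub0r).
set a := F e0 t u *m sg; set b := F e1 t u *m sg => /eqP.
rewrite oppr_eq0 => /eqP a1 b0; rewrite a1 b0 add0r addr0 => /eqP; rewrite subr_eq0 => /eqP e.
by apply: row2_eq; rewrite row_lin2 [RHS]mxE ?a1 ?b0 -?e; ring.
Qed.

Lemma axis_form_lin1 a b x y u : axis_form (a *: x + b *: y) u = a * axis_form x u + b * axis_form y u.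
Proof. by have [_ f1 _] := Ftri; rewrite /axis_form f1 mulmxDl -!scalemxAl !mxE. Qed.

Lemma axis_form_lin2 a b x y t : axis_form t (a *: x + b *: y) = a * axis_form t x + b * axis_form t y.
Proof. by have [_ _ f2] := Ftri; rewrite /axis_form f2 mulmxDl -!scalemxAl !mxE. Qed.

Lemma axis_form_neq0 : exists t u, axis_form t u != 0.
Proof.
apply: boolp.contrapT => h; case/eqP: (b_sg0 bF); apply/matrixP => i j; rewrite mxE.
have : col j sg = 0.
  apply: (b_span bF) => s t u; apply/matrixP => k l; rewrite !ord1 mulmx_col_entry axis_formE !mxE.
  suff -> : axis_form t u = 0 by rewrite mul0r.
  by apply/eqP; apply: contraT => n; case: h; exists t, u.
by move=> /colP/(_ i); rewrite !mxE.
Qed.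

Lemma sg_inj (y : 'cV[K]_2) : sg *m y = 0 -> y = 0.
Proof.
move=> h; have [t [u A0]] := axis_form_neq0.
have z (s : 'rV[K]_2) : s *m y = 0.
  have := axis_formE s t u => /(congr1 (mulmx^~ y)); rewrite -mulmxA h mulmx0 -scalemxAl => /esym/eqP.
  by rewrite scaler_eq0 (negPf A0) => /eqP.
apply/colP => i; rewrite mxE; have := z (unit_row K i) => /matrixP/(_ ord0 ord0).
by rewrite mxE (bigD1 i) //= big1 => [|j ji]; rewrite !mxE ?eqxx ?mul1r ?addr0 // (negPf ji) mul0r.
Qed.

(* A functional vanishing on all F(s,t*,u), with t* a zero of the axis form, gives
   a linear expression of u at F(s,t,u). *)
Lemma no_vanishing_functional (ts : 'rV[K]_2) (c : 'cV[K]_4) : ts != 0 ->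
  (forall u, axis_form ts u = 0) -> (forall s u, F s ts u *m c = 0) ->
  exists y, c = sg *m y.
Proof.
move=> ts0 Ats Fts; have [f0 f1 f2] := Ftri.
have [th wth] : exists th, wedge th ts = 1.
  have [t1|t1] := eqVneq (ts ord0 ord_max) 0; last first.
    by exists (row2 (ts ord0 ord_max)^-1 0); rewrite /wedge !mxE /= mul0r subr0 mulVf.
  have t0 : ts ord0 ord0 != 0.
    by apply: contraNneq ts0 => t0; apply/eqP/row2_eq; rewrite mxE.
  by exists (row2 0 (- (ts ord0 ord0)^-1)); rewrite /wedge !mxE /= mul0r sub0r mulNr opprK mulVf.
have td t : t = wedge t ts *: th + (- wedge t th) *: ts.
  by apply: row2_eq; rewrite !mxE -[LHS]mulr1 -wth /wedge; ring.
pose ga s u := (F s th u *m c) ord0 ord0.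
have ga1 s a b x y : ga s (a *: x + b *: y) = a * ga s x + b * ga s y.
  by rewrite /ga f2 mulmxDl -!scalemxAl !mxE.
have ga0 u a b x y : ga (a *: x + b *: y) u = a * ga x u + b * ga y u.
  by rewrite /ga f0 mulmxDl -!scalemxAl !mxE.
have Fc s t u : (F s t u *m c) ord0 ord0 = wedge t ts * ga s u.
  by rewrite {1}[t]td f1 mulmxDl -!scalemxAl Fts scaler0 addr0 mxE.
have Fs s t u : F s t u *m sg = (wedge t ts * axis_form th u) *: s.
  by rewrite axis_formE {1}[t]td axis_form_lin1 Ats mulr0 addr0.
(* At [F s t u] the functional [ell u'] is antisymmetric in [u] and [u']. Hence its values at
   [u' = e1] and, with a sign, at [u' = e0] are proportional to the coordinates of [u], and the pair
   [L] would be a linear inverse of [u]. *)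
pose ell u' : 'cV[K]_4 := sg *m (\col_i ga (unit_row K i) u') - axis_form th u' *: c.
have ellE s t u u' : (F s t u *m ell u') ord0 ord0 =
    wedge t ts * (axis_form th u * ga s u' - axis_form th u' * ga s u).
  have E2 (a b : K) (x y : 'M[K]_1) : (a *: x - b *: y) ord0 ord0 = a * x ord0 ord0 - b * y ord0 ord0.
    by rewrite !mxE.
  rewrite mulmxBr mulmxA Fs -scalemxAr -scalemxAl E2 Fc mul2E !mxE.
  have -> : ga s u' = s ord0 ord0 * ga e0 u' + s ord0 ord_max * ga e1 u' by rewrite {1}[s]row2_decomp ga0.
  ring.
pose L : 'M[K]_(4, 2) := \matrix_(i, j) (if j == ord0 then ell e1 i ord0 else - ell e0 i ord0).
have L0 (v : 'rV[K]_4) : (v *m L) ord0 ord0 = (v *m ell e1) ord0 ord0.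
  by rewrite !mxE; apply: eq_bigr => i _; rewrite [L _ _]mxE.
have L1 (v : 'rV[K]_4) : (v *m L) ord0 ord_max = - (v *m ell e0) ord0 ord0.
  by rewrite !mxE -sumrN; apply: eq_bigr => i _; rewrite [L _ _]mxE /= mulrN.
have Lz : L = 0.
  apply: (b_nlu bF) => s t u; rewrite /wedge L0 L1 !ellE.
  have -> : axis_form th u = u ord0 ord0 * axis_form th e0 + u ord0 ord_max * axis_form th e1.
    by rewrite {1}[u]row2_decomp axis_form_lin2.
  have -> : ga s u = u ord0 ord0 * ga s e0 + u ord0 ord_max * ga s e1 by rewrite {1}[u]row2_decomp ga1.
  ring.
have ellz : ell e0 = 0 /\ ell e1 = 0.
  split; apply/colP => i; move/matrixP: Lz.
    by move=> /(_ i ord_max); rewrite !mxE /= => /eqP; rewrite oppr_eq0 => /eqP.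
  by move=> /(_ i ord0); rewrite !mxE.
have [t [u A0]] := axis_form_neq0.
have [u' [bn ez]] : exists u', axis_form th u' != 0 /\ ell u' = 0.
  have [b0|b0] := eqVneq (axis_form th e0) 0; last by exists e0; split=> //; case: ellz.
  have [b1|b1] := eqVneq (axis_form th e1) 0; last by exists e1; split=> //; case: ellz.
  case/eqP: A0; rewrite [t]td axis_form_lin1 Ats mulr0 addr0 [u]row2_decomp axis_form_lin2 b0 b1.
  by rewrite !mulr0 addr0 mulr0.
exists ((axis_form th u')^-1 *: \col_i ga (unit_row K i) u').
move/eqP: ez; rewrite subr_eq0 => /eqP; rewrite -scalemxAr => ->.
by rewrite scalerA mulVf ?scale1r.
Qed.

(** The columns of [sg] are independent and are completed by [kap] to a basis of the linear forms.
    The zeros of [sg] form the axis, on which [kap] gives coordinates. *)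
Lemma axis_coordinates : exists G : 'M[K]_4, exists kap : 'M[K]_(4, 2),
  [/\ G \in unitmx, invmx G = row_mx sg kap :> 'M_(4, 2 + 2) & forall (c y : 'cV[K]_2), kap *m c = sg *m y -> c = 0].
Proof.
have rk : \rank sg = 2.
  rewrite -mxrank_tr; apply/eqP; rewrite -[_ == _]/(row_free sg^T) -kermx_eq0.
  apply/rowV0P => v /sub_kermxP h; apply: trmx_inj; rewrite trmx0; apply: sg_inj.
  by apply: trmx_inj; rewrite trmx_mul trmxK trmx0.
pose Re := row_ebase sg; pose Ce := col_ebase sg.
have Reu : Re \in unitmx := row_ebase_unit sg; have Ceu : Ce \in unitmx := col_ebase_unit sg.
pose G : 'M[K]_4 := block_mx (invmx Re) 0 0 1%:M *m invmx Ce.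
have Gu : G \in unitmx.
  have bu : (block_mx (invmx Re) 0 0 1%:M : 'M[K]_(2 + 2)) \in unitmx.
    by rewrite unitmxE det_ublock det1 mulr1 -unitmxE unitmx_inv.
  by rewrite /G unitmx_mul unitmx_inv Ceu andbT.
have Gsg : G *m sg = col_mx 1%:M 0 :> 'M_(2 + 2, 2).
  have sgE : sg = Ce *m (col_mx 1%:M 0 : 'M_(2 + 2, 2)) *m Re.
    by rewrite -[LHS]mulmx_ebase rk -pid_mx_col.
  have cE : (col_mx 1%:M 0 : 'M_(2 + 2, 2)) *m Re = col_mx Re 0 by rewrite mul_col_mx mul1mx mul0mx.
  have bE : (block_mx (invmx Re) 0 0 1%:M : 'M[K]_(2 + 2)) *m col_mx Re (0 : 'M_2) = col_mx 1%:M 0.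
    by rewrite mul_block_col !mul0mx mulmx0 addr0 add0r mulVmx.
  by rewrite [X in G *m X]sgE /G -!mulmxA (mulmxA (invmx Ce)) mulVmx // mul1mx cE bE.
exists G, (rsubmx (invmx G : 'M_(4, 2 + 2))).
have sgE : sg = lsubmx (invmx G : 'M_(4, 2 + 2)).
  have hE (M : 'M[K]_(4, 2 + 2)) : M *m (col_mx 1%:M 0 : 'M_(2 + 2, 2)) = lsubmx M.
    by rewrite -{1}[M]hsubmxK mul_row_col mulmx1 mulmx0 addr0.
  by rewrite -[LHS](mulKmx Gu) Gsg hE.
split=> //; first by rewrite {1}sgE hsubmxK.
move=> c y h; have : (invmx G : 'M_(4, 2 + 2)) *m col_mx y (- c) = 0.
  have hE (M : 'M[K]_(4, 2 + 2)) : M *m col_mx y (- c) = lsubmx M *m y - rsubmx M *m c.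
    by rewrite -{1}[M]hsubmxK mul_row_col mulmxN.
  by rewrite hE -sgE h subrr.
move/(congr1 (mulmx G)); rewrite mulmxA mulmxV // mul1mx mulmx0.
move/(congr1 (@dsubmx K 2 2 1)); rewrite col_mxKd linear0 => /eqP.
by rewrite oppr_eq0 => /eqP.
Qed.

End Data.

End BasePoint.

(** * The base point *)

Section BasePointExistence.
Variable K : numFieldType.
Implicit Types (F : 'rV[K]_2 -> 'rV[K]_2 -> 'rV[K]_2 -> 'rV[K]_4) (sg : 'M[K]_(4, 2)).
Local Notation e0 := (unit_row K ord0).
Local Notation e1 := (unit_row K ord_max).

Lemma wedge_eq0 (x y : 'rV[K]_2) : y != 0 -> wedge x y = 0 -> exists k, x = k *: y.
Proof.
move=> y0 w; have [y1|y1] := eqVneq (y ord0 ord_max) 0; last first.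
  exists (x ord0 ord_max / y ord0 ord_max); apply: row2_eq; rewrite mxE; last by rewrite divfK.
  apply: (mulIf y1); transitivity (wedge x y + x ord0 ord_max * y ord0 ord0); first by rewrite /wedge; ring.
  by rewrite w add0r; field; exact: y1.
have yz : y ord0 ord0 != 0 by apply: contraNneq y0 => yz; apply/eqP/row2_eq; rewrite mxE.
exists (x ord0 ord0 / y ord0 ord0); apply: row2_eq; rewrite mxE; first by rewrite divfK.
apply: (mulIf yz); transitivity (x ord0 ord0 * y ord0 ord_max - wedge x y); first by rewrite /wedge; ring.
by rewrite w subr0; field; exact: yz.
Qed.

Lemma singular_left (M : 'M[K]_2) : \det M = 0 -> exists2 u : 'rV[K]_2, u != 0 & u *m M = 0.
Proof. by move=> /eqP/det0P[u u0 uM]; exists u. Qed.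

Lemma singular_right (M : 'M[K]_2) : \det M = 0 -> exists2 c : 'cV[K]_2, c != 0 & M *m c = 0.
Proof.
rewrite -det_tr => /singular_left[u u0 uM]; exists u^T; last first.
  by apply: trmx_inj; rewrite trmx_mul trmxK uM trmx0.
by apply: contraNneq u0 => h; rewrite -[u]trmxK h trmx0.
Qed.

(** Let [u] span the left kernel of [M0]. If [q = u M1] is nonzero, the mixed terms of the
    determinant make all rows of both matrices proportional to [q], and the column orthogonal to [q]
    is a common right kernel. *)
Lemma singular_pencil (M0 M1 : 'M[K]_2) : (forall z w, \det (z *: M0 + w *: M1) = 0) ->
  (exists u : 'rV[K]_2, [/\ u != 0, u *m M0 = 0 & u *m M1 = 0]) \/
  (exists c : 'cV[K]_2, [/\ c != 0, M0 *m c = 0 & M1 *m c = 0]).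
Proof.
move=> h.
have d0 : \det M0 = 0 by have := h 1 0; rewrite scale1r scale0r addr0.
have d1 : \det M1 = 0 by have := h 0 1; rewrite scale1r scale0r add0r.
have [->|M0n] := eqVneq M0 0.
  have [u u0 uM] := singular_left d1; by left; exists u; rewrite mulmx0.
have [u u0 uM0] := singular_left d0.
have [uM1|qn] := eqVneq (u *m M1) 0; first by left; exists u.
right; have [q qE] : exists q, q = u *m M1 by exists (u *m M1).
rewrite -qE in qn.
pose c : 'cV[K]_2 := \col_i (if i == ord0 then q ord0 ord_max else - q ord0 ord0).
have mc (x : 'rV[K]_2) : x *m c = (wedge x q)%:M.
  by apply/matrixP => i j; rewrite !ord1 mul2E !mxE /wedge /= ?mulr1n; ring.
have cn : c != 0.
  apply: contraNneq qn => c0; apply/eqP/row2_eq; rewrite [RHS]mxE.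
    have := congr1 (fun m : 'cV[K]_2 => m ord_max ord0) c0; rewrite !mxE /= => /eqP.
    by rewrite oppr_eq0 => /eqP.
  by have := congr1 (fun m : 'cV[K]_2 => m ord0 ord0) c0; rewrite !mxE.
have [v uv] : exists v : 'rV[K]_2, wedge u v != 0.
  have [a|a] := eqVneq (u ord0 ord0) 0; last by exists e1; rewrite /wedge !e1E mulr1 mulr0 subr0.
  exists e0; rewrite /wedge !e0E mulr1 mulr0 sub0r oppr_eq0.
  by apply: contraNneq u0 => b; apply/eqP/row2_eq; rewrite mxE.
have wv z w : w * wedge q (z *: (v *m M0) + w *: (v *m M1)) = 0.
  have N (M : 'M[K]_2) : \det M = 0 -> wedge (u *m M) (v *m M) = 0 by rewrite wedgeM => ->; rewrite mulr0.
  have := N _ (h z w); rewrite !mulmxDr -!scalemxAr uM0 scaler0 add0r -qE => <-.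
  by rewrite /wedge !mxE; ring.
have v1 : wedge q (v *m M1) = 0 by have := wv 0 1; rewrite mul1r scale0r add0r scale1r.
have v0 : wedge q (v *m M0) = 0.
  have := wv 1 1; rewrite mul1r !scale1r => e; rewrite -[RHS]e -[LHS]addr0 -v1.
  by rewrite /wedge !mxE; ring.
have wdC x y : wedge x y = - wedge y x :> K by rewrite /wedge; ring.
have kill (M : 'M[K]_2) : wedge (u *m M) q = 0 -> wedge (v *m M) q = 0 -> M *m c = 0.
  move=> hu hv; apply/row_matrixP => i; rewrite row_mul row0.
  have [a [b ->]] : exists a b, row i M = a *: (u *m M) + b *: (v *m M).
    exists (wedge (unit_row K i) v / wedge u v), (wedge u (unit_row K i) / wedge u v).
    rewrite !scalemxAl -mulmxDl rowE; congr (_ *m _).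
    apply: (scalerI uv); rewrite scalerDr !scalerA !(mulrC (wedge u v)) !divfK //.
    by rewrite -/(unit_row K i); apply: row2_eq; rewrite !mxE /wedge !mxE; ring.
  by rewrite mulmxDl -!scalemxAl !mc hu hv raddf0 !scaler0 addr0.
exists c; split=> //; apply: kill.
- by rewrite uM0 /wedge !mxE; ring.
- by rewrite wdC v0 oppr0.
- by rewrite -qE /wedge; ring.
- by rewrite wdC v1 oppr0.
Qed.

Section WithData.
Variables (F : 'rV[K]_2 -> 'rV[K]_2 -> 'rV[K]_2 -> 'rV[K]_4) (sg : 'M[K]_(4, 2)).
Hypothesis bF : bir_data F sg.

(** At a zero [ts] of the axis form the values [F s ts u] are on the axis and are given by a pencil
    of 2x2 matrices in [s]. A common left kernel is a base point; a common right kernel is a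
    functional excluded by [no_vanishing_functional]. *)
Lemma base_of_singular (ts : 'rV[K]_2) (kap : 'M[K]_(4, 2)) :
  (forall x : 'rV[K]_4, x *m sg = 0 -> x *m kap = 0 -> x = 0) ->
  (forall c y : 'cV[K]_2, kap *m c = sg *m y -> c = 0) ->
  ts != 0 -> (forall u, axis_form F sg ts u = 0) ->
  (forall z w, \det (z *: (\matrix_(k, l) (F e0 ts (unit_row K k) *m kap) ord0 l) +
       w *: (\matrix_(k, l) (F e1 ts (unit_row K k) *m kap) ord0 l)) = 0) ->
  exists2 u, u != 0 & forall s, F s ts u = 0.
Proof.
move=> inj kc ts0 Ats; have [f0 f1 f2] := b_tri bF.
set M := fun s => \matrix_(k, l) (F s ts (unit_row K k) *m kap) ord0 l.
rewrite -/(M e0) -/(M e1) => hM.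
have uM s u : u *m M s = F s ts u *m kap.
  rewrite {2}[u]row2_decomp f2 mulmxDl -!scalemxAl; apply/rowP => l.
  by rewrite mul2E row_lin2 !mxE.
have sM s : M s = s ord0 ord0 *: M e0 + s ord0 ord_max *: M e1.
  have ME s' k l : M s' k l = (F s' ts (unit_row K k) *m kap) ord0 l by rewrite mxE.
  apply/matrixP => k l; rewrite [RHS]mxE [X in _ = X + _]mxE [X in _ = _ + X]mxE !ME.
  by rewrite {1}[s]row2_decomp f0 mulmxDl -!scalemxAl row_lin2.
case: (singular_pencil hM) => [[u [u0 u1 u2]]|[c [c0 c1 c2]]].
  exists u => // s; apply: inj; last by rewrite -uM sM mulmxDr -!scalemxAr u1 u2 !scaler0 addr0.
  by rewrite (axis_formE bF) Ats scale0r.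
have [|y hy] := no_vanishing_functional bF (c := kap *m c) ts0 Ats.
  by move=> s u; rewrite mulmxA -uM sM mulmxDr mulmxDl -!scalemxAr -!scalemxAl -!mulmxA c1 c2 !mulmx0 !scaler0 addr0.
by move: c0; rewrite (kc _ _ hy) eqxx.
Qed.

(** A nonzero bilinear form with three zeros that are distinct in both factors vanishes on the graph
    of the projectivity through them, so it is unique up to a scalar. At [x3] and [x4] it is [a] and
    [b] times the form vanishing at [y3] and [y4], and the third zero fixes the ratio of [a] and
    [b]. *)
Lemma bilinear_three_zeros (x3 x4 x5 : K) (y3 y4 y5 : 'rV[K]_2) (P Q P' Q' : 'I_2 -> K) :
  x3 != x4 -> x3 != x5 -> x4 != x5 ->
  wedge y3 y4 != 0 -> wedge y3 y5 != 0 -> wedge y4 y5 != 0 ->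
  let H (A B : 'I_2 -> K) (s y : 'rV[K]_2) :=
      y ord0 ord0 * (s ord0 ord0 * A ord0 + s ord0 ord_max * A ord_max)
      + y ord0 ord_max * (s ord0 ord0 * B ord0 + s ord0 ord_max * B ord_max) in
   H P Q (row2 1 x3) y3 = 0 -> H P Q (row2 1 x4) y4 = 0 -> H P Q (row2 1 x5) y5 = 0 ->
   H P' Q' (row2 1 x3) y3 = 0 -> H P' Q' (row2 1 x4) y4 = 0 -> H P' Q' (row2 1 x5) y5 = 0 ->
   (forall s y, H P Q s y = 0) \/ exists k, forall s y, H P' Q' s y = k * H P Q s y.
Proof.
move=> x34 x35 x45 w34 w35 w45 H.
have yn (y y' : 'rV[K]_2) : wedge y y' != 0 -> y != 0.
  by apply: contraNneq => ->; apply/eqP; rewrite /wedge !mxE; ring.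
have d43 : x4 - x3 != 0 by rewrite subr_eq0 eq_sym.
have d45 : x4 - x5 != 0 by rewrite subr_eq0.
have d53 : x5 - x3 != 0 by rewrite subr_eq0 eq_sym.
(* H(A,B)((1,x),.) is proportional to y^perp *)
have perp A B x (y : 'rV[K]_2) : y != 0 -> H A B (row2 1 x) y = 0 -> exists a,
    A ord0 + x * A ord_max = a * y ord0 ord_max /\ B ord0 + x * B ord_max = - a * y ord0 ord0.
  move=> y0 h; have [||k e] := @wedge_eq0 (row2 (A ord0 + x * A ord_max) (B ord0 + x * B ord_max))
      (row2 (y ord0 ord_max) (- y ord0 ord0)).
  - apply: contraNneq y0 => e; apply/eqP/row2_eq; rewrite [RHS]mxE.
      by move/rowP: e => /(_ ord_max); rewrite !mxE /= => /eqP; rewrite oppr_eq0 => /eqP.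
    by move/rowP: e => /(_ ord0); rewrite !mxE.
  - by move: h; rewrite /H /wedge !mxE /= => h; rewrite -[RHS]oppr0 -h; ring.
  exists k; move/rowP: e => e; have := e ord0; have := e ord_max; rewrite !mxE /= => -> ->.
  by split=> //; ring.
have solve A B : H A B (row2 1 x3) y3 = 0 -> H A B (row2 1 x4) y4 = 0 -> H A B (row2 1 x5) y5 = 0 ->
   exists a b, [/\ a * ((x4 - x5) * wedge y3 y5) = b * ((x3 - x5) * wedge y4 y5) &
     forall s y, (x4 - x3) * H A B s y =
       (s ord0 ord0 * x4 - s ord0 ord_max) * (- a * wedge y3 y) + (s ord0 ord_max - s ord0 ord0 * x3) * (- b * wedge y4 y)].
  move=> h3 h4 h5; have [a [a1 a2]] := perp _ _ _ _ (yn _ _ w34) h3.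
  have [b [b1 b2]] := perp _ _ _ _ (yn _ _ w45) h4.
  have E s y : (x4 - x3) * H A B s y =
       (s ord0 ord0 * x4 - s ord0 ord_max) * (- a * wedge y3 y) + (s ord0 ord_max - s ord0 ord0 * x3) * (- b * wedge y4 y).
    transitivity (y ord0 ord0 * ((s ord0 ord0 * x4 - s ord0 ord_max) * (A ord0 + x3 * A ord_max)
          + (s ord0 ord_max - s ord0 ord0 * x3) * (A ord0 + x4 * A ord_max))
      + y ord0 ord_max * ((s ord0 ord0 * x4 - s ord0 ord_max) * (B ord0 + x3 * B ord_max)
          + (s ord0 ord_max - s ord0 ord0 * x3) * (B ord0 + x4 * B ord_max))); first by rewrite /H; ring.
    by rewrite a1 a2 b1 b2 /wedge; ring.
  exists a, b; split=> //; have := E (row2 1 x5) y5; rewrite h5 mulr0 !mxE /= => e.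
  by apply/eqP; rewrite -subr_eq0 -oppr_eq0 [X in _ == X]e; apply/eqP; ring.
move=> p3 p4 p5 p3' p4' p5'.
have [a [b [ab E]]] := solve _ _ p3 p4 p5; have [a' [b' [ab' E']]] := solve _ _ p3' p4' p5'.
have d35 : x3 - x5 != 0 by rewrite subr_eq0.
have bE (a1 b1 : K) : a1 * ((x4 - x5) * wedge y3 y5) = b1 * ((x3 - x5) * wedge y4 y5) ->
    b1 = a1 * ((x4 - x5) * wedge y3 y5 / ((x3 - x5) * wedge y4 y5)).
  by move=> e; rewrite mulrA e mulfK // mulf_neq0.
rewrite (bE _ _ ab) in E; rewrite (bE _ _ ab') in E'.
have [a0|a0] := eqVneq a 0.
  by left=> s y; apply: (mulfI d43); rewrite E a0; ring.
right; exists (a' / a) => s y; apply: (mulfI d43); rewrite E' [RHS]mulrCA E.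
by field; rewrite a0 w45 d35.
Qed.

Lemma mx11_lin4 (a b c d : K) (x y z w : 'M[K]_1) :
  (a *: x + b *: y + c *: z + d *: w) ord0 ord0 =
  a * x ord0 ord0 + b * y ord0 ord0 + c * z ord0 ord0 + d * w ord0 ord0.
Proof. by rewrite !mxE. Qed.

(** The first two base points give functionals [kap c1], [kap c2] that vanish on [F s e0 e0] and on
    [F s e1 e1]. Up to terms in [wedge t u], which multiples of [sg] can cancel, they equal
    [u1 G(s, t)] and [u0 G'(s, t)]. The other three base points make [G'] proportional to [G], and
    the two corrected functionals become a linear inverse of [u]. *)
Lemma base_of_antisym (x1 x2 d : K) (kap : 'M[K]_(4, 2)) :
  (forall x : 'rV[K]_4, x *m sg = 0 -> x *m kap = 0 -> x = 0) ->
  (forall c y : 'cV[K]_2, kap *m c = sg *m y -> c = 0) ->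
  d != 0 -> (forall t u, axis_form F sg t u = d * wedge t u) ->
  F (row2 1 x1) e0 e0 = 0 -> F (row2 1 x2) e1 e1 = 0 ->
  (exists x3 x4 x5 y3 y4 y5, [/\ [/\ x3 != x4, x3 != x5 & x4 != x5],
     [/\ wedge y3 y4 != 0, wedge y3 y5 != 0 & wedge y4 y5 != 0],
     forall y, y \in [:: y3; y4; y5] -> y ord0 ord0 != 0 /\ y ord0 ord_max != 0
   & [/\ F (row2 1 x3) y3 y3 = 0, F (row2 1 x4) y4 y4 = 0 & F (row2 1 x5) y5 y5 = 0]]) -> False.
Proof.
move=> inj kc d0 AE h1 h2 [x3 [x4 [x5 [y3 [y4 [y5 [[x34 x35 x45] [w34 w35 w45] yn [z3 z4 z5]]]]]]]].
have [f0 f1 f2] := b_tri bF; have Ftri := b_tri bF.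
pose b (c : 'cV[K]_2) j k s := (F s j k *m (kap *m c)) ord0 ord0.
have blin c j k s : b c j k s = s ord0 ord0 * b c j k e0 + s ord0 ord_max * b c j k e1.
  by rewrite /b {1}[s]row2_decomp f0 mulmxDl -!scalemxAl !mxE.
have bexp c s t u : b c t u s = t ord0 ord0 * (u ord0 ord0 * b c e0 e0 s + u ord0 ord_max * b c e0 e1 s)
   + t ord0 ord_max * (u ord0 ord0 * b c e1 e0 s + u ord0 ord_max * b c e1 e1 s).
  rewrite /b (tri_bilin s t u Ftri) bilin_combM mx11_lin4; ring.
have exc j x : F (row2 1 x) j j = 0 -> exists2 c : 'cV[K]_2, c != 0 & forall s, b c j j s = 0.
  move=> hj; pose B : 'M[K]_2 := \matrix_(i, l) (F (unit_row K i) j j *m kap) ord0 l.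
  have BE s : s *m B = F s j j *m kap.
    rewrite {2}[s]row2_decomp f0 mulmxDl -!scalemxAl; apply/rowP => l; by rewrite mul2E row_lin2 !mxE.
  have dB : \det B = 0.
    apply/eqP/det0P; exists (row2 1 x); first by rewrite row2_neq0 ?oner_eq0.
    by rewrite BE hj mul0mx.
  have [c c0 Bc] := singular_right dB; exists c => // s.
  by rewrite /b mulmxA -BE -mulmxA Bc mulmx0 mxE.
have [c1 c10 c1b] := exc _ _ h1; have [c2 c20 c2b] := exc _ _ h2.
pose p i := b c1 e0 e1 (unit_row K i) + b c1 e1 e0 (unit_row K i).
pose q i := b c1 e1 e1 (unit_row K i).
pose p' i := b c2 e0 e0 (unit_row K i).
pose q' i := b c2 e0 e1 (unit_row K i) + b c2 e1 e0 (unit_row K i).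
pose G (s y : 'rV[K]_2) := y ord0 ord0 * (s ord0 ord0 * p ord0 + s ord0 ord_max * p ord_max)
   + y ord0 ord_max * (s ord0 ord0 * q ord0 + s ord0 ord_max * q ord_max).
pose G' (s y : 'rV[K]_2) := y ord0 ord0 * (s ord0 ord0 * p' ord0 + s ord0 ord_max * p' ord_max)
   + y ord0 ord_max * (s ord0 ord0 * q' ord0 + s ord0 ord_max * q' ord_max).
have GE s t u : b c1 t u s = u ord0 ord_max * G s t - b c1 e1 e0 s * wedge t u.
  rewrite bexp c1b (blin _ e0 e1) (blin _ e1 e0) (blin _ e1 e1) /G /p /q /wedge; ring.
have G'E s t u : b c2 t u s = u ord0 ord0 * G' s t + b c2 e0 e1 s * wedge t u.
  rewrite bexp c2b (blin _ e0 e1) (blin _ e1 e0) (blin _ e0 e0) /G' /p' /q' /wedge; ring.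
have wdxx y : wedge y y = 0 :> K by rewrite /wedge; ring.
have z (x : K) y : y \in [:: y3; y4; y5] -> F (row2 1 x) y y = 0 -> G (row2 1 x) y = 0 /\ G' (row2 1 x) y = 0.
  move=> /yn[y0 y1] hF; split.
    apply: (mulfI y1); rewrite mulr0; transitivity (b c1 y y (row2 1 x)).
      by rewrite GE wdxx mulr0 subr0.
    by rewrite /b hF mul0mx mxE.
  apply: (mulfI y0); rewrite mulr0; transitivity (b c2 y y (row2 1 x)).
    by rewrite G'E wdxx mulr0 addr0.
  by rewrite /b hF mul0mx mxE.
have [g3 g3'] : G (row2 1 x3) y3 = 0 /\ G' (row2 1 x3) y3 = 0 by apply: z; rewrite ?inE ?eqxx.
have [g4 g4'] : G (row2 1 x4) y4 = 0 /\ G' (row2 1 x4) y4 = 0 by apply: z; rewrite ?inE ?eqxx ?orbT.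
have [g5 g5'] : G (row2 1 x5) y5 = 0 /\ G' (row2 1 x5) y5 = 0 by apply: z; rewrite ?inE ?eqxx ?orbT.
(* a bilinear form with three generic zeros is determined up to a scalar *)
have par (P Q P' Q' : 'I_2 -> K) : 
   let H (A B : 'I_2 -> K) (s y : 'rV[K]_2) := y ord0 ord0 * (s ord0 ord0 * A ord0 + s ord0 ord_max * A ord_max)
      + y ord0 ord_max * (s ord0 ord0 * B ord0 + s ord0 ord_max * B ord_max) in
   H P Q (row2 1 x3) y3 = 0 -> H P Q (row2 1 x4) y4 = 0 -> H P Q (row2 1 x5) y5 = 0 ->
   H P' Q' (row2 1 x3) y3 = 0 -> H P' Q' (row2 1 x4) y4 = 0 -> H P' Q' (row2 1 x5) y5 = 0 ->
   (forall s y, H P Q s y = 0) \/ exists k, forall s y, H P' Q' s y = k * H P Q s y.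
  move=> H p3 p4 p5 p3' p4' p5'.
  exact: (@bilinear_three_zeros x3 x4 x5 y3 y4 y5).
have absurd (c y : 'cV[K]_2) : c != 0 -> kap *m c = sg *m y -> False by move=> cn h; move: cn; rewrite (kc _ _ h) eqxx.
have wdsg (m : 'I_2 -> K) s t u : (F s t u *m (sg *m \col_i m i)) ord0 ord0 =
    d * wedge t u * (s ord0 ord0 * m ord0 + s ord0 ord_max * m ord_max).
  by rewrite mulmxA (axis_formE bF) AE -scalemxAl mxE mul2E !mxE.
have sub1 (x y : 'M[K]_1) : (x - y) ord0 ord0 = x ord0 ord0 - y ord0 ord0 by rewrite !mxE.
have add1 (x y : 'M[K]_1) : (x + y) ord0 ord0 = x ord0 ord0 + y ord0 ord0 by rewrite !mxE.
have ext (c c' : 'cV[K]_4) : (forall s t u, (F s t u *m (c - c')) ord0 ord0 = 0) -> c = c'.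
  move=> h; apply/eqP; rewrite -subr_eq0; apply/eqP; apply: (b_span bF) => s t u.
  by apply/matrixP => i j; rewrite !ord1 h mxE.
have nG : ~ (forall s y, G s y = 0).
  move=> G0; apply: (@absurd c1 (\col_i (- b c1 e1 e0 (unit_row K i) / d))) => //.
  apply: ext => s t u; rewrite mulmxBr sub1 -/(b c1 t u s) GE G0 mulr0 sub0r wdsg (blin _ e1 e0).
  by field; exact: d0.
have nG' : ~ (forall s y, G' s y = 0).
  move=> G0; apply: (@absurd c2 (\col_i (b c2 e0 e1 (unit_row K i) / d))) => //.
  apply: ext => s t u; rewrite mulmxBr sub1 -/(b c2 t u s) G'E G0 mulr0 add0r wdsg (blin _ e0 e1).
  by field; exact: d0.
case: (par p q p' q' g3 g4 g5 g3' g4' g5') => // -[k Gk].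
have k0 : k != 0 by apply/eqP => k0; apply: nG' => s y; rewrite /G' Gk k0 mul0r.
pose l1 : 'cV[K]_4 := kap *m c1 + sg *m \col_i (b c1 e1 e0 (unit_row K i) / d).
pose l0 : 'cV[K]_4 := k^-1 *: (kap *m c2 - sg *m \col_i (b c2 e0 e1 (unit_row K i) / d)).
have l1E s t u : (F s t u *m l1) ord0 ord0 = u ord0 ord_max * G s t.
  rewrite mulmxDr add1 -/(b c1 t u s) GE wdsg (blin _ e1 e0); field; exact: d0.
have l0E s t u : (F s t u *m l0) ord0 ord0 = u ord0 ord0 * G s t.
  rewrite -scalemxAr mxE mulmxBr sub1 -/(b c2 t u s) G'E wdsg (blin _ e0 e1) /G' Gk -/(G s t).
  by field; rewrite d0.
pose L : 'M[K]_(4, 2) := \matrix_(i, j) (if j == ord0 then l0 i ord0 else l1 i ord0).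
have L0 (v : 'rV[K]_4) : (v *m L) ord0 ord0 = (v *m l0) ord0 ord0.
  by rewrite !mxE; apply: eq_bigr => i _; rewrite [L _ _]mxE.
have L1 (v : 'rV[K]_4) : (v *m L) ord0 ord_max = (v *m l1) ord0 ord0.
  by rewrite !mxE; apply: eq_bigr => i _; rewrite [L _ _]mxE.
have Lz : L = 0.
  by apply: (b_nlu bF) => s t u; rewrite /wedge L0 L1 l0E l1E; ring.
have l1z : l1 = 0 by apply/colP => i; move/matrixP: Lz => /(_ i ord_max); rewrite !mxE.
apply: (@absurd c1 (- \col_i (b c1 e1 e0 (unit_row K i) / d))) => //.
by apply/eqP; rewrite mulmxN -addr_eq0; apply/eqP.
Qed.

Lemma good_base x (good : K -> Prop) :
  (forall x, good x -> forall a b c e, bilin_comb (F (row2 1 x)) a b c e = 0 -> a * e = b * c) ->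
  good x -> exists t u, [/\ t != 0, u != 0 & F (row2 1 x) t u = 0].
Proof.
move=> gk gx; set s := row2 1 x.
pose B : 'M[K]_4 := \matrix_i nth 0 [:: F s e0 e0; F s e0 e1; F s e1 e0; F s e1 e1] i.
(* The column orthogonal to [s = (1, x)]; [sg *m w] kills all four vectors, which are therefore
   dependent. *)
pose w : 'cV[K]_2 := \col_i (if i == ord0 then - x else 1).
have w0 : w != 0.
  apply/eqP => /(congr1 (fun m : 'cV[K]_2 => m ord_max ord0)); rewrite !mxE /= => /eqP.
  by rewrite oner_eq0.
have dB : \det B = 0.
  apply/eqP; apply: contraT => dn; have Bu : B \in unitmx by rewrite unitmxE unitfE.
  have Fw t u : F s t u *m (sg *m w) = 0.
    rewrite mulmxA (axis_formE bF) -scalemxAl; suff -> : s *m w = 0 by rewrite scaler0.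
    by apply/matrixP => i j; rewrite !ord1 mul2E !mxE /=; ring.
  have : B *m (sg *m w) = 0.
    apply/row_matrixP => i; rewrite row_mul rowK row0.
    by case: i => [[|[|[|[|]]]]] //= _; exact: Fw.
  move/(congr1 (mulmx (invmx B))); rewrite mulKmx // mulmx0 => /(sg_inj bF) wz.
  by rewrite wz eqxx in w0.
have /eqP/det0P[r r0 rB] := dB.
have [a [b [c [e rE]]]] : exists a b c e, r = row4 a b c e by rewrite [r]row4E; do 4 eexists.
have rk : bilin_comb (F s) a b c e = 0.
  apply/rowP => j; rewrite [RHS]mxE; have := congr1 (fun m : 'rV[K]_4 => m ord0 j) rB.
  by rewrite rE row4_mulE !mxE /bilin_comb !inordK //= !mxE.
have [t0 [t1 [u0 [u1 [ea eb ec ee]]]]] := rank1_decomp (gk x gx a b c e rk).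
exists (row2 t0 t1), (row2 u0 u1).
have n0 : ~~ [&& a == 0, b == 0, c == 0 & e == 0].
  apply: contraNN r0 => /and4P[/eqP a0 /eqP b0 /eqP c0 /eqP e0']; apply/eqP; rewrite rE a0 b0 c0 e0'.
  by apply/rowP => i; rewrite !mxE; case: i => [[|[|[|[|]]]]].
split.
- apply: contraNneq n0 => h; have h0 := congr1 (fun m : 'rV[K]_2 => m ord0 ord0) h.
  have h1 := congr1 (fun m : 'rV[K]_2 => m ord0 ord_max) h; rewrite !mxE /= in h0 h1.
  by rewrite ea eb ec ee h0 h1 !mul0r eqxx.
- apply: contraNneq n0 => h; have h0 := congr1 (fun m : 'rV[K]_2 => m ord0 ord0) h.
  have h1 := congr1 (fun m : 'rV[K]_2 => m ord0 ord_max) h; rewrite !mxE /= in h0 h1.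
  by rewrite ea eb ec ee h0 h1 !mulr0 eqxx.
- by rewrite (tri_bilin _ _ _ (b_tri bF)) !mxE /= -ea -eb -ec -ee.
Qed.

Lemma axis_form_at_base s t u : s != 0 -> F s t u = 0 -> axis_form F sg t u = 0.
Proof.
move=> s0 h; have := axis_formE bF s t u; rewrite h mul0mx => /esym/eqP.
by rewrite scaler_eq0 (negPf s0) orbF => /eqP.
Qed.

End WithData.

Lemma ex_good (good : K -> Prop) (s : seq K) :
  (forall p : {poly K}, (forall x, good x -> p.[x] = 0) -> p = 0) ->
  exists2 x, good x & x \notin s.
Proof.
move=> gi; apply: boolp.contrapT => h.
have : \prod_(a <- s) ('X - a%:P) != 0 :> {poly K}.
  by apply: monic_neq0; exact: monic_prod_XsubC.
case/eqP; apply: gi => x gx; apply/eqP; rewrite -/(root _ x) root_prod_XsubC.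
by apply: contraT => xs; case: h; exists x.
Qed.

(** The axis form puts the base point of each good [x] on the diagonal, at some [v]. Different [x]
    give different [v], because a base point shared by two values of [s] is one for all [s]. Five
    values then contradict [base_of_antisym]. *)
Lemma base_of_wedge F sg : bir_data F sg -> (forall t u, axis_form F sg t u = wedge t u) ->
  exists t u, [/\ t != 0, u != 0 & forall s, F s t u = 0].
Proof.
move=> bF AE; have [f0 f1 f2] := b_tri bF; have [good [gi gk]] := b_kern bF.
apply: boolp.contrapT => NB.
have gb x : good x -> exists2 v : 'rV[K]_2, v != 0 & F (row2 1 x) v v = 0.
  move=> gx; have [t [u [t0 u0 h]]] := good_base bF gk gx.
  have w0 : wedge t u = 0 by rewrite -AE (axis_form_at_base bF _ h) // row2_neq0 ?oner_eq0.
  have [k tk] := wedge_eq0 u0 w0; exists u => //.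
  have k0 : k != 0 by apply: contraNneq t0 => k0; rewrite tk k0 scale0r.
  have := f1 k 0 u u (row2 1 x) u; rewrite !scale0r !addr0 -tk h => /esym/eqP.
  by rewrite scaler_eq0 (negPf k0) => /eqP.
have diff x x' v v' : x != x' -> v != 0 -> v' != 0 -> F (row2 1 x) v v = 0 -> F (row2 1 x') v' v' = 0 ->
    wedge v v' != 0.
  move=> xx v0 v0' h h'; apply/eqP => w0; have [k vk] := wedge_eq0 v0' w0.
  have k0 : k != 0 by apply: contraNneq v0 => k0; rewrite vk k0 scale0r.
  apply: NB; exists v', v'; split=> // s.
  have hx : F (row2 1 x) v' v' = 0.
    have := f1 k 0 v' v' (row2 1 x) v; rewrite !scale0r !addr0 -vk h => /esym/eqP.
    rewrite scaler_eq0 (negPf k0) /= => /eqP h1.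
    have := f2 k 0 v' v' (row2 1 x) v'; rewrite !scale0r !addr0 -vk h1 => /esym/eqP.
    by rewrite scaler_eq0 (negPf k0) /= => /eqP.
  have xd : x' - x != 0 by rewrite subr_eq0 eq_sym.
  have -> : s = ((s ord0 ord0 * x' - s ord0 ord_max) / (x' - x)) *: row2 1 x
     + ((s ord0 ord_max - s ord0 ord0 * x) / (x' - x)) *: row2 1 x'.
    by apply: row2_eq; rewrite !mxE /=; field; exact: xd.
  by rewrite f0 hx h' !scaler0 addr0.
have [x1 g1 _] := ex_good [::] gi.
have [x2 g2] := ex_good [:: x1] gi; rewrite !inE => n2.
have [x3 g3] := ex_good [:: x1; x2] gi; rewrite !inE !negb_or => /andP[n31 n32].
have [x4 g4] := ex_good [:: x1; x2; x3] gi; rewrite !inE !negb_or => /and3P[n41 n42 n43].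
have [x5 g5] := ex_good [:: x1; x2; x3; x4] gi; rewrite !inE !negb_or => /and4P[n51 n52 n53 n54].
have [v1 z1 h1] := gb _ g1; have [v2 z2 h2] := gb _ g2; have [v3 z3 h3] := gb _ g3.
have [v4 z4 h4] := gb _ g4; have [v5 z5 h5] := gb _ g5.
(* Coordinates in which the first two base points are [e0] and [e1]. *)
pose P : 'M[K]_2 := \matrix_(i, j) (if i == ord0 then v1 ord0 j else v2 ord0 j).
have eP0 : e0 *m P = v1 by apply: row2_eq; rewrite mul2E !mxE !eqxx /=; ring.
have eP1 : e1 *m P = v2 by apply: row2_eq; rewrite mul2E !mxE !eqxx /=; ring.
have wdn x y : x != y -> y != x by rewrite eq_sym.
have w12 : wedge v1 v2 != 0 by apply: (diff x1 x2) => //; exact: wdn.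
have dP : \det P = wedge v1 v2 by rewrite det2E !mxE.
have Pu : P \in unitmx by rewrite unitmxE unitfE dP.
have bF' := bir_data_change Pu Pu bF.
have [G [kap [Gu GE kc]]] := axis_coordinates bF.
have inj (x : 'rV[K]_4) : x *m sg = 0 -> x *m kap = 0 -> x = 0.
  move=> xs xk; rewrite -[x](mulmxKV Gu); suff -> : x *m invmx G = 0 by rewrite mul0mx.
  by rewrite GE; apply: etrans (mul_mx_row x sg kap) _; rewrite xs xk row_mx0.
have wP v v' : wedge (v *m invmx P) (v' *m invmx P) = wedge v v' / wedge v1 v2.
  by rewrite wedgeM det_inv dP.
have wPn v v' : wedge v v' != 0 -> wedge (v *m invmx P) (v' *m invmx P) != 0.
  by move=> h; rewrite wP mulf_neq0 // invr_eq0.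
apply: (@base_of_antisym _ _ bF' x1 x2 (wedge v1 v2) kap inj kc w12).
- by move=> t u; rewrite /axis_form -/(axis_form F sg _ _) AE wedgeM dP mulrC.
- by rewrite eP0.
- by rewrite eP1.
exists x3, x4, x5, (v3 *m invmx P), (v4 *m invmx P), (v5 *m invmx P); split.
- by split; rewrite eq_sym.
- by split; apply: wPn; [apply: (diff x3 x4) | apply: (diff x3 x5) | apply: (diff x4 x5)] => //; exact: wdn.
- have yE (v : 'rV[K]_2) : wedge v v2 != 0 -> wedge v v1 != 0 ->
     (v *m invmx P) ord0 ord0 != 0 /\ (v *m invmx P) ord0 ord_max != 0.
    move=> hv2 hv1; have := wPn _ _ hv2; have := wPn _ _ hv1.
    rewrite -eP0 -eP1 !mulmxK // /wedge !e0E !e1E !(mulr0, mulr1, subr0, sub0r) oppr_eq0.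
    by [].
  have d1 x v : x1 != x -> v != 0 -> F (row2 1 x) v v = 0 -> wedge v v1 != 0.
    by move=> xx vn hv; apply: (diff x x1) => //; rewrite eq_sym.
  have d2 x v : x2 != x -> v != 0 -> F (row2 1 x) v v = 0 -> wedge v v2 != 0.
    by move=> xx vn hv; apply: (diff x x2) => //; rewrite eq_sym.
  move=> y; rewrite !inE => /or3P[] /eqP->; apply: yE.
  + by apply: (d2 x3) => //; rewrite eq_sym.
  + by apply: (d1 x3) => //; rewrite eq_sym.
  + by apply: (d2 x4) => //; rewrite eq_sym.
  + by apply: (d1 x4) => //; rewrite eq_sym.
  + by apply: (d2 x5) => //; rewrite eq_sym.
  + by apply: (d1 x5) => //; rewrite eq_sym.
- by rewrite !mulmxKV.
Qed.

(** A nondegenerate axis form becomes [wedge] after a change of [u]. Otherwise it is a product of a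
    form in [t] and a form in [u], so each base point has [t] at the zero [ts] or [u] at the zero
    [us]. One of the two determinants then vanishes at each good [x], hence one of them vanishes
    identically, and [base_of_singular] applies. *)
Theorem base_point F sg : bir_data F sg ->
  exists t u, [/\ t != 0, u != 0 & forall s, F s t u = 0].
Proof.
move=> bF; have [f0 f1 f2] := b_tri bF; have [good [gi gk]] := b_kern bF.
have [G [kap [Gu GE kc]]] := axis_coordinates bF.
have inj (x : 'rV[K]_4) : x *m sg = 0 -> x *m kap = 0 -> x = 0.
  move=> xs xk; rewrite -[x](mulmxKV Gu); suff -> : x *m invmx G = 0 by rewrite mul0mx.
  by rewrite GE; apply: etrans (mul_mx_row x sg kap) _; rewrite xs xk row_mx0.
pose A := axis_form F sg.
have AE t u : A t u = t ord0 ord0 * (u ord0 ord0 * A e0 e0 + u ord0 ord_max * A e0 e1)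
    + t ord0 ord_max * (u ord0 ord0 * A e1 e0 + u ord0 ord_max * A e1 e1).
  rewrite {1}[t]row2_decomp {1}[u]row2_decomp /A (axis_form_lin1 bF) !(axis_form_lin2 bF); ring.
have [dA|dA] := eqVneq (A e0 e0 * A e1 e1) (A e0 e1 * A e1 e0); last first.
  pose U : 'M[K]_2 := \matrix_(i, j) (if j == ord0 then - A e1 (unit_row K i) else A e0 (unit_row K i)).
  have dU : \det U = A e0 e0 * A e1 e1 - A e0 e1 * A e1 e0 by rewrite det2E !mxE /=; ring.
  have Uu : U \in unitmx by rewrite unitmxE unitfE dU subr_eq0.
  have AU t u : A t u = wedge t (u *m U) by rewrite AE /wedge !mul2E !mxE /=; ring.
  have U'u : invmx U \in unitmx by rewrite unitmx_inv.
  have bF' := bir_data_change (unitmx1 _ _) U'u bF.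
  have [|t [u [t0 u0 h]]] := base_of_wedge bF'.
    by move=> t u; rewrite /axis_form -/(axis_form F sg _ _) mulmx1 -/(A _ _) AU mulmxKV.
  exists t, (u *m invmx U); rewrite mulmx_unit_neq0 //; split=> // s.
  by have := h s; rewrite mulmx1.
have [p0 [p1 [q0 [q1 [a00 a01 a10 a11]]]]] := rank1_decomp dA.
have AF t u : A t u = (t ord0 ord0 * p0 + t ord0 ord_max * p1) * (u ord0 ord0 * q0 + u ord0 ord_max * q1).
  by rewrite AE a00 a01 a10 a11; ring.
have [tn [un An]] := axis_form_neq0 bF.
pose ts := row2 p1 (- p0); pose us := row2 q1 (- q0).
have ts0 : ts != 0.
  apply: contraNneq An => h; rewrite -/(A _ _) AF.
  have h0 := congr1 (fun m : 'rV[K]_2 => m ord0 ord0) h.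
  have h1 := congr1 (fun m : 'rV[K]_2 => m ord0 ord_max) h; rewrite !mxE /= in h0 h1.
  by move/eqP: h1; rewrite oppr_eq0 => /eqP ->; rewrite h0 !mulr0 addr0 mul0r.
have us0 : us != 0.
  apply: contraNneq An => h; rewrite -/(A _ _) AF.
  have h0 := congr1 (fun m : 'rV[K]_2 => m ord0 ord0) h.
  have h1 := congr1 (fun m : 'rV[K]_2 => m ord0 ord_max) h; rewrite !mxE /= in h0 h1.
  by move/eqP: h1; rewrite oppr_eq0 => /eqP ->; rewrite h0 !mulr0 addr0 mulr0.
have Ats u : A ts u = 0 by rewrite AF !mxE /=; ring.
have Aus t : A t us = 0 by rewrite AF !mxE /=; ring.
pose M s : 'M[K]_2 := \matrix_(k, l) (F s ts (unit_row K k) *m kap) ord0 l.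
pose N s : 'M[K]_2 := \matrix_(k, l) (F s (unit_row K k) us *m kap) ord0 l.
have uM s u : u *m M s = F s ts u *m kap.
  rewrite {2}[u]row2_decomp f2 mulmxDl -!scalemxAl; apply/rowP => l.
  by rewrite mul2E row_lin2 !mxE.
have tN s t : t *m N s = F s t us *m kap.
  rewrite {2}[t]row2_decomp f1 mulmxDl -!scalemxAl; apply/rowP => l.
  by rewrite mul2E row_lin2 !mxE.
have sM s : M s = s ord0 ord0 *: M e0 + s ord0 ord_max *: M e1.
  have ME s' k l : M s' k l = (F s' ts (unit_row K k) *m kap) ord0 l by rewrite mxE.
  apply/matrixP => k l; rewrite [RHS]mxE [X in _ = X + _]mxE [X in _ = _ + X]mxE !ME.
  by rewrite {1}[s]row2_decomp f0 mulmxDl -!scalemxAl row_lin2.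
have sN s : N s = s ord0 ord0 *: N e0 + s ord0 ord_max *: N e1.
  have NE s' k l : N s' k l = (F s' (unit_row K k) us *m kap) ord0 l by rewrite mxE.
  apply/matrixP => k l; rewrite [RHS]mxE [X in _ = X + _]mxE [X in _ = _ + X]mxE !NE.
  by rewrite {1}[s]row2_decomp f0 mulmxDl -!scalemxAl row_lin2.
pose D (X Y : 'M[K]_2) : {poly K} := (\det X)%:P + (X ord0 ord0 * Y ord_max ord_max
   + Y ord0 ord0 * X ord_max ord_max - X ord0 ord_max * Y ord_max ord0 - Y ord0 ord_max * X ord_max ord0) *: 'X
   + (\det Y) *: ('X * 'X).
have DE X Y x : (D X Y).[x] = \det (X + x *: Y).
  by rewrite !hornerD hornerC !hornerZ hornerM !hornerX !det2E !mxE; ring.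
have D0 X Y : D X Y = 0 -> forall z w, \det (z *: X + w *: Y) = 0.
  move=> DXY z w.
  have E x : \det (X + x *: Y) = 0 by rewrite -DE DXY horner0.
  have d0 : \det X = 0 by have := E 0; rewrite scale0r addr0.
  have [z0|z0] := eqVneq z 0; last first.
    have -> : z *: X + w *: Y = z *: (X + (w / z) *: Y).
      by rewrite scalerDr scalerA mulrCA mulfV ?mulr1.
    by rewrite detZ E mulr0.
  (* The case [z = 0] asks for the leading coefficient, which is recovered from the values at 0, 1
     and -1. *)
  have d1 := E 1; have d2 := E (-1); rewrite !det2E in d0; rewrite !det2E !mxE in d1 d2.
  rewrite det2E !mxE; set x := _ * _ - _ in d0; set y := _ - _ in d1; set z' := _ - _ in d2.
  pose dY := Y ord0 ord0 * Y ord_max ord_max - Y ord0 ord_max * Y ord_max ord0.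
  have dY2 : 2 * dY = y + z' - 2 * x by rewrite /x /y /z' /dY; ring.
  have : 2 * dY = 0 by rewrite dY2 d0 d1 d2; ring.
  move/eqP; rewrite mulf_eq0 pnatr_eq0 /= => /eqP dY0.
  by transitivity (w * w * dY); [rewrite z0 /dY; ring | rewrite dY0 mulr0].
have prod0 : D (M e0) (M e1) * D (N e0) (N e1) = 0.
  apply: gi => x gx; have [t [u [t0 u0 h]]] := good_base bF gk gx.
  have s0 : row2 1 x != 0 by rewrite row2_neq0 ?oner_eq0.
  have /eqP := axis_form_at_base bF s0 h; rewrite -/(A _ _) AF mulf_eq0 hornerM !DE => /orP[] /eqP hz.
    have wt : wedge t ts = 0 by rewrite /wedge !mxE /= -[RHS]oppr0 -hz; ring.
    have [k tk] := wedge_eq0 ts0 wt.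
    have k0 : k != 0 by apply: contraNneq t0 => k0; rewrite tk k0 scale0r.
    have hts : F (row2 1 x) ts u = 0.
      have := f1 k 0 ts ts (row2 1 x) u; rewrite !scale0r !addr0 -tk h => /esym/eqP.
      by rewrite scaler_eq0 (negPf k0) => /eqP.
    suff -> : \det (M e0 + x *: M e1) = 0 by rewrite mul0r.
    apply/eqP/det0P; exists u => //.
    have := sM (row2 1 x); rewrite !mxE /= scale1r => <-.
    by rewrite uM hts mul0mx.
  have wu : wedge u us = 0 by rewrite /wedge !mxE /= -[RHS]oppr0 -hz; ring.
  have [k uk] := wedge_eq0 us0 wu.
  have k0 : k != 0 by apply: contraNneq u0 => k0; rewrite uk k0 scale0r.
  have hus : F (row2 1 x) t us = 0.
    have := f2 k 0 us us (row2 1 x) t; rewrite !scale0r !addr0 -uk h => /esym/eqP.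
    by rewrite scaler_eq0 (negPf k0) => /eqP.
  suff -> : \det (N e0 + x *: N e1) = 0 by rewrite mulr0.
  apply/eqP/det0P; exists t => //.
  have := sN (row2 1 x); rewrite !mxE /= scale1r => <-.
  by rewrite tN hus mul0mx.
move/eqP: prod0; rewrite mulf_eq0 => /orP[] /eqP /D0 hD.
  by have [u u0 hu] := base_of_singular bF inj kc ts0 Ats hD; exists ts, u.
by have [t t0 ht] := base_of_singular (bir_data_swap bF) inj kc us0 Aus hD; exists t, us.
Qed.

End BasePointExistence.

(** * Normal form *)

Lemma unit_first_row (K : fieldType) n (v : 'rV[K]_n.+1) : v != 0 ->
  exists2 P : 'M[K]_n.+1, P \in unitmx & row ord0 P = v.
Proof.
move=> v0; set k := (col_ebase v) ord0 ord0; have kE : col_ebase v = k%:M by rewrite [LHS]mx11_scalar.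
have k0 : k != 0 by have := col_ebase_unit v; rewrite kE unitmxE det_scalar1 unitfE.
exists (k *: row_ebase v); first by rewrite unitmxZ ?unitfE // row_ebase_unit.
have rk : \rank v = 1%N by rewrite rank_rV v0.
rewrite linearZ /= rowE -[RHS]mulmx_ebase kE mul_scalar_mx -scalemxAl rk; congr (_ *: (_ *m _)).
by apply/matrixP => i j; rewrite !mxE ord1 /= andbT eq_sym.
Qed.

Section QuadraticPencil.
Variable K : numFieldType.

(* Matrix of the multiplication by z + w j on K[j], j^2 = k, acting on rows. *)
Definition ext_mx (k z w : K) : 'M[K]_2 :=
  \matrix_(i, j) (if i == j then z else if i == ord0 then w else k * w).

Lemma ext_mxE k z w i j : ext_mx k z w i j = if i == j then z else if i == ord0 then w else k * w.
Proof. by rewrite mxE. Qed.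

Lemma eq_mx2 (X Y : 'M[K]_2) : X ord0 ord0 = Y ord0 ord0 -> X ord0 ord_max = Y ord0 ord_max ->
  X ord_max ord0 = Y ord_max ord0 -> X ord_max ord_max = Y ord_max ord_max -> X = Y.
Proof.
have e i : i = ord0 \/ i = ord_max :> 'I_2.
  by case: i => [[|[|]]] // h; [left | right]; apply: val_inj.
by move=> h1 h2 h3 h4; apply/matrixP => i j; case: (e i) => ->; case: (e j) => ->.
Qed.

Lemma mul2mxE m (X : 'M[K]_(m, 2)) n (Y : 'M[K]_(2, n)) i j :
  (X *m Y) i j = X i ord0 * Y ord0 j + X i ord_max * Y ord_max j.
Proof. by rewrite mxE big_ord_recl big_ord1; congr (_ + _ * _); congr (_ _ _); apply: val_inj. Qed.

(** Relative to an invertible member [X'] the pencil is spanned by the identity and an endomorphism.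
    Removing half the trace makes its square a scalar [k], by Cayley-Hamilton, and a basis [v],
    [v D] gives the matrix of multiplication by a square root of [k]. *)
Lemma pencil_normal_form (X Y : 'M[K]_2) :
  (exists z w, \det (z *: X + w *: Y) != 0) ->
  (forall z w, z *: X + w *: Y = 0 -> z = 0 /\ w = 0) ->
  exists k (L M B : 'M[K]_2), [/\ L \in unitmx, M \in unitmx, B \in unitmx &
    forall z w z' w', row2 z w *m B = row2 z' w' -> L *m (z *: X + w *: Y) *m M = ext_mx k z' w'].
Proof.
move=> [z0 [w0 dn]] ind.
have v0 : row2 z0 w0 != 0.
  apply: contraNneq dn => h; have := congr1 (fun m : 'rV[K]_2 => m ord0 ord0) h.
  have := congr1 (fun m : 'rV[K]_2 => m ord0 ord_max) h; rewrite !mxE /= => -> ->.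
  by rewrite !scale0r addr0 det2E !mxE !mul0r subr0.
have [B0 B0u rB] := unit_first_row v0.
have b0 : B0 ord0 ord0 = z0 by have := congr1 (fun m : 'rV[K]_2 => m ord0 ord0) rB; rewrite !mxE.
have b1 : B0 ord0 ord_max = w0 by have := congr1 (fun m : 'rV[K]_2 => m ord0 ord_max) rB; rewrite !mxE.
set z1 := B0 ord_max ord0; set w1 := B0 ord_max ord_max.
have db : z0 * w1 - w0 * z1 != 0 by move: B0u; rewrite unitmxE unitfE det2E b0 b1.
set X' := z0 *: X + w0 *: Y in dn *; pose Y' := z1 *: X + w1 *: Y.
have Xu : X' \in unitmx by rewrite unitmxE unitfE.
pose D0 := invmx X' *m Y'; pose tau := (D0 ord0 ord0 + D0 ord_max ord_max) / 2.
pose D := D0 - tau%:M.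
have trD : D ord_max ord_max = - D ord0 ord0.
  have DE i : D i i = D0 i i - tau.
    by rewrite [LHS]mxE [X in _ + X]mxE [X in - X]mxE eqxx mulr1n.
  by rewrite !DE /tau; field.
have XD : X' *m D = Y' - tau *: X' by rewrite mulmxBr mulKVmx // mul_mx_scalar.
clearbody D; clearbody tau.
set k := D ord0 ord0 ^+ 2 + D ord0 ord_max * D ord_max ord0.
have DD : D *m D = k%:M.
  by apply: eq_mx2; rewrite mul2mxE [RHS]mxE /= ?mulr1n ?mulr0n ?trD /k; ring.
(* If every vector were an eigenvector, the traceless [D] would be scalar, hence zero, against the
   independence of the pencil. *)
have [v vD] : exists v : 'rV[K]_2, wedge v (v *m D) != 0.
  apply: boolp.contrapT => h.
  have z v : wedge v (v *m D) = 0 by apply/eqP; apply: contraT => n; case: h; exists v.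
  have h01 : D ord0 ord_max = 0.
    by have := z (unit_row K ord0); rewrite /wedge !mul2E !mxE /=; move=> <-; rewrite [LHS]/=; ring.
  have h10 : D ord_max ord0 = 0.
    have := z (unit_row K ord_max); rewrite /wedge !mul2E !e1E => h1; apply/eqP; rewrite -oppr_eq0; apply/eqP.
    by rewrite -[RHS]h1; ring.
  have h00 : D ord0 ord0 = 0.
    have := z (unit_row K ord0 + unit_row K ord_max); rewrite /wedge !mul2E !mxE /= h01 h10 trD => h1.
    have : 2 * D ord0 ord0 = 0 by rewrite -[RHS]oppr0 -[in RHS]h1; ring.
    by move/eqP; rewrite mulf_eq0 pnatr_eq0 /= => /eqP.
  have D0' : D = 0 by apply: eq_mx2; rewrite ?trD ?h00 ?h01 ?h10 !mxE ?oppr0.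
  have := XD; rewrite D0' mulmx0 /X' /Y' => /esym hz.
  have [] := ind (z1 - tau * z0) (w1 - tau * w0).
    by rewrite -[RHS]hz !scalerBl scalerDr !scalerA addrACA opprD.
  move=> e1 e2; case/eqP: db.
  move/eqP: e1; rewrite subr_eq0 => /eqP ->; move/eqP: e2; rewrite subr_eq0 => /eqP ->; ring.
pose P : 'M[K]_2 := \matrix_(i, j) (if i == ord0 then v ord0 j else (v *m D) ord0 j).
have PE0 j : P ord0 j = v ord0 j by rewrite mxE.
have PE1 j : P ord_max j = (v *m D) ord0 j by rewrite mxE.
have Pu : P \in unitmx by rewrite unitmxE unitfE det2E !PE0 !PE1.
have PD : P *m D = ext_mx k 0 1 *m P.
  have vD2 j : (v *m D *m D) ord0 j = k * v ord0 j by rewrite -mulmxA DD mul_mx_scalar mxE.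
  have r0 : row ord0 P = v by apply/rowP => j; rewrite !mxE.
  have r1 : row ord_max P = v *m D by apply/rowP => j; rewrite mxE [LHS]mxE.
  have PDr i j : (P *m D) i j = (row i P *m D) ord0 j by rewrite -row_mul [RHS]mxE.
  by apply: eq_mx2; rewrite PDr ?r0 ?r1 ?vD2 [RHS]mul2mxE !ext_mxE ?PE0 ?PE1 /=; ring.
(* The last factor of the coordinate change undoes the shift [Y' = X' D + tau X']. *)
exists k, (P *m invmx X'), (invmx P), (invmx B0 *m \matrix_(i, j) (if i == j then 1 else if i == ord0 then 0 else tau)).
split.
- by rewrite unitmx_mul Pu unitmx_inv.
- by rewrite unitmx_inv.
- by rewrite unitmx_mul unitmx_inv B0u unitmxE unitfE det2E !mxE /= mulr1 mul0r subr0 oner_eq0.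
move=> z w z' w'; rewrite mulmxA; set r := row2 z w *m invmx B0 => h.
have zw : row2 z w = r *m B0 by rewrite mulmxKV.
have [zE wE] : z = r ord0 ord0 * z0 + r ord0 ord_max * z1 /\ w = r ord0 ord0 * w0 + r ord0 ord_max * w1.
  by split; [have := congr1 (fun m : 'rV[K]_2 => m ord0 ord0) zw
     | have := congr1 (fun m : 'rV[K]_2 => m ord0 ord_max) zw]; rewrite mul2E mxE /= ?b0 ?b1.
have [z'E w'E] : z' = r ord0 ord0 + tau * r ord0 ord_max /\ w' = r ord0 ord_max.
  by split; [have := congr1 (fun m : 'rV[K]_2 => m ord0 ord0) h
     | have := congr1 (fun m : 'rV[K]_2 => m ord0 ord_max) h]; rewrite mul2E !mxE /= => <-; ring.
have -> : z *: X + w *: Y = z' *: X' + w' *: (X' *m D).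
  rewrite XD zE wE z'E w'E /X' /Y'; apply/matrixP => i j; rewrite !mxE; ring.
have -> : ext_mx k z' w' = z'%:M + w' *: ext_mx k 0 1.
  by apply: eq_mx2; rewrite ext_mxE [RHS]mxE [X in X + _]mxE [X in _ + X]mxE ext_mxE /=
    ?mulr1n ?mulr0n ?mulr0 ?mulr1 ?addr0 ?add0r // mulrC.
have -> : P *m invmx X' *m (z' *: X' + w' *: (X' *m D)) = (z'%:M + w' *: ext_mx k 0 1) *m P.
  rewrite -mulmxA mulmxDr -!scalemxAr mulVmx // mulKmx // mulmxDr -!scalemxAr mulmx1 PD.
  by rewrite mulmxDl mul_scalar_mx -scalemxAl.
by rewrite mulmxK.
Qed.

End QuadraticPencil.

Section NormalForm.
Variable K : numFieldType.
Local Notation e0 := (unit_row K ord0).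
Local Notation e1 := (unit_row K ord_max).

Definition col3 (x y z : 'rV[K]_3) : 'M[K]_3 := \matrix_i nth 0 [:: x; y; z] i.

Definition det3 (a0 z0 w0 a1 z1 w1 a2 z2 w2 : K) :=
  a0 * (z1 * w2 - w1 * z2) - z0 * (a1 * w2 - w1 * a2) + w0 * (a1 * z2 - z1 * a2).

Lemma row3_mulE n (X : 'M[K]_(3, n)) a b c j : (row3 a b c *m X) ord0 j =
  a * X (inord 0) j + b * X (inord 1) j + c * X (inord 2) j.
Proof.
rewrite mxE !big_ord_recl big_ord0 !mxE /= addr0 addrA.
by congr (_ * X _ _ + _ * X _ _ + _ * X _ _); apply: val_inj; rewrite /= inordK.
Qed.

Lemma row3_col3 x y z a0 z0 w0 a1 z1 w1 a2 z2 w2 :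
  row3 x y z *m col3 (row3 a0 z0 w0) (row3 a1 z1 w1) (row3 a2 z2 w2) =
  row3 (x * a0 + y * a1 + z * a2) (x * z0 + y * z1 + z * z2) (x * w0 + y * w1 + z * w2).
Proof.
apply/rowP => j; rewrite row3_mulE !mxE !inordK //=.
by rewrite /row3 !mxE; case: j => [[|[|[|]]]].
Qed.

Lemma det_col3 a0 z0 w0 a1 z1 w1 a2 z2 w2 :
  \det (col3 (row3 a0 z0 w0) (row3 a1 z1 w1) (row3 a2 z2 w2)) = det3 a0 z0 w0 a1 z1 w1 a2 z2 w2.
Proof.
rewrite (expand_det_row _ ord0) !big_ord_recl big_ord0 /cofactor !det2E !mxE /=.
rewrite /det3 ; ring.
Qed.

Lemma mx3E (X : 'M[K]_3) : exists a0 z0 w0 a1 z1 w1 a2 z2 w2,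
  X = col3 (row3 a0 z0 w0) (row3 a1 z1 w1) (row3 a2 z2 w2).
Proof.
have [a0 [z0 [w0 h0]]] := row3E (row (inord 0) X).
have [a1 [z1 [w1 h1]]] := row3E (row (inord 1) X).
have [a2 [z2 [w2 h2]]] := row3E (row (inord 2) X).
exists a0, z0, w0, a1, z1, w1, a2, z2, w2; rewrite -h0 -h1 -h2; apply/row_matrixP => i; rewrite rowK.
by case: i => [[|[|[|]]]] //= h; congr (row _ X); apply: val_inj; rewrite /= inordK.
Qed.

(* (a s, s (z + w i)) with s = s0 + s1 i in K[i], i^2 = k, in the coordinates G *)
Definition std k G (s : 'rV[K]_2) a z w := vec G (a * s ord0 ord0) (a * s ord0 ord_max)
  (s ord0 ord0 * z + k * (s ord0 ord_max * w)) (s ord0 ord0 * w + s ord0 ord_max * z).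

Lemma vec_row_mx (x y : 'rV[K]_2) (G : 'M[K]_4) :
  vec G (x ord0 ord0) (x ord0 ord_max) (y ord0 ord0) (y ord0 ord_max) = row_mx x y *m (G : 'M_(2 + 2, 4)).
Proof.
rewrite /vec; congr (_ *m G); apply/rowP => i; rewrite !mxE.
case: splitP => j /= ->; case: j => [[|[|]]] //= h; congr (_ _ _); exact: val_inj.
Qed.
End NormalForm.

Lemma unit_row_neq0 (K : numFieldType) (i : 'I_2) : unit_row K i != 0.
Proof. by apply/eqP => /rowP/(_ i)/eqP; rewrite !mxE !eqxx oner_eq0. Qed.

(** Because of the base point, the axis form vanishes at [e1] for every [u], and a functional
    killing [F s e1 e0] kills all [F s e1 u]. So [no_vanishing_functional] applies. *)
Lemma no_vanishing_column (K : numFieldType) (F : 'rV[K]_2 -> 'rV[K]_2 -> 'rV[K]_2 -> 'rV[K]_4)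
  (sg kap : 'M[K]_(4, 2)) :
  let e0 := unit_row K ord0 in let e1 := unit_row K ord_max in
  bir_data F sg -> (forall s, F s e1 e1 = 0) ->
  (forall c y : 'cV[K]_2, kap *m c = sg *m y -> c = 0) ->
  (F e0 e1 e0 *m sg) ord0 ord0 = 0 ->
  forall c : 'cV[K]_2, (forall s, F s e1 e0 *m (kap *m c) = 0) -> c = 0.
Proof.
move=> e0 e1 bF base kapsg A2 c hc; have [f0 f1 f2] := b_tri bF.
have Ae u : axis_form F sg e1 u = 0.
  rewrite [u]row2_decomp (axis_form_lin2 bF) (axis_form_at_base bF (unit_row_neq0 _ _) (base e0)).
  by rewrite mulr0 addr0 /axis_form A2 mulr0.
have [|y /kapsg //] := no_vanishing_functional bF (unit_row_neq0 K ord_max) Ae (c := kap *m c).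
move=> s u; rewrite [u]row2_decomp f2 base scaler0 addr0 -scalemxAl.
by rewrite hc scaler0.
Qed.

Section NormalFormProof.
Variable K : numFieldType.
Local Notation e0 := (unit_row K ord0).
Local Notation e1 := (unit_row K ord_max).
Variables (F : 'rV[K]_2 -> 'rV[K]_2 -> 'rV[K]_2 -> 'rV[K]_4) (sg kap : 'M[K]_(4, 2)) (G : 'M[K]_4).
Hypothesis bF : bir_data F sg.
Hypothesis base : forall s, F s e1 e1 = 0.
Hypothesis Gu : G \in unitmx.
Hypothesis GE : invmx G = row_mx sg kap :> 'M_(4, 2 + 2).
Hypothesis kapsg : forall c y : 'cV[K]_2, kap *m c = sg *m y -> c = 0.

(** [V] extends the family from products of [t] and [u] to all vectors [m] of coefficients of the
    three monomials. In the frame [G] it has the components [A m] times [s] and [s] times [N m]. *)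
Let V s (m : 'rV[K]_3) := m ord0 (inord 0) *: F s e0 e0 + m ord0 (inord 1) *: F s e0 e1 + m ord0 (inord 2) *: F s e1 e0.
Let A (m : 'rV[K]_3) := (V e0 m *m sg) ord0 ord0.
Let N (m : 'rV[K]_3) : 'M[K]_2 := \matrix_(i, j) (V (unit_row K i) m *m kap) ord0 j.

Lemma base_V s t u : F s t u = V s (mono3 t u).
Proof.
rewrite (tri_bilin _ _ _ (b_tri bF)) /bilin_comb base scaler0 addr0.
by rewrite /V /mono3 !mxE !inordK.
Qed.

Lemma V_lin s a b x y : V s (a *: x + b *: y) = a *: V s x + b *: V s y.
Proof. by apply/rowP => j; rewrite /V row_lin2 !mxE; ring. Qed.

Lemma V_lin0 a b s s' m : V (a *: s + b *: s') m = a *: V s m + b *: V s' m.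
Proof.
have [f0 _ _] := b_tri bF; rewrite /V !f0.
move: (F s e0 e0) (F s e0 e1) (F s e1 e0) (F s' e0 e0) (F s' e0 e1) (F s' e1 e0) => x y z x' y' z'.
by apply/rowP => j; rewrite !mxE; ring.
Qed.

Lemma V_sg s m : V s m *m sg = A m *: s.
Proof.
have h (a b c : K) (x y z : 'rV[K]_2) : (a *: x + b *: y + c *: z) *m (1%:M : 'M_2) = a *: x + b *: y + c *: z.
  by rewrite mulmx1.
rewrite /A /V !mulmxDl -!scalemxAl !(axis_formE bF).
move: (axis_form F sg e0 e0) (axis_form F sg e0 e1) (axis_form F sg e1 e0) => x y z.
by apply/rowP => j; rewrite !mxE /=; ring.
Qed.

Lemma V_kap s m : V s m *m kap = s *m N m.
Proof.
rewrite {1}[s]row2_decomp V_lin0 mulmxDl -!scalemxAl; apply/rowP => l.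
by rewrite mul2E row_lin2 ![N m _ l]mxE.
Qed.

Lemma V_split s m : V s m = row_mx (A m *: s) (s *m N m) *m (G : 'M_(2 + 2, 4)).
Proof.
rewrite -V_sg -V_kap -[LHS](mulmxKV Gu) GE; congr (_ *m G).
exact: (mul_mx_row (V s m) sg kap).
Qed.

Lemma A_lin a b x y : A (a *: x + b *: y) = a * A x + b * A y.
Proof. by rewrite /A V_lin mulmxDl -!scalemxAl row_lin2. Qed.

Lemma N_lin a b x y : N (a *: x + b *: y) = a *: N x + b *: N y.
Proof.
have NE m i j : N m i j = (V (unit_row K i) m *m kap) ord0 j by rewrite mxE.
have lin (X Y : 'M[K]_2) i j : (a *: X + b *: Y) i j = a * X i j + b * Y i j by rewrite !mxE.
by apply/matrixP => i j; rewrite lin !NE V_lin mulmxDl -!scalemxAl row_lin2.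
Qed.

Lemma V_unit2 s : V s (row3 0 0 1) = F s e1 e0.
Proof. by rewrite /V !mxE !inordK //= !scale0r scale1r !add0r. Qed.

Lemma V_unit1 s : V s (row3 0 1 0) = F s e0 e1.
Proof. by rewrite /V !mxE !inordK //= !scale0r scale1r !add0r addr0. Qed.

Lemma N2_unit : A (row3 0 0 1) = 0 -> \det (N (row3 0 0 1)) != 0.
Proof.
rewrite /A V_unit2 => A2; apply/eqP => /singular_right[c c0 Nc].
suff cz : c = 0 by rewrite cz eqxx in c0.
by apply: (no_vanishing_column bF base kapsg A2) => s; rewrite mulmxA -V_unit2 V_kap -mulmxA Nc mulmx0.
Qed.

Lemma N1_unit : A (row3 0 1 0) = 0 -> \det (N (row3 0 1 0)) != 0.
Proof.
rewrite /A V_unit1 => A2; apply/eqP => /singular_right[c c0 Nc].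
suff cz : c = 0 by rewrite cz eqxx in c0.
apply: (no_vanishing_column (bir_data_swap bF) base kapsg A2) => s.
by rewrite mulmxA -V_unit1 V_kap -mulmxA Nc mulmx0.
Qed.

(** The fourth monomial has coefficient zero, so its entry [e] in a relation is free. The rank-one
    condition at [e = 0] and at [e = 1] gives both equations. *)
Lemma kernel_V m : (forall s, V s m = 0) -> m ord0 (inord 0) = 0 /\ m ord0 (inord 1) * m ord0 (inord 2) = 0.
Proof.
move=> h; have [good [gi gk]] := b_kern bF; have [x gx _] := ex_good [::] gi.
have z e : bilin_comb (F (row2 1 x)) (m ord0 (inord 0)) (m ord0 (inord 1)) (m ord0 (inord 2)) e = 0.
  by rewrite /bilin_comb base scaler0 addr0; exact: h.
have h0 := gk x gx _ _ _ _ (z 0); have h1 := gk x gx _ _ _ _ (z 1).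
by rewrite mulr0 in h0; rewrite mulr1 -h0 in h1.
Qed.

(** By [kernel_V] a common zero is supported on a single monomial, the second or the third. If it is
    nonzero, [A] vanishes on that monomial, where [N] is then invertible. *)
Lemma AN_indep m : A m = 0 -> N m = 0 -> m = 0.
Proof.
have [a [b [c ->]]] := row3E m; move=> Am Nm.
have [] := kernel_V (m := row3 a b c).
  by move=> s; rewrite V_split Am Nm mulmx0 scale0r row_mx0 mul0mx.
have dz : \det (0 : 'M[K]_2) = 0 by rewrite det2E !mxE mul0r subr0.
rewrite !mxE !inordK //= => a0 /eqP; rewrite mulf_eq0 => /orP[] /eqP z0.
  have e : row3 a b c = c *: row3 0 0 1 + 0 *: row3 0 0 1 by rewrite row3Z a0 z0 scale0r addr0 !mulr0 mulr1.
  have [c0|c0] := eqVneq c 0; first by rewrite e c0 !scale0r addr0.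
  move: Am Nm; rewrite e A_lin N_lin mul0r scale0r !addr0 => /eqP; rewrite mulf_eq0 (negPf c0) /= => /eqP /N2_unit dn.
  by move/eqP; rewrite scaler_eq0 (negPf c0) /= => /eqP Nz; rewrite Nz dz eqxx in dn.
have e : row3 a b c = b *: row3 0 1 0 + 0 *: row3 0 0 1 by rewrite row3Z a0 z0 scale0r addr0 !mulr0 mulr1.
have [c0|c0] := eqVneq b 0; first by rewrite e c0 !scale0r addr0.
move: Am Nm; rewrite e A_lin N_lin mul0r scale0r !addr0 => /eqP; rewrite mulf_eq0 (negPf c0) /= => /eqP /N1_unit dn.
by move/eqP; rewrite scaler_eq0 (negPf c0) /= => /eqP Nz; rewrite Nz dz eqxx in dn.
Qed.

Lemma A_coordinates : exists2 Q : 'M[K]_3, Q \in unitmx &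
  forall m a b c, m *m Q = row3 a b c -> A m = a.
Proof.
pose al : 'rV[K]_3 := row3 (A (row3 1 0 0)) (A (row3 0 1 0)) (A (row3 0 0 1)).
have AE a b c : A (row3 a b c) = a * A (row3 1 0 0) + b * A (row3 0 1 0) + c * A (row3 0 0 1).
  have -> : row3 a b c = a *: row3 1 0 0 + 1 *: (b *: row3 0 1 0 + c *: row3 0 0 1).
    by rewrite !row3Z; apply/rowP => i; rewrite !mxE; case: i => [[|[|[|]]]] //= _; ring.
  by rewrite A_lin A_lin mul1r addrA.
have al0 : al != 0.
  apply/eqP => h; have [t [u]] := axis_form_neq0 bF; case/eqP.
  rewrite /axis_form base_V -/(A _) /mono3 AE.
  have [-> -> ->] : [/\ A (row3 1 0 0) = 0, A (row3 0 1 0) = 0 & A (row3 0 0 1) = 0].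
    by apply: row3_inj; rewrite -/al h; apply/rowP => i; rewrite !mxE; case: i => [[|[|[|]]]].
  by rewrite !mulr0 !addr0.
have [Q Qu rQ] := unit_first_row al0.
exists Q^T; first by rewrite unitmx_tr.
move=> m a b c h; have [x [y [z mE]]] := row3E m.
have := congr1 (fun m : 'rV[K]_3 => m ord0 ord0) h; rewrite [RHS]mxE /= => <-.
have QE j : Q ord0 j = al ord0 j by rewrite -rQ mxE.
by rewrite mE AE row3_mulE !mxE !QE /al !mxE !inordK.
Qed.

Section Pencil.
Variable Q : 'M[K]_3.
Hypothesis Qu : Q \in unitmx.
Hypothesis AQ : forall m a b c, m *m Q = row3 a b c -> A m = a.
Let Nh := N (row3 1 0 0 *m invmx Q).
Let N1 := N (row3 0 1 0 *m invmx Q).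
Let N2 := N (row3 0 0 1 *m invmx Q).

Lemma N_coord m a b c : m *m Q = row3 a b c -> N m = a *: Nh + (b *: N1 + c *: N2).
Proof.
move=> h; rewrite -[m](mulmxK Qu) h.
have -> : row3 a b c = a *: row3 1 0 0 + 1 *: (b *: row3 0 1 0 + c *: row3 0 0 1).
  by rewrite !row3Z; apply/rowP => i; rewrite !mxE; case: i => [[|[|[|]]]] //= _; ring.
by rewrite mulmxDl -!scalemxAl N_lin mulmxDl -!scalemxAl N_lin scale1r.
Qed.

Lemma V_coord s m a b c : m *m Q = row3 a b c ->
  V s m = row_mx (a *: s) (s *m (a *: Nh + (b *: N1 + c *: N2))) *m (G : 'M_(2 + 2, 4)).
Proof. by move=> h; rewrite V_split (AQ h) (N_coord h). Qed.

Lemma pencil_indep z w : z *: N1 + w *: N2 = 0 -> z = 0 /\ w = 0.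
Proof.
move=> h; have hQ : row3 0 z w *m invmx Q *m Q = row3 0 z w by rewrite mulmxKV.
have m0 : row3 0 z w *m invmx Q = 0.
  by apply: AN_indep; [rewrite (AQ hQ) | rewrite (N_coord hQ) h scale0r addr0].
move/eqP: m0; rewrite mulmx_unit_neq0 ?unitmx_inv // => /eqP h0.
have [] : [/\ (0 : K) = 0, z = 0 & w = 0] by apply: row3_inj; rewrite h0; apply/rowP => i; rewrite !mxE; case: i => [[|[|[|]]]].
by [].
Qed.

Lemma F_coord s t u : exists a b c, mono3 t u *m Q = row3 a b c /\
  F s t u = row_mx (a *: s) (s *m (a *: Nh + (b *: N1 + c *: N2))) *m (G : 'M_(2 + 2, 4)).
Proof.
have [a [b [c h]]] := row3E (mono3 t u *m Q); exists a, b, c; split=> //.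
by rewrite base_V (V_coord _ h).
Qed.

Lemma G_sg_kap : ((G : 'M_(2 + 2, 4)) *m sg = col_mx 1%:M 0) * ((G : 'M_(2 + 2, 4)) *m kap = col_mx 0 1%:M).
Proof.
have : (G : 'M_(2 + 2, 4)) *m row_mx sg kap = block_mx 1%:M 0 0 1%:M.
  by rewrite -GE -scalar_mx_block; exact: mulmxV.
by rewrite mul_mx_row block_mxEh => /eq_row_mx[-> ->].
Qed.

Lemma G_sg_kapE (x y : 'rV[K]_2) :
  (row_mx x y *m (G : 'M_(2 + 2, 4)) *m sg = x) * (row_mx x y *m (G : 'M_(2 + 2, 4)) *m kap = y).
Proof.
by split; rewrite -mulmxA G_sg_kap mul_row_col mulmx0 mulmx1 ?addr0 ?add0r.
Qed.

(** On all values, [kap c] and [sg (Nh c)] would both give [a s Nh c]; so they coincide, and [kapsg]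
    gives [c = 0]. *)
Lemma no_right_kernel (c : 'cV[K]_2) : N1 *m c = 0 -> N2 *m c = 0 -> c = 0.
Proof.
move=> h1 h2; apply: (kapsg (y := Nh *m c)); apply/eqP; rewrite -subr_eq0; apply/eqP.
apply: (b_span bF) => s t u; have [a [b [e [_ ->]]]] := F_coord s t u.
rewrite mulmxBr !mulmxA !G_sg_kapE -[s *m _ *m c]mulmxA mulmxDl mulmxDl -!scalemxAl h1 h2 !scaler0 !addr0.
by rewrite -scalemxAr mulmxA subrr.
Qed.

(** With [s] written in the basis [v], [v'], the values are (s0 a, s1 a, s1 b, s1 c) [Y]. The last
    three entries recover the monomials up to the factor s1, and with them the vector u0 t: this
    would be a linear inverse of [t]. *)
Lemma no_left_kernel (v : 'rV[K]_2) : v *m N1 = 0 -> v *m N2 = 0 -> v = 0.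
Proof.
move=> h1 h2; apply/eqP; apply: contraT => v0; have [P Pu rP] := unit_first_row v0.
pose v' := row ord_max P.
have [H [HE Hlin]] : exists H : 'rV[K]_2 -> 'rV[K]_2 -> 'rV[K]_4,
   (forall x y, row_mx x y *m (G : 'M_(2 + 2, 4)) = H x y) /\
   forall a b x y x' y', H (a *: x + b *: x') (a *: y + b *: y') = a *: H x y + b *: H x' y'.
  exists (fun x y => row_mx x y *m (G : 'M_(2 + 2, 4))); split=> // a b x y x' y'.
  by rewrite -add_row_mx -!scale_row_mx mulmxDl -!scalemxAl.
pose Y : 'M[K]_4 := \matrix_i nth 0 [:: H v (v *m Nh); H v' (v' *m Nh); H 0 (v' *m N1); H 0 (v' *m N2)] i.
have YE a b c d : row4 a b c d *m Y = a *: H v (v *m Nh) + b *: H v' (v' *m Nh)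
    + c *: H 0 (v' *m N1) + d *: H 0 (v' *m N2).
  have mE (i : nat) (x : 'rV[K]_4) j : (i < 4)%N -> nth 0 [:: H v (v *m Nh); H v' (v' *m Nh); H 0 (v' *m N1); H 0 (v' *m N2)] i = x ->
     Y (inord i) j = x ord0 j by move=> i4 <-; rewrite mxE inordK.
  apply/rowP => j; rewrite row4_mulE !(mE _ _ _ _ erefl) //.
  by move: (H v _) (H v' _) (H 0 _) (H 0 _) => x y z w; rewrite !mxE.
have FY s t u a b c : mono3 t u *m Q = row3 a b c ->
  F (s *m P) t u = row4 (s ord0 ord0 * a) (s ord0 ord_max * a) (s ord0 ord_max * b) (s ord0 ord_max * c) *m Y.
  move=> hQ; rewrite base_V (V_coord _ hQ) YE HE.
  have sP : s *m P = s ord0 ord0 *: v + s ord0 ord_max *: v'.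
    by apply/rowP => j; rewrite mul2E -rP /v' !mxE.
  set M := a *: Nh + _.
  have HZ x y z : H (x *: y) (x *: z) = x *: H y z.
    by have := Hlin x 0 y z 0 0; rewrite !scale0r !addr0.
  have Hv : H (a *: v) (v *m M) = a *: H v (v *m Nh).
    by rewrite /M !mulmxDr -!scalemxAr h1 h2 !scaler0 !addr0 HZ.
  have Hv' : H (a *: v') (v' *m M) = a *: H v' (v' *m Nh) + b *: H 0 (v' *m N1) + c *: H 0 (v' *m N2).
    rewrite -addrA -Hlin !scaler0 addr0 -[X in _ + X]scale1r -Hlin scaler0 addr0 scale1r.
    by rewrite /M !mulmxDr -!scalemxAr.
  rewrite sP mulmxDl -!scalemxAl.
  have -> : a *: (s ord0 ord0 *: v + s ord0 ord_max *: v') = s ord0 ord0 *: (a *: v) + s ord0 ord_max *: (a *: v').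
    by rewrite scalerDr !scalerA !(mulrC a).
  by rewrite Hlin Hv Hv' !scalerDr !scalerA !addrA.
have Yu : Y \in unitmx.
  rewrite unitmxE unitfE; apply/eqP => /eqP; rewrite -det_tr => /det0P[x x0 xY].
  case/eqP: x0; apply: trmx_inj; rewrite trmx0; apply: (b_span bF) => s t u.
  have [a [b [c h]]] := row3E (mono3 t u *m Q).
  rewrite -[s](mulmxKV Pu) (FY _ _ _ _ _ _ h) -mulmxA.
  by rewrite -[Y]trmxK -trmx_mul xY trmx0 mulmx0.
pose sel : 'M[K]_(3, 2) := \matrix_(i, j) (if j == ord0 then (i == inord 0)%:R else (i == inord 2)%:R).
pose L : 'M[K]_(4, 2) := invmx Y *m ((col_mx 0 (invmx Q) : 'M_(1 + 3, 3)) *m sel).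
have LE s t u : F (s *m P) t u *m L = (s ord0 ord_max * u ord0 ord0) *: t.
  have [a [b [c h]]] := row3E (mono3 t u *m Q).
  rewrite (FY _ _ _ _ _ _ h) /L mulmxA mulmxK // mulmxA.
  have r4 x x1 x2 x3 : row4 x x1 x2 x3 *m (col_mx 0 (invmx Q) : 'M_(1 + 3, 3)) = row3 x1 x2 x3 *m invmx Q.
    have : row_mx (x%:M : 'M_1) (row3 x1 x2 x3) *m col_mx 0 (invmx Q) = row3 x1 x2 x3 *m invmx Q.
      by rewrite mul_row_col mulmx0 add0r.
    move=> <-; congr (_ *m _); apply/rowP => i; rewrite !mxE.
    case: splitP => k /= ->; first by rewrite !ord1 mxE eqxx.
    by rewrite !mxE; case: k => [[|[|[|]]]].
  rewrite r4 -row3Z -scalemxAl -h mulmxK // -scalemxAl.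
  have selE j : (mono3 t u *m sel) ord0 j = u ord0 ord0 * t ord0 j.
    have [-> | ->] : j = ord0 \/ j = ord_max.
      by case: j => [[|[|]]] // hj; [left | right]; apply: val_inj.
    - by rewrite /mono3 row3_mulE !mxE -!val_eqE /= !inordK //=; ring.
    - by rewrite /mono3 row3_mulE !mxE -!val_eqE /= !inordK //=; ring.
  by apply/rowP => j; rewrite mxE selE [RHS]mxE mulrA.
have L0 : L = 0.
  apply: (b_nlt bF) => s t u; rewrite -[s](mulmxKV Pu) LE /wedge !mxE; ring.
have := LE (unit_row K ord_max) (unit_row K ord0) (unit_row K ord0).
rewrite L0 mulmx0 !e0E !e1E mulr1 scale1r => /esym/eqP.
by rewrite (negPf (unit_row_neq0 _ _)).
Qed.

(** The absence of common kernels provides an invertible member of the pencil of [N1] and [N2]. The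
    remaining matrix [Nh] is absorbed in the frame, since it contributes a fixed linear function of
    the first component [a s]. *)
Lemma normal_form_pencil : exists k (S : 'M[K]_2) (H : 'M[K]_4) (P : 'M[K]_3),
  [/\ S \in unitmx, H \in unitmx, P \in unitmx &
   forall m a z w, m *m P = row3 a z w ->
    [/\ forall s, V (s *m S) m = std k H s a z w, A m = a
      & A m = 0 -> \det (N m) != 0 -> z ^+ 2 - k * w ^+ 2 != 0]].
Proof.
have [z [w dn]] : exists z w, \det (z *: N1 + w *: N2) != 0.
  apply: boolp.contrapT => h.
  have [] := @singular_pencil _ N1 N2.
  - by move=> z w; apply/eqP; apply: contraT => n; case: h; exists z, w.
  - by case=> v [v0 h1 h2]; rewrite (no_left_kernel h1 h2) eqxx in v0.
  - by case=> c [c0 h1 h2]; rewrite (no_right_kernel h1 h2) eqxx in c0.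
have [k [L [M [B [Lu Mu Bu LNM]]]]] := pencil_normal_form (ex_intro _ z (ex_intro _ w dn)) pencil_indep.
clear z w dn.
pose T : 'M[K]_4 := block_mx L (L *m Nh) 0 (invmx M).
have Tu : T \in unitmx.
  have dT : \det T = \det L * \det (invmx M) by exact: (det_ublock L (L *m Nh) (invmx M)).
  by rewrite unitmxE dT unitrM -!unitmxE Lu unitmx_inv.
pose B' : 'M[K]_3 := block_mx (1%:M : 'M_1) 0 0 B.
have B'u : B' \in unitmx.
  have dB : \det B' = \det (1%:M : 'M[K]_1) * \det B by exact: (det_ublock (1%:M : 'M[K]_1) 0 B).
  by rewrite unitmxE dB det1 mul1r -unitmxE.
exists k, L, (T *m G), (Q *m B'); split=> //; rewrite ?unitmx_mul ?Tu ?Qu //.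
move=> m a z w; rewrite mulmxA; have [a' [b [c h]]] := row3E (m *m Q); rewrite h => hB.
have [aE zwE] : a' = a /\ row2 b c *m B = row2 z w.
  have rE x y y' : row3 x y y' = row_mx (x%:M : 'M_1) (row2 y y') :> 'rV_(1 + 2).
    apply/rowP => i; rewrite !mxE; case: splitP => j /= ->; first by rewrite !ord1 mxE eqxx.
    by rewrite !mxE; case: j => [[|[|]]].
  move: hB; rewrite !rE => hB.
  have : row_mx (a'%:M : 'M_1) (row2 b c) *m B' = row_mx (a'%:M : 'M_1) (row2 b c *m B).
    apply: etrans (mul_row_block (a'%:M : 'M_1) (row2 b c) (1%:M : 'M_1) 0 0 B) _.
    by rewrite mulmx1 !mulmx0 addr0 add0r.
  rewrite [LHS]hB => hh; have [h1 h2] := @eq_row_mx K 1 1 2 _ _ _ _ hh; split=> //.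
  by have := congr1 (fun m : 'M[K]_1 => m ord0 ord0) h1; rewrite !mxE !mulr1n.
rewrite aE in h; have Am := AQ h; split=> //.
  move=> s; rewrite (V_coord _ h).
  have -> : std k (T *m G) s a z w =
      row_mx (a *: s) (s *m ext_mx k z w) *m (T *m (G : 'M_(2 + 2, 4)) : 'M_(2 + 2, 4)).
    rewrite -vec_row_mx /std !mul2E !ext_mxE !mxE /=; congr (vec _ _ _ _ _); ring.
  rewrite -(LNM _ _ _ _ zwE) [RHS](mulmxA _ T); congr (_ *m _).
  have : row_mx (a *: s) (s *m (L *m (b *: N1 + c *: N2) *m M)) *m T =
     row_mx (a *: s *m L) (a *: s *m (L *m Nh) + s *m (L *m (b *: N1 + c *: N2) *m M) *m invmx M).
    apply: etrans (mul_row_block (a *: s) (s *m (L *m (b *: N1 + c *: N2) *m M)) L (L *m Nh) 0 (invmx M)) _.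
    by rewrite mulmx0 addr0.
  move=> hh; apply: etrans (esym hh); rewrite !mulmxA mulmxK // -!scalemxAl; apply: f_equal2 => //.
  by rewrite mulmxDr -scalemxAr.
rewrite Am (N_coord h) => -> ; rewrite scale0r add0r => dn.
have := LNM _ _ _ _ zwE => /(congr1 determinant); rewrite !det_mulmx.
have -> : \det (ext_mx k z w) = z ^+ 2 - k * w ^+ 2 by rewrite det2E !ext_mxE /=; ring.
move=> <-; rewrite !mulf_neq0 //; first by rewrite -unitfE -unitmxE.
by rewrite -unitfE -unitmxE.
Qed.
End Pencil.
End NormalFormProof.

Section NormalFormTheorem.
Variable K : numFieldType.
Local Notation e0 := (unit_row K ord0).
Local Notation e1 := (unit_row K ord_max).
Local Notation fst2 r := (r ord0 ord0).
Local Notation snd2 r := (r ord0 ord_max).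

Definition normal_form (F : 'rV[K]_2 -> 'rV[K]_2 -> 'rV[K]_2 -> 'rV[K]_4) k G a0 z0 w0 a1 z1 w1 a2 z2 w2 :=
  forall s t u, F s t u =
    let m0 := fst2 t * fst2 u in let m1 := fst2 t * snd2 u in let m2 := snd2 t * fst2 u in
    std k G s (m0 * a0 + m1 * a1 + m2 * a2) (m0 * z0 + m1 * z1 + m2 * z2) (m0 * w0 + m1 * w1 + m2 * w2).

Lemma unit_second_row (v : 'rV[K]_2) : v != 0 -> exists2 T : 'M[K]_2, T \in unitmx & e1 *m T = v.
Proof.
move=> v0; have [P Pu rP] := unit_first_row v0.
pose J : 'M[K]_2 := \matrix_(i, j) (i != j)%:R.
exists (J *m P).
  by rewrite unitmx_mul Pu andbT unitmxE unitfE det2E !mxE /= mul0r mulr1 sub0r oppr_eq0 oner_eq0.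
rewrite -rP mulmxA; have -> : e1 *m J = e0 by apply: row2_eq; rewrite mul2E !mxE /=; ring.
by rewrite rowE.
Qed.

Theorem normal_form_bir_data F sg : bir_data F sg ->
  exists k (S T U : 'M[K]_2) (G : 'M[K]_4) a0 z0 w0 a1 z1 w1 a2 z2 w2,
  [/\ [/\ S \in unitmx, T \in unitmx, U \in unitmx & G \in unitmx],
      normal_form (fun s t u => F (s *m S) (t *m T) (u *m U)) k G a0 z0 w0 a1 z1 w1 a2 z2 w2,
      det3 a0 z0 w0 a1 z1 w1 a2 z2 w2 != 0,
      a1 = 0 -> z1 ^+ 2 - k * w1 ^+ 2 != 0 & a2 = 0 -> z2 ^+ 2 - k * w2 ^+ 2 != 0].
Proof.
move=> bF0; have [ts [us [ts0 us0 hts]]] := base_point bF0.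
have [T Tu eT] := unit_second_row ts0; have [U Uu eU] := unit_second_row us0.
have bF := bir_data_change Tu Uu bF0; set F' := fun s t u => _ in bF.
have base s : F' s e1 e1 = 0 by rewrite /F' eT eU.
have [G [kap [Gu GE kc]]] := axis_coordinates bF.
have [Q Qu AQ] := A_coordinates bF base.
have [k [S [H [P [Su Hu Pu VP]]]]] := normal_form_pencil bF base Gu GE kc Qu AQ.
have [a0 [z0 [w0 [a1 [z1 [w1 [a2 [z2 [w2 PE]]]]]]]]] := mx3E P.
exists k, S, T, U, H, a0, z0, w0, a1, z1, w1, a2, z2, w2; split=> //.
- move=> s t u /=; rewrite -/(F' _ _ _) (base_V bF base).
  have := row3_col3 (fst2 t * fst2 u) (fst2 t * snd2 u) (snd2 t * fst2 u) a0 z0 w0 a1 z1 w1 a2 z2 w2.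
  by rewrite -PE -/(mono3 t u) => /VP[-> _ _].
- by rewrite -det_col3 -PE -unitfE -unitmxE.
- move=> a10; have [|_ Am h] := VP (row3 0 1 0) a1 z1 w1.
    by rewrite PE row3_col3 !(mul0r, mul1r, add0r, addr0).
  by rewrite a10 in Am; apply: h => //; exact: (N1_unit bF base kc).
- move=> a20; have [|_ Am h] := VP (row3 0 0 1) a2 z2 w2.
    by rewrite PE row3_col3 !(mul0r, mul1r, add0r, addr0).
  by rewrite a20 in Am; apply: h => //; exact: (N2_unit bF base kc).
Qed.
End NormalFormTheorem.

Lemma trimap_trilinear (K : numFieldType) (w : 'rV[K]_tri_dim) : trilinear (trimap w).
Proof.
have lin (a b x0 x1 y0 y1 : K) (X Y : 'rV[K]_4) : (a * x0 + b * y0) *: X + (a * x1 + b * y1) *: Y =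
    a *: (x0 *: X + x1 *: Y) + b *: (y0 *: X + y1 *: Y).
  by rewrite !scalerDr !scalerA !scalerDl addrACA.
split=> a b x y s t.
- by rewrite (trimap_lin0 w (a *: x + _)) (trimap_lin0 w x) (trimap_lin0 w y) !row_lin2 lin.
- by rewrite (trimap_lin1 w _ (a *: x + _)) (trimap_lin1 w _ x) (trimap_lin1 w _ y) !row_lin2 lin.
- by rewrite (trimap_lin2 w _ _ (a *: x + _)) (trimap_lin2 w _ _ x) (trimap_lin2 w _ _ y) !row_lin2 lin.
Qed.

Theorem real_normal_form (R : realType) (w : 'rV[R]_tri_dim) : real_bir122 w ->
  exists k (S T U : 'M[R]_2) (G : 'M[R]_4) a0 z0 w0 a1 z1 w1 a2 z2 w2,
  [/\ [/\ S \in unitmx, T \in unitmx, U \in unitmx & G \in unitmx],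
      normal_form (fun s t u => trimap w (s *m S) (t *m T) (u *m U)) k G a0 z0 w0 a1 z1 w1 a2 z2 w2,
      det3 a0 z0 w0 a1 z1 w1 a2 z2 w2 != 0,
      a1 = 0 -> z1 ^+ 2 - k * w1 ^+ 2 != 0 & a2 = 0 -> z2 ^+ 2 - k * w2 ^+ 2 != 0].
Proof.
move=> bir; have [sg [sg0 hsg]] := real_sigma bir.
apply: (@normal_form_bir_data _ (trimap w) sg); split=> //.
- exact: trimap_trilinear.
- exact: real_span.
- by move=> s t u; apply/eqP; rewrite /wedge subr_eq0; apply/eqP.
- exact: real_kernel.
- move=> L hL; apply: (real_no_linear bir (k := 1)) => // s t u.
  by apply/eqP; rewrite -subr_eq0; apply/eqP; exact: hL.
- move=> L hL; apply: (real_no_linear bir (k := inord 2)).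
    by rewrite -val_eqE /= inordK.
  move=> s t u; rewrite inordK //.
  by apply/eqP; rewrite -subr_eq0; apply/eqP; exact: hL.
Qed.

(** * Congruences of a map in normal form *)

Section Frames.
Variable K : numFieldType.
Local Notation fst2 r := (r ord0 ord0).
Local Notation snd2 r := (r ord0 ord_max).

Definition rows4 (v0 v1 v2 v3 : 'rV[K]_4) : 'M[K]_4 := \matrix_i nth 0 [:: v0; v1; v2; v3] i.

Lemma vec_rows4 v0 v1 v2 v3 a b c d :
  vec (rows4 v0 v1 v2 v3) a b c d = a *: v0 + b *: v1 + c *: v2 + d *: v3.
Proof.
have mE (i : nat) (x : 'rV[K]_4) j : (i < 4)%N -> nth 0 [:: v0; v1; v2; v3] i = x ->
  rows4 v0 v1 v2 v3 (inord i) j = x ord0 j by move=> i4 <-; rewrite mxE inordK.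
by apply/rowP => j; rewrite /vec row4_mulE !(mE _ _ _ _ erefl) // !mxE.
Qed.

Lemma vec_sum4 G x y z w a0 b0 c0 d0 a1 b1 c1 d1 a2 b2 c2 d2 a3 b3 c3 d3 :
  x *: vec G a0 b0 c0 d0 + y *: vec G a1 b1 c1 d1 + z *: vec G a2 b2 c2 d2 + w *: vec G a3 b3 c3 d3 =
  vec G (x * a0 + y * a1 + z * a2 + w * a3) (x * b0 + y * b1 + z * b2 + w * b3)
        (x * c0 + y * c1 + z * c2 + w * c3) (x * d0 + y * d1 + z * d2 + w * d3) :> 'rV[K]_4.
Proof.
by rewrite vec_comb -[X in X + _ + _]scale1r vec_comb -[X in X + _]scale1r vec_comb !mul1r.
Qed.

Lemma rows4_unit (M : 'M[K]_4) :
  (forall a b c d, vec M a b c d = 0 -> [&& a == 0, b == 0, c == 0 & d == 0]) -> M \in unitmx.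
Proof.
move=> h; rewrite unitmxE unitfE; apply/negP => /det0P[v v0 vM].
move: v0; rewrite [v]row4E; set a := v _ _; set b := v _ _; set c := v _ _; set d := v _ _.
have /h/and4P[/eqP-> /eqP-> /eqP-> /eqP->] : vec M a b c d = 0 by rewrite /vec -row4E.
by case/eqP; apply/rowP => i; rewrite !mxE; case: i => [[|[|[|[|]]]]].
Qed.

Lemma line01_rows4 v0 v1 v2 v3 : line01 (rows4 v0 v1 v2 v3) = line_through v0 v1.
Proof. by rewrite /line01 !vec_rows4 !scale0r !scale1r !addr0 add0r. Qed.

Lemma line23_rows4 v0 v1 v2 v3 : line23 (rows4 v0 v1 v2 v3) = line_through v2 v3.
Proof. by rewrite /line23 !vec_rows4 !scale0r !scale1r !addr0 !add0r. Qed.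

Lemma klein_closed : zclosed (@klein_quadric K).
Proof.
pose X k := 'X_(inord k) : {mpoly K[6]}.
have Xh k : X k \is 1.-homog by rewrite dhomogX /= mdeg1.
exists (fun f => f = X 0%N * X 5%N - X 1%N * X 4%N + X 2%N * X 3%N); split=> [f ->|v].
  by exists 2%N; rewrite rpredD ?rpredB // ?(dhomogM (Xh _) (Xh _)).
split=> [[v0 h]|[v0 h]]; split=> //.
  by move=> f ->; rewrite mevalD mevalB !mevalM !mevalXU.
by have := h _ erefl; rewrite mevalD mevalB !mevalM !mevalXU.
Qed.

Lemma pencil_lines_klein (F0 F1 : 'rV[K]_2 -> 'rV[K]_2 -> 'rV[K]_4) :
  psubset (pencil_lines F0 F1) (@klein_quadric K).
Proof.
apply: zclosure_min klein_closed _ => p [L [[Ll _] [_ [u [v [LE ->]]]]]].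
by apply/klein_plucker/plucker_neq0/is_line_through; rewrite -LE.
Qed.

Section Congruences.
Variables (k : K) (G : 'M[K]_4).
Hypothesis Gu : G \in unitmx.

(** For the line spanned by the two values of [std] the Plücker coordinates are [a ^ 2], [k a w],
    [a z], [- a z], [- a w], [z ^ 2 - k w ^ 2]. They give an equation of S over the base field for
    every [k], whether or not its roots belong to the field. *)
Definition spec_mx : 'M[K]_(4, 6) := \matrix_i nth 0
  [:: row6 1 0 0 0 0 0; row6 0 0 1 (-1) 0 0; row6 0 k 0 0 (-1) 0; row6 0 0 0 0 0 1] i.

Lemma row4_spec a b c d : row4 a b c d *m spec_mx = row6 a (k * c) b (- b) (- c) d.
Proof.
apply/rowP => j; rewrite row4_mulE !mxE !inordK //= !mxE.
by case: j => [[|[|[|[|[|[|]]]]]]] //= _; ring.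
Qed.

Lemma spec_mx_inv : right_inv spec_mx.
Proof.
exists (\matrix_(i, j) nth 0 (nth [::] [:: [:: 1; 0; 0; 0]; [::]; [:: 0; 1; 0; 0]; [::]; [:: 0; 0; -1; 0]; [:: 0; 0; 0; 1]] i) j).
apply/row_matrixP => i; rewrite !rowE mulmx1 mulmxA.
have [a [b [c [d ->]]]] : exists a b c d, delta_mx ord0 i = row4 a b c d :> 'rV[K]_4.
  by rewrite [delta_mx _ _]row4E; do 4 eexists.
rewrite row4_spec; apply/rowP => j; rewrite row6_mulE !mxE !inordK //=.
by case: j => [[|[|[|[|]]]]] //= _; ring.
Qed.

Lemma spectral_real (M : 'M[K]_3) (F0 F1 : 'rV[K]_2 -> 'rV[K]_2 -> 'rV[K]_4) :
  M \in unitmx ->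
  (forall t u a z w, mono3 t u *m M = row3 a z w ->
     F0 t u = std k G (unit_row K ord0) a z w /\ F1 t u = std k G (unit_row K ord_max) a z w) ->
  forall p, pencil_lines F0 F1 p <-> quadric_surface (spec_mx *m compound G) 1 0 (- k) p.
Proof.
move=> Mu hF; apply: (mono3_surface (M := M)) => //.
- exact: right_inv_compound spec_mx_inv.
- by rewrite oner_eq0.
move=> t u a z w /hF[-> ->]; rewrite /std plucker_vec mulmxA row4_spec !mxE /= /qf.
by congr (row6 _ _ _ _ _ _ *m _); ring.
Qed.

(** If [nu ^ 2 = k], then (nu, 1) is a left eigenvector of every [ext_mx k z w], with eigenvalue
    [z + nu w]. Hence all values of the map at [s = (nu, 1)] lie on the line of the first two rows,
    and similarly for [- nu] and the other two. *)
Definition eigen_frame nu := rows4 (vec G nu 1 0 0) (vec G 0 0 nu 1)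
  (vec G (- nu) 1 0 0) (vec G 0 0 (- nu) 1).

Lemma eigen_frame_unit nu : nu != 0 -> eigen_frame nu \in unitmx.
Proof.
move=> n0; apply: rows4_unit => a b c d; rewrite vec_rows4 vec_sum4 => /eqP.
rewrite vec_eq0 // !(mulr0, mulr1, addr0, add0r) => /and4P[/eqP h0 /eqP h1 /eqP h2 /eqP h3].
have solve x y : x * nu + y * - nu = 0 -> x + y = 0 -> (x == 0) && (y == 0).
  move=> e1 e2; have yE : y = - x by apply/eqP; rewrite -addr_eq0 addrC e2.
  move: e1; rewrite yE mulrNN -mulr2n => /eqP; rewrite mulrn_eq0 /= mulf_eq0 (negPf n0) orbF => /eqP ->.
  by rewrite oppr0 eqxx.
have /andP[-> ->] : (a == 0) && (c == 0).
  by apply: solve.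
by apply: solve.
Qed.

Lemma spectral_eigen (M : 'M[K]_3) (F0 F1 : 'rV[K]_2 -> 'rV[K]_2 -> 'rV[K]_4) nu :
  nu ^+ 2 = k -> nu != 0 -> M \in unitmx ->
  (forall t u a z w, mono3 t u *m M = row3 a z w ->
     F0 t u = std k G (unit_row K ord0) a z w /\ F1 t u = std k G (unit_row K ord_max) a z w) ->
  forall p, pencil_lines F0 F1 p <-> join_surface (eigen_frame nu) p.
Proof.
move=> nk n0 Mu hF.
pose C : 'M[K]_2 := \matrix_(i, j) (if j == ord0 then (if i == ord0 then nu else - nu) else 1).
have Cu : C \in unitmx.
  rewrite unitmxE unitfE det2E !mxE /= mulr1 mul1r opprK -mulr2n mulrn_eq0 /=; exact: n0.
pose A0 t u := nu *: F0 t u + F1 t u; pose A1 t u := - nu *: F0 t u + F1 t u.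
have change p : pencil_lines F0 F1 p <-> pencil_lines A0 A1 p.
  apply: (pencil_lines_change (S := 1%:M) (U := 1%:M) (T := invmx C)); rewrite ?unitmx1 ?unitmx_inv //.
  move=> t u r; rewrite !mulmx1 /A0 /A1 -{1 2}[r](mulmxKV Cu); set q := r *m invmx C.
  move: q => q; rewrite !mul2E !mxE /= !mulr1 !scalerDr !scalerA !scalerDl.
  exact: addrACA.
move=> p; rewrite change.
pose M' : 'M[K]_3 := col3 (row3 1 0 0) (row3 0 1 1) (row3 0 (- nu) nu).
have M'u : M' \in unitmx.
  rewrite unitmxE unitfE det_col3 /det3 !(mul0r, mul1r, mulr0, addr0, subr0, subrr) opprK -mulr2n.
  by rewrite mulrn_eq0.
apply: (spectral_join (M := M *m M')); rewrite ?unitmx_mul ?Mu ?eigen_frame_unit //.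
move=> t u a b c; rewrite mulmxA; have [a' [z [w h]]] := row3E (mono3 t u *m M).
have [h0 h1] := hF _ _ _ _ _ h.
rewrite h row3_col3 => /row3_inj[<- <- <-]; rewrite /A0 /A1 h0 h1 /std !mxE /=.
rewrite -[X in _ + X = _ /\ _]scale1r -[X in _ /\ _ + X = _]scale1r !vec_comb.
rewrite !vec_rows4 !vec_sum4; split; congr (vec _ _ _ _ _); rewrite -?nk; ring.
Qed.

Definition double_frame := rows4 (vec G 0 1 0 0) (vec G 0 0 0 1) (vec G 1 0 0 0) (vec G 0 0 1 0).

Lemma double_frame_unit : double_frame \in unitmx.
Proof.
apply: rows4_unit => a b c d; rewrite vec_rows4 vec_sum4 => /eqP.
by rewrite vec_eq0 // !(mulr0, mulr1, addr0, add0r) => /and4P[-> -> -> ->].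
Qed.

Lemma spectral_double (M : 'M[K]_3) (F0 F1 : 'rV[K]_2 -> 'rV[K]_2 -> 'rV[K]_4) :
  k = 0 -> M \in unitmx ->
  (forall t u a z w, mono3 t u *m M = row3 a z w ->
     F0 t u = std k G (unit_row K ord0) a z w /\ F1 t u = std k G (unit_row K ord_max) a z w) ->
  forall p, pencil_lines F0 F1 p <-> cone_surface double_frame p.
Proof.
move=> k0 Mu hF.
pose C : 'M[K]_2 := \matrix_(i, j) (i != j)%:R.
have Cu : C \in unitmx.
  by rewrite unitmxE unitfE det2E !mxE /= mul0r mulr1 sub0r oppr_eq0 oner_eq0.
have change p : pencil_lines F0 F1 p <-> pencil_lines F1 F0 p.
  apply: (pencil_lines_change (S := 1%:M) (U := 1%:M) (T := C)); rewrite ?unitmx1 //.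
  by move=> t u r; rewrite !mulmx1 !mul2E !mxE /= !mulr0 !mulr1 addr0 add0r addrC.
move=> p; rewrite change.
pose M' : 'M[K]_3 := col3 (row3 1 0 0) (row3 0 0 1) (row3 0 1 0).
have M'u : M' \in unitmx.
  rewrite unitmxE unitfE det_col3 /det3 !(mul0r, mul1r, mulr0, addr0, subr0, subrr, sub0r).
  by rewrite oppr_eq0 oner_eq0.
apply: (spectral_cone (M := M *m M')); rewrite ?unitmx_mul ?Mu ?double_frame_unit //.
move=> t u a b c; rewrite mulmxA; have [a' [z [w h]]] := row3E (mono3 t u *m M).
have [h0 h1] := hF _ _ _ _ _ h.
rewrite h row3_col3 => /row3_inj[<- <- <-]; rewrite h0 h1 /std !mxE /= k0.
by rewrite !vec_rows4 !vec_sum4; split; congr (vec _ _ _ _ _); ring.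
Qed.
End Congruences.
End Frames.

Section Transversals.
Variable K : numFieldType.
Local Notation fst2 r := (r ord0 ord0).
Local Notation snd2 r := (r ord0 ord_max).
Local Notation e0 := (unit_row K ord0).
Local Notation e1 := (unit_row K ord_max).
Variables (k : K) (G : 'M[K]_4).
Hypothesis Gu : G \in unitmx.

Definition join_frame a z w :=
  rows4 (vec G 0 0 1 0) (vec G 0 0 0 1) (std k G e0 a z w) (std k G e1 a z w).

(** For [a = 0] the points [std k G s 0 z w] lie on the axis. The frame pairs each of them with the
    direction [s], and this pairing is the ruled quadric that carries the double structure. *)
Definition cone_frame z w :=
  rows4 (std k G e0 0 z w) (std k G e1 0 z w) (vec G 1 0 0 0) (vec G 0 1 0 0).

Lemma std_e0 a z w : std k G e0 a z w = vec G a 0 z w.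
Proof. by rewrite /std !mxE /=; congr (vec _ _ _ _ _); ring. Qed.

Lemma std_e1 a z w : std k G e1 a z w = vec G 0 a (k * w) z.
Proof. by rewrite /std !mxE /=; congr (vec _ _ _ _ _); ring. Qed.

Lemma std_comb a z w x y :
  x *: std k G e0 a z w + y *: std k G e1 a z w = vec G (x * a) (y * a) (x * z + y * (k * w)) (x * w + y * z).
Proof. by rewrite std_e0 std_e1 vec_comb !mulr0 addr0 add0r. Qed.

Lemma vec_cone_frame z w a b c d :
  vec (cone_frame z w) a b c d = vec G c d (a * z + b * (k * w)) (a * w + b * z).
Proof. by rewrite vec_rows4 std_e0 std_e1 vec_sum4; congr (vec _ _ _ _ _); ring. Qed.

Lemma join_frame_unit a z w : a != 0 -> join_frame a z w \in unitmx.
Proof.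
move=> a0; apply: rows4_unit => x y x' y'; rewrite vec_rows4 std_e0 std_e1 vec_sum4 => /eqP.
rewrite vec_eq0 // !(mulr0, mulr1, addr0, add0r) !mulf_eq0 (negPf a0) !orbF => /and4P[hx /eqP-> + +].
by rewrite (eqP hx) !(mul0r, addr0) eqxx => -> ->.
Qed.

Lemma cone_frame_unit z w : z ^+ 2 - k * w ^+ 2 != 0 -> cone_frame z w \in unitmx.
Proof.
move=> d0; apply: rows4_unit => x y x' y'; rewrite vec_rows4 std_e0 std_e1 vec_sum4 => /eqP.
rewrite vec_eq0 // !(mulr0, mulr1, addr0, add0r) => /and4P[-> -> /eqP h1 /eqP h2].
have hx : x * (z ^+ 2 - k * w ^+ 2) = 0.
  transitivity (z * (x * z + y * (k * w)) - k * w * (x * w + y * z)); first by ring.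
  by rewrite h1 h2 !mulr0 subr0.
have hy : y * (z ^+ 2 - k * w ^+ 2) = 0.
  transitivity (z * (x * w + y * z) - w * (x * z + y * (k * w))); first by ring.
  by rewrite h1 h2 !mulr0 subr0.
by move/eqP: hx; move/eqP: hy; rewrite !mulf_eq0 (negPf d0) !orbF => -> ->.
Qed.

Lemma cone_frame_axis z w : z ^+ 2 - k * w ^+ 2 != 0 ->
  line_through (std k G e0 0 z w) (std k G e1 0 z w) = line_through (vec G 0 0 1 0) (vec G 0 0 0 1).
Proof.
move=> d0; apply: line_eq.
- by have := is_line01 (cone_frame_unit d0); rewrite line01_rows4.
- by have := is_line23 Gu; rewrite /line23.
move=> v /mem_line[a [b ->]]; rewrite std_e0 std_e1; apply/mem_line.
exists (a * z + b * (k * w)), (a * w + b * z); rewrite !vec_comb; congr (vec _ _ _ _ _); ring.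
Qed.

(** Each quadric assigns tangent planes to the points of the axis through its pairing with the
    directions [s]. The two pairings differ by multiplication with p + q i = (z1 + w1 i) / (z2 + w2
    i); equality of the tangent planes already at one point forces q = 0. *)
Lemma cone_frames_distinct z1 w1 z2 w2 :
  z1 ^+ 2 - k * w1 ^+ 2 != 0 -> z2 ^+ 2 - k * w2 ^+ 2 != 0 -> w1 * z2 - z1 * w2 != 0 ->
  ~ same_double_line (line01 (cone_frame z1 w1)) (ruled_quadric (cone_frame z1 w1)) (ruled_quadric (cone_frame z2 w2)).
Proof.
move=> d1 d2 dn; have J1u := cone_frame_unit d1; have J2u := cone_frame_unit d2.
have ll : line01 (cone_frame z1 w1) = line01 (cone_frame z2 w2).
  by rewrite !line01_rows4 !cone_frame_axis.
move/(same_double_line_grad J1u J2u ll); set d := z2 ^+ 2 - _ in d2.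
have v01 z w c e : vec G c e 0 0 = vec (cone_frame z w) 0 0 c e.
  by rewrite vec_cone_frame !mul0r addr0.
pose p := (z1 * z2 - k * w1 * w2) / d; pose q := (w1 * z2 - z1 * w2) / d.
have P12 : vec (cone_frame z1 w1) 1 0 0 0 = vec (cone_frame z2 w2) p q 0 0.
  by rewrite !vec_cone_frame; congr (vec _ _ _ _ _); rewrite /p /q /d; field.
have inM : vec (cone_frame z1 w1) 1 0 0 0 \in line01 (cone_frame z1 w1).
  by apply/mem_line01; exists 1, 0.
move=> /(_ _ inM)[c hc].
have hc' a b : 1 * b - 0 * a = c * (p * b - q * a).
  have <- : grad (ruled_quadric (cone_frame z1 w1)) (vec (cone_frame z1 w1) 1 0 0 0) (vec G a b 0 0) = 1 * b - 0 * a.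
    by rewrite (v01 z1 w1) grad_ruled_quadric //; ring.
  have <- : grad (ruled_quadric (cone_frame z2 w2)) (vec (cone_frame z2 w2) p q 0 0) (vec G a b 0 0) = p * b - q * a.
    by rewrite (v01 z2 w2) grad_ruled_quadric //; ring.
  by rewrite -P12.
have h1 := hc' 0 1; have h2 := hc' 1 0.
have c0 : c != 0 by apply/eqP => c0; move/eqP: h1; rewrite c0 !mul0r subr0 mul1r oner_eq0.
have /eqP : q = 0.
  apply: (mulfI c0); transitivity (- (c * (p * 0 - q * 1))); first by ring.
  by rewrite -h2; ring.
by rewrite /q mulf_eq0 invr_eq0 (negPf d2) orbF (negPf dn).
Qed.

Variables (a0 z0 w0 a1 z1 w1 a2 z2 w2 : K).
Hypothesis dn : det3 a0 z0 w0 a1 z1 w1 a2 z2 w2 != 0.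
Variables F0 F1 : 'rV[K]_2 -> 'rV[K]_2 -> 'rV[K]_4.
Hypothesis F0E : forall s u, F0 s u = std k G s (fst2 u * a0 + snd2 u * a1)
  (fst2 u * z0 + snd2 u * z1) (fst2 u * w0 + snd2 u * w1).
Hypothesis F1E : forall s u, F1 s u = fst2 u *: std k G s a2 z2 w2.

(** Subtracting [a / a2] times the row (a2, z2, w2) brings the pencil into the form of
    [transversal_join]; the minor that remains is [det3] divided by [a2]. *)
Lemma pencil_join : a2 != 0 -> forall p, pencil_lines F0 F1 p <-> join_surface (join_frame a2 z2 w2) p.
Proof.
move=> a2n.
pose z' z a := z - a / a2 * z2; pose w' w a := w - a / a2 * w2.
apply: (@transversal_join _ _ (z' z0 a0) (w' w0 a0) (k * w' w0 a0) (z' z0 a0)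
   (z' z1 a1) (w' w1 a1) (k * w' w1 a1) (z' z1 a1) (a0 / a2) (a1 / a2)).
- exact: join_frame_unit.
- move=> s u; rewrite F0E vec_rows4 std_e0 std_e1 vec_sum4 /std /z' /w'.
  by congr (vec _ _ _ _ _); field.
- move=> s u; rewrite F1E vec_rows4 std_e0 std_e1 vec_sum4 /std.
  by congr (_ *: vec _ _ _ _ _); ring.
apply: contra dn => /and3P[/eqP h _ _]; apply/eqP; transitivity (a2 * (z' z0 a0 * w' w1 a1 - w' w0 a0 * z' z1 a1)).
  by rewrite /det3 /z' /w'; field.
by rewrite h mulr0.
Qed.

(** The constants [z'] and [w'] are the components of (z + w i) / (z2 + w2 i), that is, the pencil
    relative to its member on the axis. *)
Lemma pencil_cone : a2 = 0 -> z2 ^+ 2 - k * w2 ^+ 2 != 0 ->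
  forall p, pencil_lines F0 F1 p <-> cone_surface (cone_frame z2 w2) p.
Proof.
move=> a20 d0; set d := z2 ^+ 2 - _ in d0.
pose z' z w := (z * z2 - k * w * w2) / d; pose w' z w := (w * z2 - z * w2) / d.
apply: (@transversal_cone _ _ (z' z0 w0) (w' z0 w0) (k * w' z0 w0) (z' z0 w0)
   (z' z1 w1) (w' z1 w1) (k * w' z1 w1) (z' z1 w1) a0 a1).
- exact: cone_frame_unit.
- move=> s u; rewrite F0E vec_rows4 std_e0 std_e1 vec_sum4 /std /z' /w' /d.
  by congr (vec _ _ _ _ _); field.
- move=> s u; rewrite F1E vec_rows4 std_e0 std_e1 vec_sum4 /std a20.
  by congr (_ *: vec _ _ _ _ _); ring.
apply: contra dn => /and3P[/eqP h _ _]; apply/eqP; transitivity (- d * (a0 * w' z1 w1 - a1 * w' z0 w0)).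
  by rewrite /det3 /w' a20; field.
by rewrite h mulr0.
Qed.
End Transversals.

Section GenericCongruences.
Variable K : numFieldType.
Local Notation fst2 r := (r ord0 ord0).
Local Notation snd2 r := (r ord0 ord_max).
Local Notation e0 := (unit_row K ord0).
Local Notation e1 := (unit_row K ord_max).

Lemma vecZ (G : 'M[K]_4) c x y z t : c *: vec G x y z t = vec G (c * x) (c * y) (c * z) (c * t).
Proof.
by rewrite -[LHS]addr0 -(scale0r (vec G 0 0 0 0)) vec_comb; congr (vec _ _ _ _ _); rewrite mulr0 addr0.
Qed.

Lemma stdZ k (G : 'M[K]_4) s c a z w : c *: std k G s a z w = std k G s (c * a) (c * z) (c * w).
Proof. by rewrite /std vecZ; congr (vec _ _ _ _ _); ring. Qed.

Lemma normal_form_units F k G a0 z0 w0 a1 z1 w1 a2 z2 w2 : trilinear F ->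
  (forall i j l : 'I_2, F (unit_row K i) (unit_row K j) (unit_row K l) =
    let m0 := (j == ord0)%:R * (l == ord0)%:R in let m1 := (j == ord0)%:R * (l != ord0)%:R in
    let m2 := (j != ord0)%:R * (l == ord0)%:R in
    std k G (unit_row K i) (m0 * a0 + m1 * a1 + m2 * a2) (m0 * z0 + m1 * z1 + m2 * z2) (m0 * w0 + m1 * w1 + m2 * w2)) ->
  normal_form F k G a0 z0 w0 a1 z1 w1 a2 z2 w2.
Proof.
move=> [f0 f1 f2] h s t u; rewrite {1}[s]row2_decomp f0 {1 2}[t]row2_decomp !f1 {1 2 3 4}[u]row2_decomp !f2 !h /=.
rewrite !std_e0 !std_e1 !vec_comb /std; congr (vec _ _ _ _ _); ring.
Qed.

Section Changed.
Variables (w : 'rV[K]_tri_dim) (S T U : 'M[K]_2).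
Hypotheses (Su : S \in unitmx) (Tu : T \in unitmx) (Uu : U \in unitmx).
Let F s t u := trimap w (s *m S) (t *m T) (u *m U).

Lemma param_congruence0_change p : param_congruence w 0 p <-> pencil_lines (fun t u => F e0 t u) (fun t u => F e1 t u) p.
Proof.
rewrite param_congruence0; apply: (pencil_lines_change (S := invmx T) (U := invmx U) (T := invmx S)).
1-3: by rewrite unitmx_inv.
move=> t u r; rewrite -trimap_lin0 /F !mulmxKV //.
have [f0 _ _] := trimap_trilinear w.
rewrite -f0 !scalemxAl -mulmxDl -row2_decomp mulmxKV //.
Qed.

Lemma param_congruence1_change p : param_congruence w 1 p <-> pencil_lines (fun s u => F s e0 u) (fun s u => F s e1 u) p.
Proof.
rewrite param_congruence1; apply: (pencil_lines_change (S := invmx S) (U := invmx U) (T := invmx T)).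
1-3: by rewrite unitmx_inv.
move=> t u r; rewrite -trimap_lin1 /F !mulmxKV //.
have [_ f0 _] := trimap_trilinear w.
rewrite -f0 !scalemxAl -mulmxDl -row2_decomp mulmxKV //.
Qed.

Lemma param_congruence2_change p : param_congruence w 2 p <-> pencil_lines (fun s t => F s t e0) (fun s t => F s t e1) p.
Proof.
rewrite param_congruence2; apply: (pencil_lines_change (S := invmx S) (U := invmx T) (T := invmx U)).
1-3: by rewrite unitmx_inv.
move=> t u r; rewrite -trimap_lin2 /F !mulmxKV //.
have [_ _ f0] := trimap_trilinear w.
rewrite -f0 !scalemxAl -mulmxDl -row2_decomp mulmxKV //.
Qed.
End Changed.

Section NormalForm.
Variables (F : 'rV[K]_2 -> 'rV[K]_2 -> 'rV[K]_2 -> 'rV[K]_4) (k : K) (G : 'M[K]_4).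
Variables (a0 z0 w0 a1 z1 w1 a2 z2 w2 : K).
Hypothesis Gu : G \in unitmx.
Hypothesis nf : normal_form F k G a0 z0 w0 a1 z1 w1 a2 z2 w2.
Hypothesis dn : det3 a0 z0 w0 a1 z1 w1 a2 z2 w2 != 0.
Let S0 := pencil_lines (fun t u => F e0 t u) (fun t u => F e1 t u).
Let S1 := pencil_lines (fun s u => F s e0 u) (fun s u => F s e1 u).
Let S2 := pencil_lines (fun s t => F s t e0) (fun s t => F s t e1).

Let M := col3 (row3 a0 z0 w0) (row3 a1 z1 w1) (row3 a2 z2 w2).
Let Mu : M \in unitmx.
Proof. by rewrite unitmxE unitfE det_col3. Qed.
Let hS t u a z w : mono3 t u *m M = row3 a z w -> F e0 t u = std k G e0 a z w /\ F e1 t u = std k G e1 a z w.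
Proof. by rewrite /mono3 row3_col3 => /row3_inj[<- <- <-]; rewrite !nf. Qed.

Lemma s_surface p : S0 p <-> quadric_surface (spec_mx k *m compound G) 1 0 (- k) p.
Proof. exact: (spectral_real Gu Mu hS). Qed.

Lemma s_join nu : nu ^+ 2 = k -> nu != 0 -> forall p, S0 p <-> join_surface (eigen_frame G nu) p.
Proof. by move=> h1 h2; exact: (spectral_eigen Gu h1 h2 Mu hS). Qed.

Lemma s_cone : k = 0 -> forall p, S0 p <-> cone_surface (double_frame G) p.
Proof. by move=> h1; exact: (spectral_double Gu h1 Mu hS). Qed.

Let F10 s u : F s e0 u = std k G s (fst2 u * a0 + snd2 u * a1) (fst2 u * z0 + snd2 u * z1) (fst2 u * w0 + snd2 u * w1).
Proof. by rewrite nf /= !e0E !mul1r !mul0r !addr0. Qed.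
Let F11 s u : F s e1 u = fst2 u *: std k G s a2 z2 w2.
Proof. by rewrite nf /= !e1E !mul1r !mul0r !add0r stdZ. Qed.
Let F20 s u : F s u e0 = std k G s (fst2 u * a0 + snd2 u * a2) (fst2 u * z0 + snd2 u * z2) (fst2 u * w0 + snd2 u * w2).
Proof. by rewrite nf /= !e0E !mulr1 !mulr0 !mul0r !addr0. Qed.
Let F21 s u : F s u e1 = fst2 u *: std k G s a1 z1 w1.
Proof. by rewrite nf /= !e1E !mulr1 !mulr0 !mul0r !add0r !addr0 stdZ. Qed.
Let dn' : det3 a0 z0 w0 a2 z2 w2 a1 z1 w1 != 0.
Proof. by rewrite -oppr_eq0; apply: contraNneq dn => <-; rewrite /det3; apply/eqP; ring. Qed.

Lemma t_join : a2 != 0 -> forall p, S1 p <-> join_surface (join_frame k G a2 z2 w2) p.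
Proof. exact: (pencil_join Gu dn F10 F11). Qed.
Lemma t_cone : a2 = 0 -> z2 ^+ 2 - k * w2 ^+ 2 != 0 -> forall p, S1 p <-> cone_surface (cone_frame k G z2 w2) p.
Proof. exact: (pencil_cone Gu dn F10 F11). Qed.
Lemma u_join : a1 != 0 -> forall p, S2 p <-> join_surface (join_frame k G a1 z1 w1) p.
Proof. exact: (pencil_join Gu dn' F20 F21). Qed.
Lemma u_cone : a1 = 0 -> z1 ^+ 2 - k * w1 ^+ 2 != 0 -> forall p, S2 p <-> cone_surface (cone_frame k G z1 w1) p.
Proof. exact: (pencil_cone Gu dn' F20 F21). Qed.
End NormalForm.
End GenericCongruences.

Lemma focal_line_ext (K : fieldType) (X Y : pset K 6) N :
  (forall p, X p <-> Y p) -> focal_line X N <-> focal_line Y N.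
Proof.
move=> XY; have m V : meets_all X V <-> meets_all Y V.
  by split=> h p L /XY; exact: h.
by split=> -[Nl [h1 h2 h3]]; split=> //; split=> //; try exact/m; move=> W Wv WN /m; exact: h3.
Qed.

Lemma focal_lines_are_ext (K : fieldType) (X Y : pset K 6) L M :
  (forall p, X p <-> Y p) -> focal_lines_are Y L M -> focal_lines_are X L M.
Proof. by move=> XY h N; rewrite (focal_line_ext N XY); exact: h. Qed.

(** * Real frames over the complex numbers *)

Section Complexification.
Variable R : realType.
Local Notation C := R[i].
Local Notation toC := (map_mx (real_complex R)).

Lemma toC_row4 a b c d : toC (row4 a b c d) = row4 a%:C b%:C c%:C d%:C.
Proof. by apply/rowP => i; rewrite !mxE; case: i => [[|[|[|[|]]]]]. Qed.

Lemma toC_vec (G : 'M[R]_4) a b c d : toC (vec G a b c d) = vec (toC G) a%:C b%:C c%:C d%:C.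
Proof. by rewrite /vec map_mxM toC_row4. Qed.

Lemma toC_unit_row i : toC (unit_row R i) = unit_row C i.
Proof. by rewrite /unit_row map_delta_mx. Qed.

Lemma toC_std k (G : 'M[R]_4) s a z w : toC (std k G s a z w) = std k%:C (toC G) (toC s) a%:C z%:C w%:C.
Proof. by rewrite /std toC_vec !mxE !rmorphD !rmorphM. Qed.

Lemma toC_rows4 (v0 v1 v2 v3 : 'rV[R]_4) : toC (rows4 v0 v1 v2 v3) = rows4 (toC v0) (toC v1) (toC v2) (toC v3).
Proof. by apply/matrixP => i j; rewrite !mxE; case: i => [[|[|[|[|]]]]] //= _; rewrite mxE. Qed.

Lemma toC_compound (G : 'M[R]_4) : toC (compound G) = compound (toC G).
Proof. by apply/matrixP => i j; rewrite !mxE rmorphB !rmorphM. Qed.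

Lemma toC_int_mx m n s : toC (int_mx R m n s) = int_mx C m n s.
Proof. by apply/matrixP => i j; rewrite !mxE rmorph_int. Qed.

Lemma toC_spec_mx k : toC (spec_mx k) = spec_mx k%:C.
Proof.
apply/matrixP => i j; rewrite !mxE; case: i => [[|[|[|[|]]]]] //= _; rewrite !mxE;
 case: j => [[|[|[|[|[|[|]]]]]]] //= _; by rewrite rmorphN1.
Qed.

Lemma toC_join_frame k (G : 'M[R]_4) a z w :
  toC (join_frame k G a z w) = join_frame k%:C (toC G) a%:C z%:C w%:C.
Proof. by rewrite /join_frame toC_rows4 !toC_std !toC_vec !toC_unit_row. Qed.

Lemma toC_cone_frame k (G : 'M[R]_4) z w :
  toC (cone_frame k G z w) = cone_frame k%:C (toC G) z%:C w%:C.
Proof. by rewrite /cone_frame toC_rows4 !toC_std !toC_vec !toC_unit_row. Qed.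

Lemma conj_toC n (v : 'rV[R]_n) : conj_row (toC v) = toC v.
Proof. by apply/rowP => i; rewrite !mxE; apply/eqP; rewrite eq_complex /= oppr0 !eqxx. Qed.

Lemma conj_row_comb n (a b : C) (u v : 'rV[C]_n) :
  conj_row (a *: u + b *: v) = a^* *: conj_row u + b^* *: conj_row v.
Proof. by apply/rowP => i; rewrite !mxE rmorphD !rmorphM. Qed.

Lemma conj_lines_through (u v : 'rV[C]_4) :
  conj_lines (line_through u v) (line_through (conj_row u) (conj_row v)).
Proof.
move=> x; apply/mem_line/mem_line => -[a [b xE]]; exists a^*, b^*.
  by rewrite xE conj_row_comb.
by rewrite -[x]conj_rowK xE conj_row_comb !conj_rowK.
Qed.

Lemma real_line_through (u v : 'rV[R]_4) : real_line (line_through (toC u) (toC v)).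
Proof. by have := conj_lines_through (toC u) (toC v); rewrite !conj_toC. Qed.

Lemma pencil_linear (F0 F1 : 'rV[C]_2 -> 'rV[C]_2 -> 'rV[C]_4) (X : pset C 6) (A : 'M[R]_(4, 6)) al be ga :
  right_inv A -> (al != 0) || (be != 0) || (ga != 0) ->
  (forall p, X p <-> pencil_lines F0 F1 p) ->
  (forall p, pencil_lines F0 F1 p <-> quadric_surface (toC A) al%:C be%:C ga%:C p) ->
  linear_congruence X.
Proof.
move=> Ai q0 XF FA; apply: (complex_surface_linear Ai q0) => [p|p /XF].
  by rewrite XF FA.
exact: pencil_lines_klein.
Qed.
End Complexification.

Section RealCongruences.
Variable R : realType.
Local Notation C := R[i].
Local Notation toC := (map_mx (real_complex R)).
Local Notation e0 := (unit_row C ord0).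
Local Notation e1 := (unit_row C ord_max).
Variables (w : 'rV[R]_tri_dim) (k : R) (S T U : 'M[R]_2) (G : 'M[R]_4).
Variables (a0 z0 w0 a1 z1 w1 a2 z2 w2 : R).
Hypotheses (Su : S \in unitmx) (Tu : T \in unitmx) (Uu : U \in unitmx) (Gu : G \in unitmx).
Hypothesis nf : normal_form (fun s t u => trimap w (s *m S) (t *m T) (u *m U)) k G a0 z0 w0 a1 z1 w1 a2 z2 w2.
Hypothesis dn : det3 a0 z0 w0 a1 z1 w1 a2 z2 w2 != 0.
Hypothesis c1 : a1 = 0 -> z1 ^+ 2 - k * w1 ^+ 2 != 0.
Hypothesis c2 : a2 = 0 -> z2 ^+ 2 - k * w2 ^+ 2 != 0.

Let F s t u := trimap (to_complex w) (s *m toC S) (t *m toC T) (u *m toC U).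

Lemma complex_frame_unit : toC G \in unitmx.
Proof. by rewrite map_unitmx. Qed.

Lemma complex_normal_form : normal_form F k%:C (toC G) a0%:C z0%:C w0%:C a1%:C z1%:C w1%:C a2%:C z2%:C w2%:C.
Proof.
apply: normal_form_units.
  have [f0 f1 f2] := trimap_trilinear (to_complex w).
  by split=> a b x y s t; rewrite /F mulmxDl -!scalemxAl (f0, f1, f2).
move=> i j l /=; rewrite /F -!toC_unit_row -!map_mxM trimap_toC nf /= toC_std.
have uE (x y : 'I_2) : unit_row R x ord0 y = (y == x)%:R by rewrite unit_rowE.
have m1E (x : 'I_2) : (ord_max == x)%:R = (x != ord0)%:R :> C.
  by case: x => [[|[|]]].
by rewrite !uE !rmorphD !rmorphM !rmorph_nat /= !m1E !(eq_sym ord0).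
Qed.

Lemma complex_det3 : det3 a0%:C z0%:C w0%:C a1%:C z1%:C w1%:C a2%:C z2%:C w2%:C != 0.
Proof. by rewrite /det3 -!(rmorphM, rmorphB, rmorphD) fmorph_eq0. Qed.

Let nfC := complex_normal_form.
Let dnC := complex_det3.
Let GCu := complex_frame_unit.

Let X0 p : congruence w 0 p <-> pencil_lines (fun t u => F e0 t u) (fun t u => F e1 t u) p.
Proof. by apply: param_congruence0_change; rewrite map_unitmx. Qed.
Let X1 p : congruence w 1 p <-> pencil_lines (fun s u => F s e0 u) (fun s u => F s e1 u) p.
Proof. by apply: param_congruence1_change; rewrite map_unitmx. Qed.
Let X2 p : congruence w 2 p <-> pencil_lines (fun s t => F s t e0) (fun s t => F s t e1) p.
Proof. by apply: param_congruence2_change; rewrite map_unitmx. Qed.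

Lemma s_linear : linear_congruence (congruence w 0).
Proof.
apply: (pencil_linear (A := spec_mx k *m compound G) (al := 1) (be := 0) (ga := - k) _ _ X0).
- exact: right_inv_compound Gu (spec_mx_inv k).
- by rewrite oner_eq0.
move=> p; rewrite (s_surface GCu nfC dnC) map_mxM toC_spec_mx toC_compound.
by rewrite rmorphN.
Qed.

Lemma join_linear (H : 'M[R]_4) F0 F1 (X : pset C 6) : H \in unitmx ->
  (forall p, X p <-> pencil_lines F0 F1 p) -> (forall p, pencil_lines F0 F1 p <-> join_surface (toC H) p) ->
  linear_congruence X.
Proof.
move=> Hu XF FJ; apply: (pencil_linear (A := join_mx R *m compound H) (al := 0) (be := 1) (ga := 0) _ _ XF).
- exact: right_inv_compound Hu (join_mx_inv R).
- by rewrite oner_eq0 orbT.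
by move=> p; rewrite FJ map_mxM toC_int_mx toC_compound !rmorph0 rmorph1.
Qed.

Lemma cone_linear (H : 'M[R]_4) F0 F1 (X : pset C 6) : H \in unitmx ->
  (forall p, X p <-> pencil_lines F0 F1 p) -> (forall p, pencil_lines F0 F1 p <-> cone_surface (toC H) p) ->
  linear_congruence X.
Proof.
move=> Hu XF FJ; apply: (pencil_linear (A := cone_mx R *m compound H) (al := 0) (be := 0) (ga := 1) _ _ XF).
- exact: right_inv_compound Hu (cone_mx_inv R).
- by rewrite oner_eq0 orbT.
by move=> p; rewrite FJ map_mxM toC_int_mx toC_compound !rmorph0 rmorph1.
Qed.

Definition axis_line := line_through (vec (toC G) 0 0 1 0) (vec (toC G) 0 0 0 1).
Definition eigen_line nu := line_through (vec (toC G) nu 1 0 0) (vec (toC G) 0 0 nu 1).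
Definition cross_line a z w := line_through (std k%:C (toC G) e0 a%:C z%:C w%:C) (std k%:C (toC G) e1 a%:C z%:C w%:C).

Lemma axis_line_real : real_line axis_line.
Proof. by have := real_line_through (vec G 0 0 1 0) (vec G 0 0 0 1); rewrite !toC_vec. Qed.

Lemma cross_line_real a z v : real_line (cross_line a z v).
Proof.
by have := real_line_through (std k G (unit_row R ord0) a z v) (std k G (unit_row R ord_max) a z v);
   rewrite !toC_std !toC_unit_row.
Qed.

Lemma eigen_line_real (nu : R) : real_line (eigen_line nu%:C).
Proof. by have := real_line_through (vec G nu 1 0 0) (vec G 0 0 nu 1); rewrite !toC_vec. Qed.

Lemma eigen_line_conj nu : conj_lines (eigen_line nu) (eigen_line nu^*).
Proof.
have := conj_lines_through (vec (toC G) nu 1 0 0) (vec (toC G) 0 0 nu 1).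
have cv a b c d : conj_row (vec (toC G) a b c d) = vec (toC G) a^* b^* c^* d^*.
  rewrite /vec conj_rowM; congr (_ *m _); apply/rowP => i; rewrite !mxE.
  by case: i => [[|[|[|[|]]]]].
by rewrite !cv !rmorph0 !rmorph1.
Qed.

Lemma s_hyperbolic nu : nu ^+ 2 = k%:C -> nu != 0 ->
  skew_lines (eigen_line nu) (eigen_line (- nu)) /\
  focal_lines_are (congruence w 0) (eigen_line nu) (eigen_line (- nu)).
Proof.
move=> h1 h2; have Eu := eigen_frame_unit GCu h2.
have := skew_line01_23 Eu; have := join_focal_lines Eu.
rewrite line01_rows4 line23_rows4 => fl sk; split=> //.
apply: focal_lines_are_ext fl => p; rewrite X0; exact: (s_join GCu nfC dnC h1 h2).
Qed.

Lemma s_parabolic : k = 0 -> exists q, inf_near q (eigen_line 0) (eigen_line 0) /\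
  parabolic (congruence w 0) (eigen_line 0) q.
Proof.
move=> k0; have Eu := double_frame_unit GCu.
have XE p : congruence w 0 p <-> cone_surface (double_frame (toC G)) p.
  by rewrite X0; apply: (s_cone GCu nfC dnC); rewrite k0.
have lE : line01 (double_frame (toC G)) = eigen_line 0 by rewrite line01_rows4.
exists (ruled_quadric (double_frame (toC G))); rewrite -lE; split; first exact: ruled_quadric_inf_near.
split; first exact: s_linear.
- by move=> N; rewrite (focal_line_ext N XE) cone_focal_lines.
- by move=> p; rewrite XE; exact: cone_tangent.
Qed.

Section Cross.
Variables (X : pset C 6) (a z v : R) (F0 F1 : 'rV[C]_2 -> 'rV[C]_2 -> 'rV[C]_4).
Hypothesis XF : forall p, X p <-> pencil_lines F0 F1 p.

Lemma cross_hyperbolic : a != 0 ->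
  (forall p, pencil_lines F0 F1 p <-> join_surface (join_frame k%:C (toC G) a%:C z%:C v%:C) p) ->
  hyperbolic X axis_line (cross_line a z v).
Proof.
move=> an hJ; have Ju := join_frame_unit k Gu z v an.
have JCu : join_frame k%:C (toC G) a%:C z%:C v%:C \in unitmx by rewrite -toC_join_frame map_unitmx.
split.
- by apply: (join_linear Ju XF) => p; rewrite hJ toC_join_frame.
- by have := skew_line01_23 JCu; rewrite line01_rows4 line23_rows4.
- exact: axis_line_real.
- exact: cross_line_real.
have := join_focal_lines JCu; rewrite line01_rows4 line23_rows4.
by apply: focal_lines_are_ext => p; rewrite XF hJ.
Qed.

Definition cone_quadric z v := ruled_quadric (cone_frame k%:C (toC G) z%:C v%:C).

Lemma cone_frame_axis_line : z ^+ 2 - k * v ^+ 2 != 0 ->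
  (cone_frame k%:C (toC G) z%:C v%:C \in unitmx) * (line01 (cone_frame k%:C (toC G) z%:C v%:C) = axis_line).
Proof.
move=> dv; have Ju := cone_frame_unit Gu dv.
split; first by rewrite -toC_cone_frame map_unitmx.
rewrite line01_rows4 cone_frame_axis //.
by rewrite -!rmorphXn -rmorphM -rmorphB fmorph_eq0.
Qed.

Lemma cross_parabolic : z ^+ 2 - k * v ^+ 2 != 0 ->
  (forall p, pencil_lines F0 F1 p <-> cone_surface (cone_frame k%:C (toC G) z%:C v%:C) p) ->
  inf_near (cone_quadric z v) axis_line axis_line /\ parabolic X axis_line (cone_quadric z v).
Proof.
move=> dv hJ; have Ju := cone_frame_unit Gu dv.
have [JCu <-] := cone_frame_axis_line dv.
have XE p : X p <-> cone_surface (cone_frame k%:C (toC G) z%:C v%:C) p by rewrite XF.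
split; first exact: ruled_quadric_inf_near.
split.
- by apply: (cone_linear Ju XF) => p; rewrite hJ toC_cone_frame.
- by move=> N; rewrite (focal_line_ext N XE) cone_focal_lines.
- by move=> p; rewrite XE; exact: cone_tangent.
Qed.
End Cross.

Lemma t_hyperbolic : a2 != 0 -> hyperbolic (congruence w 1) axis_line (cross_line a2 z2 w2).
Proof.
move=> h; apply: (cross_hyperbolic X1 h); apply: (t_join GCu nfC dnC).
by rewrite fmorph_eq0.
Qed.

Lemma u_hyperbolic : a1 != 0 -> hyperbolic (congruence w 2) axis_line (cross_line a1 z1 w1).
Proof.
move=> h; apply: (cross_hyperbolic X2 h); apply: (u_join GCu nfC dnC).
by rewrite fmorph_eq0.
Qed.

Lemma t_parabolic : a2 = 0 -> inf_near (cone_quadric z2 w2) axis_line axis_line /\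
  parabolic (congruence w 1) axis_line (cone_quadric z2 w2).
Proof.
move=> h; apply: (cross_parabolic X1 (c2 h)); apply: (t_cone GCu nfC dnC); first by rewrite h.
by rewrite -!rmorphXn -rmorphM -rmorphB fmorph_eq0 c2.
Qed.

Lemma u_parabolic : a1 = 0 -> inf_near (cone_quadric z1 w1) axis_line axis_line /\
  parabolic (congruence w 2) axis_line (cone_quadric z1 w1).
Proof.
move=> h; apply: (cross_parabolic X2 (c1 h)); apply: (u_cone GCu nfC dnC); first by rewrite h.
by rewrite -!rmorphXn -rmorphM -rmorphB fmorph_eq0 c1.
Qed.

Let Z := z1 * a2 - z2 * a1.
Let W := w1 * a2 - w2 * a1.

Lemma skew_linesP (L M : {vspace 'rV[C]_4}) : (forall v, v \in L -> v \in M -> v = 0) -> skew_lines L M.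
Proof.
move=> h; apply/eqP; rewrite -subv0; apply/subvP => v; rewrite memv_cap => /andP[vL vM].
by rewrite (h v vL vM) mem0v.
Qed.

(** If a common point has parameter [s] on the first line, then s (Z + W i) = 0; and
    [Z ^ 2 - k * W ^ 2] is the norm of Z + W i. *)
Lemma cross_lines_skew : Z ^+ 2 - k * W ^+ 2 != 0 -> a1 != 0 ->
  skew_lines (cross_line a1 z1 w1) (cross_line a2 z2 w2).
Proof.
move=> d0 a10; apply: skew_linesP => v /mem_line[a [b ->]] /mem_line[c [d h]].
have [h0 h1 h2 h3] := vec_inj GCu (etrans (etrans (esym (std_comb _ _ _ _ _ _ _)) h) (std_comb _ _ _ _ _ _ _)).
have e1' : a * Z%:C + b * (k%:C * W%:C) = 0.
  rewrite /Z /W !rmorphB !rmorphM.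
  transitivity ((a * z1%:C + b * (k%:C * w1%:C)) * a2%:C - (a * a1%:C) * z2%:C - (b * a1%:C) * (k%:C * w2%:C)).
    by ring.
  by rewrite h2 h0 h1; ring.
have e2 : a * W%:C + b * Z%:C = 0.
  rewrite /Z /W !rmorphB !rmorphM.
  transitivity ((a * w1%:C + b * z1%:C) * a2%:C - (a * a1%:C) * w2%:C - (b * a1%:C) * z2%:C).
    by ring.
  by rewrite h3 h0 h1; ring.
have dC : Z%:C ^+ 2 - k%:C * W%:C ^+ 2 != 0 by rewrite -!rmorphXn -rmorphM -rmorphB fmorph_eq0.
have az : a * (Z%:C ^+ 2 - k%:C * W%:C ^+ 2) = 0.
  transitivity (Z%:C * (a * Z%:C + b * (k%:C * W%:C)) - k%:C * W%:C * (a * W%:C + b * Z%:C)); first by ring.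
  by rewrite e1' e2 !mulr0 subr0.
have bz : b * (Z%:C ^+ 2 - k%:C * W%:C ^+ 2) = 0.
  transitivity (Z%:C * (a * W%:C + b * Z%:C) - W%:C * (a * Z%:C + b * (k%:C * W%:C))); first by ring.
  by rewrite e1' e2 !mulr0 subr0.
move/eqP: az; move/eqP: bz; rewrite !mulf_eq0 (negPf dC) !orbF => /eqP -> /eqP ->.
by rewrite !scale0r addr0.
Qed.

(** If both vanished, the last two rows of [det3] would be proportional. *)
Lemma cross_lines_indep : a1 != 0 -> (Z != 0) || (W != 0).
Proof.
move=> a10; rewrite -negb_and; apply: contra dn => /andP[/eqP h1 /eqP h2].
rewrite -(mulrI_eq0 _ (mulfI a10)); apply/eqP.
transitivity (a0 * (w1 * Z - z1 * W) + z0 * (a1 * W) - w0 * (a1 * Z)); first by rewrite /det3 /Z /W; ring.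
by rewrite h1 h2; ring.
Qed.

Lemma cross_lines_elliptic : k < 0 -> a1 != 0 -> Z ^+ 2 - k * W ^+ 2 != 0.
Proof.
move=> k0 a10; have h := cross_lines_indep a10; apply: contraTneq h => e.
have z2' : Z ^+ 2 = 0.
  apply/eqP; rewrite eq_le sqr_ge0 andbT; move/eqP: e; rewrite subr_eq0 => /eqP ->.
  by rewrite nmulr_rle0 // sqr_ge0.
move: e; rewrite z2' sub0r => /eqP; rewrite oppr_eq0 mulf_eq0 (lt_eqF k0) /= sqrf_eq0 => ->.
by rewrite -(sqrf_eq0 Z) z2' eqxx.
Qed.

(** The common point is the value of both families at the eigenvector [s = (nu, 1)]; the hypothesis
    makes their eigenvalues proportional to [a1] and [a2]. *)
Lemma cross_lines_meet (nu : R) : nu ^+ 2 = k -> Z + nu * W = 0 -> a1 != 0 -> a2 != 0 ->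
  \dim (cross_line a1 z1 w1 :&: cross_line a2 z2 w2 :&: eigen_line nu%:C)%VS = 1%N.
Proof.
move=> nuk hZ a10 a20; pose p := std k%:C (toC G) (row2 nu%:C 1) a1%:C z1%:C w1%:C.
have a1C : a1%:C != 0 by rewrite fmorph_eq0.
have a2C : a2%:C != 0 by rewrite fmorph_eq0.
have pE : p = vec (toC G) (a1%:C * nu%:C) a1%:C (nu%:C * (z1%:C + nu%:C * w1%:C)) (z1%:C + nu%:C * w1%:C).
  by rewrite /p /std !mxE /= -nuk rmorphXn; congr (vec _ _ _ _ _); ring.
have p0 : p != 0 by rewrite pE vec_eq0 // (negPf a1C) andbF.
suff -> : (cross_line a1 z1 w1 :&: cross_line a2 z2 w2 :&: eigen_line nu%:C)%VS = <[p]>%VS.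
  by rewrite dim_vline p0.
apply/vspaceP => v; rewrite !memv_cap; apply/idP/vlineP.
  move=> /andP[/andP[/mem_line[a [b ->]] _] /mem_line[c [d h]]].
  have [] := vec_inj GCu (etrans (etrans (esym (std_comb _ _ _ _ _ _ _)) h) (vec_comb _ _ _ _ _ _ _ _ _ _ _)).
  rewrite !(mulr0, addr0, mulr1) => h0 h1 _ _; exists b.
  have ab : a = nu%:C * b by apply: (mulIf a1C); rewrite h0 -h1; ring.
  rewrite [LHS]std_comb pE vecZ ab -nuk rmorphXn; congr (vec _ _ _ _ _); ring.
have hZC : (z1%:C + nu%:C * w1%:C) * a2%:C = (z2%:C + nu%:C * w2%:C) * a1%:C.
  apply/eqP; rewrite -subr_eq0; apply/eqP; have := congr1 (real_complex R) hZ.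
  by rewrite /Z /W rmorph0 rmorphD rmorphM !rmorphB !rmorphM /= => <-; ring.
move=> [b ->]; rewrite -!memv_cap; apply: memvZ; rewrite !memv_cap pE -andbA; apply/and3P; split; apply/mem_line.
- exists nu%:C, 1; rewrite std_e0 std_e1 vec_comb -nuk rmorphXn; congr (vec _ _ _ _ _); ring.
- exists (a1%:C / a2%:C * nu%:C), (a1%:C / a2%:C); rewrite std_e0 std_e1 vec_comb -nuk rmorphXn.
  have hq : z1%:C + nu%:C * w1%:C = (z2%:C + nu%:C * w2%:C) * a1%:C / a2%:C by rewrite -hZC mulfK.
  by rewrite hq; congr (vec _ _ _ _ _); field.
- by exists a1%:C, (z1%:C + nu%:C * w1%:C); rewrite vec_comb; congr (vec _ _ _ _ _); ring.
Qed.

Lemma cone_quadrics_distinct : a1 = 0 -> a2 = 0 ->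
  ~ same_double_line axis_line (cone_quadric z1 w1) (cone_quadric z2 w2).
Proof.
move=> a10 a20; have toCd z v : z ^+ 2 - k * v ^+ 2 != 0 -> z%:C ^+ 2 - k%:C * v%:C ^+ 2 != 0.
  by rewrite -!rmorphXn -rmorphM -rmorphB fmorph_eq0.
have [_ <-] := cone_frame_axis_line (c1 a10).
apply: cone_frames_distinct => //; [exact/toCd/c1 | exact/toCd/c2 |].
rewrite -!rmorphM -rmorphB fmorph_eq0; apply: contra dn => /eqP h; apply/eqP.
transitivity (- a0 * (w1 * z2 - z1 * w2)); last by rewrite h mulr0.
by rewrite /det3 a10 a20; ring.
Qed.
End RealCongruences.

(** * Degenerations *)

Lemma focal_lines_are_lines (K : fieldType) (X : pset K 6) L M :
  focal_lines_are X L M -> is_line L /\ is_line M.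
Proof. by move=> h; split; [have [] := (h L).2 (or_introl erefl) | have [] := (h M).2 (or_intror erefl)]. Qed.

Section Classification.
Variable R : realType.
Local Notation C := R[i].
Local Notation toC := (map_mx (real_complex R)).

(** The sign of the root is chosen so that [b] and [c], if they meet, do so on the eigenline of
    [nu]. That eigenline is then taken as [x]. *)
Lemma real_sqrt_choice (k Z W : R) : 0 <= k -> exists2 nu : R, nu ^+ 2 = k &
  Z ^+ 2 - k * W ^+ 2 = 0 -> Z + nu * W = 0.
Proof.
move=> k0; have [h|h] := eqVneq (Z + Num.sqrt k * W) 0; first by exists (Num.sqrt k); rewrite ?sqr_sqrtr.
exists (- Num.sqrt k); first by rewrite sqrrN sqr_sqrtr.
move=> d; have : (Z + Num.sqrt k * W) * (Z - Num.sqrt k * W) = 0.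
  by rewrite mulrC -subr_sqr exprMn sqr_sqrtr.
by move/eqP; rewrite mulf_eq0 (negPf h) /= mulNr => /eqP.
Qed.

Lemma complex_sqrt_neg (k : R) : k < 0 -> exists nu : C, [/\ nu ^+ 2 = k%:C, nu != 0 & nu^* = - nu].
Proof.
move=> k0; exists (0 +i* Num.sqrt (- k)); split.
- apply/eqP; rewrite eq_complex /= !mul0r mulr0 addr0 eqxx andbT sub0r.
  by rewrite -expr2 sqr_sqrtr ?oppr_ge0 ?ltW // opprK.
- by rewrite eq_complex /= negb_and sqrtr_eq0 -ltNge oppr_gt0 k0 orbT.
- by apply/eqP; rewrite eq_complex /= oppr0 !eqxx.
Qed.

Definition congruence_configuration (S T U : pset C 6) (a b c x y : {vspace 'rV[C]_4}) :=
   ([/\ real_line a, real_line b, real_line c, real_line x & real_line y] /\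
    ((* a.1 *)
     [/\ [/\ skew_lines a b, skew_lines a c, skew_lines b c & skew_lines x y],
         hyperbolic S x y, hyperbolic T a c & hyperbolic U a b] \/
     (* a.2 *)
     [/\ skew_lines a c, skew_lines x y, hyperbolic S x y, hyperbolic T a c
       & exists q, inf_near q b a /\ parabolic U a q] \/
     (* a.3 *)
     [/\ [/\ skew_lines a b, skew_lines a c & skew_lines b c],
         exists q, inf_near q y x /\ parabolic S x q,
         hyperbolic T a c & hyperbolic U a b] \/
     (* a.4 *)
     [/\ skew_lines a c, exists q, inf_near q y x /\ parabolic S x q,
         hyperbolic T a c & exists q, inf_near q b a /\ parabolic U a q] \/
     (* a.5 *)
     [/\ [/\ skew_lines a b, skew_lines a c, \dim (b :&: c :&: x)%VS = 1%N & skew_lines x y],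
         hyperbolic S x y, hyperbolic T a c & hyperbolic U a b] \/
     (* a.6 *)
     [/\ skew_lines x y, hyperbolic S x y
       & exists q q', [/\ inf_near q b a, inf_near q' c a,
           ~ same_double_line a q q', parabolic T a q' & parabolic U a q]] \/
     (* a.7 *)
     [/\ exists q, inf_near q y x /\ parabolic S x q
       & exists q q', [/\ inf_near q b a, inf_near q' c a,
           ~ same_double_line a q q', parabolic T a q' & parabolic U a q]] \/
     (* a.8 *)
     [/\ [/\ skew_lines a b, skew_lines a c & \dim (b :&: c :&: x)%VS = 1%N],
         exists q, inf_near q y x /\ parabolic S x q,
         hyperbolic T a c & hyperbolic U a b]))
   \/
   ([/\ real_line a, real_line b, real_line c, skew_lines x y & conj_lines x y] /\
    ((* b.1 *)
     [/\ [/\ skew_lines a b, skew_lines a c & skew_lines b c],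
         elliptic S x y, hyperbolic T a c & hyperbolic U a b] \/
     (* b.2 *)
     [/\ skew_lines a c, elliptic S x y, hyperbolic T a c
       & exists q, inf_near q b a /\ parabolic U a q] \/
     (* b.3 *)
     [/\ elliptic S x y
       & exists q q', [/\ inf_near q b a, inf_near q' c a,
           ~ same_double_line a q q', parabolic T a q' & parabolic U a q]])).

Section Cases.
Variables (S T U : pset C 6) (a b c x y : {vspace 'rV[C]_4}).
Hypotheses (ra : real_line a) (rb : real_line b) (rc : real_line c).

Definition transversal_hyperbolic := [/\ skew_lines a b, skew_lines a c, hyperbolic T a c & hyperbolic U a b].
Definition transversal_mixed := [/\ skew_lines a c, hyperbolic T a c
  & exists q, inf_near q b a /\ parabolic U a q].
Definition transversal_parabolic := exists q q', [/\ inf_near q b a, inf_near q' c a,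
  ~ same_double_line a q q', parabolic T a q' & parabolic U a q].

Lemma elliptic_cases : elliptic S x y ->
  [\/ transversal_hyperbolic /\ skew_lines b c, transversal_mixed | transversal_parabolic] ->
  congruence_configuration S T U a b c x y.
Proof.
move=> hS h; right; have [_ sk cj _] := hS; split; first by split.
case: h => [[[sb sc hT hU] bc]|[sc hT hU]|hTU].
- by left; split=> //; split.
- by right; left; split.
- by right; right; split.
Qed.

Lemma hyperbolic_cases : hyperbolic S x y ->
  [\/ transversal_hyperbolic /\ (skew_lines b c \/ \dim (b :&: c :&: x)%VS = 1%N),
      transversal_mixed | transversal_parabolic] ->
  congruence_configuration S T U a b c x y.
Proof.
move=> hS h; left; have [_ sk rx ry _] := hS; split; first by split.
case: h => [[[sb sc hT hU] [bc|bc]]|[sc hT hU]|hTU].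
- by left; split=> //; split.
- by do 4 right; left; split=> //; split.
- by right; left; split.
- by do 5 right; left; split.
Qed.

Lemma parabolic_cases : real_line x -> real_line y -> (exists q, inf_near q y x /\ parabolic S x q) ->
  [\/ transversal_hyperbolic /\ (skew_lines b c \/ \dim (b :&: c :&: x)%VS = 1%N),
      transversal_mixed | transversal_parabolic] ->
  congruence_configuration S T U a b c x y.
Proof.
move=> rx ry hS h; left; split; first by split.
case: h => [[[sb sc hT hU] [bc|bc]]|[sc hT hU]|hTU].
- by do 2 right; left; split=> //; split.
- by do 7 right; split=> //; split.
- by do 3 right; left; split.
- by do 6 right; left; split.
Qed.
End Cases.

(** The permutation exchanges T and U when [a2] alone vanishes, because the mixed case of the list
    has U parabolic. A line infinitely near the axis is represented by its limit, so [b] or [c] is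
    then the axis itself. *)
Lemma transversal_cases (w : 'rV[R]_tri_dim) k (S T U : 'M[R]_2) G a0 z0 w0 a1 z1 w1 a2 z2 w2 :
  S \in unitmx -> T \in unitmx -> U \in unitmx -> G \in unitmx ->
  normal_form (fun s t u => trimap w (s *m S) (t *m T) (u *m U)) k G a0 z0 w0 a1 z1 w1 a2 z2 w2 ->
  det3 a0 z0 w0 a1 z1 w1 a2 z2 w2 != 0 ->
  (a1 = 0 -> z1 ^+ 2 - k * w1 ^+ 2 != 0) -> (a2 = 0 -> z2 ^+ 2 - k * w2 ^+ 2 != 0) ->
  let a := axis_line G in let Z := z1 * a2 - z2 * a1 in let W := w1 * a2 - w2 * a1 in
  exists (s : 'S_3) b c,
   [/\ s 0 = 0, [/\ is_line b, is_line c, real_line b & real_line c] &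
    [\/ transversal_hyperbolic (congruence w (s 1)) (congruence w (s 2)) a b c /\
        [/\ k < 0 -> skew_lines b c, Z ^+ 2 - k * W ^+ 2 != 0 -> skew_lines b c
          & forall nu : R, nu ^+ 2 = k -> Z + nu * W = 0 -> \dim (b :&: c :&: eigen_line G nu%:C)%VS = 1%N],
        transversal_mixed (congruence w (s 1)) (congruence w (s 2)) a b c
      | transversal_parabolic (congruence w (s 1)) (congruence w (s 2)) a b c]].
Proof.
move=> Su Tu Uu Gu nf dn c1 c2 a Z W.
have ra : real_line a := axis_line_real G.
have la : is_line a := is_line23 (complex_frame_unit Gu).
have [a10|a10] := eqVneq a1 0; have [a20|a20] := eqVneq a2 0.
- have [n1 p1] := u_parabolic Su Tu Uu Gu nf dn c1 a10; have [n2 p2] := t_parabolic Su Tu Uu Gu nf dn c2 a20.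
  exists 1%g, a, a; split; [by rewrite perm1 | split; [exact: la | exact: la | exact: ra | exact: ra] |].
  apply: Or33; rewrite !perm1; exists (cone_quadric k G z1 w1), (cone_quadric k G z2 w2).
  split; [exact: n1 | exact: n2 | | exact: p2 | exact: p1].
  exact: (cone_quadrics_distinct Gu dn c1 c2 a10 a20).
- have hT := t_hyperbolic Su Tu Uu Gu nf dn a20.
  have [_ sk _ rc fT] := hT; have [_ lc] := focal_lines_are_lines fT.
  exists 1%g, a, (cross_line k G a2 z2 w2).
  split; [by rewrite perm1 | split; [exact: la | exact: lc | exact: ra | exact: rc] |].
  apply: Or32; rewrite !perm1; split; [exact: sk | exact: hT |].
  by exists (cone_quadric k G z1 w1); exact: (u_parabolic Su Tu Uu Gu nf dn c1 a10).
- have hU := u_hyperbolic Su Tu Uu Gu nf dn a10.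
  have [_ sk _ rc fU] := hU; have [_ lc] := focal_lines_are_lines fU.
  exists (tperm 1 2), a, (cross_line k G a1 z1 w1).
  split; [by rewrite tpermD | split; [exact: la | exact: lc | exact: ra | exact: rc] |].
  apply: Or32; rewrite tpermL tpermR; split; [exact: sk | exact: hU |].
  by exists (cone_quadric k G z2 w2); exact: (t_parabolic Su Tu Uu Gu nf dn c2 a20).
have hU := u_hyperbolic Su Tu Uu Gu nf dn a10; have hT := t_hyperbolic Su Tu Uu Gu nf dn a20.
have [_ skU _ rU fU] := hU; have [_ lU] := focal_lines_are_lines fU.
have [_ skT _ rT fT] := hT; have [_ lT] := focal_lines_are_lines fT.
exists 1%g, (cross_line k G a1 z1 w1), (cross_line k G a2 z2 w2).
split; [by rewrite perm1 | split; [exact: lU | exact: lT | exact: rU | exact: rT] |].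
apply: Or31; rewrite !perm1; split.
  by split; [exact: skU | exact: skT | exact: hT | exact: hU].
split.
- by move=> k0; apply: (cross_lines_skew Gu _ a10); exact: (cross_lines_elliptic dn).
- by move=> d; apply: (cross_lines_skew Gu d a10).
- by move=> nu h1 h2; apply: (cross_lines_meet Gu h1 h2 a10 a20).
Qed.

Theorem real_map_classification (w : 'rV[R]_tri_dim) : real_bir122 w ->
   exists a b c x y : {vspace 'rV[R[i]]_4},
   [/\ is_line a, is_line b, is_line c, is_line x & is_line y] /\
   exists s : 'S_3,
   congruence_configuration (congruence w (s 0)) (congruence w (s 1)) (congruence w (s 2)) a b c x y.
Proof.
move=> bir; have [k [S [T [U [G [a0 [z0 [w0 [a1 [z1 [w1 [a2 [z2 [w2 hyp]]]]]]]]]]]]]] := real_normal_form bir.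
have [[Su Tu Uu Gu] nf dn c1 c2] := hyp.
have ra : real_line (axis_line G) := axis_line_real G.
have la : is_line (axis_line G) := is_line23 (complex_frame_unit Gu).
have [s [b [c [s0 [lb lc rb rc] TU]]]] := transversal_cases Su Tu Uu Gu nf dn c1 c2.
have sl := s_linear Su Tu Uu Gu nf dn.
have [k0|k0] := ltP k 0.
  have [nu [nuk nu0 nuc]] := complex_sqrt_neg k0.
  have [sk fl] := s_hyperbolic Su Tu Uu Gu nf dn nuk nu0.
  have [lx ly] := focal_lines_are_lines fl.
  have cj : conj_lines (eigen_line G nu) (eigen_line G (- nu)) by rewrite -nuc; exact: eigen_line_conj.
  exists (axis_line G), b, c, (eigen_line G nu), (eigen_line G (- nu)).
  split; [by split; [exact: la | exact: lb | exact: lc | exact: lx | exact: ly] | exists s].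
  apply: (elliptic_cases ra rb rc).
    by rewrite s0; split; [exact: sl | exact: sk | exact: cj | exact: fl].
  case: TU => [[h [h1 _ _]]|h|h]; [apply: Or31; split; [exact: h | exact: h1] | exact: Or32 | exact: Or33].
have [nu nuk nuZ] := real_sqrt_choice (z1 * a2 - z2 * a1) (w1 * a2 - w2 * a1) k0.
have TU' : [\/ transversal_hyperbolic (congruence w (s 1)) (congruence w (s 2)) (axis_line G) b c /\
   (skew_lines b c \/ \dim (b :&: c :&: eigen_line G nu%:C)%VS = 1%N),
   transversal_mixed (congruence w (s 1)) (congruence w (s 2)) (axis_line G) b c
   | transversal_parabolic (congruence w (s 1)) (congruence w (s 2)) (axis_line G) b c].
  case: TU => [[h [_ h1 h2]]|h|h]; [apply: Or31; split; first exact: h | exact: Or32 | exact: Or33].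
  have [d|d] := eqVneq ((z1 * a2 - z2 * a1) ^+ 2 - k * (w1 * a2 - w2 * a1) ^+ 2) 0.
    by right; exact: (h2 nu nuk (nuZ d)).
  by left; exact: (h1 d).
have [kz|kz] := eqVneq k 0.
  have nu0 : nu%:C = 0.
    have -> : nu = 0 by apply/eqP; rewrite -sqrf_eq0 nuk kz.
    by rewrite rmorph0.
  rewrite nu0 in TU'.
  have SP := s_parabolic Su Tu Uu Gu nf dn kz; have [q [nq [lin fq _]]] := SP.
  have lx : is_line (eigen_line G 0) := (proj1 ((fq (eigen_line G 0)).2 erefl)).
  have rx : real_line (eigen_line G 0) by rewrite -nu0; exact: eigen_line_real.
  exists (axis_line G), b, c, (eigen_line G 0), (eigen_line G 0).
  split; [by split; [exact: la | exact: lb | exact: lc | exact: lx | exact: lx] | exists s].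
  by apply: (parabolic_cases ra rb rc rx rx _ TU'); rewrite s0; exact: SP.
have nu0 : nu != 0 by rewrite -sqrf_eq0 nuk.
have nukC : nu%:C ^+ 2 = k%:C by rewrite -rmorphXn nuk.
have nuC0 : nu%:C != 0 by rewrite fmorph_eq0.
have [sk fl] := s_hyperbolic Su Tu Uu Gu nf dn nukC nuC0.
have [lx ly] := focal_lines_are_lines fl.
have rx := eigen_line_real G nu; have ry : real_line (eigen_line G (- nu%:C)).
  by rewrite -rmorphN; exact: eigen_line_real.
exists (axis_line G), b, c, (eigen_line G nu%:C), (eigen_line G (- nu%:C)).
split; [by split; [exact: la | exact: lb | exact: lc | exact: lx | exact: ly] | exists s].
apply: (hyperbolic_cases ra rb rc _ TU').
by rewrite s0; split; [exact: sl | exact: sk | exact: rx | exact: ry | exact: fl].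
Qed.
End Classification.

(** * General maps *)

Section SpectralQuartic.
Variable K : numFieldType.
Local Notation e0 := (unit_row K ord0).
Local Notation e1 := (unit_row K ord_max).
Local Notation fst2 r := (r ord0 ord0).
Local Notation snd2 r := (r ord0 ord_max).
Implicit Types f : 'rV[K]_2 -> 'rV[K]_2 -> 'rV[K]_2 -> 'rV[K]_4.

(** For fixed [t] the four vectors span the bilinear surface in [s] and [u]; the determinant
    vanishes where this surface lies in a plane. *)
Definition quartic f t := \det (rows4 (f e0 t e0) (f e1 t e0) (f e0 t e1) (f e1 t e1)).

Lemma rows4_mul (v0 v1 v2 v3 : 'rV[K]_4) (M : 'M[K]_4) :
  rows4 v0 v1 v2 v3 *m M = rows4 (v0 *m M) (v1 *m M) (v2 *m M) (v3 *m M).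
Proof.
by apply/row_matrixP => i; rewrite row_mul !rowK; case: i => [[|[|[|[|]]]]].
Qed.

(** Changes of [s] and [u] act on the four rows through the Kronecker product of two 2x2 matrices,
    hence by a constant factor. *)
Lemma quartic_change f (S T U : 'M[K]_2) : trilinear f ->
  S \in unitmx -> T \in unitmx -> U \in unitmx ->
  exists c, forall t, quartic f t = c * quartic (fun s t u => f (s *m S) (t *m T) (u *m U)) (t *m invmx T).
Proof.
move=> [f0 f1 f2] Su Tu Uu; pose S' := invmx S; pose U' := invmx U.
pose kr (i k : 'I_2) := row4 (S' i ord0 * U' k ord0) (S' i ord_max * U' k ord0)
   (S' i ord0 * U' k ord_max) (S' i ord_max * U' k ord_max).
exists (\det (rows4 (kr ord0 ord0) (kr ord_max ord0) (kr ord0 ord_max) (kr ord_max ord_max))) => t.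
rewrite /quartic mulmxKV // -det_mulmx rows4_mul; congr (\det _).
set F := fun i k => f (unit_row K i *m S) t (unit_row K k *m U).
rewrite -/(F ord0 ord0) -/(F ord_max ord0) -/(F ord0 ord_max) -/(F ord_max ord_max).
suff h i k : f (unit_row K i) t (unit_row K k) =
    kr i k *m rows4 (F ord0 ord0) (F ord_max ord0) (F ord0 ord_max) (F ord_max ord_max).
  by rewrite -!h.
have e (V : 'M[K]_2) (Vu : V \in unitmx) j : unit_row K j = invmx V j ord0 *: (e0 *m V) + invmx V j ord_max *: (e1 *m V).
  rewrite !scalemxAl -mulmxDl -[LHS](mulmxKV Vu); congr (_ *m _).
  by rewrite [LHS]row2_decomp -rowE !mxE.
rewrite {1}(e S Su i) {1}(e U Uu k) !f0 !f2 -/S' -/U'.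
rewrite -[RHS]/(vec _ _ _ _ _) vec_rows4 !scalerDr !scalerA.
by rewrite /F -!addrA; congr (_ + _); rewrite addrCA.
Qed.

Lemma det3E (M : 'M[K]_3) : \det M = M (inord 0) (inord 0) * (M (inord 1) (inord 1) * M (inord 2) (inord 2) - M (inord 1) (inord 2) * M (inord 2) (inord 1))
  - M (inord 0) (inord 1) * (M (inord 1) (inord 0) * M (inord 2) (inord 2) - M (inord 1) (inord 2) * M (inord 2) (inord 0))
  + M (inord 0) (inord 2) * (M (inord 1) (inord 0) * M (inord 2) (inord 1) - M (inord 1) (inord 1) * M (inord 2) (inord 0)).
Proof.
have [a [b [c [d [e [f [g [h [i ->]]]]]]]]] := mx3E M.
by rewrite det_col3 /det3 !mxE !inordK //= !mxE !inordK.
Qed.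

Lemma det_rows4 (a0 a1 a2 a3 b0 b1 b2 b3 c0 c1 c2 c3 d0 d1 d2 d3 : K) :
  \det (rows4 (row4 a0 a1 a2 a3) (row4 b0 b1 b2 b3) (row4 c0 c1 c2 c3) (row4 d0 d1 d2 d3)) =
  a0 * det3 b1 b2 b3 c1 c2 c3 d1 d2 d3 - a1 * det3 b0 b2 b3 c0 c2 c3 d0 d2 d3
  + a2 * det3 b0 b1 b3 c0 c1 c3 d0 d1 d3 - a3 * det3 b0 b1 b2 c0 c1 c2 d0 d1 d2.
Proof.
rewrite (expand_det_row _ ord0) !big_ord_recl big_ord0 /cofactor !det3E !mxE /= !inordK //=.
rewrite !mxE /= /bump /= !inordK //= /det3; ring.
Qed.

Lemma det_rows4_std k (a0 z0 w0 a1 z1 w1 : K) :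
  \det (rows4 (row4 a0 0 z0 w0) (row4 0 a0 (k * w0) z0) (row4 a1 0 z1 w1) (row4 0 a1 (k * w1) z1)) =
  (a0 * z1 - a1 * z0) ^+ 2 - k * (a0 * w1 - a1 * w0) ^+ 2.
Proof. by rewrite det_rows4 /det3; ring. Qed.

Section Invariants.
Variable A : comNzRingType.
Implicit Types a p m r e : A.

(* For a binary quartic a x^4 + b x^3 y + c x^2 y^2 + d x y^3 + e y^4 with values a, p, m, r, e
   at (1,0), (1,1), (1,-1), (1,2), (0,1): 2 c, 6 d and 6 b. *)
Definition twice_c a p m r e := p + m - 2 * a - 2 * e.
Definition six_d a p m r e := r - a - 2 * twice_c a p m r e - 16 * e - (p - m).
Definition six_b a p m r e := 3 * (p - m) - six_d a p m r e.

(* 216 (b^3 - 4 a b c + 8 a^2 d), which vanishes on multiples of squares. *)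
Definition square_inv a p m r e := let b := six_b a p m r e in
  b ^+ 3 - 72 * a * b * twice_c a p m r e + 288 * a ^+ 2 * six_d a p m r e.

(* 12 (12 a e - 3 b d + c^2), which vanishes on quartics with a triple root. *)
Definition cube_inv a p m r e :=
  144 * a * e - six_b a p m r e * six_d a p m r e + 3 * twice_c a p m r e ^+ 2.
End Invariants.

(** Five values determine a binary quartic. They are preferred to its coefficients because they are
    available both as numbers and as forms in the coefficients of the map. *)
Definition on_values (A : Type) (q : 'rV[K]_2 -> K) (g : K -> K -> K -> K -> K -> A) :=
  g (q (row2 1 0)) (q (row2 1 1)) (q (row2 1 (-1))) (q (row2 1 2)) (q (row2 0 1)).

Lemma square_inv_square (q : 'rV[K]_2 -> K) c m0 m1 m2 :
  (forall t, q t = c * (m0 * fst2 t ^+ 2 + m1 * (fst2 t * snd2 t) + m2 * snd2 t ^+ 2) ^+ 2) ->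
  on_values q (@square_inv K) = 0.
Proof.
by move=> qE; rewrite /on_values !qE !mxE /= /square_inv /six_b /six_d /twice_c; ring.
Qed.

Lemma cube_inv_cube (q : 'rV[K]_2 -> K) l0 l1 m0 m1 :
  (forall t, q t = (l0 * fst2 t + l1 * snd2 t) ^+ 3 * (m0 * fst2 t + m1 * snd2 t)) ->
  on_values q (@cube_inv K) = 0.
Proof.
by move=> qE; rewrite /on_values !qE !mxE /= /cube_inv /six_b /six_d /twice_c; ring.
Qed.

Section NormalForm.
Variables (f : 'rV[K]_2 -> 'rV[K]_2 -> 'rV[K]_2 -> 'rV[K]_4) (k : K) (S T U : 'M[K]_2) (G : 'M[K]_4).
Variables (a0 z0 w0 a1 z1 w1 a2 z2 w2 : K).
Hypotheses (ft : trilinear f) (Su : S \in unitmx) (Tu : T \in unitmx) (Uu : U \in unitmx).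
Hypothesis nf : normal_form (fun s t u => f (s *m S) (t *m T) (u *m U)) k G a0 z0 w0 a1 z1 w1 a2 z2 w2.

(** The double factor vanishes at the parameter of the base point. The remaining factor is the norm
    of a linear form with coefficients in K[i]. *)
Lemma quartic_normal_form : exists c, forall t, quartic f t = let r := t *m invmx T in
  c * (fst2 r ^+ 2 * ((fst2 r * (a0 * z1 - a1 * z0) + snd2 r * (z1 * a2 - z2 * a1)) ^+ 2
     - k * (fst2 r * (a0 * w1 - a1 * w0) + snd2 r * (w1 * a2 - w2 * a1)) ^+ 2)).
Proof.
have [c cE] := quartic_change ft Su Tu Uu; exists (c * \det G) => t; rewrite cE /=.
set r := t *m _; rewrite -mulrA; congr (c * _); rewrite /quartic !nf /= !e0E !e1E.
rewrite !std_e0 !std_e1 /vec -rows4_mul det_mulmx mulrC; congr (_ * _).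
by rewrite det_rows4_std; ring.
Qed.

(** For [k = 0] the norm is a square; for [a1 = 0] it is a constant times the square of the linear
    form with coefficients [a0] and [a2]. *)
Lemma quartic_square : k = 0 \/ a1 = 0 -> on_values (quartic f) (@square_inv K) = 0.
Proof.
have [c cE] := quartic_normal_form => h; set V := invmx T in cE.
pose l0 := V ord0 ord0; pose l1 := V ord_max ord0; pose n0 := V ord0 ord_max; pose n1 := V ord_max ord_max.
case: h => h.
  pose p := a0 * z1 - a1 * z0; pose q := z1 * a2 - z2 * a1.
  apply: (@square_inv_square _ c (l0 * (p * l0 + q * n0)) (l0 * (p * l1 + q * n1) + l1 * (p * l0 + q * n0)) (l1 * (p * l1 + q * n1))).
  by move=> t; rewrite cE h /= !mul2E -/l0 -/l1 -/n0 -/n1 -/p -/q; ring.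
apply: (@square_inv_square _ (c * (z1 ^+ 2 - k * w1 ^+ 2)) (l0 * (a0 * l0 + a2 * n0))
  (l0 * (a0 * l1 + a2 * n1) + l1 * (a0 * l0 + a2 * n0)) (l1 * (a0 * l1 + a2 * n1))).
by move=> t; rewrite cE h /= !mul2E -/l0 -/l1 -/n0 -/n1; ring.
Qed.

(** The hypothesis is the vanishing of the coefficient of [y ^ 2] in the norm, which leaves a third
    factor [x]. *)
Lemma quartic_cube : (z1 * a2 - z2 * a1) ^+ 2 - k * (w1 * a2 - w2 * a1) ^+ 2 = 0 ->
  on_values (quartic f) (@cube_inv K) = 0.
Proof.
have [c cE] := quartic_normal_form => h; set V := invmx T in cE.
pose l0 := V ord0 ord0; pose l1 := V ord_max ord0; pose n0 := V ord0 ord_max; pose n1 := V ord_max ord_max.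
pose p := a0 * z1 - a1 * z0; pose q := z1 * a2 - z2 * a1.
pose p' := a0 * w1 - a1 * w0; pose q' := w1 * a2 - w2 * a1.
pose A := p ^+ 2 - k * p' ^+ 2; pose B := 2 * (p * q - k * p' * q').
apply: (@cube_inv_cube _ l0 l1 (c * (A * l0 + B * n0)) (c * (A * l1 + B * n1))).
move=> t; rewrite cE /= !mul2E -/l0 -/l1 -/n0 -/n1 -/p -/q -/p' -/q' /=.
set x := fst2 t * l0 + _; set y := fst2 t * n0 + _.
have -> : (x * p + y * q) ^+ 2 - k * (x * p' + y * q') ^+ 2 = x ^+ 2 * A + x * y * B + y ^+ 2 * (q ^+ 2 - k * q' ^+ 2).
  by rewrite /A /B; ring.
by rewrite h /x /y; ring.
Qed.
End NormalForm.

(** Exchanging [t] and [u] exchanges the last two rows of the normal form, so the second quartic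
    yields the condition on [a2]. *)
Lemma quartic_conditions f k (S T U : 'M[K]_2) (G : 'M[K]_4) a0 z0 w0 a1 z1 w1 a2 z2 w2 :
  trilinear f -> S \in unitmx -> T \in unitmx -> U \in unitmx ->
  normal_form (fun s t u => f (s *m S) (t *m T) (u *m U)) k G a0 z0 w0 a1 z1 w1 a2 z2 w2 ->
  on_values (quartic f) (@square_inv K) != 0 ->
  on_values (quartic (fun s t u => f s u t)) (@square_inv K) != 0 ->
  on_values (quartic f) (@cube_inv K) != 0 ->
  [/\ k != 0, a1 != 0, a2 != 0 & (z1 * a2 - z2 * a1) ^+ 2 - k * (w1 * a2 - w2 * a1) ^+ 2 != 0].
Proof.
move=> ft Su Tu Uu nf J1 J2 I1; have [f0 f1 f2] := ft.
have nf' : normal_form (fun s t u => f (s *m S) (u *m T) (t *m U)) k G a0 z0 w0 a2 z2 w2 a1 z1 w1.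
  by move=> s t u; rewrite nf /=; congr (std _ _ _ _ _ _); ring.
have ft' : trilinear (fun s t u => f s u t) by [].
split.
- by apply: contra J1 => /eqP h; apply/eqP; apply: (quartic_square ft Su Tu Uu nf); left.
- by apply: contra J1 => /eqP h; apply/eqP; apply: (quartic_square ft Su Tu Uu nf); right.
- by apply: contra J2 => /eqP h; apply/eqP; apply: (quartic_square ft' Su Uu Tu nf'); right.
- by apply: contra I1 => /eqP h; apply/eqP; apply: (quartic_cube ft Su Tu Uu nf).
Qed.
End SpectralQuartic.

(** * The open condition as a form in the coefficients of the map *)

Section OpenCondition.
Variable K : numFieldType.
Local Notation e0 := (unit_row K ord0).
Local Notation e1 := (unit_row K ord_max).
Local Notation P := {mpoly K[tri_dim]}.

Definition trimap_form (s t u : 'rV[K]_2) (l : 'I_4) : P :=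
  \sum_i \sum_j \sum_k (s ord0 i * t ord0 j * u ord0 k) *: 'X_(enum_rank (l, [ffun m : 'I_3 => nth i [:: i; j; k] m])).

Lemma trimap_form_homog s t u l : trimap_form s t u l \is 1.-homog.
Proof.
by do 3 (apply: rpred_sum => ? _); apply: rpredZ; rewrite dhomogX /= mdeg1.
Qed.

Lemma meval_trimap_form (w : 'rV[K]_tri_dim) s t u l : (trimap_form s t u l).@[w ord0] = trimap w s t u ord0 l.
Proof.
rewrite /trimap_form /trimap raddf_sum /= summxE; apply: eq_bigr => i _.
rewrite raddf_sum /= summxE; apply: eq_bigr => j _.
rewrite raddf_sum /= summxE; apply: eq_bigr => k _.
by rewrite mevalZ mevalXU !mxE.
Qed.

Definition det_form (L : nat -> 'I_4 -> P) : P := \det (\matrix_(r < 4, l < 4) L r l).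

Lemma det_form_homog L : (forall r l, L r l \is 1.-homog) -> det_form L \is 4.-homog.
Proof.
move=> Lh; apply: rpred_sum => s _.
have -> : (-1) ^+ s = ((-1) ^+ s)%:MP :> P by rewrite rmorphXn /= rmorphN1.
rewrite mul_mpolyC; apply: rpredZ; rewrite !big_ord_recl big_ord0 mulr1.
by apply: (dhomogM (d := 1) (e := 3)); [|apply: (dhomogM (d := 1) (e := 2)); [|apply: (dhomogM (d := 1) (e := 1))]]; rewrite mxE.
Qed.

Definition quartic_form (L : 'rV[K]_2 -> 'rV[K]_2 -> 'rV[K]_2 -> 'I_4 -> P) t :=
  det_form (fun r l => nth 0 [:: L e0 t e0 l; L e1 t e0 l; L e0 t e1 l; L e1 t e1 l] r).

Lemma meval_quartic_form L (f : 'rV[K]_2 -> 'rV[K]_2 -> 'rV[K]_2 -> 'rV[K]_4) (w : 'rV[K]_tri_dim) t : (forall s t u l, (L s t u l).@[w ord0] = f s t u ord0 l) ->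
  (quartic_form L t).@[w ord0] = quartic f t.
Proof.
move=> LE; rewrite /quartic_form /det_form -[LHS]/(meval (w ord0) _) -det_map_mx; congr (\det _).
apply/matrixP => r l; rewrite !mxE; case: r => [[|[|[|[|]]]]] //= _; exact: LE.
Qed.

Definition on_mpoly_values (q : 'rV[K]_2 -> P) (g : P -> P -> P -> P -> P -> P) :=
  g (q (row2 1 0)) (q (row2 1 1)) (q (row2 1 (-1))) (q (row2 1 2)) (q (row2 0 1)).

Section Homogeneous.
Variables a p m r e : P.
Hypotheses (ha : a \is 4.-homog) (hp : p \is 4.-homog) (hm : m \is 4.-homog) (hr : r \is 4.-homog) (he : e \is 4.-homog).

Lemma homog_nat d n (q : P) : q \is d.-homog -> n%:R * q \is d.-homog.
Proof. by move=> h; rewrite mulr_natl rpredMn. Qed.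

Lemma twice_c_homog : twice_c a p m r e \is 4.-homog.
Proof. by rewrite /twice_c !(rpredB, rpredD) ?homog_nat. Qed.

Lemma six_d_homog : six_d a p m r e \is 4.-homog.
Proof. by rewrite /six_d !(rpredB, rpredD) ?homog_nat ?twice_c_homog. Qed.

Lemma six_b_homog : six_b a p m r e \is 4.-homog.
Proof. by apply: rpredB six_d_homog; apply: homog_nat; apply: rpredB. Qed.

Lemma square_inv_homog : square_inv a p m r e \is 12.-homog.
Proof.
have hb := six_b_homog; have hc := twice_c_homog; have hd := six_d_homog.
rewrite /square_inv !(rpredB, rpredD) //.
- exact: (dhomogMn 3 hb).
- by apply: (dhomogM (d := 8) (e := 4)) => //; apply: (dhomogM (d := 4) (e := 4)) => //; apply: homog_nat.
- by apply: (dhomogM (d := 8) (e := 4)) => //; apply: homog_nat; exact: (dhomogMn 2 ha).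
Qed.

Lemma cube_inv_homog : cube_inv a p m r e \is 8.-homog.
Proof.
have hb := six_b_homog; have hc := twice_c_homog; have hd := six_d_homog.
rewrite /cube_inv !(rpredB, rpredD) //.
- by apply: (dhomogM (d := 4) (e := 4)) => //; apply: homog_nat.
- exact: (dhomogM (d := 4) (e := 4)).
- by apply: homog_nat; exact: (dhomogMn 2 hc).
Qed.
End Homogeneous.

Definition swap_form s t u := trimap_form s u t.

Definition open_form : P :=
  on_mpoly_values (quartic_form trimap_form) (@square_inv _)
  * on_mpoly_values (quartic_form swap_form) (@square_inv _)
  * on_mpoly_values (quartic_form trimap_form) (@cube_inv _).

Lemma open_form_homog : homogeneous open_form.
Proof.
have h (L : 'rV[K]_2 -> 'rV[K]_2 -> 'rV[K]_2 -> 'I_4 -> P) t : (forall s t u l, L s t u l \is 1.-homog) -> quartic_form L t \is 4.-homog.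
  by move=> Lh; apply: det_form_homog => [[|[|[|[|]]]]] l //=; rewrite nth_nil rpred0.
have hs q : (forall t, q t \is 4.-homog) -> on_mpoly_values q (@square_inv _) \is 12.-homog.
  by move=> qh; apply: square_inv_homog.
have hc q : (forall t, q t \is 4.-homog) -> on_mpoly_values q (@cube_inv _) \is 8.-homog.
  by move=> qh; apply: cube_inv_homog.
have h1 t := h _ t trimap_form_homog; have h2 t := h swap_form t (fun s t u => trimap_form_homog s u t).
(* The values of the quartic have degree 4 in the coefficients, and the invariants have degrees 3, 3
   and 2 in these values. *)
exists 32%N; exact: (dhomogM (dhomogM (hs _ h1) (hs _ h2)) (hc _ h1)).
Qed.

Lemma rmorph_invariants (A B : comNzRingType) (g : {rmorphism A -> B}) (a p m r e : A) :
  (g (square_inv a p m r e) = square_inv (g a) (g p) (g m) (g r) (g e)) *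
  (g (cube_inv a p m r e) = cube_inv (g a) (g p) (g m) (g r) (g e)).
Proof.
have c : g (twice_c a p m r e) = twice_c (g a) (g p) (g m) (g r) (g e).
  by rewrite /twice_c !rmorphB rmorphD !rmorphM !rmorph_nat.
have d : g (six_d a p m r e) = six_d (g a) (g p) (g m) (g r) (g e).
  by rewrite /six_d 4!rmorphB !rmorphM !rmorph_nat c rmorphB.
have b : g (six_b a p m r e) = six_b (g a) (g p) (g m) (g r) (g e).
  by rewrite /six_b rmorphB rmorphM rmorphB rmorph_nat d.
split; first by rewrite /square_inv rmorphD rmorphB !rmorphM ?rmorphXn !rmorph_nat b c d.
by rewrite /cube_inv rmorphD rmorphB !rmorphM ?rmorphXn !rmorph_nat b c d.
Qed.

Lemma meval_open_form (w : 'rV[K]_tri_dim) : open_form.@[w ord0] =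
  on_values (quartic (trimap w)) (@square_inv K) * on_values (quartic (fun s t u => trimap w s u t)) (@square_inv K)
  * on_values (quartic (trimap w)) (@cube_inv K).
Proof.
have h1 t : (quartic_form trimap_form t).@[w ord0] = quartic (trimap w) t.
  by apply: meval_quartic_form => *; exact: meval_trimap_form.
have h2 t : (quartic_form swap_form t).@[w ord0] = quartic (fun s t u => trimap w s u t) t.
  by apply: meval_quartic_form => *; exact: meval_trimap_form.
have hs (q : 'rV[K]_2 -> P) qk : (forall t, (q t).@[w ord0] = qk t) ->
    (on_mpoly_values q (@square_inv _)).@[w ord0] = on_values qk (@square_inv K).
  by move=> qE; rewrite /on_values -!qE; exact: (rmorph_invariants (meval (w ord0)) _ _ _ _ _).1.
have hc (q : 'rV[K]_2 -> P) qk : (forall t, (q t).@[w ord0] = qk t) ->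
    (on_mpoly_values q (@cube_inv _)).@[w ord0] = on_values qk (@cube_inv K).
  by move=> qE; rewrite /on_values -!qE; exact: (rmorph_invariants (meval (w ord0)) _ _ _ _ _).2.
have mul3 (a b c : P) (a' b' c' : K) : a.@[w ord0] = a' -> b.@[w ord0] = b' -> c.@[w ord0] = c' ->
    (a * b * c).@[w ord0] = a' * b' * c' by move=> <- <- <-; rewrite !mevalM.
exact: (mul3 _ _ _ _ _ _ (hs _ _ h1) (hs _ _ h2) (hc _ _ h1)).
Qed.
End OpenCondition.

(** * Common factors, and an explicit map of type (1,2,2) *)

Section Factors.
Variables (K : numFieldType) (n : nat).
Implicit Types (f g d : {mpoly K[n]}) (v : 'I_n -> K).

Definition set_var v i c : 'I_n -> K := fun j => if j == i then c else v j.

Definition free_of i f := forall v c, f.@[set_var v i c] = f.@[v].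

Lemma meval_ext f v v' : (forall i, v i = v' i) -> f.@[v] = f.@[v'].
Proof. by move=> e; apply: meval_eq. Qed.

Definition subst_var i c f := f \mPo [tuple (if j == i then c%:MP else 'X_j) : {mpoly K[n]} | j < n].

Lemma meval_subst_var i c f v : (subst_var i c f).@[v] = f.@[set_var v i c].
Proof.
rewrite comp_mpoly_meval; apply: meval_ext => j; rewrite tnth_mktuple /set_var.
by case: eqP => _; rewrite ?mevalC ?mevalXU.
Qed.

(* At a point where f does not vanish, a factor of f restricted to the i-th direction divides a
   nonzero constant. *)
Lemma factor_free i f g d : f != 0 -> f = g * d -> free_of i f -> free_of i d.
Proof.
move=> f0 fE fi.
pose line v : 'I_n -> {poly K} := fun j => if j == i then 'X else (v j)%:P.
have lineE p v c : (mmap (@polyC K) (line v) p).[c] = p.@[set_var v i c].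
  rewrite horner_mmap; apply: meval_ext => j; rewrite /line /set_var.
  by case: eqP => _; rewrite ?hornerX ?hornerC.
have key c : subst_var i c d - d = 0.
  apply: (mpoly_generic_eq0 f0) => v fv; rewrite mevalB meval_subst_var.
  have GD : mmap (@polyC K) (line v) g * mmap (@polyC K) (line v) d = (f.@[v])%:P.
    apply/eqP; rewrite -subr_eq0; apply/eqP; apply: poly_nat_eq0 => m.
    by rewrite hornerD hornerN hornerM hornerC !lineE -mevalM -fE fi subrr.
  have D0 : mmap (@polyC K) (line v) d != 0.
    by apply: contraNneq fv => D0; move/eqP: GD; rewrite D0 mulr0 eq_sym polyC_eq0.
  have G0 : mmap (@polyC K) (line v) g != 0.
    by apply: contraNneq fv => G0; move/eqP: GD; rewrite G0 mul0r eq_sym polyC_eq0.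
  have := congr1 (fun p : {poly K} => size p) GD; rewrite size_mul // size_polyC fv.
  have := D0; have := G0; rewrite -!size_poly_gt0 => s1 s2 /= s3.
  have /size_poly1P[b _ DE] : size (mmap (@polyC K) (line v) d) == 1%N by apply/eqP; move: s1 s2 s3; set x := size _; set y := size _; clearbody x y; lia.
  have := lineE d v c; have := lineE d v (v i); rewrite DE !hornerC => h1 h2.
  have <- : d.@[set_var v i (v i)] = d.@[v] by apply: meval_ext => j; rewrite /set_var; case: eqP => // ->.
  by rewrite -h2 h1 subrr.
move=> v c; have /(congr1 (meval v)) := key c; rewrite mevalB meval_subst_var meval0 => /eqP.
by rewrite subr_eq0 => /eqP.
Qed.

Lemma mpoly_unit_of_eval h d (c : K) : c != 0 -> (forall v, h.@[v] * d.@[v] = c) -> d \is a GRing.unit.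
Proof.
move=> c0 hd; apply/unitrPr; exists (c^-1%:MP * h); apply: mpoly_ext => v.
by rewrite !mevalM meval1 mevalC mulrCA [d.@[v] * _]mulrC hd mulVf.
Qed.
End Factors.

Section Witness.
Variable K : numFieldType.
Local Notation fst2 r := (r ord0 ord0).
Local Notation snd2 r := (r ord0 ord_max).

(* The coefficients of (s0 A : s1 A : s0 t1 u0 : s1 t0 u1) with A = t0 u0 + t0 u1 + t1 u0. *)
Definition witness_coef (l : nat) (i j k : 'I_2) : K :=
  (nth false [:: (i == ord0) && ((j == ord0) || (k == ord0)); (i != ord0) && ((j == ord0) || (k == ord0));
    [&& i == ord0, j != ord0 & k == ord0]; [&& i != ord0, j == ord0 & k != ord0]] l)%:R.

Definition witness : 'rV[K]_tri_dim :=
  \row_n let le : 'I_4 * {ffun 'I_3 -> 'I_2} := enum_val n in witness_coef le.1 (le.2 0) (le.2 1) (le.2 (inord 2)).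

Lemma tri_vec_witness i j k l : tri_vec witness i j k ord0 l = witness_coef l i j k.
Proof. by rewrite /tri_vec mxE /tri_coef mxE enum_rankK /= !ffunE /= inordK. Qed.

Lemma trimap_witness s t u : trimap witness s t u =
  let A := fst2 t * fst2 u + fst2 t * snd2 u + snd2 t * fst2 u in
  row4 (fst2 s * A) (snd2 s * A) (fst2 s * snd2 t * fst2 u) (snd2 s * fst2 t * snd2 u).
Proof.
apply/rowP => l; rewrite trimap_coord !tri_vec_witness /witness_coef !mxE.
by case: l => [[|[|[|[|]]]]] //= _; ring.
Qed.

Let A3 (t u : 'rV[K]_2) := fst2 t * fst2 u + fst2 t * snd2 u + snd2 t * fst2 u.
Definition coord_row (v : 'I_(3 * 2) -> K) (k : 'I_3) : 'rV[K]_2 := \row_j v (mxvec_index k j).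

Lemma tri_poly_eval (w : 'rV[K]_tri_dim) i v : (tri_poly w i).@[v] =
  trimap w (coord_row v 0) (coord_row v 1) (coord_row v (inord 2)) ord0 i.
Proof.
pose z : 'M[K]_(3, 2) := \matrix_(k, j) v (mxvec_index k j).
have vE : forall l, v l = mxvec z ord0 l by move=> l; case: (mxvec_indexP l) => k j; rewrite mxvecE mxE.
rewrite (meval_ext _ vE); have := tri_evalE w z => /rowP/(_ i); rewrite [LHS]mxE => ->.
have rE k : row k z = coord_row v k by apply/rowP => j; rewrite !mxE.
have -> : (2 : 'I_3) = inord 2 by apply: val_inj; rewrite /= inordK.
by rewrite !rE.
Qed.

Let X i : {mpoly K[4]} := 'X_i.

(** On the image, H equals s0 s1 A t0 u0, while the other two products are s0 s1 A t1 u0 and s0 s1 A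
    t0 u1. Their ratios to H are those of the coordinates of t and of u. *)
Definition witness_inverse (k : 'I_3) (j : 'I_2) : {mpoly K[4]} :=
  let H := X 0 * X 1 - X 1 * X (inord 2) - X 0 * X (inord 3) in
  nth 0 [:: if j == 0 then X 0 else X 1; if j == 0 then H else X 1 * X (inord 2);
    if j == 0 then H else X 0 * X (inord 3)] k.

Lemma witness_tri_poly i v : (tri_poly witness i).@[v] =
  let s := coord_row v 0 in let t := coord_row v 1 in let u := coord_row v (inord 2) in
  nth 0 [:: fst2 s * A3 t u; snd2 s * A3 t u; fst2 s * snd2 t * fst2 u; snd2 s * fst2 t * snd2 u] i.
Proof. by rewrite tri_poly_eval trimap_witness /= mxE. Qed.

Lemma ord3P (k : 'I_3) : [\/ k = 0, k = 1 | k = inord 2].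
Proof.
by case: k => [[|[|[|]]]] // h; [apply: Or31 | apply: Or32 | apply: Or33]; apply: val_inj; rewrite /= ?inordK.
Qed.

Lemma witness_inverse_homog k j : witness_inverse k j \is (type122 k).-homog.
Proof.
have Xh i : X i \is 1.-homog by rewrite dhomogX /= mdeg1.
have X2 i l : X i * X l \is 2.-homog by exact: (dhomogM (Xh i) (Xh l)).
have H2 : X 0 * X 1 - X 1 * X (inord 2) - X 0 * X (inord 3) \is 2.-homog by rewrite !rpredB.
have [-> | -> | ->] := ord3P k; rewrite /witness_inverse ?inordK //; case: ifP => _.
1,2: exact: Xh.
1,2: by [exact: H2 | exact: X2].
all: have -> : type122 (inord 2) = 2 by rewrite /type122 -val_eqE /= inordK.
all: by [exact: H2 | exact: X2].
Qed.

Lemma ord_neq n i j : (i < n.+1)%N -> (j < n.+1)%N -> i != j -> (inord i == inord j :> 'I_n.+1) = false.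
Proof. by move=> hi hj ij; rewrite -val_eqE /= !inordK // (negPf ij). Qed.

Lemma X_neq0 n (i : 'I_n) : 'X_i != 0 :> {mpoly K[n]}.
Proof. by apply/eqP => /(congr1 (meval (fun=> 1)))/eqP; rewrite mevalXU meval0 oner_eq0. Qed.

(** A common factor of a quadratic pair divides a monomial, so it is free of the variables absent
    from it. Setting one of these to 1 and varying the other changes H by the constant -1, which the
    factor must divide. The linear pair is treated similarly. *)
Lemma witness_inverse_coprime k : no_common_factor (witness_inverse k).
Proof.
move=> d hd; have [g0 h0] := hd 0; have [g1 h1] := hd 1.
have o4 (i j : nat) : (i < 4)%N -> (j < 4)%N -> i != j -> (inord i == inord j :> 'I_4) = false.
  exact: ord_neq.
have e0 : (0 : 'I_4) = inord 0 by apply: val_inj; rewrite /= inordK.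
have e1 : (1 : 'I_4) = inord 1 by apply: val_inj; rewrite /= inordK.
have X2n i j : X i * X j != 0 by rewrite mulf_neq0 ?X_neq0.
have factor_subst i c v : free_of i d -> d.@[v] = d.@[set_var v i c] by move=> ->.
have [kE | kE | kE] := ord3P k; rewrite kE /witness_inverse ?inordK //= ?e0 ?e1 in h0 h1.
- have f1 : free_of (inord 1) d.
    apply: (factor_free _ h0); rewrite ?X_neq0 // => v c.
    by rewrite !mevalXU /set_var o4.
  apply: (@mpoly_unit_of_eval _ _ (subst_var (inord 1) 1 g1) d 1); rewrite ?oner_eq0 // => v.
  rewrite meval_subst_var (factor_subst (inord 1) 1 v f1) -mevalM -h1 mevalXU /set_var.
  by rewrite eqxx.
- have gd v : g0.@[v] * d.@[v] = v (inord 0) * v (inord 1) - v (inord 1) * v (inord 2) - v (inord 0) * v (inord 3).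
    by rewrite -mevalM -h0 !mevalB !mevalM !mevalXU.
  have f0 : free_of (inord 0) d.
    by apply: (factor_free _ h1); rewrite ?X2n // => v c; rewrite !mevalM !mevalXU /set_var !o4.
  have f3 : free_of (inord 3) d.
    by apply: (factor_free _ h1); rewrite ?X2n // => v c; rewrite !mevalM !mevalXU /set_var !o4.
  have [sb sbE] : exists sb : K -> {mpoly K[4]} -> {mpoly K[4]}, forall c p v,
      (sb c p).@[v] = p.@[set_var (set_var v (inord 0) 1) (inord 3) c].
    by exists (fun c p => subst_var (inord 0) 1 (subst_var (inord 3) c p)) => c p v; rewrite !meval_subst_var.
  have dE c v : d.@[v] = d.@[set_var (set_var v (inord 0) 1) (inord 3) c] by rewrite f3 f0.
  apply: (@mpoly_unit_of_eval _ _ (sb 1 g0 - sb 0 g0) d (-1)); rewrite ?oppr_eq0 ?oner_eq0 // => v.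
  have sv c : let x := set_var (set_var v (inord 0) 1) (inord 3) c in
      x (inord 0) * x (inord 1) - x (inord 1) * x (inord 2) - x (inord 0) * x (inord 3)
      = v (inord 1) - v (inord 1) * v (inord 2) - c by rewrite /set_var !eqxx !o4 //= !mul1r.
  rewrite mevalB mulrBl {1}(dE 1) (dE 0 v) !sbE !gd; have := sv 1; have := sv 0; cbv zeta => -> ->; ring.
have gd v : g0.@[v] * d.@[v] = v (inord 0) * v (inord 1) - v (inord 1) * v (inord 2) - v (inord 0) * v (inord 3).
  by rewrite -mevalM -h0 !mevalB !mevalM !mevalXU.
have f1 : free_of (inord 1) d.
  by apply: (factor_free _ h1); rewrite ?X2n // => v c; rewrite !mevalM !mevalXU /set_var !o4.
have f2 : free_of (inord 2) d.
  by apply: (factor_free _ h1); rewrite ?X2n // => v c; rewrite !mevalM !mevalXU /set_var !o4.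
have [sb sbE] : exists sb : K -> {mpoly K[4]} -> {mpoly K[4]}, forall c p v,
    (sb c p).@[v] = p.@[set_var (set_var v (inord 1) 1) (inord 2) c].
  by exists (fun c p => subst_var (inord 1) 1 (subst_var (inord 2) c p)) => c p v; rewrite !meval_subst_var.
have dE c v : d.@[v] = d.@[set_var (set_var v (inord 1) 1) (inord 2) c] by rewrite f2 f1.
apply: (@mpoly_unit_of_eval _ _ (sb 1 g0 - sb 0 g0) d (-1)); rewrite ?oppr_eq0 ?oner_eq0 // => v.
have sv c : let x := set_var (set_var v (inord 1) 1) (inord 2) c in
    x (inord 0) * x (inord 1) - x (inord 1) * x (inord 2) - x (inord 0) * x (inord 3)
    = v (inord 0) - c - v (inord 0) * v (inord 3) by rewrite /set_var !eqxx !o4 //= mulr1 mul1r.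
rewrite mevalB mulrBl {1}(dE 1) (dE 0 v) !sbE !gd; have := sv 1; have := sv 0; cbv zeta => -> ->; ring.
Qed.

Lemma coord_row_set v k j c k' : coord_row (set_var v (mxvec_index k j) c) k' =
  \row_l (if (k' == k) && (l == j) then c else coord_row v k' ord0 l).
Proof.
apply/rowP => l; rewrite !mxE /set_var.
by rewrite (inj_eq (@cast_ord_inj _ _ _)) (inj_eq enum_rank_inj) xpair_eqE.
Qed.

(** A divisor of s0 t1 u0 is free of s1, t0 and u1. Setting these to 1 in s1 t0 u1 shows that it
    divides 1. *)
Lemma witness_coprime : no_common_factor (tri_poly witness).
Proof.
move=> d hd; have [g2 h2] := hd (inord 2); have [g3 h3] := hd (inord 3).
have o3 (i j : nat) : (i < 3)%N -> (j < 3)%N -> i != j -> (inord i == inord j :> 'I_3) = false.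
  exact: ord_neq.
have e0 : (0 : 'I_3) = inord 0 by apply: val_inj; rewrite /= inordK.
have e1 : (1 : 'I_3) = inord 1 by apply: val_inj; rewrite /= inordK.
have f20 : tri_poly witness (inord 2) != 0.
  apply/eqP => /(congr1 (meval (fun=> 1)))/eqP; rewrite witness_tri_poly inordK //= !mxE meval0.
  by rewrite !mulr1 oner_eq0.
have fs : free_of (mxvec_index (inord 0) ord_max) d.
  apply: (factor_free f20 h2) => v c.
  by rewrite !witness_tri_poly inordK //= e0 e1 !coord_row_set !mxE !eqxx !o3 //= ?andbF.
have ft : free_of (mxvec_index (inord 1) ord0) d.
  apply: (factor_free f20 h2) => v c.
  by rewrite !witness_tri_poly inordK //= e0 e1 !coord_row_set !mxE !eqxx !o3 //= ?andbF.
have fu : free_of (mxvec_index (inord 2) ord_max) d.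
  apply: (factor_free f20 h2) => v c.
  by rewrite !witness_tri_poly inordK //= e0 e1 !coord_row_set !mxE !eqxx !o3 //= ?andbF.
have [sb sbE] : exists sb : {mpoly K[3 * 2]} -> {mpoly K[3 * 2]}, forall p v, (sb p).@[v] =
    p.@[set_var (set_var (set_var v (mxvec_index (inord 0) ord_max) 1)
      (mxvec_index (inord 1) ord0) 1) (mxvec_index (inord 2) ord_max) 1].
  exists (fun p => subst_var (mxvec_index (inord 0) ord_max) 1 (subst_var (mxvec_index (inord 1) ord0) 1
     (subst_var (mxvec_index (inord 2) ord_max) 1 p))) => p v.
  by rewrite !meval_subst_var.
apply: (@mpoly_unit_of_eval _ _ (sb g3) d 1); rewrite ?oner_eq0 // => v.
rewrite sbE -(fs v 1) -(ft _ 1) -(fu _ 1).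
have gd v' : g3.@[v'] * d.@[v'] = (tri_poly witness (inord 3)).@[v'] by rewrite h3 mevalM.
rewrite gd witness_tri_poly inordK //= e0 e1; set v' := set_var _ _ _.
have -> : coord_row v' (inord 0) ord0 ord_max = 1.
  by rewrite !coord_row_set mxE (o3 0%N 2%N) //= mxE (o3 0%N 1%N) //= mxE !eqxx.
have -> : coord_row v' (inord 1) ord0 ord0 = 1.
  by rewrite !coord_row_set mxE (o3 1%N 2%N) //= mxE !eqxx.
have -> : coord_row v' (inord 2) ord0 ord_max = 1 by rewrite coord_row_set mxE !eqxx.
by rewrite !mulr1.
Qed.

Lemma witness_birational : tri_birational witness type122.
Proof.
split; first exact: witness_coprime.
exists witness_inverse; split.
- exact: witness_inverse_homog.
- exact: witness_inverse_coprime.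
- have n3 : 1 + 1 + 1 != 0 :> K by have -> : 1 + 1 + 1 = 3%:R :> K by [ring]; rewrite pnatr_eq0.
  move=> k; split.
    exists 1 => /(congr1 (meval (mxvec (const_mx 1) ord0))); rewrite meval_phi tri_evalE trimap_witness meval0.
    have [-> | -> | ->] := ord3P k; rewrite /witness_inverse ?inordK //= ?mevalM !mevalXU !mxE ?inordK //=;
      by apply/eqP; rewrite !(mul1r, mulr1) n3.
  apply: mpoly_vec_ext => z; rewrite !mevalM !meval_phi /param_var !mevalXU !mxvecE tri_evalE trimap_witness.
  have i0 : (0 : 'I_2) = ord0 by apply: val_inj.
  have i1 : (1 : 'I_2) = ord_max by apply: val_inj.
  have i2 : (2 : 'I_3) = inord 2 by apply: val_inj; rewrite /= inordK.
  have [-> | -> | ->] := ord3P k; rewrite /witness_inverse ?inordK //= ?mevalB ?mevalM !mevalXU !mxE ?inordK //=;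
    rewrite ?i2 ?i0 ?i1; ring.
pose x (v : 'I_4 -> K) := (v (inord 0), v (inord 1), v (inord 2), v (inord 3)).
have e0 : (0 : 'I_4) = inord 0 by apply: val_inj; rewrite /= inordK.
have e1 : (1 : 'I_4) = inord 1 by apply: val_inj; rewrite /= inordK.
pose H (v : 'I_4 -> K) := v (inord 0) * v (inord 1) - v (inord 1) * v (inord 2) - v (inord 0) * v (inord 3).
pose psi := [tuple mxvec (\matrix_(k < 3, j < 2) witness_inverse k j) ord0 l | l < 3 * 2].
have cE v k j : coord_row (fun l => (tnth psi l).@[v]) k ord0 j = (witness_inverse k j).@[v].
  by rewrite mxE tnth_mktuple mxvecE mxE.
have psiE i v : (tri_poly witness i \mPo psi).@[v] = v (inord 0) * v (inord 1) * H v * v i.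
  rewrite comp_mpoly_meval witness_tri_poly /= /A3 !cE /witness_inverse inordK //=.
  rewrite !mevalB !mevalM !mevalXU e0 e1 /H.
  have iE : i = inord i by rewrite inord_val.
  rewrite [in RHS]iE; case: i {iE} => [[|[|[|[|]]]]] //= _; ring.
split.
  exists 0 => /(congr1 (meval (fun i : 'I_4 => if i == inord 3 then 2 else 1))); rewrite psiE meval0 /H e0.
  rewrite eqxx !ord_neq // !mul1r mulr1 subrr sub0r => /eqP.
  by rewrite oppr_eq0 pnatr_eq0.
by move=> i i'; apply: mpoly_ext => v; rewrite !mevalM !mevalXU !psiE; ring.
Qed.
End Witness.

Section WitnessOpen.
Variable K : numFieldType.

Lemma quartic_witness (t : 'rV[K]_2) :
  let q := - ((t ord0 ord0 + t ord0 ord_max) * t ord0 ord0 ^+ 2 * t ord0 ord_max) in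
  (quartic (trimap (witness K)) t = q) * (quartic (fun s t u => trimap (witness K) s u t) t = q).
Proof.
by rewrite /quartic !trimap_witness /= !e0E !e1E !det_rows4 /det3; split; ring.
Qed.

(** Both quartics are - t0 ^ 3 t1 - t0 ^ 2 t1 ^ 2, with middle coefficients b = c = -1 and a = d = e
    = 0. The invariants are then (-6) ^ 3 = -216 and 3 (-2) ^ 2 = 12. *)
Lemma witness_open : (open_form K).@[(witness K) ord0] != 0.
Proof.
rewrite meval_open_form /on_values !quartic_witness !mxE /=.
set a := square_inv _ _ _ _ _; set b := cube_inv _ _ _ _ _.
have -> : a = - 216%:R by rewrite /a /square_inv /six_b /six_d /twice_c; ring.
have -> : b = 12%:R by rewrite /b /cube_inv /six_b /six_d /twice_c; ring.
by rewrite !mulf_neq0 ?oppr_eq0 ?pnatr_eq0.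
Qed.
End WitnessOpen.

(** * Focal lines of a general map *)

Section GeneralMap.
Variable R : realType.
Local Notation C := R[i].

Lemma lines_meet_at (L M : {vspace 'rV[C]_4}) v : v != 0 -> v \in L -> v \in M -> lines_meet L M.
Proof.
move=> v0 vL vM h; have : v \in (L :&: M)%VS by rewrite memv_cap vL.
by rewrite h memv0 (negPf v0).
Qed.

Section Meet.
Variables (k : R) (G : 'M[R]_4) (nu : C).
Hypothesis Gu : G \in unitmx.
Hypothesis nuk : nu ^+ 2 = k%:C.

Lemma axis_meets_eigen : lines_meet (axis_line G) (eigen_line G nu).
Proof.
have GCu := complex_frame_unit Gu.
apply: (@lines_meet_at _ _ (vec (map_mx (real_complex R) G) 0 0 nu 1)).
- by rewrite vec_eq0 // oner_eq0 !andbF.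
- apply/mem_line; exists nu, 1; rewrite vec_comb; congr (vec _ _ _ _ _); ring.
- apply/mem_line; exists 0, 1; rewrite vec_comb; congr (vec _ _ _ _ _); ring.
Qed.

Lemma cross_meets_eigen a z v : a != 0 -> lines_meet (cross_line k G a z v) (eigen_line G nu).
Proof.
move=> a0; have GCu := complex_frame_unit Gu.
have aC : a%:C != 0 by rewrite fmorph_eq0.
apply: (@lines_meet_at _ _ (vec (map_mx (real_complex R) G) (a%:C * nu) a%:C
   (nu * (z%:C + nu * v%:C)) (z%:C + nu * v%:C))).
- by rewrite vec_eq0 // (negPf aC) andbF.
- apply/mem_line; exists nu, 1; rewrite std_e0 std_e1 vec_comb -nuk; congr (vec _ _ _ _ _); ring.
- apply/mem_line; exists a%:C, (z%:C + nu * v%:C); rewrite vec_comb; congr (vec _ _ _ _ _); ring.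
Qed.
End Meet.

Lemma focal_lines_unique (X : pset C 6) L M L' M' : focal_lines_are X L M -> focal_lines_are X L' M' ->
  skew_lines L' M' -> (L' = L /\ M' = M) \/ (L' = M /\ M' = L).
Proof.
move=> h h' sk; have [lL _] := focal_lines_are_lines h'.
have hL : L' = L \/ L' = M by apply/h/h'; left.
have hM : M' = L \/ M' = M by apply/h/h'; right.
have n : L' <> M'.
  by move=> e; move: lL sk; rewrite /is_line /skew_lines -e capvv => + L0; rewrite L0 dimv0.
by case: hL n => -> n; case: hM n => -> n; [| left | right |].
Qed.

(** The line [a] is distinguished as the common focal line of T and U: any other matching would
    identify two of the skew lines [a], [b], [c]. *)
Lemma focal_configuration_unique (w : 'rV[R]_tri_dim) a b c x y a' b' c' x' y' :
  focal_configuration w a b c x y -> focal_configuration w a' b' c' x' y' ->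
  [/\ a' = a, b' = b, c' = c & (x' = x /\ y' = y) \/ (x' = y /\ y' = x)].
Proof.
move=> [[la lb lc lx ly] [sxy sab sac sbc] _ [fS fT fU]].
move=> [[la' lb' lc' lx' ly'] [sxy' sab' sac' sbc'] _ [fS' fT' fU']].
have self (L : {vspace 'rV[C]_4}) : is_line L -> ~ skew_lines L L.
  by move=> lL; rewrite /skew_lines capvv => L0; move: lL; rewrite L0 /is_line dimv0.
have hx := focal_lines_unique fS fS' sxy'.
have [[aE cE]|[aE cE]] := focal_lines_unique fT fT' sac'; last first.
  have [[aE' _]|[aE' _]] := focal_lines_unique fU fU' sab'.
    by move: sac; rewrite -aE -aE' => /(self _ la').
  by move: sbc; rewrite -aE -aE' => /(self _ la').
have [[_ bE]|[aE' _]] := focal_lines_unique fU fU' sab'; first by [].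
by move: sab; rewrite -aE -aE' => /(self _ la').
Qed.

Lemma real_map_neq0 (w : 'rV[R]_tri_dim) : real_bir122 w -> w != 0.
Proof.
move=> bir; apply/eqP => w0; have span := real_span bir (c := const_mx 1).
have h : const_mx 1 <> 0 :> 'cV[R]_4.
  by move/matrixP/(_ ord0 ord0); rewrite !mxE => /eqP; rewrite oner_eq0.
apply/h/span => s t u; rewrite w0.
have -> : trimap 0 s t u = 0 by apply/rowP => l; rewrite trimap_coord /tri_vec !mxE /tri_coef !mxE; ring.
by rewrite mul0mx.
Qed.

Lemma to_complex_witness : to_complex (witness R) = witness C.
Proof. by apply/rowP => n; rewrite !mxE /witness_coef; exact: (rmorph_nat (real_complex R)). Qed.

Lemma open_focal_configuration (w : 'rV[R]_tri_dim) : real_bir122 w -> (open_form R).@[w ord0] != 0 ->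
  exists a b c x y, focal_configuration w a b c x y /\
   ([/\ real_line a, real_line b, real_line c, real_line x & real_line y] \/
    [/\ real_line a, real_line b, real_line c, skew_lines x y & conj_lines x y]).
Proof.
move=> bir; rewrite meval_open_form !mulf_eq0 !negb_or => /andP[/andP[J1 J2] I1].
have [k [S [T [U [G [a0 [z0 [w0 [a1 [z1 [w1 [a2 [z2 [w2 hyp]]]]]]]]]]]]]] := real_normal_form bir.
have [[Su Tu Uu Gu] nf dn c1 c2] := hyp.
have [k0 a10 a20 dd] := quartic_conditions (trimap_trilinear w) Su Tu Uu nf J1 J2 I1.
have [_ sac rc ra fT] := t_hyperbolic Su Tu Uu Gu nf dn a20.
have [_ sab _ rb fU] := u_hyperbolic Su Tu Uu Gu nf dn a10.
have sbc := cross_lines_skew Gu dd a10.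
have [la lc] := focal_lines_are_lines fT; have [_ lb] := focal_lines_are_lines fU.
have conf nu : nu ^+ 2 = k%:C -> nu != 0 -> focal_configuration w (axis_line G)
   (cross_line k G a1 z1 w1) (cross_line k G a2 z2 w2) (eigen_line G nu) (eigen_line G (- nu)).
  move=> nuk nu0; have [sxy fS] := s_hyperbolic Su Tu Uu Gu nf dn nuk nu0.
  have [lx ly] := focal_lines_are_lines fS.
  have nuk' : (- nu) ^+ 2 = k%:C by rewrite sqrrN.
  split.
  - by split; [exact: la | exact: lb | exact: lc | exact: lx | exact: ly].
  - by split; [exact: sxy | exact: sab | exact: sac | exact: sbc].
  - move=> l; rewrite !inE => /or3P[] /eqP->.
    + by split; apply: axis_meets_eigen.
    + by split; apply: cross_meets_eigen.
    + by split; apply: cross_meets_eigen.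
  - by split; [exact: fS | exact: fT | exact: fU].
have [kn|kp] := ltP k 0.
  have [nu [nuk nu0 nuc]] := complex_sqrt_neg kn.
  exists (axis_line G), (cross_line k G a1 z1 w1), (cross_line k G a2 z2 w2), (eigen_line G nu), (eigen_line G (- nu)).
  split; first exact: conf.
  right; have [sxy _] := s_hyperbolic Su Tu Uu Gu nf dn nuk nu0.
  have cj : conj_lines (eigen_line G nu) (eigen_line G (- nu)) by rewrite -nuc; exact: eigen_line_conj.
  by split; [exact: rc | exact: rb | exact: ra | exact: sxy | exact: cj].
have [nu nuk _] := real_sqrt_choice 0 0 kp.
have nukC : nu%:C ^+ 2 = k%:C by rewrite -rmorphXn nuk.
have nuC0 : nu%:C != 0 by rewrite fmorph_eq0 -sqrf_eq0 nuk.
exists (axis_line G), (cross_line k G a1 z1 w1), (cross_line k G a2 z2 w2), (eigen_line G nu%:C), (eigen_line G (- nu%:C)).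
split; first exact: conf.
left; have rx := eigen_line_real G nu; have ry : real_line (eigen_line G (- nu%:C)).
  by rewrite -rmorphN; exact: eigen_line_real.
by split; [exact: rc | exact: rb | exact: ra | exact: rx | exact: ry].
Qed.
End GeneralMap.

Theorem general_real_map (R : realType) :
  general (@real_bir122 R) (fun w =>
    [/\ exists a b c x y, focal_configuration w a b c x y,
        forall a b c x y a' b' c' x' y',
          focal_configuration w a b c x y ->
          focal_configuration w a' b' c' x' y' ->
          [/\ a' = a, b' = b, c' = c
            & (x' = x /\ y' = y) \/ (x' = y /\ y' = x)]
      & forall a b c x y, focal_configuration w a b c x y ->
          [/\ real_line a, real_line b, real_line c, real_line x
            & real_line y] \/
          [/\ real_line a, real_line b, real_line c, skew_lines x y
            & conj_lines x y]]).
Proof.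
exists (fun v : 'rV[R]_tri_dim => v != 0 /\ (open_form R).@[v ord0] = 0); split.
- exists (eq^~ (open_form R)); split=> [f ->|v]; first exact: open_form_homog.
  by split=> -[v0 h]; split=> //; [move=> f -> | exact: h].
- exists (witness R); split.
    by rewrite /real_bir122 to_complex_witness; exact: witness_birational.
  by move=> [_ h]; have := witness_open R; rewrite h eqxx.
move=> w bir wZ.
have ow : (open_form R).@[w ord0] != 0.
  by apply/eqP => h; apply: wZ; split=> //; exact: real_map_neq0.
have [a [b [c [x [y [conf rl]]]]]] := open_focal_configuration bir ow.
split.
- by exists a, b, c, x, y.
- by move=> ? ? ? ? ? ? ? ? ? ? f1 f2; exact: (focal_configuration_unique f1 f2).
move=> a' b' c' x' y' conf'; have [-> -> -> hxy] := focal_configuration_unique conf conf'.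
have [[_ _ _ lx ly] [sxy _ _ _] _ _] := conf.
(* Only the interchange of [x] and [y] is left, under which both alternatives are symmetric. *)
case: hxy => -[-> ->]; first exact: rl.
case: rl => -[ra rb rc rx ry]; [left | right]; split; try assumption.
  by rewrite /skew_lines capvC.
have cK (v : 'rV[R[i]]_4) : conj_row (conj_row v) = v := conj_rowK v.
by move=> v; rewrite -{1}(cK v) -ry.
Qed.

Theorem theoremD3 (R : realType) :
  general (@real_bir122 R) (fun w =>
    [/\ exists a b c x y, focal_configuration w a b c x y,
        forall a b c x y a' b' c' x' y',
          focal_configuration w a b c x y ->
          focal_configuration w a' b' c' x' y' ->
          [/\ a' = a, b' = b, c' = c
            & (x' = x /\ y' = y) \/ (x' = y /\ y' = x)]
      & forall a b c x y, focal_configuration w a b c x y ->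
          [/\ real_line a, real_line b, real_line c, real_line x
            & real_line y] \/
          [/\ real_line a, real_line b, real_line c, skew_lines x y
            & conj_lines x y]])
  /\
  (forall w : 'rV[R]_tri_dim, real_bir122 w ->
   exists a b c x y : {vspace 'rV[R[i]]_4},
   [/\ is_line a, is_line b, is_line c, is_line x & is_line y] /\
   exists s : 'S_3,
   let S := congruence w (s 0) in
   let T := congruence w (s 1) in
   let U := congruence w (s 2) in
   ([/\ real_line a, real_line b, real_line c, real_line x & real_line y] /\
    ((* a.1 *)
     [/\ [/\ skew_lines a b, skew_lines a c, skew_lines b c & skew_lines x y],
         hyperbolic S x y, hyperbolic T a c & hyperbolic U a b] \/
     (* a.2 *)
     [/\ skew_lines a c, skew_lines x y, hyperbolic S x y, hyperbolic T a c
       & exists q, inf_near q b a /\ parabolic U a q] \/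
     (* a.3 *)
     [/\ [/\ skew_lines a b, skew_lines a c & skew_lines b c],
         exists q, inf_near q y x /\ parabolic S x q,
         hyperbolic T a c & hyperbolic U a b] \/
     (* a.4 *)
     [/\ skew_lines a c, exists q, inf_near q y x /\ parabolic S x q,
         hyperbolic T a c & exists q, inf_near q b a /\ parabolic U a q] \/
     (* a.5 *)
     [/\ [/\ skew_lines a b, skew_lines a c, \dim (b :&: c :&: x)%VS = 1%N & skew_lines x y],
         hyperbolic S x y, hyperbolic T a c & hyperbolic U a b] \/
     (* a.6 *)
     [/\ skew_lines x y, hyperbolic S x y
       & exists q q', [/\ inf_near q b a, inf_near q' c a,
           ~ same_double_line a q q', parabolic T a q' & parabolic U a q]] \/
     (* a.7 *)
     [/\ exists q, inf_near q y x /\ parabolic S x q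
       & exists q q', [/\ inf_near q b a, inf_near q' c a,
           ~ same_double_line a q q', parabolic T a q' & parabolic U a q]] \/
     (* a.8 *)
     [/\ [/\ skew_lines a b, skew_lines a c & \dim (b :&: c :&: x)%VS = 1%N],
         exists q, inf_near q y x /\ parabolic S x q,
         hyperbolic T a c & hyperbolic U a b]))
   \/
   ([/\ real_line a, real_line b, real_line c, skew_lines x y & conj_lines x y] /\
    ((* b.1 *)
     [/\ [/\ skew_lines a b, skew_lines a c & skew_lines b c],
         elliptic S x y, hyperbolic T a c & hyperbolic U a b] \/
     (* b.2 *)
     [/\ skew_lines a c, elliptic S x y, hyperbolic T a c
       & exists q, inf_near q b a /\ parabolic U a q] \/
     (* b.3 *)
     [/\ elliptic S x y
       & exists q q', [/\ inf_near q b a, inf_near q' c a,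
           ~ same_double_line a q q', parabolic T a q' & parabolic U a q]]))).
Proof. by split; [exact: general_real_map | exact: real_map_classification]. Qed.
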